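(* Let $\sigma$ be a closed convex curve in $S_K$. Let $\kappa \in [0,\infty)$. The following are equivalent: (a) $\kappa_\sigma(q) \ge \kappa$ for almost all $q\in \sigma$, (b) $\chi_\sigma(q) \ge \kappa$ for almost all $q\in \sigma$, (c) $\kappa_{\sigma, K}\ge \kappa$ globally, (d) $\chi_{\sigma, K} \ge \kappa$ globally.
   Context: $K\ge0$, $S_K$ is the 2-dimensional model space of constant curvature $K$. For three points $p,q,m$, $\chi_K(p,q,m)$ is the curvature of the unique circle of constant geodesic curvature in $S_K$ containing the comparison triangle; $\chi_\sigma(q)$ is the limit of $\chi_K(p,q,m)$ as $p,m\to q$ from opposite sides of $q$. For a subarc $I$ with endpoints $p,q$, $\kappa_K(I)$ is the curvature of the arc of constant geodesic curvature in $S_K$ with the same length and endpoint distance; $\kappa_\sigma(q)$ is the limit of $\kappa_K(I)$ over subarcs $I\ni q$ with $|I|\to0$. ''$\chi_{\sigma,K}\ge\kappa$ globally'' means $\chi_K(p,q,m)\ge\kappa$ for all $p,q,m\in\sigma$ with perimeter of the triangle $\le 2\pi/\sqrt K$ when $K>0$; ''$\kappa_{\sigma,K}\ge\kappa$ globally'' means $\kappa_K(I)\ge\kappa$ for every subarc $I$ with endpoints $p,q$ with $|I|+|pq|\le 2\pi/\sqrt K$ when $K>0$. *)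

(* Defs.v *)
From HB Require Import structures.
From mathcomp Require Import all_boot all_order all_algebra.
From mathcomp Require Import all_classical all_reals all_analysis.
Set Implicit Arguments. Unset Strict Implicit. Unset Printing Implicit Defensive.
Import Order.TTheory GRing.Theory Num.Theory.
Local Open Scope classical_set_scope.
Local Open Scope ring_scope.

Section ModelSpace.
Variable R : realType.

Definition vec3 := 'rV[R]_3.
Definition dot3 (u v : vec3) : R := \sum_(i < 3) u ord0 i * v ord0 i.
Definition norm3 (u : vec3) : R := Num.sqrt (dot3 u u).

(** The model space S_K (K >= 0), embedded in R^3:
    for K > 0 the round sphere of radius 1/sqrt K centred at (0,0,1/sqrt K),
    for K = 0 the plane x_3 = 0.  Uniformly: sqrt K * |x|^2 = 2 x_3. *)
Definition SK (K : R) (x : vec3) : Prop :=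
  Num.sqrt K * dot3 x x = 2 * x ord0 (inord 2).

(** Intrinsic distance of two points of S_K at Euclidean (chordal) distance c. *)
Definition dist_of_chord (K c : R) : R :=
  if K == 0 then c else 2 / Num.sqrt K * asin (Num.sqrt K * c / 2).
Definition dK (K : R) (x y : vec3) : R := dist_of_chord K (norm3 (x - y)).

(** Circles of constant geodesic curvature in S_K are the (non-degenerate)
    plane sections of S_K (for K = 0 also the lines).  A circle of Euclidean
    radius rho in S_K has geodesic curvature sqrt (1/rho^2 - K); lines and
    great circles have geodesic curvature 0. *)

(** 1/rho^2 for the Euclidean circumcircle of x,y,z in R^3
    (= 0 if x,y,z are collinear, i.e. the "circle" is a line). *)
Definition circ_inv_sq (x y z : vec3) : R :=
  let u := y - x in let v := z - x in let w := z - y in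
  4 * (dot3 u u * dot3 v v - (dot3 u v) ^+ 2) / (dot3 u u * dot3 v v * dot3 w w).
Definition circle_gcurv (K : R) (x y z : vec3) : R :=
  Num.sqrt (circ_inv_sq x y z - K).

Definition comparison_triangle (K a b c : R) (T : vec3 * vec3 * vec3) : Prop :=
  let: (x, y, z) := T in
  [/\ SK K x, SK K y & SK K z] /\ [/\ dK K x y = a, dK K y z = b & dK K z x = c].

Definition chiK (K a b c : R) : R :=
  let T := xget (0, 0, 0) (comparison_triangle K a b c) in
  circle_gcurv K T.1.1 T.1.2 T.2.

(** Endpoint distance of an arc of length l on a circle of constant geodesic
    curvature k >= 0 in S_K: such a circle has Euclidean radius
    rho = 1/sqrt(k^2+K) (a line if k = K = 0), so the chord of the arc is
    2 rho sin (l / (2 rho)). *)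
Definition arc_chord (K k l : R) : R :=
  if k ^+ 2 + K == 0 then l
  else let rho := (Num.sqrt (k ^+ 2 + K))^-1 in
       dist_of_chord K (2 * rho * sin (l / (2 * rho))).

(** k is the curvature of an arc of constant geodesic curvature in S_K
    (not exceeding a full circle) with length l and endpoint distance d. *)
Definition cgc_arc (K l d : R) (k : R) : Prop :=
  [/\ 0 <= k, l * Num.sqrt (k ^+ 2 + K) <= 2 * pi & arc_chord K k l = d].

Definition kappaK (K l d : R) : R := xget 0 (cgc_arc K l d).

Definition partition_sums (K : R) (g : R -> vec3) (a b : R) : set R :=
  [set x | exists (n : nat) (p : nat -> R),
     [/\ p 0%N = a, p n = b, (forall i, (i < n)%N -> p i <= p i.+1)
       & x = \sum_(i < n) dK K (g (p i)) (g (p i.+1))]].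
Definition curve_length (K : R) (g : R -> vec3) (a b : R) : R :=
  sup (partition_sums K g a b).

Definition SK_boundary (K : R) (O : set vec3) : set vec3 :=
  [set x | SK K x /\ forall e, 0 < e ->
     (exists y, [/\ SK K y, O y & dK K x y < e]) /\
     (exists y, [/\ SK K y, ~ O y & dK K x y < e])].
Definition SK_nonempty_interior (K : R) (O : set vec3) : Prop :=
  exists x e, 0 < e /\ forall y, SK K y -> dK K x y < e -> O y.
(** O is convex: with any two of its points x, y (not antipodal if K > 0),
    O contains every minimizing geodesic between them, i.e. every z of S_K
    with |xz| + |zy| = |xy|. *)
Definition SK_convex (K : R) (O : set vec3) : Prop :=
  forall x y, O x -> O y -> (0 < K -> dK K x y < pi / Num.sqrt K) ->
    forall z, SK K z -> dK K x z + dK K z y = dK K x y -> O z.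

(** g is an arc-length parametrization (L-periodic) of a closed convex curve
    sigma of length L in S_K: a simple closed rectifiable curve which is the
    boundary of a convex subset of S_K with nonempty interior. *)
Definition closed_convex_curve (K : R) (g : R -> vec3) (L : R) : Prop :=
  [/\ 0 < L, (forall t, SK K (g t)) &
      (forall t, g (t + L) = g t)] /\
  [/\ (forall s t, 0 <= s -> s < t -> t < L -> g s <> g t),
      (forall s t, s <= t -> curve_length K g s t = t - s)
    & exists O : set vec3, [/\ O `<=` SK K, SK_convex K O,
        SK_nonempty_interior K O & SK_boundary K O = range g]].

Definition kappa_arc (K : R) (g : R -> vec3) (s t : R) : R :=
  kappaK K (t - s) (dK K (g s) (g t)).
Definition chi_pts (K : R) (g : R -> vec3) (r s t : R) : R :=
  chiK K (dK K (g r) (g s)) (dK K (g s) (g t)) (dK K (g t) (g r)).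

Definition kappa_sigma_lim (K : R) (g : R -> vec3) (t0 l : R) : Prop :=
  forall e, 0 < e -> exists d, 0 < d /\
    forall s t, s <= t0 -> t0 <= t -> 0 < t - s -> t - s < d ->
      `|kappa_arc K g s t - l| < e.
Definition chi_sigma_lim (K : R) (g : R -> vec3) (t0 l : R) : Prop :=
  forall e, 0 < e -> exists d, 0 < d /\
    forall a b, 0 < a -> a < d -> 0 < b -> b < d ->
      `|chi_pts K g (t0 - a) t0 (t0 + b) - l| < e.

Definition kappa_global_ge (K : R) (g : R -> vec3) (L kappa : R) : Prop :=
  forall s t, s < t -> t < s + L ->
    (0 < K -> (t - s) + dK K (g s) (g t) <= 2 * pi / Num.sqrt K) ->
    kappa <= kappa_arc K g s t.
Definition chi_global_ge (K : R) (g : R -> vec3) (kappa : R) : Prop :=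
  forall r s t, g r <> g s -> g s <> g t -> g t <> g r ->
    (0 < K -> dK K (g r) (g s) + dK K (g s) (g t) + dK K (g t) (g r)
                <= 2 * pi / Num.sqrt K) ->
    kappa <= chi_pts K g r s t.

Definition ae_on (L : R) (P : R -> Prop) : Prop :=
  (@lebesgue_measure R).-negligible [set t | 0 <= t <= L /\ ~ P t].

End ModelSpace.

(* Main.v *)
(** S_K is embedded in R^3, with unit normal N; all distances are expressed through chords.
    A convex curve has supporting normals n at every point, and in a local chart the slope of n is
    monotone.  Lebesgue's theorem on monotone functions therefore gives n a first order expansion at
    almost every point t, with coefficient k, and there the limits of kappa_K and of chi_K exist and
    are both equal to k.  Hence (a) and (b) are equivalent and follow from (c) and (d) respectively.

    Conversely, k >= kappa almost everywhere forces the normal to turn at rate at least kappa at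
    every point, corners included.  If m < kappa, a negative minimum over (t, n) of
    <g u - g t, n> - (m / 2) |g u - g t|^2 could then be decreased by moving t, so that
    <g u - g t, n> >= (kappa / 2) |g u - g t|^2: the curve is contained in each of its tangent discs
    of curvature kappa (rolling theorem of Blaschke).  Put rho^2 = kappa^2 + K.
    - At the vertex of the largest angle of a triangle the inclusion bounds the circumradius by
      1 / rho, which is (d).
    - With beta = asin (rho * chord / 2), (d) is the triangle inequality for beta, so that
      beta <= rho * length / 2.
    - Let M be the axis of the tangent disc.  The twist about M of the moving frame, relative to the
      frame at a base point, grows at rate at least rho and stays in an open interval of length
      2 * pi, because only the base point has twist zero; hence rho * L <= 2 * pi.
    The last two facts, applied to an arc or to its complement, give (c). *)

Require Import Defs.
From HB Require Import structures.
From mathcomp Require Import all_boot all_order all_algebra.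
From mathcomp Require Import all_classical all_reals all_analysis.
From mathcomp Require Import ring lra.
Set Implicit Arguments. Unset Strict Implicit. Unset Printing Implicit Defensive.
Import Order.TTheory GRing.Theory Num.Theory.
Import numFieldNormedType.Exports.
Local Open Scope classical_set_scope.
Local Open Scope ring_scope.

(* Drops the equations and inequalities that were not moved to the goal, except signs: lra gets slow in large contexts. *)
Ltac lc := repeat match goal with H : ?T |- _ => lazymatch T with
  | is_true (Order.le 0 _) => fail | is_true (Order.lt 0 _) => fail
  | is_true _ => clear H | @eq _ _ _ => clear H end end.

(* As [lc], but only the signs of variables are kept. *)
Ltac lz := repeat match goal with H : ?T |- _ => lazymatch T with
  | is_true (Order.le 0 ?x) => first [is_var x; fail 1 | clear H]
  | is_true (Order.lt 0 ?x) => first [is_var x; fail 1 | clear H]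
  | is_true _ => clear H | @eq _ _ _ => clear H end end.

(** * Monotone functions and Dini derivatives *)

(** The curve is only Lipschitz and may have corners, so statements range over all pairs of a
    parameter and a supporting normal, and first variations use the right limit of the normals
    ([right_frame]); the left side follows by reversing the curve and the sign [s]. Passing from
    almost every point to every point works for lower bounds only: jumps and singular parts of a
    monotone slope can only add to its growth. Nothing bounds the turning of the normal from above,
    so errors are measured against the turning itself as well as against the length. The value of
    [kappaK] sits in the term of order 4 of a squared chord. A first order expansion of the normal
    reaches it, because a squared chord is a double integral of products of tangents. The length
    bound cannot use the angle of the tangent, whose total turning on a sphere depends on the
    enclosed area. Along a circle of curvature [kappa] the suitably tilted frame rotates about a
    fixed axis at rate [rho]; comparing the tilted frames of the curve gives the twist, in which no
    area appears. *)

Section Growth.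
Variable R : realType.
Implicit Types (f : R -> R) (A E : set R) (s : seq (R * R)).
Local Notation mu := (@lebesgue_measure R).

(** Outer measure at most [C], expressed through measurable covers: the sets of points with
    prescribed Dini slopes are used without establishing that they are measurable. *)
Definition outer_le A (C : R) := forall e : R, 0 < e ->
  exists H : set R, [/\ measurable H, A `<=` H & (mu H <= (C + e)%:E)%E].

Lemma outer_leW A B C D : A `<=` B -> C <= D -> outer_le B C -> outer_le A D.
Proof.
move=> AB CD BC e e0; have [H [mH BH lH]] := BC _ e0.
exists H; split=> //; first exact: subset_trans BH.
by rewrite (le_trans lH)// lee_fin lerD2r.
Qed.

Lemma outer_le_closed A C : (forall e : R, 0 < e -> outer_le A (C + e)) -> outer_le A C.
Proof.
move=> h e e0; have e20 : 0 < e / 2 by rewrite divr_gt0.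
have [H [mH AH lH]] := h _ e20 _ e20.
by exists H; split=> //; rewrite [e]splitr addrA.
Qed.

Lemma outer_leU A B C D : outer_le A C -> outer_le B D -> outer_le (A `|` B) (C + D).
Proof.
move=> hA hB e e0; have e20 : 0 < e / 2 by rewrite divr_gt0.
have [H [mH AH lH]] := hA _ e20; have [G [mG BG lG]] := hB _ e20.
exists (H `|` G); split; [exact: measurableU | exact: setUSS |].
apply: (le_trans (@measureU2 _ _ _ mu _ _ mH mG)).
rewrite [e]splitr addrACA EFinD; exact: leeD.
Qed.

Lemma outer_le0_negligible A : outer_le A 0 -> mu.-negligible A.
Proof.
move=> h.
have /choice[H hH] : forall n : nat, exists H : set R,
    [/\ measurable H, A `<=` H & (mu H <= (n.+1%:R^-1)%:E)%E].
  move=> n; have [|H [mH AH lH]] := h (n.+1%:R^-1); first by rewrite invr_gt0 ltr0n.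
  by exists H; split=> //; rewrite add0r in lH.
exists (\bigcap_n H n); split.
- by apply: bigcapT_measurable => n; case: (hH n).
- apply/eqP; rewrite eq_le measure_ge0 andbT; apply/lee_addgt0Pr => e e0.
  rewrite add0e; have := near_infty_natSinv_lt (PosNum e0).
  move=> [N _ hN]; have [mHN _ lHN] := hH N.
  apply: (@le_trans _ _ (mu (H N))).
    apply: le_measure; rewrite ?inE//; last exact: bigcap_inf.
    by apply: bigcapT_measurable => n; case: (hH n).
  apply: (le_trans lHN); rewrite lee_fin ltW//.
  by have := hN N (leqnn _).
- by move=> x Ax n _; case: (hH n) => _ /(_ x Ax).
Qed.

(** Intersecting each cover with all later ones makes the covers increase while they still contain
    [F n]; then continuity of the measure from below applies. *)
Lemma outer_le_bigcup (F : (set R)^nat) C : nondecreasing_seq F ->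
  (forall n, outer_le (F n) C) -> outer_le (\bigcup_n F n) C.
Proof.
move=> ndF hF e e0.
have /choice[H hH] : forall n : nat, exists H : set R,
    [/\ measurable H, F n `<=` H & (mu H <= (C + e)%:E)%E].
  by move=> n; exact: hF.
pose G n := \bigcap_(k in [set k | (n <= k)%N]) H k.
have mG n : measurable (G n).
  by apply: bigcap_measurable => [|k _]; [exists n => /= | case: (hH k)].
have mUG : measurable (\bigcup_n G n) by exact: bigcup_measurable.
exists (\bigcup_n G n); split=> //.
- move=> x [n _ Fnx]; exists n => // k /= nk; case: (hH k) => _ + _; apply.
  by move: Fnx; apply: (subsetPset _ _ (ndF _ _ nk)).
- have ndG : {homo G : n m / (n <= m)%N >-> (n <= m)%O}.
    move=> n m nm; apply/subsetPset => x Gx k /= mk; apply: Gx => /=.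
    exact: leq_trans mk.
  have cv := @nondecreasing_cvg_mu _ _ _ mu G mG mUG ndG.
  rewrite -(cvg_lim _ cv)//; apply: lime_le.
    by apply/cvg_ex; eexists; exact: cv.
  apply: nearW => n /=; have [mHn _ lHn] := hH n.
  apply: le_trans lHn; apply: le_measure; rewrite ?inE//; first exact: mG.
  by apply: bigcap_inf => /=.
Qed.

(** Non-overlapping intervals of [[c, d]] from left to right. Such finite lists take the place of a
    Vitali cover. *)
Fixpoint chain (c d : R) s : Prop :=
  if s is (u, v) :: s' then [/\ c <= u, u < v & chain v d s'] else c <= d.

Lemma chain_le s c d : chain c d s -> c <= d.
Proof.
elim: s c => [//|[u v] s IH] c /= [cu uv /IH]; exact: (fun h => le_trans (le_trans cu (ltW uv)) h).
Qed.

Lemma chain_rcons s c y x d : chain c y s -> y < x -> x <= d ->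
  chain c d (rcons s (y, x)).
Proof.
by elim: s c => [|[u v] s IH] c /= => [cy yx xd|[cu uv h] yx xd]; split=> //; exact: IH.
Qed.

Lemma chain_sum f s c d : (forall x y, c <= x -> x <= y -> y <= d -> f x <= f y) ->
  chain c d s -> \sum_(p <- s) (f p.2 - f p.1) <= f d - f c.
Proof.
elim: s c => [|[u v] s IH] c ndf /= => [cd|[cu uv h]].
  by rewrite big_nil subr_ge0 ndf.
have vd := chain_le h.
rewrite big_cons /= -[leRHS](subrKA (f v)) addrC lerD//.
  apply: IH h => x y vx; apply: ndf; exact: le_trans (le_trans cu (ltW uv)) vx.
rewrite lerD2l lerN2 ndf// (le_trans (ltW uv))//.
Qed.

(** Take a point of [A] within [eta] of its infimum, use its interval, and continue with the points
    of [A] beyond that interval. The infimum need not be attained, which costs the margin [eta];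
    each interval uses up length [h], so the process stops. *)
Lemma greedy_right (h eta : R) : 0 < h -> 0 < eta ->
  forall (F : R -> R -> Prop) (d c : R) A, c <= d ->
  (forall x, A x -> c <= x /\ exists y : R, [/\ x + h <= y, y <= d & F x y]) ->
  exists s, [/\ chain c d s, (forall p, p \in s -> F p.1 p.2),
    (size s)%:R * h <= d - c &
    forall x, A x -> exists p, [/\ p \in s, p.1 - eta <= x & x <= p.2 + eta]].
Proof.
move=> h0 eta0 F d c A cd hA.
have [k hk] : exists k : nat, d - c < k%:R * h.
  exists (Num.Def.archi_bound ((d - c) / h)).
  by rewrite -ltr_pdivrMr// archi_boundP// divr_ge0 ?subr_ge0// ltW.
elim: k c A cd hA hk => [|k IH] c A cd hA hk.
  by move: hk; rewrite mul0r subr_lt0 ltNge cd.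
have [A0|/set0P[z Az]] := eqVneq A set0.
  exists [::]; split=> //=; first by rewrite mul0r subr_ge0.
  by move=> x; rewrite A0.
have infA : has_inf A by split; [exists z | exists c => x /hA[]].
have [x Ax xlt] := inf_adherent eta0 infA.
have [cx [y [xy yd Fxy]]] := hA x Ax.
have ltxy : x < y by rewrite (lt_le_trans _ xy)// ltrDl.
have [] := IH y (A `&` [set w | y <= w]) yd.
- by move=> w [Aw yw]; split=> //; have [_ []] := hA w Aw; move=> y' ?; exists y'.
- move: hk; rewrite -natr1 mulrDl mul1r => hk.
  (move: cx hk xy; lc; lra).
move=> s [cs Fs ss cov]; exists ((x, y) :: s); split=> //=.
- by move=> p; rewrite inE => /orP[/eqP->//|/Fs].
- rewrite -natr1 mulrDl mul1r; move: cx ss xy; lc; lra.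
move=> w Aw; have [yw|wy] := leP y w.
  have [p [ps p1 p2]] := cov w (conj Aw yw).
  by exists p; rewrite inE ps orbT.
exists (x, y); rewrite mem_head; split=> //=; last by rewrite ltW// (lt_trans wy)// ltrDl.
rewrite lerBlDr (le_trans (ltW xlt))// lerD2r.
by apply: ge_inf => //; case: infA.
Qed.

Lemma greedy_left (h eta : R) : 0 < h -> 0 < eta ->
  forall (F : R -> R -> Prop) (c d : R) A, c <= d ->
  (forall x, A x -> x <= d /\ exists y : R, [/\ y <= x - h, c <= y & F y x]) ->
  exists s, [/\ chain c d s, (forall p, p \in s -> F p.1 p.2),
    (size s)%:R * h <= d - c &
    forall x, A x -> exists p, [/\ p \in s, p.1 - eta <= x & x <= p.2 + eta]].
Proof.
move=> h0 eta0 F c d A cd hA.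
have [k hk] : exists k : nat, d - c < k%:R * h.
  exists (Num.Def.archi_bound ((d - c) / h)).
  by rewrite -ltr_pdivrMr// archi_boundP// divr_ge0 ?subr_ge0// ltW.
elim: k d A cd hA hk => [|k IH] d A cd hA hk.
  by move: hk; rewrite mul0r subr_lt0 ltNge cd.
have [A0|/set0P[z Az]] := eqVneq A set0.
  exists [::]; split=> //=; first by rewrite mul0r subr_ge0.
  by move=> x; rewrite A0.
have supA : has_sup A by split; [exists z | exists d => x /hA[]].
have [x Ax xlt] := sup_adherent eta0 supA.
have [xd [y [yx cy Fxy]]] := hA x Ax.
have ltyx : y < x by rewrite (le_lt_trans yx)// ltrBlDr ltrDl.
have [] := IH y (A `&` [set w | w <= y]) cy.
- by move=> w [Aw yw]; split=> //; have [_ []] := hA w Aw; move=> y' ?; exists y'.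
- move: hk; rewrite -natr1 mulrDl mul1r => hk; move: hk xd yx; lc; lra.
move=> s [cs Fs ss cov]; exists (rcons s (y, x)); split.
- exact: chain_rcons.
- by move=> p; rewrite mem_rcons inE => /orP[/eqP->//|/Fs].
- rewrite size_rcons -natr1 mulrDl mul1r; move: ss xd yx; lc; lra.
move=> w Aw; have [yw|wy] := leP w y.
  have [p [ps p1 p2]] := cov w (conj Aw yw).
  by exists p; rewrite mem_rcons inE ps orbT.
exists (y, x); rewrite mem_rcons mem_head; split=> //=; first (move: wy; lc; lra).
have wsup : w <= sup A by apply: ub_le_sup => //; case: supA.
(move: wsup xlt; lc; lra).
Qed.

Lemma outer_le_itv (a b : R) : a <= b -> outer_le `[a, b] (b - a).
Proof.
move=> ab e e0; exists [set` `[a, b]]; split=> //.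
rewrite lebesgue_measure_itv /= lte_fin; case: ifPn => _.
  by rewrite -EFinD lee_fin lerDl ltW.
by rewrite lee_fin addr_ge0 ?subr_ge0// ltW.
Qed.

Lemma outer_le_seq s (F : R * R -> set R) (C : R * R -> R) :
  (forall p, p \in s -> outer_le (F p) (C p)) ->
  outer_le [set x | exists2 p, p \in s & F p x] (\sum_(p <- s) C p).
Proof.
elim: s => [|p s IH] h.
  rewrite big_nil => e e0; exists set0; split=> //; last by rewrite measure0 add0r lee_fin ltW.
  by move=> x [].
rewrite big_cons.
apply: (@outer_leW _ (F p `|` [set x | exists2 q, q \in s & F q x])); [|exact: lexx|].
  move=> x [q]; rewrite inE => /orP[/eqP->|qs] Fx; first by left.
  by right; exists q.
apply: outer_leU; first by apply: h; rewrite mem_head.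
by apply: IH => q qs; apply: h; rewrite inE qs orbT.
Qed.

Lemma chain_mem s c d p : chain c d s -> p \in s -> [/\ c <= p.1, p.1 < p.2 & p.2 <= d].
Proof.
elim: s c => [//|[u v] s IH] c /= [cu uv h]; rewrite inE => /orP[/eqP->|ps] /=.
  by split=> //; exact: chain_le h.
have [vp pp pd] := IH _ h ps; split=> //.
by rewrite (le_trans cu)// (le_trans (ltW uv)).
Qed.

Definition thick s (eta : R) : set R :=
  [set x | exists p, [/\ p \in s, p.1 - eta <= x & x <= p.2 + eta]].

Lemma outer_le_thick s (c d eta : R) : 0 <= eta -> chain c d s ->
  outer_le (thick s eta) (\sum_(p <- s) (p.2 - p.1) + (size s)%:R * (2 * eta)).
Proof.
move=> eta0 cs.
have -> : \sum_(p <- s) (p.2 - p.1) + (size s)%:R * (2 * eta) =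
    \sum_(p <- s) (p.2 + eta - (p.1 - eta)).
  transitivity (\sum_(p <- s) (p.2 - p.1 + 2 * eta)); last first.
    by apply: eq_bigr => p _; ring.
  elim: (s) => [|p s' IH]; first by rewrite !big_nil mul0r addr0.
  by rewrite !big_cons -IH /= -natr1; ring.
apply: (@outer_leW _ [set x | exists2 p, p \in s & `[p.1 - eta, p.2 + eta]%classic x]);
  [|exact: lexx|].
  by move=> x [p [ps p1 p2]]; exists p => //=; rewrite in_itv /= p1.
apply: (@outer_le_seq _ (fun p => `[p.1 - eta, p.2 + eta]%classic)) => p ps.
by apply: outer_le_itv; have [_ + _] := chain_mem cs ps; lra.
Qed.

(** The number of intervals is at most [(d - c) / h] whatever [eta] is, so the total thickening
    vanishes with [eta]. *)
Lemma outer_le_growth f (c d beta h : R) A : c <= d -> 0 < beta -> 0 < h ->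
  (forall x y, c <= x -> x <= y -> y <= d -> f x <= f y) ->
  (forall eta : R, 0 < eta -> exists s, [/\ chain c d s,
    (forall p, p \in s -> beta * (p.2 - p.1) <= f p.2 - f p.1),
    (size s)%:R * h <= d - c & A `<=` thick s eta]) ->
  outer_le A ((f d - f c) / beta).
Proof.
move=> cd b0 h0 ndf hA; apply: outer_le_closed => e e0.
pose eta := e * h / (2 * (d - c + 1)).
have dc1 : 0 < d - c + 1 by lra.
have eta0 : 0 < eta by rewrite divr_gt0 ?mulr_gt0.
have [s [cs Fs ss As]] := hA _ eta0.
apply: (outer_leW As _ (outer_le_thick (ltW eta0) cs)).
apply: lerD.
  rewrite ler_pdivlMr// mulrC mulr_sumr.
  apply: le_trans (chain_sum ndf cs).
  by rewrite !big_seq; exact: ler_sum.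
have -> : (size s)%:R * (2 * eta) = ((size s)%:R * h) * (e / (d - c + 1)).
  by rewrite /eta; field; apply: lt0r_neq0.
rewrite mulrA ler_pdivrMr// mulrC ler_wpM2l ?(ltW e0)//; move: ss; lc; lra.
Qed.

(** The greedy choice needs intervals of a fixed minimal length; the whole set is recovered as an
    increasing union over [n]. *)
Definition wide A (P : R -> R -> Prop) (n : nat) : set R :=
  A `&` [set x | exists2 y : R, x + n.+1%:R^-1 <= y & P x y].

Lemma bigcup_wide A (P : R -> R -> Prop) :
  (forall x, A x -> exists2 y, x < y & P x y) -> A = \bigcup_n wide A P n.
Proof.
move=> hA; apply/seteqP; split=> [x Ax|x [n _ []]//].
have [y xy Pxy] := hA x Ax.
have yx0 : 0 < y - x by rewrite subr_gt0.
have [N _ hN] := near_infty_natSinv_lt (PosNum yx0).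
exists N => //; split=> //; exists y => //.
by have /= hh := hN N (leqnn _); rewrite -lerBrDl; exact: ltW.
Qed.

Lemma wide_ndecr A (P : R -> R -> Prop) : nondecreasing_seq (wide A P).
Proof.
move=> n m nm; apply/subsetPset => x [Ax [y xy Pxy]]; split=> //; exists y => //.
by apply: le_trans xy; rewrite lerD2l lef_pV2 ?posrE ?ltr0n// ler_nat.
Qed.

Lemma growth_right f (c d beta : R) A : c <= d -> 0 < beta ->
  (forall x y, c <= x -> x <= y -> y <= d -> f x <= f y) ->
  (forall x, A x -> c <= x /\
     exists y, [/\ x < y, y <= d & beta * (y - x) <= f y - f x]) ->
  outer_le A ((f d - f c) / beta).
Proof.
move=> cd b0 ndf hA; pose P (x y : R) : Prop := y <= d /\ beta * (y - x) <= f y - f x.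
rewrite (@bigcup_wide A P); last by move=> x /hA[_ [y [? ? ?]]]; exists y.
apply: outer_le_bigcup; first exact: wide_ndecr.
move=> n; have h0 : 0 < n.+1%:R^-1 :> R by rewrite invr_gt0 ltr0n.
apply: (@outer_le_growth _ _ _ _ n.+1%:R^-1) => // eta eta0.
have [|s [? ? ? ?]] := @greedy_right _ _ h0 eta0
  (fun x y => beta * (y - x) <= f y - f x) d c (wide A P n) cd; last by exists s; split.
by move=> x [/hA[cx _] [y xy [yd h]]]; split=> //; exists y.
Qed.

Lemma growth_left f (c d beta : R) A : c <= d -> 0 < beta ->
  (forall x y, c <= x -> x <= y -> y <= d -> f x <= f y) ->
  (forall x, A x -> x <= d /\
     exists y, [/\ y < x, c <= y & beta * (x - y) <= f x - f y]) ->
  outer_le A ((f d - f c) / beta).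
Proof.
move=> cd b0 ndf hA.
(* [wide] looks to the right only, so a point [y] on the left of [x] is encoded by its mirror image
   [2 * x - y]. *)
pose P (x y : R) : Prop := c <= 2 * x - y /\ beta * (y - x) <= f x - f (2 * x - y).
rewrite (@bigcup_wide A P); last first.
  move=> x /hA[_ [y [? ? ?]]]; exists (2 * x - y); first lra.
  rewrite /P (_ : 2 * x - (2 * x - y) = y); last ring.
  by split=> //; rewrite (_ : 2 * x - y - x = x - y)//; ring.
apply: outer_le_bigcup; first exact: wide_ndecr.
move=> n; have h0 : 0 < n.+1%:R^-1 :> R by rewrite invr_gt0 ltr0n.
apply: (@outer_le_growth _ _ _ _ n.+1%:R^-1) => // eta eta0.
have [|s [? ? ? ?]] := @greedy_left _ _ h0 eta0
  (fun y x => beta * (x - y) <= f x - f y) c d (wide A P n) cd; last by exists s; split.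
move=> x [/hA[cx _] [y xy [yd h]]]; split=> //; exists (2 * x - y); split=> //.
  by move: (n.+1%:R^-1) xy => w xy; lra.
by rewrite (_ : x - (2 * x - y) = y - x)//; ring.
Qed.

Lemma chain_open_measure (U : set R) s c d : measurable U -> chain c d s ->
  (forall p, p \in s -> `]p.1, p.2[ `<=` U) ->
  ((\sum_(p <- s) (p.2 - p.1))%:E <= mu (U `&` `]c, d[))%E.
Proof.
move=> mU; elim: s c => [|[u v] s IH] c /= => [cd _|[cu uv h] sU].
  by rewrite big_nil measure_ge0.
rewrite big_cons EFinD /=.
have vd := chain_le h.
have m2 : measurable (U `&` `]v, d[) by exact: measurableI.
have IHs : ((\sum_(p <- s) (p.2 - p.1))%:E <= mu (U `&` `]v, d[))%E.
  by apply: IH h _ => p ps; apply: sU; rewrite inE ps orbT.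
apply: (@le_trans _ _ (mu `]u, v[ + mu (U `&` `]v, d[))%E).
  by apply: leeD IHs; rewrite lebesgue_measure_itv /= lte_fin uv -EFinD.
rewrite -(@measureU _ _ _ mu)//; last first.
  rewrite -subset0 => x [] /=; rewrite !in_itv /= => /andP[_ xv] [_ /andP[vx _]].
  by have := lt_trans xv vx; rewrite ltxx.
have sub (x : R) : (`]u, v[ `|` U `&` `]v, d[) x -> (U `&` `]c, d[) x.
  move=> [/= xuv|[Ux]].
    split; first by apply: (sU (u, v)) => //; rewrite mem_head.
    move: xuv; rewrite /= !in_itv /= => /andP[ux xv].
    by rewrite (le_lt_trans cu)//= (lt_le_trans xv).
  rewrite /= !in_itv /= => /andP[vx xd]; split=> //; rewrite xd andbT.
  by rewrite (le_lt_trans cu)// (lt_trans uv).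
by apply: le_measure; rewrite ?inE; [exact: measurableU|exact: measurableI|exact: sub].
Qed.

(** The four Dini derivates through their level sets: difference quotients above [b], or below [a],
    at arbitrarily small distance on one side. *)
Definition upper_right f (b : R) : set R :=
  [set x | forall e : R, 0 < e -> exists y : R, [/\ x < y, y < x + e & b * (y - x) < f y - f x]].
Definition upper_left f (b : R) : set R :=
  [set x | forall e : R, 0 < e -> exists y : R, [/\ y < x, x - e < y & b * (x - y) < f x - f y]].
Definition lower_right f (a : R) : set R :=
  [set x | forall e : R, 0 < e -> exists y : R, [/\ x < y, y < x + e & f y - f x < a * (y - x)]].
Definition lower_left f (a : R) : set R :=
  [set x | forall e : R, 0 < e -> exists y : R, [/\ y < x, x - e < y & f x - f y < a * (x - y)]].

Lemma upper_outer f (c d b : R) A : c <= d -> 0 < b ->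
  (forall x y, c <= x -> x <= y -> y <= d -> f x <= f y) ->
  A `<=` upper_right f b \/ A `<=` upper_left f b ->
  outer_le (A `&` `]c, d[) ((f d - f c) / b).
Proof.
move=> cd b0 ndf [] hA.
  apply: growth_right => // x [/hA Ax]; rewrite /= in_itv /= => /andP[cx xd].
  split; first exact: ltW.
  have [|y [xy yd h]] := Ax (d - x); first lra.
  by exists y; split=> //; move: h yd; lc; lra.
apply: growth_left => // x [/hA Ax]; rewrite /= in_itv /= => /andP[cx xd].
split; first exact: ltW.
have [|y [xy yd h]] := Ax (x - c); first lra.
by exists y; split=> //; move: h yd; lc; lra.
Qed.

(* Inside an almost optimal open cover the low slopes select intervals on which f
   grows little, and the high slopes then force what they cover to be small. *)
Lemma slope_gap_contraction f (c d a b C : R) E : c <= d -> 0 <= a -> 0 < b -> 0 <= C ->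
  (forall x y, c <= x -> x <= y -> y <= d -> f x <= f y) ->
  E `<=` `]c, d[ ->
  E `<=` lower_right f a \/ E `<=` lower_left f a ->
  E `<=` upper_right f b \/ E `<=` upper_left f b ->
  outer_le E C -> outer_le E (a / b * C).
Proof.
move=> cd a0 b0 C0 ndf Ecd lowE upE EC; apply: outer_le_closed => e e0.
pose e1 := e / (4 * (a / b + 1)).
have ab0 : 0 <= a / b by rewrite divr_ge0// ltW.
have e10 : 0 < e1 by rewrite divr_gt0// mulr_gt0//; lra.
have [H [mH EH lH]] := EC _ e10.
have [|U [oU HU lU]] := lebesgue_regularity_outer mH _ e10.
  by apply: (le_lt_trans lH); rewrite ltry.
have mU : measurable U by exact: measurable_realfun.open_measurable.
have muU : (mu U <= (C + 2 * e1)%:E)%E.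
  have -> : U = H `|` (U `\` H) by rewrite setDE setUIr setUv setIT; apply/esym/setUidPr.
  apply: (le_trans (@measureU2 _ _ _ mu _ _ mH (measurableD mU mH))).
  have -> : C + 2 * e1 = (C + e1) + e1 by ring.
  by rewrite EFinD leeD// ltW.
have UE (x : R) : E x -> exists2 r : R, 0 < r & forall y : R, `|y - x| < r -> U y /\ c < y < d.
  move=> Ex; have Ux := HU _ (EH _ Ex).
  have := oU; rewrite openE => /(_ _ Ux) /nbhs_ballP[r /= r0 hr].
  have := Ecd x Ex; rewrite /= in_itv /= => /andP[cx xd].
  exists (Num.min r (Num.min (x - c) (d - x))).
    by rewrite !lt_min r0 !subr_gt0 cx.
  move=> y; rewrite !lt_min => /and3P[yr y1 y2]; split.
    by apply: hr; rewrite /ball /= distrC.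
  by move: y1 y2; rewrite !ltr_norml; lc; lra.
have key : forall (A : set R) (h : R), 0 < h -> A `<=` E ->
  (forall eta : R, 0 < eta -> exists s, [/\ chain c d s,
    (forall p, p \in s -> `]p.1, p.2[ `<=` U /\ f p.2 - f p.1 <= a * (p.2 - p.1)),
    (size s)%:R * h <= d - c & A `<=` thick s eta]) ->
  outer_le A (a / b * C + e).
  move=> A h h0 AE hA.
  pose e2 := e / 2; have e20 : 0 < e2 by rewrite divr_gt0.
  pose eta := e2 * h / (2 * (d - c + 1)).
  have dc1 : 0 < d - c + 1 by move: cd; lc; lra.
  have eta0 : 0 < eta by rewrite divr_gt0 ?mulr_gt0.
  have [s [cs Fs ss As]] := hA _ eta0.
  pose bd := (\sum_(p <- s) ((f p.2 - f p.1) / b)).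
  pose rim := \sum_(p <- s) (eta + eta).
  (* A point of [A] lies inside a selected interval, where the high slopes bound the outer measure
     by the rise over [b], or in a rim of width [eta]. *)
  apply: (@outer_leW _ ([set x | exists2 p, p \in s & (E `&` `]p.1, p.2[) x] `|`
    [set x | exists2 p, p \in s & (`[p.1 - eta, p.1] `|` `[p.2, p.2 + eta]) x]) (bd + rim)).
  - move=> x Ax; have [p [ps p1 p2]] := As _ Ax.
    have [xp1|xp1] := leP x p.1; first by right; exists p => //; left; rewrite /= in_itv /= p1.
    have [xp2|xp2] := leP p.2 x; first by right; exists p => //; right; rewrite /= in_itv /= xp2.
    by left; exists p => //; split; [exact: AE | rewrite /= in_itv /= xp1].
  - have ab1 : 0 < a / b + 1 by lc; lra.
    have rimE : rim <= e2.
      have -> : rim = (size s)%:R * h * (e2 / (d - c + 1)).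
        transitivity ((size s)%:R * (2 * eta)); last by rewrite /eta; field; rewrite lt0r_neq0.
        rewrite /rim; elim: (s) => [|q s' IH]; first by rewrite big_nil mul0r.
        by rewrite big_cons IH /= -natr1; ring.
      rewrite mulrA ler_pdivrMr// mulrC ler_wpM2l ?(ltW e20)//; move: ss; lc; lra.
    have sumE : \sum_(p <- s) (p.2 - p.1) <= C + 2 * e1.
      rewrite -lee_fin; apply: le_trans muU.
      apply: (le_trans (chain_open_measure mU cs _)); first by move=> q /Fs[].
      by apply: le_measure; rewrite ?inE//; exact: measurableI.
    have bdE : bd <= a / b * (C + 2 * e1).
      apply: (@le_trans _ _ (a / b * \sum_(p <- s) (p.2 - p.1))); last exact: ler_wpM2l.
      rewrite /bd mulr_sumr !big_seq; apply: ler_sum => q /Fs[_ hq].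
      by rewrite mulrAC ler_wpM2r// invr_ge0 ltW.
    have e1E : a / b * (2 * e1) <= e2.
      have -> : a / b * (2 * e1) = (a / b) / (a / b + 1) * e2.
        by rewrite /e1 /e2; field; rewrite !lt0r_neq0//; lc; lra.
      by rewrite ler_piMl ?(ltW e20)// ler_pdivrMr//; lc; lra.
    have e2E : e2 + e2 = e by rewrite /e2 -splitr.
    have := mulrDr (a / b) C (2 * e1) => q; move: bdE e1E e2E rimE; lc; lra.
  - apply: outer_leU.
      apply: (@outer_le_seq s (fun p => E `&` `]p.1, p.2[) (fun p => (f p.2 - f p.1) / b)).
      move=> p ps; have [p1 pp p2] := chain_mem cs ps.
      apply: upper_outer => //; first exact: ltW.
      by move=> x y px xy yp; apply: ndf => //; [exact: le_trans px | exact: le_trans p2].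
    apply: (@outer_le_seq s (fun p => `[p.1 - eta, p.1] `|` `[p.2, p.2 + eta]) (fun p => eta + eta)).
    move=> p ps; apply: outer_leU.
      by apply: (outer_leW (@subset_refl _ _) _ (outer_le_itv _)); lc; lra.
    by apply: (outer_leW (@subset_refl _ _) _ (outer_le_itv _)); lc; lra.
pose good (x y : R) : Prop := `]x, y[ `<=` U /\ f y - f x <= a * (y - x).
case: lowE => lowE.
  pose P (x y : R) : Prop := y <= d /\ good x y.
  rewrite (@bigcup_wide E P); last first.
    move=> x Ex; have [r r0 hr] := UE x Ex; have [y [xy yr h]] := lowE _ Ex _ r0.
    exists y => //; split.
      have [|_ /andP[_ /ltW//]] := hr y; first by rewrite ger0_norm; move: xy yr; lc; lra.
    split; last exact: ltW.
    move=> z; rewrite /= in_itv /= => /andP[xz zy].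
    by have [] := hr z => //; rewrite ger0_norm; move: xz yr zy; lc; lra.
  apply: outer_le_bigcup; first exact: wide_ndecr.
  move=> n; have h0 : 0 < n.+1%:R^-1 :> R by rewrite invr_gt0 ltr0n.
  apply: (key _ _ h0); first by move=> x [].
  move=> eta eta0.
  have [|s [? ? ? ?]] := @greedy_right _ _ h0 eta0 good d c (wide E P n) cd;
    last by exists s; split.
  move=> x [/Ecd]; rewrite /= in_itv /= => /andP[cx _] [y xy [yd h]].
  by split; [exact: ltW | exists y].
pose P (x y : R) : Prop := c <= 2 * x - y /\ good (2 * x - y) x.
rewrite (@bigcup_wide E P); last first.
  move=> x Ex; have [r r0 hr] := UE x Ex; have [y [yx yr h]] := lowE _ Ex _ r0.
  exists (2 * x - y); first (move: yx; lc; lra).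
  rewrite /P (_ : 2 * x - (2 * x - y) = y); last ring.
  split; first by have [|_ /andP[/ltW]] := hr y => //; rewrite ltr0_norm; move: yr yx; lc; lra.
  split; last exact: ltW.
  move=> z; rewrite /= in_itv /= => /andP[yz zx].
  by have [] := hr z => //; rewrite ltr0_norm; move: yr yz zx; lc; lra.
apply: outer_le_bigcup; first exact: wide_ndecr.
move=> n; have h0 : 0 < n.+1%:R^-1 :> R by rewrite invr_gt0 ltr0n.
apply: (key _ _ h0); first by move=> x [].
move=> eta eta0.
have [|s [? ? ? ?]] := @greedy_left _ _ h0 eta0 good c d (wide E P n) cd;
  last by exists s; split.
move=> x [/Ecd]; rewrite /= in_itv /= => /andP[_ xd] [y xy [yd h]].
split; first exact: ltW.
exists (2 * x - y); split=> //.
by move: (n.+1%:R^-1) xy => w xy; move: xy; lc; lra.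
Qed.

(** The infimum of all bounds for the outer measure of [E] is itself a bound, and the contraction by
    [a / b < 1] forces it to be 0. *)
Lemma slope_gap_negligible f (c d a b : R) E : c <= d -> 0 <= a -> a < b ->
  (forall x y, c <= x -> x <= y -> y <= d -> f x <= f y) ->
  E `<=` `]c, d[ ->
  E `<=` lower_right f a \/ E `<=` lower_left f a ->
  E `<=` upper_right f b \/ E `<=` upper_left f b ->
  outer_le E 0.
Proof.
move=> cd a0 ab ndf Ecd lowE upE.
have b0 : 0 < b by exact: le_lt_trans ab.
pose S := [set C | 0 <= C /\ outer_le E C].
have Sdc : S (d - c).
  split; first by rewrite subr_ge0.
  apply: (@outer_leW _ `[c, d]%classic _ _ _ (lexx _)); last exact: outer_le_itv.
  by move=> x /Ecd; rewrite /= !in_itv /= => /andP[/ltW -> /ltW ->].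
have hS : has_inf S by split; [exists (d - c) | exists 0 => C []].
have S0 : 0 <= inf S by apply: lb_le_inf => [|C []//]; case: hS.
have Einf : outer_le E (inf S).
  apply: outer_le_closed => e e0; have [C [_ EC] Ce] := inf_adherent e0 hS.
  exact: (outer_leW (@subset_refl _ E) (ltW Ce) EC).
have h := slope_gap_contraction cd a0 b0 S0 ndf Ecd lowE upE Einf.
have : inf S <= a / b * inf S.
  apply: ge_inf; [by case: hS|]; split=> //.
  by rewrite mulr_ge0// divr_ge0// ltW.
rewrite -subr_ge0 -{2}[inf S]mul1r -mulrBl => h1.
have h2 : a / b - 1 < 0 by rewrite subr_lt0 ltr_pdivrMr// mul1r.
by move: h1; rewrite nmulr_rge0// => h1; apply: outer_leW Einf.
Qed.

Definition diff_at f (x l : R) := forall e : R, 0 < e -> exists2 r : R, 0 < r &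
  forall y : R, `|y - x| < r -> `|f y - f x - l * (y - x)| <= e * `|y - x|.

Lemma diff_at_slopes f (x : R) :
  (exists b : R, [/\ 0 < b, ~ upper_right f b x & ~ upper_left f b x]) ->
  (exists2 r : R, 0 < r & forall y : R, `|y - x| < r -> 0 <= (f y - f x) * (y - x)) ->
  (forall a b : R, 0 <= a -> a < b ->
     (lower_right f a x \/ lower_left f a x) ->
     (upper_right f b x \/ upper_left f b x) -> False) ->
  exists l : R, diff_at f x l.
Proof.
move=> [b0 [b0pos nbr nbl]] [r0 r00 mon] gap.
pose S := [set b : R | 0 <= b /\ (upper_right f b x \/ upper_left f b x)].
have Sub (b : R) : S b -> b <= b0.
  move=> [_ Sb]; rewrite leNgt; apply/negP => bb; case: Sb => Sb.
    apply: nbr => e e0; have [y [xy ye h]] := Sb _ e0; exists y; split=> //.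
    by apply: le_lt_trans h; rewrite ler_wpM2r ?subr_ge0 ?ltW//.
  apply: nbl => e e0; have [y [xy ye h]] := Sb _ e0; exists y; split=> //.
  by apply: le_lt_trans h; rewrite ler_wpM2r ?subr_ge0 ?ltW//.
have hul (b : R) : ~ (upper_right f b x \/ upper_left f b x) ->
    exists2 r : R, 0 < r & forall y : R, `|y - x| < r ->
      (x < y -> f y - f x <= b * (y - x)) /\ (y < x -> f x - f y <= b * (x - y)).
  move=> /not_orP[/existsNP[e1 /not_implyP[e10 h1]] /existsNP[e2 /not_implyP[e20 h2]]].
  exists (Num.min e1 e2); first by rewrite lt_min e10.
  move=> y; rewrite lt_min => /andP[y1 y2]; split=> xy; rewrite leNgt; apply/negP => h.
    by apply: h1; exists y; split=> //; move: y1; rewrite ltr_norml; lc; lra.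
  by apply: h2; exists y; split=> //; move: y2; rewrite ltr_norml; lra.
have hll (a : R) : ~ (lower_right f a x \/ lower_left f a x) ->
    exists2 r : R, 0 < r & forall y : R, `|y - x| < r ->
      (x < y -> a * (y - x) <= f y - f x) /\ (y < x -> a * (x - y) <= f x - f y).
  move=> /not_orP[/existsNP[e1 /not_implyP[e10 h1]] /existsNP[e2 /not_implyP[e20 h2]]].
  exists (Num.min e1 e2); first by rewrite lt_min e10.
  move=> y; rewrite lt_min => /andP[y1 y2]; split=> xy; rewrite leNgt; apply/negP => h.
    by apply: h1; exists y; split=> //; move: y1; rewrite ltr_norml; lc; lra.
  by apply: h2; exists y; split=> //; move: y2; rewrite ltr_norml; lc; lra.
(* [S] is empty if the quotients do not exceed any nonnegative level near [x]; the added 0 is then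
   the derivative. *)
pose l := sup (S `|` [set 0]).
have hsup : has_sup (S `|` [set 0]).
  by split; [exists 0; right | exists b0 => b [/Sub//|->]; exact: ltW].
have l0 : 0 <= l by apply: ub_le_sup; [case: hsup | right].
exists l => e e0.
have [r1 r10 H1] : exists2 r : R, 0 < r & forall y : R, `|y - x| < r ->
      (x < y -> f y - f x <= (l + e) * (y - x)) /\ (y < x -> f x - f y <= (l + e) * (x - y)).
  apply: hul => h; have : l + e <= l.
    by apply: ub_le_sup; [case: hsup | left; split=> //; lra].
  lra.
have [r2 r20 H2] : exists2 r : R, 0 < r & forall y : R, `|y - x| < r ->
      (x < y -> (l - e) * (y - x) <= f y - f x) /\ (y < x -> (l - e) * (x - y) <= f x - f y).
  have [le|el] := leP l e.
    exists r0 => // y /mon h; split=> xy.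
      apply: (@le_trans _ _ 0); first by rewrite mulr_le0_ge0//; move: le xy; lc; lra.
      by move: h; rewrite pmulr_lge0// subr_gt0.
    apply: (@le_trans _ _ 0); first by rewrite mulr_le0_ge0//; move: le xy; lc; lra.
    by move: h; rewrite nmulr_lge0 ?subr_lt0//; lc; lra.
  apply: hll => h; have [b Sb lb] := sup_adherent e0 hsup.
  case: Sb => [[b00 Sb]|b00]; last by move: lb; rewrite b00 -/l; move: el; lc; lra.
  by apply: (gap (l - e) b) => //; move: el; lc; lra.
exists (Num.min r1 r2); first by rewrite lt_min r10.
move=> y; rewrite lt_min => /andP[/H1[y1 y2] /H2[y3 y4]].
have [xy|yx|->] := ltgtP x y; last by rewrite !subrr mulr0 subrr normr0 mulr0.
  move: (y1 xy) (y3 xy); rewrite (gtr0_norm (x := y - x)) ?subr_gt0// ler_norml; move: xy y1 y3; lc; lra.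
move: (y2 yx) (y4 yx); rewrite (ltr0_norm (x := y - x)) ?subr_lt0// ler_norml; move: y2 y4 yx; lc; lra.
Qed.

Theorem monotone_ae_diff f (c d : R) : c < d ->
  (forall x y, c <= x -> x <= y -> y <= d -> f x <= f y) ->
  mu.-negligible [set x | c < x < d /\ ~ exists l : R, diff_at f x l].
Proof.
move=> cd ndf; have cd' := ltW cd.
pose I : set R := `]c, d[%classic.
(* Consecutive levels [n / (m + 1)] and [(n + 1) / (m + 1)]: countably many pairs that fit into
   every gap. *)
pose gapset (lo up : (R -> R) -> R -> set R) (n m : nat) : set R :=
  let a : R := (n%:R / (m.+1)%:R) in
  I `&` (lo f a `&` up f (a + (m.+1)%:R^-1)).
have ngap lo up n m : (lo = lower_right \/ lo = lower_left) ->
    (up = upper_right \/ up = upper_left) -> mu.-negligible (gapset lo up n m).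
  move=> hlo hup; apply: outer_le0_negligible.
  apply: (@slope_gap_negligible f c d (n%:R / m.+1%:R) (n%:R / m.+1%:R + m.+1%:R^-1)) => //.
  - by rewrite ltrDl invr_gt0 ltr0n.
  - by move=> x [].
  - by case: hlo => ->; [left | right] => x [_ []].
  - by case: hup => ->; [left | right] => x [_ []].
(* Points with arbitrarily steep quotients: for every [b] their outer measure is at most the total
   rise divided by [b]. *)
pose inf_r : set R := I `&` [set x | forall b : R, 0 < b -> upper_right f b x].
pose inf_l : set R := I `&` [set x | forall b : R, 0 < b -> upper_left f b x].
have fdc : 0 <= f d - f c by rewrite subr_ge0 ndf.
have ninf (F : set R) : (forall b : R, 0 < b -> outer_le F ((f d - f c) / b)) ->
    mu.-negligible F.
  move=> h; apply: outer_le0_negligible; apply: outer_le_closed => e e0; rewrite add0r.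
  apply: (outer_leW (@subset_refl _ F) _ (h ((f d - f c) / e + 1) _)).
    have q0 : 0 <= (f d - f c) / e by rewrite divr_ge0// ltW.
    rewrite ler_pdivrMr; last by lra.
    by rewrite mulrDr mulr1 mulrC divfK ?lt0r_neq0//; lra.
  have q0 : 0 <= (f d - f c) / e by rewrite divr_ge0// ltW.
  lra.
have ninfr : mu.-negligible inf_r.
  apply: ninf => b b0; rewrite /inf_r setIC.
  by apply: upper_outer => //; left=> x /(_ b b0).
have ninfl : mu.-negligible inf_l.
  apply: ninf => b b0; rewrite /inf_l setIC.
  by apply: upper_outer => //; right=> x /(_ b b0).
pose bad : set R := \bigcup_n \bigcup_m
  ((gapset lower_right upper_right n m `|` gapset lower_right upper_left n m) `|`
   (gapset lower_left upper_right n m `|` gapset lower_left upper_left n m)).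
have nbad : mu.-negligible bad.
  apply: negligible_bigcup => n; apply: negligible_bigcup => m.
  by apply: negligibleU; apply: negligibleU; apply: ngap; auto.
apply: (negligibleS _ (negligibleU nbad (negligibleU ninfr ninfl))).
move=> x [cxd nd]; apply: contrapT => /not_orP[nb /not_orP[nr nl]].
have Ix : I x by rewrite /I /= in_itv.
apply: nd; apply: diff_at_slopes.
- have [b1 b10 h1] : exists2 b : R, 0 < b & ~ upper_right f b x.
    apply: contrapT => h; apply: nr; split=> // b b0.
    by apply: contrapT => hb; apply: h; exists b.
  have [b2 b20 h2] : exists2 b : R, 0 < b & ~ upper_left f b x.
    apply: contrapT => h; apply: nl; split=> // b b0.
    by apply: contrapT => hb; apply: h; exists b.
  have m1 : b1 <= Num.max b1 b2 by rewrite le_max lexx.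
  have m2 : b2 <= Num.max b1 b2 by rewrite le_max lexx orbT.
  exists (Num.max b1 b2); split; first by rewrite lt_max b10.
    move=> hh; apply: h1 => e e0; have [y [xy ye h]] := hh _ e0.
    by exists y; split=> //; apply: le_lt_trans h; rewrite ler_wpM2r// subr_ge0 ltW.
  move=> hh; apply: h2 => e e0; have [y [xy ye h]] := hh _ e0.
  by exists y; split=> //; apply: le_lt_trans h; rewrite ler_wpM2r// subr_ge0 ltW.
- move: cxd => /andP[cx xd].
  exists (Num.min (x - c) (d - x)); first by rewrite lt_min !subr_gt0 cx.
  move=> y; rewrite lt_min !ltr_norml => /andP[/andP[y1 y2] /andP[y3 y4]].
  have [xy|yx] := leP x y.
    by rewrite mulr_ge0 ?subr_ge0// ndf; move: xy y1 y2 y4; lc; lra.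
  by rewrite mulr_le0// ?subr_le0; [apply: ndf|]; move: y1 y3 y4 yx; lc; lra.
- move=> a b a0 ab lo up; apply: nb.
  (* With mesh below [(b - a) / 2], two consecutive levels lie between [a] and [b]. *)
  have [m hm] : exists m : nat, 2 / (b - a) < m.+1%:R.
    exists (Num.Def.archi_bound (2 / (b - a))).
    apply: lt_trans (archi_boundP _) _; first by rewrite divr_ge0//; move: ab; lc; lra.
    by rewrite ltr_nat.
  have m0 : 0 < m.+1%:R :> R by rewrite ltr0n.
  have [n hn1 hn2] : exists2 n : nat, a * m.+1%:R <= n%:R & n%:R <= a * m.+1%:R + 1.
    have am0 : 0 <= a * m.+1%:R by rewrite mulr_ge0.
    have /andP[h1 h2] := truncn_itv am0.
    exists (Num.Def.trunc (a * m.+1%:R)).+1; first exact: ltW.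
    by rewrite -natr1 lerD2r.
  have an : a <= n%:R / m.+1%:R by rewrite ler_pdivlMr.
  have nb' : n%:R / m.+1%:R + m.+1%:R^-1 <= b.
    rewrite -{2}[m.+1%:R^-1]mul1r -mulrDl ler_pdivrMr//.
    have : 2 < m.+1%:R * (b - a) by rewrite -ltr_pdivrMr//; move: ab; lc; lra.
    by move: (m.+1%:R) hn2 => w hn2; move: hn2; lc; lra.
  have lor : lower_right f a x -> lower_right f (n%:R / m.+1%:R) x.
    move=> h e e0; have [y [xy ye hy]] := h _ e0; exists y; split=> //.
    by apply: lt_le_trans hy _; rewrite ler_wpM2r// subr_ge0 ltW.
  have lol : lower_left f a x -> lower_left f (n%:R / m.+1%:R) x.
    move=> h e e0; have [y [xy ye hy]] := h _ e0; exists y; split=> //.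
    by apply: lt_le_trans hy _; rewrite ler_wpM2r// subr_ge0 ltW.
  have upr : upper_right f b x -> upper_right f (n%:R / m.+1%:R + m.+1%:R^-1) x.
    move=> h e e0; have [y [xy ye hy]] := h _ e0; exists y; split=> //.
    by apply: le_lt_trans hy; rewrite ler_wpM2r// subr_ge0 ltW.
  have upl : upper_left f b x -> upper_left f (n%:R / m.+1%:R + m.+1%:R^-1) x.
    move=> h e e0; have [y [xy ye hy]] := h _ e0; exists y; split=> //.
    by apply: le_lt_trans hy; rewrite ler_wpM2r// subr_ge0 ltW.
  exists n => //; exists m => //.
  case: lo => [/lor|/lol] lo; case: up => [/upr|/upl] up.
  + by left; left; split.
  + by left; right; split.
  + by right; left; split.
  + by right; right; split.
Qed.

(** The points of slope above [b] fill the interval up to a null set, and their outer measure is at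
    most the rise over [b]. This half of the fundamental theorem survives jumps and singular growth,
    and it carries a bound valid almost everywhere to the corners. *)
Lemma ae_slope_growth f (c d b : R) : c <= d -> 0 < b ->
  (forall x y, c <= x -> x <= y -> y <= d -> f x <= f y) ->
  mu.-negligible [set x | c < x < d /\ ~ exists2 l : R, diff_at f x l & b < l] ->
  b * (d - c) <= f d - f c.
Proof.
move=> cd b0 ndf [N [mN N0 hN]].
pose A : set R := [set x | c < x < d /\ exists2 l : R, diff_at f x l & b < l].
have outA : outer_le A ((f d - f c) / b).
  apply: growth_right => // x [/andP[cx xd] [l dl bl]]; split; first exact: ltW.
  have [|r r0 hr] := dl (l - b); first lra.
  pose y := Num.min (x + r / 2) d.
  have y1 : y <= x + r / 2 by rewrite ge_min lexx.
  have y2 : y <= d by rewrite ge_min lexx orbT.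
  have xy : x < y by rewrite lt_min xd andbT; lc; lra.
  exists y; split=> //.
  have yx0 : 0 < y - x by move: xy; lc; lra.
  have := hr y; rewrite (gtr0_norm yx0) => /(_ ltac:((move: y1; lc; lra))).
  by rewrite ler_norml => /andP[+ _]; rewrite mulrBl; lc; lra.
rewrite mulrC -ler_pdivlMr//; apply/ler_addgt0Pr => e e0.
have [H [mH AH lH]] := outA _ e0.
rewrite -lee_fin; apply: le_trans lH.
have -> : (d - c)%:E = mu `]c, d[.
  rewrite lebesgue_measure_itv /= lte_fin; case: ifPn => [_|]; first by rewrite EFinB.
  by rewrite -leNgt => dc; congr EFin; lra.
apply: (@le_trans _ _ (mu (H `|` N))).
  have sub (x : R) : `]c, d[%classic x -> (H `|` N) x.
    rewrite /= in_itv /= => cxd.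
    have [[l dl bl]|h] := pselect (exists2 l : R, diff_at f x l & b < l).
      by left; apply: AH; split=> //; exists l.
    by right; apply: hN.
  by apply: le_measure; rewrite ?inE//; exact: measurableU.
apply: (le_trans (@measureU2 _ _ _ mu _ _ mH mN)).
by move: N0; rewrite /= => N0; rewrite [X in (_ + X)%E]N0 adde0.
Qed.

(** A supremum argument without a separate continuity hypothesis: the estimate on the left of [s]
    puts the supremum into the set, the one on the right moves past it. *)
Lemma dini_le f (a b C : R) : a <= b ->
  (forall x, a <= x <= b -> forall e : R, 0 < e -> exists2 r : R, 0 < r &
     forall y : R, a <= y <= b ->
       (x < y < x + r -> f y - f x <= (C + e) * (y - x)) /\
       (x - r < y < x -> f x - f y <= (C + e) * (x - y))) ->
  f b - f a <= C * (b - a).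
Proof.
move=> ab h.
suff key (e : R) : 0 < e -> f b - f a <= (C + e) * (b - a).
  apply/ler_addgt0Pr => e e0.
  have ba1 : 0 < b - a + 1 by lra.
  apply: (le_trans (key (e / (b - a + 1)) _)); first by rewrite divr_gt0.
  rewrite mulrDl lerD2l mulrAC ler_pdivrMr// ler_wpM2l ?(ltW e0)//; lra.
move=> e0.
pose S := [set x | a <= x <= b /\ f x - f a <= (C + e) * (x - a)].
have Sa : S a by split; [lra | rewrite !subrr mulr0].
have hS : has_sup S by split; [exists a | exists b => x [/andP[]]].
pose s := sup S.
have as_ : a <= s by apply: ub_le_sup => //; case: hS.
have sb : s <= b by apply: ge_sup => [|x [/andP[]]//]; case: hS.
have [|r r0 hr] := h s _ _ e0; first lra.
have Ss : S s.
  split; first lra.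
  have [x [/andP[ax xb] fx] sx] := sup_adherent r0 hS.
  have xs : x <= s by apply: ub_le_sup; [case: hS | split=> //; (move: ax xb; lc; lra)].
  move: xs; rewrite le_eqVlt => /orP[/eqP<-//|xs].
  have [|_ /(_ ltac:(rewrite sx xs//))] := hr x; first (move: ax xb; lc; lra).
  rewrite -/s; lra.
move: sb; rewrite le_eqVlt => /orP[/eqP sb|sb]; first by rewrite -sb; case: Ss.
pose y := Num.min (s + r / 2) b.
have y1 : y <= s + r / 2 by rewrite ge_min lexx.
have y2 : y <= b by rewrite ge_min lexx orbT.
have sy : s < y by rewrite lt_min sb andbT; lc; lra.
have [|h1 _] := hr y; first (move: as_ sy y2; lc; lra).
have Sy : S y.
  split; first (move: as_ sy y2; lc; lra).
  have := h1 ltac:((move: sy y1; lc; lra)); case: Ss => _; lc; lra.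
have : y <= s by apply: ub_le_sup => //; case: hS.
(move: sy; lc; lra).
Qed.

End Growth.

(** * Vectors and the model space *)

Section Vectors.
Variable R : realType.
Local Notation V := (vec3 R).
Implicit Types (u v w a b : V) (k : R).

Definition c0 u : R := u ord0 (inord 0).
Definition c1 u : R := u ord0 (inord 1).
Definition c2 u : R := u ord0 (inord 2).
Definition mk3 (x y z : R) : V :=
  \row_(i < 3) (if val i == 0%N then x else if val i == 1%N then y else z).

Lemma c0_mk x y z : c0 (mk3 x y z) = x. Proof. by rewrite /c0 mxE /= inordK. Qed.
Lemma c1_mk x y z : c1 (mk3 x y z) = y. Proof. by rewrite /c1 mxE /= inordK. Qed.
Lemma c2_mk x y z : c2 (mk3 x y z) = z. Proof. by rewrite /c2 mxE /= inordK. Qed.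
Lemma c0D u v : c0 (u + v) = c0 u + c0 v. Proof. by rewrite /c0 mxE. Qed.
Lemma c1D u v : c1 (u + v) = c1 u + c1 v. Proof. by rewrite /c1 mxE. Qed.
Lemma c2D u v : c2 (u + v) = c2 u + c2 v. Proof. by rewrite /c2 mxE. Qed.
Lemma c0N u : c0 (- u) = - c0 u. Proof. by rewrite /c0 mxE. Qed.
Lemma c1N u : c1 (- u) = - c1 u. Proof. by rewrite /c1 mxE. Qed.
Lemma c2N u : c2 (- u) = - c2 u. Proof. by rewrite /c2 mxE. Qed.
Lemma c0Z k u : c0 (k *: u) = k * c0 u. Proof. by rewrite /c0 mxE. Qed.
Lemma c1Z k u : c1 (k *: u) = k * c1 u. Proof. by rewrite /c1 mxE. Qed.
Lemma c2Z k u : c2 (k *: u) = k * c2 u. Proof. by rewrite /c2 mxE. Qed.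
Lemma c00 : c0 0 = 0. Proof. by rewrite /c0 mxE. Qed.
Lemma c10 : c1 0 = 0. Proof. by rewrite /c1 mxE. Qed.
Lemma c20 : c2 0 = 0. Proof. by rewrite /c2 mxE. Qed.

Lemma vec3P u v : c0 u = c0 v -> c1 u = c1 v -> c2 u = c2 v -> u = v.
Proof.
move=> h0 h1 h2; apply/rowP => -[[|[|[|//]]] h]; rewrite -(ord1 ord0).
- by move: h0; rewrite /c0 (_ : inord 0 = Ordinal h)//; apply/val_inj; rewrite /= inordK.
- by move: h1; rewrite /c1 (_ : inord 1 = Ordinal h)//; apply/val_inj; rewrite /= inordK.
- by move: h2; rewrite /c2 (_ : inord 2 = Ordinal h)//; apply/val_inj; rewrite /= inordK.
Qed.

Lemma dotE u v : dot3 u v = c0 u * c0 v + c1 u * c1 v + c2 u * c2 v.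
Proof.
rewrite /dot3 !big_ord_recl big_ord0 addr0 addrA /c0 /c1 /c2.
have <- : inord 0 = ord0 :> 'I_3 by apply/val_inj; rewrite /= inordK.
have <- : inord 1 = lift (inord 0) ord0 :> 'I_3 by apply/val_inj; rewrite /= !inordK.
have <- : inord 2 = lift (inord 0) (lift ord0 ord0) :> 'I_3.
  by apply/val_inj; rewrite /= !inordK.
by [].
Qed.

Definition cross u v : V :=
  mk3 (c1 u * c2 v - c2 u * c1 v) (c2 u * c0 v - c0 u * c2 v) (c0 u * c1 v - c1 u * c0 v).

Lemma c0X u v : c0 (cross u v) = c1 u * c2 v - c2 u * c1 v. Proof. exact: c0_mk. Qed.
Lemma c1X u v : c1 (cross u v) = c2 u * c0 v - c0 u * c2 v. Proof. exact: c1_mk. Qed.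
Lemma c2X u v : c2 (cross u v) = c0 u * c1 v - c1 u * c0 v. Proof. exact: c2_mk. Qed.

Definition vE := (dotE, c0D, c1D, c2D, c0N, c1N, c2N, c0Z, c1Z, c2Z, c00, c10, c20,
  c0X, c1X, c2X, c0_mk, c1_mk, c2_mk).

Lemma dotC u v : dot3 u v = dot3 v u. Proof. rewrite !vE; ring. Qed.
Lemma dotDl u v w : dot3 (u + v) w = dot3 u w + dot3 v w. Proof. rewrite !vE; ring. Qed.
Lemma dotDr u v w : dot3 w (u + v) = dot3 w u + dot3 w v. Proof. rewrite !vE; ring. Qed.
Lemma dotNl u w : dot3 (- u) w = - dot3 u w. Proof. rewrite !vE; ring. Qed.
Lemma dotNr u w : dot3 w (- u) = - dot3 w u. Proof. rewrite !vE; ring. Qed.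
Lemma dotZl k u w : dot3 (k *: u) w = k * dot3 u w. Proof. rewrite !vE; ring. Qed.
Lemma dotZr k u w : dot3 w (k *: u) = k * dot3 w u. Proof. rewrite !vE; ring. Qed.
Lemma dot0l w : dot3 0 w = 0. Proof. rewrite !vE; ring. Qed.
Lemma dot0r w : dot3 w 0 = 0. Proof. rewrite !vE; ring. Qed.
Definition dE := (dotDl, dotDr, dotNl, dotNr, dotZl, dotZr, dot0l, dot0r).

Lemma dot_ge0 u : 0 <= dot3 u u.
Proof. by rewrite dotE -!expr2 !addr_ge0// sqr_ge0. Qed.

Lemma dot_eq0 u : (dot3 u u == 0) = (u == 0).
Proof.
apply/idP/eqP => [|->]; last by rewrite dot0l.
rewrite dotE -!expr2 paddr_eq0 ?addr_ge0 ?sqr_ge0//.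
rewrite paddr_eq0 ?sqr_ge0// !sqrf_eq0 => /andP[/andP[/eqP h0 /eqP h1] /eqP h2].
by apply: vec3P; rewrite ?c00 ?c10 ?c20.
Qed.

Lemma dot_gt0 u : u != 0 -> 0 < dot3 u u.
Proof. by move=> u0; rewrite lt_neqAle dot_ge0 andbT eq_sym dot_eq0. Qed.

Lemma norm3_ge0 u : 0 <= norm3 u. Proof. exact: sqrtr_ge0. Qed.

Lemma norm3_sq u : norm3 u ^+ 2 = dot3 u u.
Proof. by rewrite sqr_sqrtr// dot_ge0. Qed.

Lemma norm3_eq0 u : (norm3 u == 0) = (u == 0).
Proof. by rewrite -dot_eq0 -norm3_sq sqrf_eq0. Qed.

Lemma norm3_gt0 u : (0 < norm3 u) = (u != 0).
Proof. by rewrite lt_neqAle norm3_ge0 andbT eq_sym norm3_eq0. Qed.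

Lemma norm3_0 : norm3 (0 : V) = 0. Proof. by apply/eqP; rewrite norm3_eq0. Qed.

Lemma norm3_unit u : dot3 u u = 1 -> norm3 u = 1.
Proof. by rewrite /norm3 => ->; rewrite sqrtr1. Qed.

Lemma norm3_le u k : 0 <= k -> (norm3 u <= k) = (dot3 u u <= k ^+ 2).
Proof. by move=> k0; rewrite -norm3_sq ler_sqr ?nnegrE ?norm3_ge0. Qed.

Lemma norm3Z k u : norm3 (k *: u) = `|k| * norm3 u.
Proof. by rewrite /norm3 !dE mulrA -expr2 sqrtrM ?sqr_ge0// sqrtr_sqr. Qed.

Lemma norm3N u : norm3 (- u) = norm3 u.
Proof. by rewrite /norm3 !dE opprK. Qed.

Lemma norm3BC u v : norm3 (u - v) = norm3 (v - u).
Proof. by rewrite -norm3N opprB. Qed.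

Lemma cauchy_sq u v : dot3 u v ^+ 2 <= dot3 u u * dot3 v v.
Proof.
rewrite -subr_ge0.
have -> : dot3 u u * dot3 v v - dot3 u v ^+ 2 = dot3 (cross u v) (cross u v).
  rewrite !vE; ring.
exact: dot_ge0.
Qed.

Lemma cauchy u v : `|dot3 u v| <= norm3 u * norm3 v.
Proof.
rewrite -ler_sqr ?nnegrE ?mulr_ge0 ?norm3_ge0 ?normr_ge0//.
by rewrite real_normK ?num_real// exprMn !norm3_sq cauchy_sq.
Qed.

Lemma dot_le u v : dot3 u v <= norm3 u * norm3 v.
Proof. exact: le_trans (ler_norm _) (cauchy u v). Qed.

Lemma dot_ge u v : - (norm3 u * norm3 v) <= dot3 u v.
Proof. by have := cauchy u v; rewrite ler_norml => /andP[]. Qed.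

Lemma norm3D u v : norm3 (u + v) <= norm3 u + norm3 v.
Proof.
rewrite norm3_le ?addr_ge0 ?norm3_ge0// sqrrD !norm3_sq !dE (dotC v u).
have := dot_le u v; lra.
Qed.

Lemma norm3B u v : norm3 (u - v) <= norm3 u + norm3 v.
Proof. by rewrite -(norm3N v) norm3D. Qed.

Lemma norm3_tri u v w : norm3 (u - w) <= norm3 (u - v) + norm3 (v - w).
Proof. by have -> : u - w = (u - v) + (v - w); [rewrite addrA subrK | exact: norm3D]. Qed.

Lemma cross_gram a b u v : dot3 (cross a b) u * dot3 (cross a b) v =
  dot3 a a * (dot3 b b * dot3 u v - dot3 b v * dot3 u b)
  - dot3 a b * (dot3 a b * dot3 u v - dot3 b v * dot3 u a)
  + dot3 a v * (dot3 a b * dot3 u b - dot3 b b * dot3 u a).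
Proof. rewrite !vE; ring. Qed.

Lemma dot_crossl a b : dot3 (cross a b) a = 0. Proof. rewrite !vE; ring. Qed.
Lemma dot_crossr a b : dot3 (cross a b) b = 0. Proof. rewrite !vE; ring. Qed.

Lemma norm3_cross a b : norm3 (cross a b) <= norm3 a * norm3 b.
Proof.
rewrite norm3_le ?mulr_ge0 ?norm3_ge0// exprMn !norm3_sq.
have -> : dot3 (cross a b) (cross a b) = dot3 a a * dot3 b b - dot3 a b ^+ 2 by rewrite !vE; ring.
by have := sqr_ge0 (dot3 a b); lra.
Qed.

(* Oriented frame (frameT s m n, n, m); the sign s will be the orientation of the curve. *)
Definition frameT : R -> V -> V -> V := locked (fun s m n => s *: cross m n).
Lemma frameTE s m n : frameT s m n = s *: cross m n.
Proof. by rewrite /frameT -lock. Qed.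

Section Frame.
Variables (s : R) (m n : V).
Hypotheses (ss : s * s = 1) (mm : dot3 m m = 1) (nn : dot3 n n = 1) (mn : dot3 m n = 0).
Local Notation T := (frameT s m n).

Lemma frame_parseval u v :
  dot3 u v = dot3 u T * dot3 v T + dot3 u n * dot3 v n + dot3 u m * dot3 v m.
Proof.
rewrite !frameTE !dotZr mulrACA ss mul1r (dotC u (cross _ _)) (dotC v (cross _ _)) cross_gram.
rewrite mm nn mn (dotC n v) (dotC m v); ring.
Qed.

Lemma frameTT : dot3 T T = 1.
Proof.
rewrite !frameTE !dE mulrA ss mul1r.
have -> : dot3 (cross m n) (cross m n) = dot3 m m * dot3 n n - dot3 m n ^+ 2 by rewrite !vE; ring.
by rewrite mm nn mn; ring.
Qed.

Lemma frameTn : dot3 T n = 0. Proof. by rewrite frameTE dotZl dot_crossr mulr0. Qed.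
Lemma frameTm : dot3 T m = 0. Proof. by rewrite frameTE dotZl dot_crossl mulr0. Qed.

Lemma frame_decomp u : u = dot3 u T *: T + dot3 u n *: n + dot3 u m *: m.
Proof.
apply/eqP; rewrite -subr_eq0 -dot_eq0; set w := _ - _.
have wT : dot3 w T = 0 by rewrite /w !dE frameTT (dotC n T) frameTn (dotC m T) frameTm; ring.
have wn : dot3 w n = 0 by rewrite /w !dE frameTn nn mn; ring.
have wm : dot3 w m = 0 by rewrite /w !dE frameTm mm (dotC n) mn; ring.
by rewrite frame_parseval wT wn wm; apply/eqP; ring.
Qed.
End Frame.
End Vectors.

(** * The model space as a quadric with unit normal *)

Section Space.
Variable R : realType.
Local Notation V := (vec3 R).
Variable K : R.
Hypothesis K0 : 0 <= K.
Local Notation q := (Num.sqrt K).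

Lemma sqK : q * q = K. Proof. by rewrite -expr2 sqr_sqrtr. Qed.
Lemma q_ge0 : 0 <= q. Proof. exact: sqrtr_ge0. Qed.

(* Unit normal of S_K: e_3 for the plane, the inward normal for the sphere. *)
Definition nK : V -> V := locked (fun x => mk3 0 0 1 - q *: x).
Lemma nKE x : nK x = mk3 0 0 1 - q *: x. Proof. by rewrite /nK -lock. Qed.

Lemma nK_unit x : SK K x -> dot3 (nK x) (nK x) = 1.
Proof.
rewrite /SK -[x ord0 _]/(c2 x) => h.
have -> : dot3 (nK x) (nK x) = 1 - 2 * q * c2 x + q * q * dot3 x x by rewrite !nKE !vE; ring.
by rewrite -(mulrA q q) h; ring.
Qed.

Lemma nKB x y : nK y - nK x = - q *: (y - x).
Proof. by apply: vec3P; rewrite !nKE !vE; ring. Qed.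

(** The equation of the quadric recentred at [x]. It eliminates the normal component of a chord from
    all later formulas. *)
Lemma SK_chord x y : SK K x -> SK K y ->
  dot3 (y - x) (nK x) = q * dot3 (y - x) (y - x) / 2.
Proof.
rewrite /SK -[x ord0 _]/(c2 x) -[y ord0 _]/(c2 y) => hx hy.
have -> : dot3 (y - x) (nK x) = c2 y - c2 x - q * (dot3 y x - dot3 x x).
  by rewrite !nKE !vE; ring.
have -> : c2 y = q * dot3 y y / 2 by rewrite hy mulrAC divff ?mul1r.
have -> : c2 x = q * dot3 x x / 2 by rewrite hx mulrAC divff ?mul1r.
by rewrite !dE (dotC x y); field.
Qed.

(** Inverse stereographic projection from the antipode of [x], applied to the tangent vector
    [s *: u]; for [K = 0] it is the translation by this vector. *)
Lemma SK_move x (s : R) u : SK K x -> dot3 u u = 1 -> dot3 u (nK x) = 0 ->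
  SK K (x + (1 + K * s ^+ 2 / 4)^-1 *: (s *: u + (q * s ^+ 2 / 2) *: nK x)).
Proof.
move=> hx uu un.
have nn := nK_unit hx.
set D := 1 + K * s ^+ 2 / 4.
have D0 : D != 0 by rewrite lt0r_neq0// /D; have := mulr_ge0 K0 (sqr_ge0 s); lra.
move: hx; rewrite /SK -![_ ord0 (inord 2)]/(c2 _) => hx.
set w := s *: u + _ *: nK x.
have ww : dot3 w w = s ^+ 2 * D.
  have -> : D = 1 + q * q * s ^+ 2 / 4 by rewrite sqK.
  by rewrite /w !dE uu nn (dotC (nK x) u) un; field.
have wx : c2 w = q * dot3 x w + q * s ^+ 2 / 2.
  have : dot3 w (nK x) = q * s ^+ 2 / 2 by rewrite /w !dE un nn; ring.
  have -> : dot3 w (nK x) = c2 w - q * dot3 x w by rewrite !nKE !vE; ring.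
  by move=> <-; ring.
clearbody w D.
have -> : dot3 (x + D^-1 *: w) (x + D^-1 *: w) = dot3 x x + D^-1 * (2 * dot3 x w) + D^-2 * (s ^+ 2 * D).
  by rewrite !dE ww (dotC w x); field.
by rewrite c2D c2Z wx (mulrDr 2) -hx; field.
Qed.

Lemma SK_chord_le x y : SK K x -> SK K y -> q * norm3 (x - y) <= 2.
Proof.
move=> /nK_unit hx /nK_unit hy.
have <- : norm3 (nK y - nK x) = q * norm3 (x - y).
  by rewrite nKB norm3Z normrN ger0_norm ?q_ge0// norm3BC.
apply: (le_trans (norm3B _ _)).
by rewrite /norm3 hx hy sqrtr1; lra.
Qed.
End Space.

(** * Taylor bounds for sine, cosine and arcsine *)

Section Trig.
Variable R : realType.
Implicit Types (x y e : R).

Lemma deriv_ge0_le (f df : R -> R) (a b : R) : a <= b ->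
  (forall x, a <= x <= b -> is_derive x 1 f (df x)) ->
  (forall x, a <= x <= b -> 0 <= df x) -> f a <= f b.
Proof.
move=> ab hd h0.
have hd' x : x \in `]a, b[ -> is_derive x 1 f (df x).
  by rewrite in_itv /= => /andP[ax xb]; apply: hd; rewrite !ltW.
have [|c ch fE] := @MVT_segment R f df a b ab hd'.
  apply: derivable_within_continuous => x; rewrite in_itv /= => hx.
  by have := hd x hx => ?; exact: ex_derive.
by rewrite -subr_ge0 fE mulr_ge0 ?subr_ge0// h0//; move: ch; rewrite in_itv.
Qed.

Lemma sin_le_id x : 0 <= x -> sin x <= x.
Proof.
move=> x0; rewrite -subr_ge0.
have := @deriv_ge0_le (fun y : R => y - sin y) (fun y : R => 1 - cos y) 0 x x0.
by rewrite sin0 subrr; apply=> y _; rewrite subr_ge0 cos_le1.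
Qed.

Lemma cos_ge_taylor x : 0 <= x -> 1 - x ^+ 2 / 2 <= cos x.
Proof.
move=> x0; rewrite -subr_ge0.
have := @deriv_ge0_le (fun y : R => cos y - (1 - y ^+ 2 / 2)) (fun y : R => y - sin y) 0 x x0.
rewrite cos0 expr0n /= mul0r subr0 subrr; apply=> y /andP[y0 _].
  apply: is_derive_eq; rewrite !scaler0 ?scaler1 /GRing.scale /=; by field.
by rewrite subr_ge0 sin_le_id.
Qed.

Lemma sin_ge_taylor x : 0 <= x -> x - x ^+ 3 / 6 <= sin x.
Proof.
move=> x0; rewrite -subr_ge0.
have := @deriv_ge0_le (fun y : R => sin y - (y - y ^+ 3 / 6))
  (fun y : R => cos y - (1 - y ^+ 2 / 2)) 0 x x0.
rewrite sin0 expr0n /= mul0r !subr0; apply=> y /andP[y0 _].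
  apply: is_derive_eq; rewrite !scaler0 ?scaler1 /GRing.scale /=; by field.
by rewrite subr_ge0 cos_ge_taylor.
Qed.

Lemma cos_le_taylor x : 0 <= x -> cos x <= 1 - x ^+ 2 / 2 + x ^+ 4 / 24.
Proof.
move=> x0; rewrite -subr_ge0.
have := @deriv_ge0_le (fun y : R => 1 - y ^+ 2 / 2 + y ^+ 4 / 24 - cos y)
  (fun y : R => sin y - (y - y ^+ 3 / 6)) 0 x x0.
rewrite cos0 !expr0n /= !mul0r subr0 addr0 subrr; apply=> y /andP[y0 _].
  apply: is_derive_eq; rewrite !scaler0 ?scaler1 /GRing.scale /=; by field.
by rewrite subr_ge0 sin_ge_taylor.
Qed.

Lemma sin_le_taylor x : 0 <= x -> sin x <= x - x ^+ 3 / 6 + x ^+ 5 / 120.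
Proof.
move=> x0; rewrite -subr_ge0.
have := @deriv_ge0_le (fun y : R => y - y ^+ 3 / 6 + y ^+ 5 / 120 - sin y)
  (fun y : R => 1 - y ^+ 2 / 2 + y ^+ 4 / 24 - cos y) 0 x x0.
rewrite sin0 !expr0n /= !mul0r !subr0 addr0; apply=> y /andP[y0 _].
  apply: is_derive_eq; rewrite !scaler0 ?scaler1 /GRing.scale /=; by field.
by rewrite subr_ge0 cos_le_taylor.
Qed.

Lemma asin_itv x : 0 <= x <= 1 -> [/\ 0 <= asin x, asin x <= pi / 2 & sin (asin x) = x].
Proof.
move=> /andP[x0 x1].
have h : -1 <= x <= 1 by lra.
have [/andP[h1 h2] h3] := asin_def h; split=> //.
rewrite leNgt; apply/negP => a0.
have p0 := pi_gt0 R.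
have := @ltr_sin R (asin x) 0; rewrite !in_itv /= a0 sin0 h3 => /(_ _ _).
by rewrite h1 h2 => /(_ isT) /(_ ltac:((lc; lra))) xl; move: x0; rewrite leNgt xl.
Qed.

Lemma asin_ge_id x : 0 <= x <= 1 -> x <= asin x.
Proof. by move=> /asin_itv[a0 _ {1}<-]; exact: sin_le_id. Qed.

Lemma ler_asin x y : 0 <= x -> x <= y -> y <= 1 -> asin x <= asin y.
Proof.
move=> x0 xy y1; rewrite leNgt; apply/negP => h.
have [a0 a1 a2] := @asin_itv x ltac:(lra).
have [b0 b1 b2] := @asin_itv y ltac:(lra).
have := @ltr_sin R (asin y) (asin x); rewrite !in_itv /= h a2 b2 => /(_ _ _).
have p0 := pi_gt0 R.
move=> /(_ ltac:((move: b1; lc; lra))) /(_ ltac:((move: a1; lc; lra))) yx; move: xy yx; lc; lra.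
Qed.

(** For [y = asin x < 2] the cubic bound of sine first gives [y <= 3 * x], then an excess of at most
    [27 / 6 * x ^+ 3]; the constant 5 rounds this up. *)
Lemma asin_le_cube x : 0 <= x <= 1 -> asin x <= x + 5 * x ^+ 3.
Proof.
move=> hx; have [a0 a1 a2] := asin_itv hx.
have h := sin_ge_taylor a0; rewrite a2 in h.
have p2 := pihalf_lt2 R.
set y := asin x in a0 a1 h *; clearbody y.
have y3 : y <= 3 * x.
  have : y ^+ 3 <= 4 * y by rewrite exprS mulrC ler_wpM2r// expr2; nra.
  lra.
have : y ^+ 3 <= (3 * x) ^+ 3 by rewrite lerXn2r ?nnegrE//; lra.
have x3 : 0 <= x ^+ 3 by rewrite exprn_ge0//; lra.
rewrite exprMn (_ : 3 ^+ 3 = 27 :> R); [lra | ring].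
Qed.
End Trig.

(** * Intrinsic and chordal distance *)

Section Dist.
Variables (R : realType) (K : R).
Hypothesis K0 : 0 <= K.
Local Notation V := (vec3 R).
Local Notation q := (Num.sqrt K).
Implicit Types (c : R).

Lemma q_eq0 : (q == 0) = (K == 0).
Proof. by rewrite sqrtr_eq0 eq_le K0 andbT. Qed.

Lemma q_gt0 : K != 0 -> 0 < q.
Proof. by move=> h; rewrite lt_neqAle eq_sym q_eq0 h sqrtr_ge0. Qed.

Lemma doc_half c : 0 <= c -> q * c <= 2 -> 0 <= q * c / 2 <= 1.
Proof. by move=> c0 c2; rewrite divr_ge0 ?mulr_ge0 ?sqrtr_ge0//=; lra. Qed.

Lemma doc_ge c : 0 <= c -> q * c <= 2 -> c <= dist_of_chord K c.
Proof.
move=> c0 c2; rewrite /dist_of_chord; case: (eqVneq K 0) => // /q_gt0 q0.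
have h := asin_ge_id (doc_half c0 c2).
rewrite mulrAC ler_pdivlMr//; lra.
Qed.

Lemma doc_le c : 0 <= c -> q * c <= 2 -> dist_of_chord K c <= c + 5 / 4 * K * c ^+ 3.
Proof.
move=> c0 c2; rewrite /dist_of_chord; case: (eqVneq K 0) => [->|/q_gt0 q0].
  by rewrite mulr0 mul0r addr0.
have h := asin_le_cube (doc_half c0 c2).
rewrite mulrAC ler_pdivrMr//.
have -> : (c + 5 / 4 * K * c ^+ 3) * q = 2 * (q * c / 2 + 5 * (q * c / 2) ^+ 3).
  by rewrite -[X in 5 / 4 * X](sqK K0); field.
by rewrite ler_pM2l.
Qed.

Lemma doc_inj c c' : 0 <= c -> q * c <= 2 -> 0 <= c' -> q * c' <= 2 ->
  dist_of_chord K c = dist_of_chord K c' -> c = c'.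
Proof.
move=> c0 c2 c0' c2'; rewrite /dist_of_chord; case: (eqVneq K 0) => // /q_gt0 q0.
move/(congr1 (fun z => z * q / 2)).
rewrite (_ : 2 / q * asin (q * c / 2) * q / 2 = asin (q * c / 2)); last by field; rewrite lt0r_neq0.
rewrite (_ : 2 / q * asin (q * c' / 2) * q / 2 = asin (q * c' / 2)); last by field; rewrite lt0r_neq0.
have [_ _ h] := asin_itv (doc_half c0 c2).
have [_ _ h'] := asin_itv (doc_half c0' c2').
move=> /(congr1 sin); rewrite h h' => /(congr1 (fun z => z * 2 / q)).
rewrite (_ : q * c / 2 * 2 / q = c); last by field; rewrite lt0r_neq0.
by rewrite (_ : q * c' / 2 * 2 / q = c')//; field; rewrite lt0r_neq0.
Qed.

Lemma doc0 : dist_of_chord K 0 = 0.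
Proof.
rewrite /dist_of_chord; case: eqP => // _; rewrite mulr0 mul0r.
have := @asin_itv R 0; rewrite lexx ler01 => /(_ isT)[a0 a1 a2].
apply/eqP; rewrite mulf_eq0 (_ : asin 0 = 0) ?eqxx ?orbT//.
apply/eqP; rewrite eq_le a0 andbT.
by have := @asin_le_cube R 0; rewrite expr0n /= mulr0 addr0; apply; rewrite lexx ler01.
Qed.

Variables (x y : V).
Hypotheses (hx : SK K x) (hy : SK K y).

Lemma dK_ge_norm : norm3 (y - x) <= dK K x y.
Proof. by rewrite norm3BC doc_ge ?norm3_ge0// SK_chord_le. Qed.

Lemma dK_le_norm : dK K x y <= norm3 (y - x) + 5 / 4 * K * norm3 (y - x) ^+ 3.
Proof. by rewrite (norm3BC y) doc_le ?norm3_ge0// SK_chord_le. Qed.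

Lemma dKC : dK K x y = dK K y x. Proof. by rewrite /dK norm3BC. Qed.
End Dist.

(** * The properties of a convex curve used in the sequel *)

Section Oval.
Variables (R : realType) (K : R).
Local Notation V := (vec3 R).
Local Notation q := (Num.sqrt K).
Local Notation N := (nK K).

(** All normals of supporting lines, hence several at a corner. The last clause selects the side of
    [o], also when the curve is a great circle, and being uniform in [t] it survives limits. *)
Definition supp (g : R -> V) (o : V) (del t : R) (n : V) : Prop :=
  [/\ dot3 n n = 1, dot3 (N (g t)) n = 0, (forall u, 0 <= dot3 (g u - g t) n)
    & del <= dot3 (o - g t) n].

(* [o] is an interior point at height at least [del] over every supporting line, [s] is the
   orientation and [r] a scale below which the curve turns around [o] in the direction [s]. *)
Record oval (g : R -> V) (L : R) (o : V) (del s r : R) : Prop := Oval {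
  ov_L : 0 < L;
  ov_del : 0 < del;
  ov_s : s * s = 1;
  ov_r : [/\ 0 < r, 2 * r <= L, 6 * r <= del & 4 * (K * r ^+ 2) <= 1];
  ov_SK : forall t, SK K (g t);
  ov_o : SK K o;
  ov_per : forall t, g (t + L) = g t;
  ov_inj : forall x y : R, x < y -> y < x + L -> g x <> g y;
  ov_dK : forall x y : R, x <= y -> dK K (g x) (g y) <= y - x;
  ov_len : forall (x y B : R) (e : V), x <= y ->
    (forall u w : R, x <= u -> u <= w -> w <= y -> dK K (g u) (g w) <= B * dot3 (g w - g u) e) ->
    y - x <= B * dot3 (g y - g x) e;
  ov_supp : forall t, exists n, supp g o del t n;
  ov_or : forall x y : R, x < y -> y < x + r ->
    0 < s * dot3 (g y - g x) (cross (N (g x)) (o - g x)) }.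

Lemma orient_antisym (o x y : V) :
  dot3 (y - x) (cross (N x) (o - x)) = - dot3 (x - y) (cross (N y) (o - y)).
Proof. by rewrite !nKE !vE; ring. Qed.

(** Reversal exchanges left and right, so one-sided statements need a proof on the right only. *)
Lemma oval_rev g L o del s r : 0 <= K ->
  oval g L o del s r -> oval (fun t => g (- t)) L o del (- s) r.
Proof.
move=> K0 [L0 d0 ss hr gSK oSK per inj ldK len sup orr]; split=> //.
- by rewrite mulrNN.
- by move=> t; rewrite -[LHS]per; congr g; rewrite opprD subrK.
- by move=> x y xy yx /esym; apply: inj; rewrite ?ltrN2//; lra.
- move=> x y xy; rewrite dKC//; apply: le_trans (ldK _ _ _) _; first by rewrite lerN2.
  by rewrite opprK addrC.
- move=> x y B e xy h.
  have := len (- y) (- x) B (- e); rewrite opprK addrC lerN2 => /(_ xy).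
  rewrite !dE => h'.
  have -> : B * (dot3 (g (- y)) e - dot3 (g (- x)) e) =
            B * (- dot3 (g (- x)) e - - dot3 (g (- y)) e) by ring.
  apply: h' => u w yu uw wx; have := h (- w) (- u).
  by rewrite !opprK dKC// !dE lerNr lerN2 lerNl => /(_ wx uw yu) hh; apply: (le_trans hh); lc; lra.
- move=> t; have [n [h1 h2 h3 h4]] := sup (- t).
  by exists n; split=> // u; exact: h3.
- move=> x y xy yx; rewrite orient_antisym mulrNN.
  by apply: orr; move: xy yx; lc; lra.
Qed.
End Oval.

(** * Convex sets in the model space *)

Section Lift.
Variables (R : realType) (K : R).
Hypothesis K0 : 0 <= K.
Local Notation V := (vec3 R).
Local Notation q := (Num.sqrt K).
Local Notation N := (nK K).
Implicit Types (u v w x y z o p : V).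

(* Homogeneous coordinates: geodesic segments of S_K become positive combinations. *)
Definition lift : V -> V := locked (fun x => if K == 0 then x + mk3 0 0 1 else N x).
(** The positively homogeneous function equal to 1 on lifted points; dividing by it leads from the
    cone back to S_K. *)
Definition gauge : V -> R := locked (fun v => if K == 0 then c2 v else norm3 v).
Definition lscale : R := if K == 0 then 1 else q.

Lemma liftE x : lift x = if K == 0 then x + mk3 0 0 1 else N x.
Proof. by rewrite /lift -lock. Qed.
Lemma gaugeE v : gauge v = if K == 0 then c2 v else norm3 v.
Proof. by rewrite /gauge -lock. Qed.

Lemma lscale_gt0 : 0 < lscale.
Proof. by rewrite /lscale; case: (eqVneq K 0) => // /(q_gt0 K0). Qed.

Lemma gauge_lift x : SK K x -> gauge (lift x) = 1.
Proof.
rewrite liftE gaugeE; case: (eqVneq K 0) => [k0|_] hx.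
  move: hx; rewrite /SK -[x ord0 _]/(c2 x) k0 sqrtr0 mul0r => /esym /eqP.
  by rewrite mulf_eq0 pnatr_eq0 /= !vE => /eqP ->; rewrite add0r.
by rewrite /norm3 nK_unit// sqrtr1.
Qed.

Lemma gaugeZ (k : R) v : 0 <= k -> gauge (k *: v) = k * gauge v.
Proof.
by move=> k0; rewrite !gaugeE; case: eqP => _; rewrite ?c2Z// norm3Z ger0_norm.
Qed.

Lemma gauge_lip u v : `|gauge u - gauge v| <= norm3 (u - v).
Proof.
rewrite !gaugeE; case: eqP => _.
  rewrite -c2N -c2D -ler_sqr ?nnegrE ?norm3_ge0// real_normK ?num_real// norm3_sq dotE.
  by have := sqr_ge0 (c0 (u - v)); have := sqr_ge0 (c1 (u - v)); rewrite !expr2; lra.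
have := norm3D (u - v) v; rewrite subrK => h1.
have := norm3D (v - u) u; rewrite subrK norm3BC => h2.
by rewrite ler_norml; lra.
Qed.

Lemma unlift v : 0 < gauge v -> exists2 x, SK K x & lift x = (gauge v)^-1 *: v.
Proof.
rewrite gaugeE /SK; case: (eqVneq K 0) => [k0 v0|k0 v0].
  exists ((c2 v)^-1 *: v - mk3 0 0 1); last by rewrite liftE k0 eqxx subrK.
  rewrite k0 sqrtr0 mul0r -[_ ord0 _]/(c2 _) !vE mulVf ?lt0r_neq0// subrr mulr0//.
have q0 := q_gt0 K0 k0.
set w := (norm3 v)^-1 *: v.
have ww : dot3 w w = 1.
  by rewrite /w !dE -norm3_sq; field; rewrite lt0r_neq0.
clearbody w; exists (q^-1 *: (mk3 0 0 1 - w)).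
  rewrite -[_ ord0 _]/(c2 _).
  have -> : dot3 (q^-1 *: (mk3 0 0 1 - w)) (q^-1 *: (mk3 0 0 1 - w)) =
      q^-1 * q^-1 * (1 - 2 * c2 w + dot3 w w) by rewrite !vE; ring.
  by rewrite ww !vE; field; rewrite lt0r_neq0.
by rewrite liftE (negbTE k0) nKE scalerA divff ?lt0r_neq0// scale1r opprB addrC subrK.
Qed.

Lemma liftB x y : norm3 (lift x - lift y) = lscale * norm3 (x - y).
Proof.
rewrite !liftE /lscale; case: eqP => _.
  by rewrite mul1r opprD addrACA subrr addr0.
by rewrite nKB norm3Z normrN ger0_norm ?sqrtr_ge0.
Qed.

Lemma lift_inj x y : lift x = lift y -> x = y.
Proof.
move=> h; have := liftB x y; rewrite h subrr norm3_0 => /esym/eqP.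
by rewrite mulf_eq0 (gt_eqF lscale_gt0) /= norm3_eq0 subr_eq0 => /eqP.
Qed.

Lemma unlift_near o v (mu d : R) : SK K o -> 0 < mu -> d <= mu / 2 ->
  norm3 (v - mu *: lift o) <= d ->
  0 < gauge v /\ exists x, [/\ SK K x, lift x = (gauge v)^-1 *: v &
    lscale * norm3 (x - o) <= 2 * d * (1 + norm3 (lift o)) / mu].
Proof.
move=> ho mu0 dmu hd.
have := gauge_lip v (mu *: lift o).
rewrite gaugeZ ?(ltW mu0)// gauge_lift// mulr1 => /le_trans /(_ hd) hg.
have g2 : mu / 2 <= gauge v by move: hg; rewrite ler_norml; lra.
have g0 : 0 < gauge v by lra.
split=> //; have [x hx lx] := unlift g0; exists x; split=> //.
rewrite -liftB.
have E : gauge v *: (lift x - lift o) = (v - mu *: lift o) + (mu - gauge v) *: lift o.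
  rewrite lx scalerBr scalerA divff ?lt0r_neq0// scale1r scalerBl addrA.
  by congr (_ - _); rewrite -addrA [- _ + _]addrC subrr addr0.
have : gauge v * norm3 (lift x - lift o) <= d * (1 + norm3 (lift o)).
  rewrite -[X in X * _](gtr0_norm g0) -norm3Z E mulrDr mulr1.
  apply: (le_trans (norm3D _ _)); apply: lerD => //.
  by rewrite norm3Z ler_wpM2r ?norm3_ge0// distrC.
have n0 := norm3_ge0 (lift x - lift o).
move=> h; rewrite ler_pdivlMr// mulrC; nra.
Qed.

(** The constant term disappears because [b] is tangent at [z]. So the side of a geodesic through
    [z] is read off from a linear form on the lifts, which positive combinations respect. *)
Lemma lift_lin z b : SK K z -> dot3 b (N z) = 0 ->
  exists f, forall x, SK K x -> dot3 (x - z) b = dot3 (lift x) f.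
Proof.
move=> hz bz; case: (eqVneq K 0) => [k0|k0].
  exists (b - dot3 z b *: mk3 0 0 1) => x hx.
  have hx2 : c2 x = 0.
    move: hx; rewrite /SK -[x ord0 _]/(c2 x) k0 sqrtr0 mul0r => /esym /eqP.
    by rewrite mulf_eq0 pnatr_eq0 /= => /eqP.
  have b2 : c2 b = 0.
    by move: bz; rewrite nKE k0 sqrtr0 !vE !mul0r !subr0 !mulr0 !add0r mulr1.
  by rewrite liftE k0 eqxx !vE hx2 b2; ring.
have q0 := q_gt0 K0 k0.
exists (- q^-1 *: b) => x hx; rewrite liftE (negbTE k0).
have -> : dot3 (x - z) b = - q^-1 * dot3 (- q *: (x - z)) b.
  by rewrite !dotZl; field; rewrite lt0r_neq0.
by rewrite -nKB !dE (dotC (N z)) bz subr0.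
Qed.

(** [asin (norm3 (x - y) / 2)] is half the angle between unit vectors. The cosines of the doubled
    angles are compared by the addition formula; [cos (al + be) >= 0] keeps the sum in the range
    where cosine is injective, and the last hypothesis excludes antipodes. *)
Lemma arc_add u v w (l m s : R) : dot3 u u = 1 -> dot3 v v = 1 -> dot3 w w = 1 ->
  0 <= l -> 0 <= m -> 0 < s -> w = s *: (l *: u + m *: v) -> -1 < dot3 u v ->
  asin (norm3 (u - w) / 2) + asin (norm3 (w - v) / 2) = asin (norm3 (u - v) / 2).
Proof.
move=> uu vv ww l0 m0 s0 wE c1.
set c := dot3 u v in c1 *.
have half (x y : V) : dot3 x x = 1 -> dot3 y y = 1 ->
    let t := asin (norm3 (x - y) / 2) in
    [/\ 0 <= t, t <= pi / 2, cos (t + t) = dot3 x y,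
      cos t = Num.sqrt ((1 + dot3 x y) / 2) & sin t = Num.sqrt ((1 - dot3 x y) / 2)].
  move=> xx yy t.
  have n2 : (norm3 (x - y) / 2) ^+ 2 = (1 - dot3 x y) / 2.
    by rewrite expr_div_n norm3_sq !dE xx yy (dotC y x); field.
  have n0 : 0 <= norm3 (x - y) / 2 by rewrite divr_ge0// norm3_ge0.
  have n1 : norm3 (x - y) / 2 <= 1.
    have := norm3B x y; rewrite /norm3 xx yy sqrtr1; lc; lra.
  have [t0 t1 t2] := @asin_itv R (norm3 (x - y) / 2) ltac:((move: n1; lc; lra)).
  have st : sin t = Num.sqrt ((1 - dot3 x y) / 2).
    by rewrite t2 -n2 sqrtr_sqr ger0_norm.
  have ct2 : cos t ^+ 2 = (1 + dot3 x y) / 2 by rewrite cos2sin2 t2 n2; field.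
  split=> //.
    by rewrite -mulr2n cos_mulr2n ct2; field.
  rewrite -ct2 sqrtr_sqr ger0_norm// cos_ge0_pihalf//.
  by have := pi_gt0 R; move: t0 t1; rewrite -/t => t0 t1 p0; move: t1; lc; lra.
have [a0 a1 a2 a3 a4] := half u w uu ww.
have [b0 b1 b2 b3 b4] := half w v ww vv.
have [g0 g1 g2 _ _] := half u v uu vv.
set al := asin _ in a0 a1 a2 a3 a4 *; set be := asin _ in b0 b1 b2 b3 b4 *.
set ga := asin _ in g0 g1 g2 *.
have uw : dot3 u w = s * (l + m * c) by rewrite wE !dE uu -/c; ring.
have wv : dot3 w v = s * (l * c + m) by rewrite wE !dE vv -/c; ring.
have ss : s ^+ 2 * (l ^+ 2 + m ^+ 2 + 2 * l * m * c) = 1.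
  transitivity (dot3 w w); last exact: ww.
  by rewrite wE !dE uu vv (dotC v u) -/c; ring.
have cle : c <= 1.
  have := cauchy_sq u v; rewrite uu vv mulr1 -/c => h; nra.
have sum_ge0 : 0 <= dot3 u w + dot3 w v.
  rewrite uw wv; have -> : s * (l + m * c) + s * (l * c + m) = s * (l + m) * (1 + c) by ring.
  by rewrite !mulr_ge0//; move: c1; lc; lra.
have bnd x y : dot3 x x = 1 -> dot3 y y = 1 -> -1 <= dot3 x y <= 1.
  move=> xx yy; have := cauchy_sq x y; rewrite xx yy mulr1 => h.
  apply/andP; split; nra.
have /andP[uw1 uw2] := bnd _ _ uu ww; have /andP[wv1 wv2] := bnd _ _ ww vv.
have cge0 : 0 <= cos (al + be).
  rewrite cosD a3 a4 b3 b4 -!sqrtrM ?divr_ge0//; try lra.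
  by rewrite subr_ge0 ler_wsqrtr//; nra.
have ab2 : al + be <= pi / 2.
  rewrite leNgt; apply/negP => h.
  have := @ltr_cos R (pi / 2) (al + be); rewrite !in_itv /= h cos_pihalf.
  move=> /(_ ltac:((move: g1; lc; lra))) /(_ ltac:((move: a1 b1; lc; lra))); rewrite ltNge cge0//.
apply: (@mulrI _ 2); first by rewrite unitfE.
apply: (@cos_inj R); rewrite ?in_itv /=; [(move: ab2; lc; lra)|(move: g1; lc; lra)|].
have -> : 2 * ga = ga + ga by ring.
have -> : 2 * (al + be) = (al + al) + (be + be) by ring.
rewrite g2 cosD a2 b2 -/c.
have -> : sin (al + al) = s * m * Num.sqrt (1 - c ^+ 2).
  rewrite -mulr2n sin_mulr2n a3 a4 -sqrtrM ?divr_ge0//; try lra.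
  have -> : (1 + dot3 u w) / 2 * ((1 - dot3 u w) / 2) = (s * m / 2) ^+ 2 * (1 - c ^+ 2).
    have -> : (1 + dot3 u w) / 2 * ((1 - dot3 u w) / 2) = (1 - dot3 u w ^+ 2) / 4 by field.
    by rewrite uw -{1}ss; field.
  rewrite sqrtrM ?sqr_ge0// sqrtr_sqr ger0_norm ?divr_ge0 ?mulr_ge0 ?(ltW s0)//.
  by rewrite mulr2n; field.
have -> : sin (be + be) = s * l * Num.sqrt (1 - c ^+ 2).
  rewrite -mulr2n sin_mulr2n b3 b4 -sqrtrM ?divr_ge0//; try lra.
  have -> : (1 + dot3 w v) / 2 * ((1 - dot3 w v) / 2) = (s * l / 2) ^+ 2 * (1 - c ^+ 2).
    have -> : (1 + dot3 w v) / 2 * ((1 - dot3 w v) / 2) = (1 - dot3 w v ^+ 2) / 4 by field.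
    by rewrite wv -{1}ss; field.
  rewrite sqrtrM ?sqr_ge0// sqrtr_sqr ger0_norm ?divr_ge0 ?mulr_ge0 ?(ltW s0)//.
  by rewrite mulr2n; field.
rewrite uw wv.
have c2 : Num.sqrt (1 - c ^+ 2) * Num.sqrt (1 - c ^+ 2) = 1 - c ^+ 2.
  by rewrite -expr2 sqr_sqrtr//; nra.
have -> : s * m * Num.sqrt (1 - c ^+ 2) * (s * l * Num.sqrt (1 - c ^+ 2)) =
  s * m * (s * l) * (Num.sqrt (1 - c ^+ 2) * Num.sqrt (1 - c ^+ 2)) by ring.
rewrite c2; transitivity (s ^+ 2 * (l ^+ 2 + m ^+ 2 + 2 * l * m * c) * c); first ring.
by rewrite ss mul1r.
Qed.

(** Radial projection maps the segment between two lifts onto the minimizing geodesic, on which the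
    distances to the ends add up. The lifts cancel exactly for antipodal points. *)
Lemma convex_comb (O : set V) x y (l m : R) : O `<=` SK K -> SK_convex K O ->
  O x -> O y -> lift x + lift y != 0 -> 0 <= l -> 0 <= m -> 0 < l + m ->
  exists w, [/\ O w, 0 < gauge (l *: lift x + m *: lift y) &
    lift w = (gauge (l *: lift x + m *: lift y))^-1 *: (l *: lift x + m *: lift y)].
Proof.
move=> OSK cO Ox Oy nxy l0 m0 lm; set v := _ + _.
have hx := OSK _ Ox; have hy := OSK _ Oy.
have gv : 0 < gauge v.
  move: nxy; rewrite /v !liftE gaugeE; case: (eqVneq K 0) => [k0|k0] nxy.
    have c2z p : SK K p -> c2 p = 0.
      rewrite /SK -[p ord0 _]/(c2 p) k0 sqrtr0 mul0r => /esym /eqP.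
      by rewrite mulf_eq0 pnatr_eq0 /= => /eqP.
    by rewrite !vE !c2z// !add0r !mulr1.
  rewrite norm3_gt0; apply: contra nxy => /eqP e0.
  have nx := nK_unit hx; have ny := nK_unit hy.
  have h1 : l + m * dot3 (N x) (N y) = 0.
    have := congr1 (dot3 (N x)) e0; rewrite !dE nx mulr1 => ->//.
  have h2 : l * dot3 (N x) (N y) + m = 0.
    have := congr1 (fun w => dot3 w (N y)) e0; rewrite !dE ny mulr1 => ->//.
  have h3 : dot3 (N x) (N y) = -1.
    have : (l + m) * (1 + dot3 (N x) (N y)) = 0.
      transitivity ((l + m * dot3 (N x) (N y)) + (l * dot3 (N x) (N y) + m)); first ring.
      by rewrite h1 h2 addr0.
    by move/eqP; rewrite mulf_eq0 gt_eqF//= addrC addr_eq0 => /eqP.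
  by rewrite -dot_eq0 !dE nx ny (dotC (N y)) h3; apply/eqP; ring.
have [w hw lw] := unlift gv.
suff dw : dK K x w + dK K w y = dK K x y /\ (0 < K -> dK K x y < pi / Num.sqrt K).
  by exists w; split=> //; apply: (cO x y) => //; case: dw.
clear cO Ox Oy; move: gv lw nxy; rewrite /v {v} !gaugeE !liftE /dK /dist_of_chord.
case: (eqVneq K 0) => [k0|k0] gv lw nxy.
  split; last by rewrite k0 ltxx.
  have c2z p : SK K p -> c2 p = 0.
    rewrite /SK -[p ord0 _]/(c2 p) k0 sqrtr0 mul0r => /esym /eqP.
    by rewrite mulf_eq0 pnatr_eq0 /= => /eqP.
  have gE : c2 (l *: (x + mk3 0 0 1) + m *: (y + mk3 0 0 1)) = l + m.
    by rewrite !vE !c2z// !add0r !mulr1.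
  have wE : w = (l + m)^-1 *: (l *: x + m *: y).
    have := congr1 (fun p => p - mk3 0 0 1) lw; rewrite addrK gE => ->.
    by apply: vec3P; rewrite !vE; field; rewrite lt0r_neq0.
  have -> : x - w = (m / (l + m)) *: (x - y).
    by rewrite wE; apply: vec3P; rewrite !vE; field; rewrite lt0r_neq0.
  have -> : w - y = (l / (l + m)) *: (x - y).
    by rewrite wE; apply: vec3P; rewrite !vE; field; rewrite lt0r_neq0.
  rewrite !norm3Z !ger0_norm ?divr_ge0//; try exact: ltW.
  by field; rewrite lt0r_neq0.
have q0 := q_gt0 K0 k0.
have nx := nK_unit hx; have ny := nK_unit hy; have nw := nK_unit hw.
have qn (p r : V) : q * norm3 (p - r) = norm3 (N p - N r).
  by rewrite nKB norm3Z normrN ger0_norm ?sqrtr_ge0.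
have cgt : -1 < dot3 (N x) (N y).
  have h : 0 < dot3 (N x + N y) (N x + N y) by rewrite dot_gt0.
  by move: h; rewrite !dE nx ny (dotC (N y)); lc; lra.
rewrite !qn; split.
  by rewrite -mulrDr (@arc_add _ _ _ l m (norm3 (l *: N x + m *: N y))^-1)// invr_gt0.
move=> _; rewrite mulrAC ltr_pM2r ?invr_gt0//.
have n1 : norm3 (N x - N y) / 2 < 1.
  rewrite ltr_pdivrMr// mul1r -[ltRHS]ger0_norm// -sqrtr_sqr /norm3 ltr_sqrt//.
  by rewrite !dE nx ny (dotC (N y)) expr2; move: cgt; lc; lra.
have n0 : 0 <= norm3 (N x - N y) / 2 by rewrite divr_ge0// norm3_ge0.
have := @asin_ltpi2 R (norm3 (N x - N y) / 2) ltac:((move: n1; lc; lra)); lc; lra.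
Qed.

Lemma vertical z z' (c : R) : SK K z -> SK K z' -> z' - z = c *: N z ->
  z' = z \/ (K != 0 /\ lift z' = - lift z).
Proof.
move=> hz hz' e.
have nz := nK_unit hz; have nz' := nK_unit hz'.
have := SK_chord hz hz'; rewrite e !dE nz !mulr1 => hc.
have [k0|k0] := eqVneq K 0.
  left; apply/eqP; rewrite -subr_eq0 e.
  by move: hc; rewrite k0 sqrtr0 !mul0r => ->; rewrite scale0r.
have /eqP : c * (2 - q * c) = 0 by lra.
rewrite mulf_eq0 => /orP[/eqP c0|/eqP h].
  by left; apply/eqP; rewrite -subr_eq0 e c0 scale0r.
right; split=> //; rewrite !liftE (negbTE k0).
have -> : N z' = N z + (N z' - N z) by rewrite addrC subrK.
rewrite nKB e scalerA -{1}[N z]scale1r -scalerDl -[RHS]scaleN1r; congr (_ *: _).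
by rewrite mulNr; lra.
Qed.
End Lift.

Section Hull.
Variables (R : realType) (K : R).
Hypothesis K0 : 0 <= K.
Local Notation V := (vec3 R).
Local Notation q := (Num.sqrt K).
Local Notation N := (nK K).
Local Notation lift := (lift K).
Local Notation gauge := (gauge K).
Variable O : set V.
Hypotheses (OSK : O `<=` SK K) (cO : SK_convex K O).
Implicit Types (u v w x y z o p : V).

Definition ballO o (e : R) := [/\ SK K o, 0 < e & forall y, SK K y -> norm3 (y - o) < e -> O y].

Lemma comb_mem w x y (l m s : R) : O x -> O y -> lift x + lift y != 0 ->
  0 <= l -> 0 <= m -> 0 < l + m -> SK K w -> 0 < s ->
  lift w = s *: (l *: lift x + m *: lift y) -> O w.
Proof.
move=> Ox Oy nxy l0 m0 lm hw s0 lw.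
have [w' [Ow' g0 lw']] := convex_comb K0 OSK cO Ox Oy nxy l0 m0 lm.
suff -> : w = w' by [].
apply: (lift_inj K0); rewrite lw' lw; congr (_ *: _).
have := gauge_lift hw; rewrite lw gaugeZ ?(ltW s0)// => h.
by apply: (@mulIf _ (gauge (l *: lift x + m *: lift y))); rewrite ?h ?mulVf// lt0r_neq0.
Qed.

Lemma ballO_move o u (e s : R) : ballO o e -> dot3 u u = 1 -> dot3 u (N o) = 0 ->
  `|s| < e -> exists2 x, O x &
    x - o = (1 + K * s ^+ 2 / 4)^-1 *: (s *: u + (q * s ^+ 2 / 2) *: N o).
Proof.
move=> [ho e0 hball] uu uN se.
have := SK_move K0 s ho uu uN.
have Ks := mulr_ge0 K0 (sqr_ge0 s).
set D := 1 + K * s ^+ 2 / 4; set w := s *: u + _ *: N o => hx.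
have D1 : 1 <= D by rewrite /D; lra.
have D0 : 0 < D by lra.
exists (o + D^-1 *: w); last by rewrite addrC addKr.
apply: hball => //; rewrite addrC addKr; apply: le_lt_trans se.
rewrite norm3_le// real_normK ?num_real//.
have -> : dot3 (D^-1 *: w) (D^-1 *: w) = D^-1 * s ^+ 2.
  have DE : D = 1 + q * q * s ^+ 2 / 4 by rewrite sqK.
  have -> : dot3 (D^-1 *: w) (D^-1 *: w) = D^-1 * D^-1 * (s ^+ 2 * (1 + q * q * s ^+ 2 / 4)).
    by rewrite /w !dE uu (nK_unit ho) (dotC (N o)) uN; field; rewrite lt0r_neq0.
  by rewrite -DE; field; rewrite lt0r_neq0.
by rewrite ler_piMl ?sqr_ge0// invf_le1.
Qed.

(* [s / (2 (1 + K s^2 / 4))] bounds the height of o over every supporting line. *)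
Lemma ballO_height o z n (e s : R) : ballO o e -> SK K z -> dot3 n n = 1 -> dot3 n (N z) = 0 ->
  (forall x, O x -> 0 <= dot3 (x - z) n) -> 0 < s -> s < e ->
  s / (2 * (1 + K * s ^+ 2 / 4)) <= dot3 (o - z) n.
Proof.
move=> bo hz nn nN hn s0 se; have [ho e0 hball] := bo.
have nNo : dot3 n (N o) = - q * dot3 (o - z) n.
  have -> : N o = N z + (N o - N z) by rewrite addrC subrK.
  by rewrite nKB dotDr nN dotZr add0r (dotC n).
have Oo : O o by apply: hball; rewrite ?subrr ?norm3_0.
set h := dot3 (o - z) n in nNo *; have h0 : 0 <= h by exact: hn.
have Ks := mulr_ge0 K0 (sqr_ge0 s).
set D := 1 + K * s ^+ 2 / 4.
have D1 : 1 <= D by rewrite /D; lra.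
have q0 := q_ge0 K.
have Dq : q * s <= D.
  have -> : D = 1 + (q * s) ^+ 2 / 4 by rewrite /D exprMn (expr2 q) sqK.
  by have := sqr_ge0 (q * s / 2 - 1); nra.
rewrite ler_pdivrMr; last (move: D1; lc; lra).
have [Kh|Kh] := leP (3 / 4) (K * h ^+ 2).
  have qh : 3 / 4 <= (q * h) ^+ 2 by rewrite exprMn expr2 sqK.
  have qh0 : 0 <= q * h by rewrite mulr_ge0.
  have qh1 : 1 / 2 <= q * h by nra.
  have q00 : 0 < q by rewrite lt_neqAle q0 andbT eq_sym; apply: contraTneq qh1 => ->; rewrite mul0r; lc; lra.
  have : q * s <= 2 * (q * h) * D by nra.
  by rewrite (_ : 2 * (q * h) * D = q * (h * (2 * D))) ?ler_pM2l//; ring.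
pose t := n - dot3 n (N o) *: N o.
have No := nK_unit ho.
have tt : dot3 t t = 1 - K * h ^+ 2.
  transitivity (1 - q * q * h ^+ 2); last by rewrite sqK.
  by rewrite /t !dE nn No (dotC (N o)) nNo; ring.
have tN : dot3 t (N o) = 0 by rewrite /t !dE No mulr1 subrr.
have tn : dot3 t n = dot3 t t by rewrite /t !dE nn No (dotC (N o) n); ring.
clearbody t.
have nt2 : norm3 t ^+ 2 = 1 - K * h ^+ 2 by rewrite norm3_sq.
have nt0 := norm3_ge0 t.
have nt1 : 1 / 2 <= norm3 t by nra.
have ntp : 0 < norm3 t by move: nt1; lc; lra.
have [|||x Ox xE] := @ballO_move o (- (norm3 t)^-1 *: t) e s bo.
- by rewrite !dE -norm3_sq; field; rewrite lt0r_neq0.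
- by rewrite !dE tN mulr0.
- by rewrite gtr0_norm.
have := hn _ Ox.
have -> : x - z = (o - z) + (x - o) by apply: vec3P; rewrite !vE; ring.
rewrite dotDl -/h xE -/D dotZl dotDl !dotZl (dotC (N o)) nNo tn -norm3_sq.
have -> : s * (- (norm3 t)^-1 * norm3 t ^+ 2) + q * s ^+ 2 / 2 * (- q * h) =
    - (s * norm3 t + (q * q) * s ^+ 2 * h / 2) by field; rewrite lt0r_neq0.
rewrite sqK// mulrN subr_ge0 ler_pdivrMl; last (move: D1; lc; lra).
have := mulr_ge0 Ks h0 => Ksh hD; nra.
Qed.

Lemma ballO_comb w o z (e l m s : R) : O w -> ballO o e -> lift w + lift o != 0 ->
  0 < l -> 0 < m -> 0 < s -> SK K z -> lift z = s *: (l *: lift w + m *: lift o) ->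
  exists e', ballO z e'.
Proof.
move=> Ow [ho e0 hball] nwo l0 m0 s0 hz lz.
have ls0 := lscale_gt0 K0.
pose A := 1 + norm3 (lift o).
have A0 : 0 < A by rewrite /A; have := norm3_ge0 (lift o); lra.
pose c := Num.min (lscale K * e) (norm3 (lift w + lift o)).
have c0 : 0 < c by rewrite lt_min mulr_gt0//= norm3_gt0.
pose d := Num.min (m / 2) (m * c / (4 * A)).
have d0 : 0 < d by rewrite lt_min !divr_gt0 ?mulr_gt0.
exists (d * s / lscale K); split=> //; first by rewrite divr_gt0// mulr_gt0.
move=> y hy; rewrite ltr_pdivlMr// => hyz.
pose v := s^-1 *: lift y - l *: lift w.
have vE : v - m *: lift o = s^-1 *: (lift y - lift z).
  rewrite lz scalerBr scalerA mulVf ?lt0r_neq0// scale1r /v opprD addrA//.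
have nv : norm3 (v - m *: lift o) <= d.
  rewrite vE norm3Z gtr0_norm ?invr_gt0// liftB// mulrC ler_pdivrMr//.
  by rewrite mulrC ltW.
have d2 : d <= m / 2 by rewrite ge_min lexx.
have [g0 [x1 [hx1 lo1 no1]]] := unlift_near K0 ho m0 d2 nv.
have dc : lscale K * norm3 (x1 - o) < c.
  apply: (le_lt_trans no1); rewrite -/A.
  have d4 : d <= m * c / (4 * A) by rewrite ge_min lexx orbT.
  rewrite ltr_pdivrMr//.
  apply: (@le_lt_trans _ _ (2 * (m * c / (4 * A)) * A)).
    by rewrite ler_pM2r// ler_pM2l.
  have -> : 2 * (m * c / (4 * A)) * A = c * m / 2 by field; rewrite lt0r_neq0.
  by have := mulr_gt0 c0 m0; lc; lra.
have Oo1 : O x1.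
  apply: hball => //; rewrite -(ltr_pM2l ls0).
  by apply: (lt_le_trans dc); rewrite ge_min lexx.
have nwo1 : lift w + lift x1 != 0.
  apply: contraTneq dc => h; rewrite -leNgt -liftB//.
  have -> : lift x1 - lift o = - (lift w + lift o).
    have -> : lift x1 = - lift w by apply/eqP; rewrite -addr_eq0 addrC h.
    by rewrite opprD.
  by rewrite norm3N ge_min lexx orbT.
apply: (@comb_mem y w x1 l (gauge v) s) => //; [exact: ltW|exact: ltW|exact: addr_gt0|].
rewrite lo1 scalerA divff ?lt0r_neq0// scale1r /v addrC subrK scalerA divff ?lt0r_neq0//.
by rewrite scale1r.
Qed.

(** The geodesic from [y] through any [p] ends near the antipode of [y], hence inside the ball. The
    vector [t *: lift p - lift y] with small [t] is a point beyond [p] on it. *)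
Lemma ballO_antipode_full y y' (e : R) : K != 0 -> O y -> lift y' = - lift y ->
  ballO y' e -> forall p, SK K p -> O p.
Proof.
move=> k0 Oy ly [hy' e0 hball] p hp.
have ls0 := lscale_gt0 K0.
have unit x : SK K x -> dot3 (lift x) (lift x) = 1.
  by move=> /(nK_unit) hx; rewrite liftE (negbTE k0).
have hy := OSK Oy.
have [pe|pn] := eqVneq (lift p) (lift y); first by rewrite (lift_inj K0 pe).
have [pe|pn'] := eqVneq (lift p) (- lift y).
  have -> : p = y' by apply: (lift_inj K0); rewrite ly.
  by apply: hball => //; rewrite subrr norm3_0.
pose t := Num.min (1 / 2) (lscale K * e / 8).
have t0 : 0 < t by rewrite lt_min !divr_gt0 ?mulr_gt0.
have t1 : t <= 1 / 2 by rewrite ge_min lexx.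
have t2 : t <= lscale K * e / 8 by rewrite ge_min lexx orbT.
pose v := t *: lift p - lift y.
have nv : norm3 (v - 1 *: lift y') <= t.
  rewrite ly scale1r opprK /v subrK norm3Z gtr0_norm// /norm3 unit// sqrtr1 mulr1//.
have [g0 [x [hx lx nx]]] := unlift_near K0 hy' ltr01 t1 nv.
have Ox : O x.
  apply: hball => //; rewrite -(ltr_pM2l ls0); apply: (le_lt_trans nx).
  rewrite /norm3 unit// sqrtr1 divr1; have := mulr_gt0 ls0 e0; move: t2; lc; lra.
have nyx : lift y + lift x != 0.
  apply: contraNneq pn => h; apply/eqP.
  have e1 : t *: lift p = (1 - gauge v) *: lift y.
    have : gauge v *: lift x = v by rewrite lx scalerA divff ?lt0r_neq0// scale1r.
    have -> : lift x = - lift y by apply/eqP; rewrite -addr_eq0 addrC h.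
    move=> gE; have tp : t *: lift p = v + lift y by rewrite /v subrK.
    by rewrite tp scalerBl scale1r addrC -scalerN gE.
  have e2 : t ^+ 2 = (1 - gauge v) ^+ 2.
    have := congr1 (fun u => dot3 u u) e1; rewrite !dE !unit// !mulr1 -!expr2//.
  move/eqP: e2; rewrite eqf_sqr => /orP[/eqP e2|/eqP e2].
    by move: e1; rewrite -e2 => /scalerI; apply; rewrite lt0r_neq0.
  exfalso; move/negP: pn'; apply; apply/eqP.
  move: e1; rewrite -[1 - _]opprK -e2 scaleNr -scalerN => /scalerI; apply; rewrite lt0r_neq0//.
apply: (@comb_mem p y x 1 (gauge v) t^-1) => //; [exact: ltW| (lc; lra) | by rewrite invr_gt0|].
rewrite lx scalerA divff ?lt0r_neq0// !scale1r /v addrC subrK scalerA mulVf ?lt0r_neq0//.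
by rewrite scale1r.
Qed.

Section Support.
Variables (o z : V) (e : R).
Hypotheses (bo : ballO o e) (hz : SK K z).
Hypothesis zclos : forall e' : R, 0 < e' -> exists2 y, O y & norm3 (y - z) < e'.
Hypothesis zint : forall e', ~ ballO z e'.

Let nofull : ~ (forall p, SK K p -> O p).
Proof. by move=> h; apply: (zint (e' := 1)); split=> // y hy _; exact: h. Qed.

Let noanti z' e' : K != 0 -> lift z' = - lift z -> ~ ballO z' e'.
Proof.
move=> k0 lz' [hz' e0 hball].
have ls0 := lscale_gt0 K0.
have e20 : 0 < e' / 2 by rewrite divr_gt0.
have [y Oy nyz] := zclos e20; have hy := OSK Oy.
have gy : 0 < gauge (- lift y).
  by rewrite gaugeE (negbTE k0) norm3N liftE (negbTE k0) /norm3 nK_unit// sqrtr1.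
have [y' hy' ly'] := unlift K0 gy.
have ly : lift y' = - lift y.
  by rewrite ly' gaugeE (negbTE k0) norm3N liftE (negbTE k0) /norm3 nK_unit// sqrtr1 invr1 scale1r.
apply: nofull; apply: (ballO_antipode_full k0 Oy ly (e := e' / 2)); split=> // x hx nx.
apply: hball => //; apply: (le_lt_trans (norm3_tri _ y' _)).
have : norm3 (y' - z') = norm3 (y - z).
  apply: (@mulfI _ (lscale K)); first by rewrite lt0r_neq0.
  by rewrite -!liftB// ly lz' -opprD norm3N.
lra.
Qed.

Let vert_ball z' (c : R) e' : SK K z' -> z' - z = c *: N z -> ~ ballO z' e'.
Proof.
move=> hz' zc; have [->|[k0 lz']] := vertical hz hz' zc; first exact: zint.
exact: noanti.
Qed.

(** Let [d] be the tangent direction at [z] towards [o], and [a] orthogonal to it. No point of [O]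
    lies straight behind [z] ([W]), so the quotients of the [d] and [a] coordinates on the right are
    at least those on the left ([comb0]). Their infimum on the right is the slope of a supporting
    line. *)
Lemma support_exists : exists n, [/\ dot3 n n = 1, dot3 n (N z) = 0 &
  forall x, O x -> 0 <= dot3 (x - z) n].
Proof.
have ho : SK K o by case: bo.
have nz := nK_unit hz.
have [t [tN tE]] : exists t, dot3 t (N z) = 0 /\ o - z = t + dot3 (o - z) (N z) *: N z.
  exists ((o - z) - dot3 (o - z) (N z) *: N z); split; last by rewrite subrK.
  by rewrite (dotDl (o - z)) dotNl dotZl nz mulr1 subrr.
have t0 : t != 0.
  apply/eqP => t0; apply: (@vert_ball o (dot3 (o - z) (N z)) e) => //.
  by rewrite {1}tE t0 add0r.
have nt0 : 0 < norm3 t by rewrite norm3_gt0.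
have [d [dd Nd td]] : exists d, [/\ dot3 d d = 1, dot3 (N z) d = 0 & t = norm3 t *: d].
  exists ((norm3 t)^-1 *: t); split.
  - by rewrite !dE -norm3_sq; field; rewrite lt0r_neq0.
  - by rewrite dotZr dotC tN mulr0.
  - by rewrite scalerA divff ?lt0r_neq0// scale1r.
pose a := frameT 1 (N z) d.
have s1 : 1 * 1 = 1 :> R by rewrite mulr1.
have aa : dot3 a a = 1 by exact: frameTT.
have ad : dot3 a d = 0 by exact: frameTn.
have aN : dot3 a (N z) = 0 by exact: frameTm.
have dec x : x = dot3 x a *: a + dot3 x d *: d + dot3 x (N z) *: N z by exact: frame_decomp.
clearbody a.
have oa : dot3 (o - z) a = 0.
  by rewrite tE td !dotDl !dotZl (dotC d) ad (dotC _ a) aN !mulr0 addr0.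
have od : dot3 (o - z) d = norm3 t.
  by rewrite tE {1}td !dotDl !dotZl dd Nd mulr0 addr0 mulr1.
have [fa hfa] := lift_lin K0 hz aN.
have [fd hfd] : exists f, forall x, SK K x -> dot3 (x - z) d = dot3 (lift x) f.
  by apply: lift_lin => //; rewrite dotC.
(* A point behind [z] would be joined to the ball about [o] by a geodesic through [z] or its
   antipode, which would then be interior. *)
have W w : O w -> dot3 (w - z) a = 0 -> dot3 (w - z) d < 0 -> False.
  move=> Ow wa wd; have hw := OSK Ow.
  have [wo|wo] := eqVneq (lift w + lift o) 0.
    have k0 : K != 0.
      apply: contra_eq_neq wo => k0; apply/eqP => /(congr1 (@c2 R)).
      have c2z p : SK K p -> c2 p = 0.
        rewrite /SK -[p ord0 _]/(c2 p) k0 sqrtr0 mul0r => /esym /eqP.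
        by rewrite mulf_eq0 pnatr_eq0 /= => /eqP.
      by rewrite !liftE k0 eqxx !vE !c2z// !add0r => /eqP; rewrite (_ : 1 + 1 = 2) ?pnatr_eq0//; ring.
    apply: nofull; apply: (ballO_antipode_full k0 Ow _ bo).
    by apply/eqP; rewrite -addr_eq0 addrC wo.
  have l0 : 0 < norm3 t by [].
  have m0 : 0 < - dot3 (w - z) d by move: wd; lc; lra.
  have Oo : O o by case: bo => _ e0; apply=> //; rewrite subrr norm3_0.
  have [z' [Oz' g0 lz']] := convex_comb K0 OSK cO Ow Oo wo (ltW l0) (ltW m0) (addr_gt0 l0 m0).
  have hz' := OSK Oz'.
  have [e' be'] : exists e', ballO z' e'.
    by apply: (ballO_comb Ow bo wo l0 m0 _ hz' lz'); rewrite invr_gt0.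
  have z'a : dot3 (z' - z) a = 0.
    by rewrite hfa// lz' !dE -!hfa// oa wa !mulr0 addr0 mulr0.
  have z'd : dot3 (z' - z) d = 0.
    by rewrite hfd// lz' (dotZl _ _ fd) (dotDl _ _ fd) !(dotZl _ _ fd) -!hfd// od; ring.
  apply: (@vert_ball z' (dot3 (z' - z) (N z)) e') => //.
  by rewrite {1}(dec (z' - z)) z'a z'd !scale0r !add0r.
(* If the order failed, the geodesic from [x] to [y] would cross the axis behind [z], against
   [W]. *)
have comb0 x y : O x -> O y -> 0 < dot3 (x - z) a -> dot3 (y - z) a < 0 ->
    dot3 (y - z) d / dot3 (y - z) a <= dot3 (x - z) d / dot3 (x - z) a.
  move=> Ox Oy xa ya; rewrite leNgt; apply/negP => h.
  have hx := OSK Ox; have hy := OSK Oy.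
  have h' : - dot3 (y - z) a * dot3 (x - z) d + dot3 (x - z) a * dot3 (y - z) d < 0.
    move: h; rewrite ltr_pdivrMr// mulrAC ltr_ndivlMr//; lc; lra.
  have [xy|xy] := eqVneq (lift x + lift y) 0.
    have ex : lift x = - lift y by apply/eqP; rewrite -addr_eq0 xy.
    by move: h'; rewrite !hfa// !hfd// ex !dE; lc; lra.
  have m0 : 0 < - dot3 (y - z) a by move: ya; lc; lra.
  have [w [Ow g0 lw]] := convex_comb K0 OSK cO Ox Oy xy (ltW m0) (ltW xa) (addr_gt0 m0 xa).
  have hw := OSK Ow.
  apply: (W w) => //.
    by rewrite hfa// lw (dotZl _ _ fa) (dotDl _ _ fa) !(dotZl _ _ fa) -!hfa//; ring.
  by rewrite hfd// lw (dotZl _ _ fd) (dotDl _ _ fd) !(dotZl _ _ fd) -!hfd// pmulr_rlt0 ?invr_gt0.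
have aNo : dot3 a (N o) = 0.
  have -> : N o = N z + (N o - N z) by rewrite addrC subrK.
  by rewrite nKB dotDr aN dotZr (dotC a) oa mulr0 addr0.
have e0 : 0 < e by case: bo.
have side (s : R) : `|s| < e -> exists2 x, O x & exists2 D : R, 0 < D & dot3 (x - z) a = D^-1 * s.
  move=> se; have [x Ox xE] := ballO_move bo aa aNo se.
  exists x => //; exists (1 + K * s ^+ 2 / 4); first by have := mulr_ge0 K0 (sqr_ge0 s); lc; lra.
  have -> : x - z = (o - z) + (x - o) by apply: vec3P; rewrite !vE; ring.
  by rewrite dotDl oa xE !dE aa (dotC _ a) aNo; ring.
have [xp Oxp xpa] : exists2 x, O x & 0 < dot3 (x - z) a.
  have [|x Ox [D D0 xE]] := side (e / 2); first by rewrite gtr0_norm; lc; lra.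
  by exists x => //; rewrite xE mulr_gt0 ?invr_gt0//; lc; lra.
have [xm Oxm xma] : exists2 x, O x & dot3 (x - z) a < 0.
  have [|x Ox [D D0 xE]] := side (- (e / 2)); first by rewrite normrN gtr0_norm; lc; lra.
  by exists x => //; rewrite xE mulrN oppr_lt0 mulr_gt0 ?invr_gt0//; lc; lra.
pose S := [set r : R | exists x, [/\ O x, 0 < dot3 (x - z) a & r = dot3 (x - z) d / dot3 (x - z) a]].
have hS : has_inf S.
  split; first by exists (dot3 (xp - z) d / dot3 (xp - z) a); exists xp.
  by exists (dot3 (xm - z) d / dot3 (xm - z) a) => r [x [Ox xa ->]]; exact: comb0.
pose p := inf S.
have p1 : 0 < 1 + p ^+ 2 by have := sqr_ge0 p; lc; lra.
exists ((Num.sqrt (1 + p ^+ 2))^-1 *: (d - p *: a)); split.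
- rewrite !dE dd aa ad (dotC d a) ad.
  transitivity ((Num.sqrt (1 + p ^+ 2))^-1 ^+ 2 * (1 + p ^+ 2)); first ring.
  by rewrite exprVn sqr_sqrtr ?mulVf ?lt0r_neq0// ltW.
- by rewrite !dE (dotC d) Nd aN; ring.
move=> x Ox; rewrite dotZr mulr_ge0 ?invr_ge0 ?sqrtr_ge0// dotDr dotNr dotZr subr_ge0.
have [xa|xa|xa] := ltgtP (dot3 (x - z) a) 0.
- rewrite -ler_ndivrMr//; apply: lb_le_inf; first by case: hS.
  by move=> r [y [Oy ya ->]]; exact: comb0.
- rewrite -ler_pdivlMr//; apply: ge_inf; first by case: hS.
  by exists x.
- by rewrite xa mulr0 leNgt; apply/negP => xd; exact: (W x).
Qed.
End Support.
End Hull.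

(** * Convex sets that contain no ball *)

Section HullFlat.
Variables (R : realType) (K : R).
Hypothesis K0 : 0 <= K.
Local Notation V := (vec3 R).
Local Notation q := (Num.sqrt K).
Local Notation N := (nK K).
Local Notation lift := (lift K).
Local Notation gauge := (gauge K).
Variable O : set V.
Hypotheses (OSK : O `<=` SK K) (cO : SK_convex K O).
Implicit Types (u v w x y z o p : V).

Definition det3 u v w : R := dot3 (cross u v) w.

Lemma cramer x y z p : det3 x y z *: p =
  det3 p y z *: x + det3 x p z *: y + det3 x y p *: z.
Proof. by apply: vec3P; rewrite /det3 !vE; ring. Qed.

(** The sum of three independent lifts is interior to their cone: by Cramer's rule the coefficients
    of nearby vectors stay positive. *)
Lemma ballO_triple x y z : O x -> O y -> O z -> det3 (lift x) (lift y) (lift z) != 0 ->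
  exists o e, ballO K O o e.
Proof.
move=> Ox Oy Oz; have hx := OSK Ox; have hy := OSK Oy; have hz := OSK Oz.
set X := lift x; set Y := lift y; set Z := lift z => d0.
have ls0 := lscale_gt0 K0.
pose v := X + Y + Z.
have g0 : 0 < gauge v.
  rewrite gaugeE; case: (eqVneq K 0) => [k0|k0].
    have c2z p : SK K p -> c2 p = 0.
      rewrite /SK -[p ord0 _]/(c2 p) k0 sqrtr0 mul0r => /esym /eqP.
      by rewrite mulf_eq0 pnatr_eq0 /= => /eqP.
    by rewrite /v /X /Y /Z !liftE k0 eqxx !vE !c2z// !add0r; lra.
  rewrite norm3_gt0; apply: contra_neq d0 => v0.
  have -> : X = - Y - Z by apply/eqP; rewrite -subr_eq0 opprD !opprK addrA -/v v0.
  by rewrite /det3 !vE; ring.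
have [ o ho lo] := unlift K0 g0.
pose D := det3 X Y Z.
have [M M0 hM] : exists2 M : R, 0 < M & forall p,
    [/\ `|det3 p Y Z| <= M * norm3 p, `|det3 X p Z| <= M * norm3 p & `|det3 X Y p| <= M * norm3 p].
  pose M1 := norm3 (cross Y Z); pose M2 := norm3 (cross Z X); pose M3 := norm3 (cross X Y).
  have [m1 m2 m3] : [/\ 0 <= M1, 0 <= M2 & 0 <= M3] by split; exact: norm3_ge0.
  exists (M1 + M2 + M3 + 1); first by lra.
  move=> p; have np := norm3_ge0 p; split.
  - have -> : det3 p Y Z = dot3 (cross Y Z) p by rewrite /det3 !vE; ring.
    by apply: (le_trans (cauchy _ _)); rewrite ler_wpM2r// /M1; lra.
  - have -> : det3 X p Z = dot3 (cross Z X) p by rewrite /det3 !vE; ring.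
    by apply: (le_trans (cauchy _ _)); rewrite ler_wpM2r// /M2; lc; lra.
  - by apply: (le_trans (cauchy _ _)); rewrite ler_wpM2r// /M3; lc; lra.
have gi0 : 0 < (gauge v)^-1 by rewrite invr_gt0.
have nD0 : 0 < `|D| by rewrite normr_gt0.
have oE : [/\ det3 (lift o) Y Z = D / gauge v, det3 X (lift o) Z = D / gauge v &
    det3 X Y (lift o) = D / gauge v].
  by rewrite lo /v /D /det3; split; rewrite !vE; ring.
pose e := `|D| / (gauge v * M * lscale K).
exists o, e; split=> //; first by rewrite divr_gt0// !mulr_gt0.
move=> p hp npo.
have nl : M * norm3 (lift p - lift o) < `|D| / gauge v.
  move: npo; rewrite liftB// /e ltr_pdivlMr ?mulr_gt0// => h.
  by rewrite ltr_pdivlMr//; lra.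
pose al := det3 (lift p) Y Z / D; pose be := det3 X (lift p) Z / D; pose ga := det3 X Y (lift p) / D.
have pos (c : R) (dp : R) : `|dp - D / gauge v| < `|D| / gauge v -> 0 < dp / D.
  move=> h; have D0 : D != 0 by [].
  have : `|dp / D - (gauge v)^-1| < (gauge v)^-1.
    rewrite -(ltr_pM2r nD0) -normrM mulrBl divfK// mulrC (mulrC _ `|D|)//.
  by rewrite ltr_norml; lc; lra.
have [hM1 hM2 hM3] := hM (lift p - lift o).
have al0 : 0 < al.
  apply: (pos 0); apply: le_lt_trans nl; case: oE => <- _ _; apply: le_trans hM1.
  by rewrite /det3 !vE le_eqVlt; apply/orP; left; apply/eqP; congr `|_|; ring.
have be0 : 0 < be.
  apply: (pos 0); apply: le_lt_trans nl; case: oE => _ <- _; apply: le_trans hM2.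
  by rewrite /det3 !vE le_eqVlt; apply/orP; left; apply/eqP; congr `|_|; ring.
have ga0 : 0 < ga.
  apply: (pos 0); apply: le_lt_trans nl; case: oE => _ _ <-; apply: le_trans hM3.
  by rewrite /det3 !vE le_eqVlt; apply/orP; left; apply/eqP; congr `|_|; ring.
have pE : lift p = al *: X + be *: Y + ga *: Z.
  apply: (@scalerI _ _ D) => //; rewrite cramer !scalerDr !scalerA /al /be /ga.
  by rewrite ![D * (_ / D)]mulrC !divfK.
have nXY : X + Y != 0.
  apply: contra_neq d0 => h.
  have -> : X = - Y by apply/eqP; rewrite -addr_eq0 h.
  by rewrite /det3 !vE; ring.
have [w [Ow gw lw]] := convex_comb K0 OSK cO Ox Oy nXY (ltW al0) (ltW be0) (addr_gt0 al0 be0).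
set G := gauge _ in gw lw.
have nWZ : lift w + Z != 0.
  apply: contra_neq d0 => h.
  have -> : Z = - lift w by apply/eqP; rewrite -addr_eq0 addrC h.
  by rewrite lw /det3 !vE; ring.
apply: (@comb_mem _ _ K0 _ OSK cO p w z G ga 1) => //; try exact: ltW.
  exact: addr_gt0.
by rewrite scale1r lw scalerA divff ?lt0r_neq0// scale1r pE.
Qed.

Lemma flat_exists : (forall o e, ~ ballO K O o e) ->
  exists2 n, n != 0 & forall x, O x -> dot3 (lift x) n = 0.
Proof.
move=> nb.
have d0 x y z : O x -> O y -> O z -> det3 (lift x) (lift y) (lift z) = 0.
  move=> Ox Oy Oz; apply/eqP; apply/negPn/negP => h.
  by have [ o [e b]] := ballO_triple Ox Oy Oz h; exact: (nb o e).
have [[x [y [Ox Oy xy]]]|h] := pselect (exists x y, [/\ O x, O y & cross (lift x) (lift y) != 0]).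
  by exists (cross (lift x) (lift y)) => // z Oz; rewrite dotC; exact: d0.
have [[x Ox]|hO] := pselect (exists x, O x); last first.
  exists (mk3 0 0 1) => [|x Ox]; last by exfalso; apply: hO; exists x.
  by rewrite -dot_eq0 !vE !mulr0 !add0r mulr1 oner_neq0.
have x0 : lift x != 0.
  apply/eqP => h0; have := gauge_lift (OSK Ox); rewrite h0 gaugeE.
  by rewrite c20 norm3_0 if_same => /esym/eqP; rewrite oner_eq0.
have [n [n0 nx]] : exists n, n != 0 /\ dot3 (lift x) n = 0.
  have [z0|z0] := eqVneq (cross (lift x) (mk3 0 0 1)) 0.
    exists (mk3 1 0 0); split; first by rewrite -dot_eq0 !vE !mulr0 !addr0 mulr1 oner_neq0.
    have := congr1 (@c1 R) z0; rewrite !vE; lra.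
  by exists (cross (lift x) (mk3 0 0 1)); split=> //; rewrite dotC dot_crossl.
exists n => // y Oy.
have z0 : cross (lift x) (lift y) = 0.
  by apply/eqP; apply/negPn/negP => hh; apply: h; exists x, y.
have hp : dot3 (lift x) (lift x) *: lift y = dot3 (lift x) (lift y) *: lift x.
  have : cross (cross (lift x) (lift y)) (lift x) = 0 by rewrite z0; apply: vec3P; rewrite !vE; ring.
  move=> hc; apply/eqP; rewrite -subr_eq0 -hc; apply/eqP; apply: vec3P; rewrite !vE; ring.
have := congr1 (fun w => dot3 w n) hp; rewrite !dotZl nx mulr0 => /eqP.
by rewrite mulf_eq0 dot_eq0 (negbTE x0) /= => /eqP.
Qed.
End HullFlat.

(** * Arc-length parametrization *)

Section CurveBasics.
Variables (R : realType) (K : R) (g : R -> vec3 R) (L : R).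
Hypotheses (K0 : 0 <= K) (cc : closed_convex_curve K g L).

Let L0 : 0 < L. Proof. by case: cc => -[]. Qed.
Let gSK t : SK K (g t). Proof. by case: cc => -[]. Qed.
Let per t : g (t + L) = g t. Proof. by case: cc => -[]. Qed.

Lemma ccc_inj (x y : R) : x < y -> y < x + L -> g x <> g y.
Proof.
move=> xy yx.
have pern (n : nat) t : g (t + n%:R * L) = g t.
  by elim: n => [|n IH]; rewrite ?mul0r ?addr0// -natr1 mulrDl mul1r addrA per.
have perz (z : int) t : g (t + z%:~R * L) = g t.
  case: z => n; first exact: pern.
  rewrite NegzE -[in RHS](subrK (n.+1%:R * L) t) pern; congr g.
  by rewrite mulrNz mulNr.
have inj0 : forall s t, 0 <= s -> s < t -> t < L -> g s <> g t by case: cc => _ [].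
pose z := Num.floor (x / L).
have /andP[z1 z2] := floor_itv (x / L).
have x1 : z%:~R * L <= x by rewrite -ler_pdivlMr.
have x2 : x < z%:~R * L + L.
  by rewrite -{2}[L]mul1r -mulrDl -ltr_pdivrMr// -(intrD _ z 1).
rewrite -(perz (- z) x) -(perz (- z) y) !mulrNz !mulNr.
have [h|h] := ltP (y - z%:~R * L) L.
  by apply: inj0 => //; rewrite ?ltrD2r// subr_ge0.
have -> : y - z%:~R * L = (y - z%:~R * L - L) + L by rewrite subrK.
by rewrite per => /esym; move: (z%:~R * L) x1 x2 h => w x1 x2 h; apply: inj0; move: h x2 yx; lc; lra.
Qed.

(** Without a supremum [sup] takes its default value 0, which the positive length [y - x]
    excludes. *)
Lemma ccc_sup (x y : R) : x < y -> has_sup (partition_sums K g x y).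
Proof.
move=> xy; apply: contrapT => h.
have : curve_length K g x y = y - x by case: cc => _ [_ /(_ x y (ltW xy))].
by rewrite /curve_length sup_out//; lra.
Qed.

Lemma ccc_dK (x y : R) : x <= y -> dK K (g x) (g y) <= y - x.
Proof.
rewrite le_eqVlt => /orP[/eqP->|xy]; first by rewrite /dK !subrr norm3_0 doc0.
have <- : curve_length K g x y = y - x by case: cc => _ [_ /(_ x y (ltW xy))].
apply: ub_le_sup; first by case: (ccc_sup xy).
exists 1%N, (fun i => if i == 0%N then x else y); split=> //.
  by move=> i; rewrite ltnS leqn0 => /eqP ->; exact: ltW.
by rewrite big_ord_recl big_ord0 addr0.
Qed.

(** The bound telescopes over a partition, so it passes from chords to the length. This is how the
    parametrization is later shown to advance at unit speed. *)
Lemma ccc_len (x y B : R) (e : vec3 R) : x <= y ->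
  (forall u w : R, x <= u -> u <= w -> w <= y -> dK K (g u) (g w) <= B * dot3 (g w - g u) e) ->
  y - x <= B * dot3 (g y - g x) e.
Proof.
rewrite le_eqVlt => /orP[/eqP->|xy] h; first by rewrite !subrr dot0l mulr0.
have <- : curve_length K g x y = y - x by case: cc => _ [_ /(_ x y (ltW xy))].
apply: ge_sup; first by case: (ccc_sup xy).
move=> _ [n [p [p0 pn pm ->]]].
have mono i j : (i <= j)%N -> (j <= n)%N -> p i <= p j.
  elim: j => [|j IH]; first by rewrite leqn0 => /eqP ->.
  rewrite leq_eqVlt => /orP[/eqP->//|]; rewrite ltnS => ij jn.
  by apply: le_trans (IH ij (ltnW jn)) (pm _ jn).
apply: (@le_trans _ _ (\sum_(i < n) (B * (dot3 (g (p i.+1)) e - dot3 (g (p i)) e)))).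
  apply: ler_sum => i _; have := h (p i) (p i.+1); rewrite !dE; apply.
  - by rewrite -p0 mono// ltnW.
  - exact: pm.
  - by rewrite -pn mono.
rewrite -mulr_sumr -(big_mkord xpredT (fun i => dot3 (g (p i.+1)) e - dot3 (g (p i)) e)).
by rewrite telescope_sumr// pn p0 !dE.
Qed.

Lemma ccc_lip (x y : R) : norm3 (g y - g x) <= `|y - x|.
Proof.
have [xy|yx] := leP x y.
  rewrite ger0_norm ?subr_ge0//; apply: le_trans (ccc_dK xy); exact: dK_ge_norm.
rewrite ltr0_norm ?subr_lt0// opprB norm3BC; apply: le_trans (ccc_dK (ltW yx)); exact: dK_ge_norm.
Qed.
End CurveBasics.

Section LipCont.
Variable R : realType.

Lemma lip_continuous (f : R -> R) (C : R) :
  (forall x y : R, `|f y - f x| <= C * `|y - x|) -> continuous f.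
Proof.
move=> h x; apply/cvgrPdist_le => e e0.
have C1 : 0 < `|C| + 1 by have := normr_ge0 C; lra.
apply/nbhs_ballP; exists (e / (`|C| + 1)) => /=; first by rewrite divr_gt0.
move=> y; rewrite /ball /= distrC => hy; rewrite distrC; apply: (le_trans (h x y)).
apply: (@le_trans _ _ ((`|C| + 1) * `|y - x|)).
  by rewrite ler_wpM2r//; have := ler_norm C; lra.
by rewrite mulrC -ler_pdivlMr// ltW.
Qed.

Lemma continuous_compR (k e : R -> R) : continuous k -> continuous e -> continuous (fun z => k (e z)).
Proof. by move=> ck ce z; apply: continuous_comp; [exact: ce | exact: ck]. Qed.

Lemma continuous_subR (f h : R -> R) : continuous f -> continuous h -> continuous (fun z => f z - h z).
Proof. by move=> cf ch z; apply: cvgB; [exact: cf | exact: ch]. Qed.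

Lemma continuous_sum3 (a b a' b' a'' b'' : R -> R) : continuous a -> continuous b ->
  continuous a' -> continuous b' -> continuous a'' -> continuous b'' ->
  continuous (fun z => a z * b z + a' z * b' z + a'' z * b'' z).
Proof.
move=> h1 h2 h3 h4 h5 h6 z.
by apply: cvgD; [apply: cvgD|]; apply: cvgM; [exact: h1|exact: h2|exact: h3|exact: h4|exact: h5|exact: h6].
Qed.

Lemma same_sign (f : R -> R) (a b : R) : a <= b -> {within `[a, b], continuous f} ->
  (forall x, a <= x <= b -> f x != 0) -> 0 < f a * f b.
Proof.
move=> ab cf nf; rewrite ltNge; apply/negP => h.
have [c] : exists2 c : R, c \in `[a, b] & f c = 0.
  apply: IVT => //; rewrite ge_min le_max.
  have [fa|fa] := leP (f a) 0; have [fb|fb] := leP (f b) 0.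
  - have fa0 : f a < 0 by rewrite lt_neqAle nf ?fa//; lra.
    have fb0 : f b < 0 by rewrite lt_neqAle nf ?fb//; lra.
    by have := nmulr_rgt0 (f b) fa0; rewrite fb0 => hh; move: h; rewrite leNgt hh.
  - by rewrite (ltW fb) orbT.
  - by rewrite (ltW fa) orbT.
  - by have := mulr_gt0 fa fb; rewrite ltNge h.
by rewrite in_itv /= => /nf /eqP.
Qed.

Lemma closed_not_injective (f : R -> R) (L : R) : 0 < L -> continuous f -> f L = f 0 ->
  {in `[0, L[ &, injective f} -> False.
Proof.
move=> L0 cf fL inj.
have cw : {within `[0, L[, continuous f} by exact: continuous_subspaceT.
have := cf L; move/cvgrPdist_lt => cL.
have near_L (e : R) : 0 < e -> exists2 x, L / 2 < x < L & `|f x - f L| < e.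
  move=> e0; have /nbhs_ballP[d /= d0 hd] := cL _ e0.
  pose x := Num.max (L - d / 2) (3 * L / 4).
  have x1 : L - d / 2 <= x by rewrite le_max lexx.
  have x2 : 3 * L / 4 <= x by rewrite le_max lexx orbT.
  have x3 : x < L by rewrite gt_max; apply/andP; split; lc; lra.
  exists x; first by apply/andP; split; move: x2 x3; lc; lra.
  by rewrite distrC; apply: hd; rewrite /ball /= ger0_norm; move: x1 x3; lc; lra.
have i0 : (0 : R) \in `[0, L[ by rewrite in_itv /= lexx.
have i1 : L / 2 \in `[0, L[ by rewrite in_itv /=; apply/andP; split; lc; lra.
have ix x : L / 2 < x < L -> x \in `[0, L[.
  by move=> /andP[h1 h2]; rewrite in_itv /= h2 andbT; move: h1; lc; lra.
have l2 : 0 < L / 2 by lc; lra.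
case: (itv_continuous_inj_mono cw inj) => mono.
  have h1 := mono _ _ i0 i1 l2.
  have [|x hx hf] := near_L (f (L / 2) - f 0); first (move: h1; lc; lra).
  have h2 := mono _ _ i1 (ix _ hx) ltac:(by case/andP: hx).
  by move: hf; rewrite fL ltr_norml; move: h2; lc; lra.
have h1 := mono _ _ i1 i0 l2.
have [|x hx hf] := near_L (f 0 - f (L / 2)); first (move: h1; lc; lra).
have h2 := mono _ _ (ix _ hx) i1 ltac:(by case/andP: hx).
by move: hf; rewrite fL ltr_norml; move: h2; lc; lra.
Qed.
End LipCont.

(** * From closed convex curves to ovals *)

Section CurveOval.
Variables (R : realType) (K : R) (g : R -> vec3 R) (L : R).
Hypotheses (K0 : 0 <= K) (cc : closed_convex_curve K g L).
Local Notation V := (vec3 R).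
Local Notation q := (Num.sqrt K).
Local Notation N := (nK K).

Let L0 : 0 < L. Proof. by case: cc => -[]. Qed.
Let gSK t : SK K (g t). Proof. by case: cc => -[]. Qed.
Let per t : g (t + L) = g t. Proof. by case: cc => -[]. Qed.

Lemma ccc_coord_continuous (f : V -> R) : (forall u v, f (u - v) = f u - f v) ->
  (forall u, `|f u| <= norm3 u) -> continuous (fun t => f (g t)).
Proof.
move=> fB fn; apply: (@lip_continuous _ _ 1) => x y; rewrite mul1r -fB.
exact: le_trans (fn _) (ccc_lip K0 cc x y).
Qed.

Lemma coord_norm (u : V) : [/\ `|c0 u| <= norm3 u, `|c1 u| <= norm3 u & `|c2 u| <= norm3 u].
Proof.
have h0 := sqr_ge0 (c0 u); have h1 := sqr_ge0 (c1 u); have h2 := sqr_ge0 (c2 u).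
rewrite !expr2 in h0 h1 h2.
by split; rewrite -ler_sqr ?nnegrE ?norm3_ge0// real_normK ?num_real// norm3_sq dotE expr2; lc; lra.
Qed.

Lemma ccc_c0 : continuous (fun t => c0 (g t)).
Proof. by apply: ccc_coord_continuous => [u v|u]; [rewrite c0D c0N | case: (coord_norm u)]. Qed.
Lemma ccc_c1 : continuous (fun t => c1 (g t)).
Proof. by apply: ccc_coord_continuous => [u v|u]; [rewrite c1D c1N | case: (coord_norm u)]. Qed.
Lemma ccc_c2 : continuous (fun t => c2 (g t)).
Proof. by apply: ccc_coord_continuous => [u v|u]; [rewrite c2D c2N | case: (coord_norm u)]. Qed.

Lemma ccc_supports : exists (o : V) (del : R), [/\ SK K o, 0 < del & forall t, exists n, supp K g o del t n].
Proof.
case: cc => _ [_ _ [ O [OSK cO _ bd]]].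
have bdt t : SK_boundary K O (g t) by rewrite bd; exists t.
have clos t (e : R) : 0 < e -> exists2 y, O y & norm3 (y - g t) < e.
  move=> e0; have [_ /(_ e e0)[[y [hy Oy yt]] _]] := bdt t; exists y => //.
  by apply: le_lt_trans yt; exact: dK_ge_norm.
have nint t (e : R) : ~ ballO K O (g t) e.
  move=> [_ e0 hb]; have [_ /(_ e e0)[_ [y [hy nOy yt]]]] := bdt t; apply: nOy; apply: hb => //.
  by apply: le_lt_trans yt; exact: dK_ge_norm.
have [[ o [e bo]]|nb] := pselect (exists o e, ballO K O o e).
  have [ho e0 _] := bo.
  pose s := e / 2; pose del := s / (2 * (1 + K * s ^+ 2 / 4)).
  have s0 : 0 < s by rewrite /s; lra.
  have del0 : 0 < del.
    by rewrite divr_gt0// mulr_gt0//; have := mulr_ge0 K0 (sqr_ge0 s); lra.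
  exists o, del; split=> // t.
  have [n [nn nN nO]] := support_exists K0 OSK cO bo (gSK t) (clos t) (nint t).
  exists n; split=> //; first by rewrite dotC.
    move=> u; apply/ler_addgt0Pr => d d0.
    have [y Oy yu] := clos u _ d0; have := nO y Oy.
    have -> : y - g t = (g u - g t) + (y - g u) by apply: vec3P; rewrite !vE; ring.
    rewrite dotDl; have := dot_le (y - g u) n; rewrite (norm3_unit nn) mulr1; move: yu; lc; lra.
  by apply: (ballO_height K0 bo (gSK t)) => //; rewrite /s; lra.
have nb' o (e : R) : ~ ballO K O o e by move=> h; apply: nb; exists o, e.
have [n n0 nO] := flat_exists K0 OSK cO nb'.
have ng t : dot3 (lift K (g t)) n = 0.
  apply/eqP; rewrite -normr_eq0 eq_le normr_ge0 andbT; apply/ler_addgt0Pr => e e0; rewrite add0r.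
  have ls0 := lscale_gt0 K0.
  have nn1 : 0 < norm3 n by rewrite norm3_gt0.
  have [|y Oy yt] := clos t (e / (lscale K * norm3 n)); first by rewrite divr_gt0// mulr_gt0.
  have -> : dot3 (lift K (g t)) n = dot3 (lift K (g t) - lift K y) n by rewrite dotDl dotNl (nO y Oy) subr0.
  apply: (le_trans (cauchy _ _)); rewrite liftB// norm3BC.
  by move: yt; rewrite ltr_pdivlMr ?mulr_gt0// => /ltW; apply: le_trans; rewrite mulrA ler_pM2r// mulrC.
(* For [K > 0] the curve lies on the great circle with normal [m]; a pole serves as [o], and its
   height along [m] is [q^-1]. *)
have [k0|k0] := eqVneq K 0; last first.
  have q0 := q_gt0 K0 k0.
  have nn1 : 0 < norm3 n by rewrite norm3_gt0.
  have [m [mm mg]] : exists m, dot3 m m = 1 /\ forall t, dot3 (N (g t)) m = 0.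
    exists ((norm3 n)^-1 *: n); split; first by rewrite !dE -norm3_sq; field; rewrite lt0r_neq0.
    by move=> t; have := ng t; rewrite liftE (negbTE k0) dotZr => ->; rewrite mulr0.
  have gm : gauge K (- m) = 1 by rewrite gaugeE (negbTE k0) norm3N /norm3 mm sqrtr1.
  have [|o ho] := @unlift _ _ K0 (- m); first by rewrite gm.
  rewrite gm invr1 scale1r liftE (negbTE k0) => lo.
  exists o, q^-1; split=> //; first by rewrite invr_gt0.
  have eB x y : dot3 (y - x) m = - q^-1 * (dot3 (N y) m - dot3 (N x) m).
    have -> : dot3 (N y) m - dot3 (N x) m = dot3 (N y - N x) m by rewrite !dE.
    by rewrite nKB dotZl; field; rewrite lt0r_neq0.
  move=> t; exists m; split=> //; first by move=> u; rewrite eB !mg subrr mulr0.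
  by rewrite eB mg lo dotNl mm subr0 mulrN1 opprK.
(* For [K = 0] the curve would lie on a line, where [f] is an injective continuous coordinate on a
   closed curve. *)
exfalso.
have c2z t : c2 (g t) = 0.
  have := gSK t; rewrite /SK -[_ ord0 _]/(c2 _) k0 sqrtr0 mul0r => /esym /eqP.
  by rewrite mulf_eq0 pnatr_eq0 /= => /eqP.
have ng' t : c0 (g t) * c0 n + c1 (g t) * c1 n + c2 n = 0.
  by have := ng t; rewrite liftE k0 eqxx !vE c2z => <-; ring.
pose f t := c1 (g t) * c0 n - c0 (g t) * c1 n.
apply: (@closed_not_injective _ f L L0).
- move=> x; apply: cvgB; apply: cvgM; try exact: cvg_cst; [exact: ccc_c1|exact: ccc_c0].
- by rewrite /f -[in g L](add0r L) per.
move=> x y; rewrite !in_itv /= => /andP[x0 xL] /andP[y0 yL] fxy.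
have nn1 : 0 < c0 n ^+ 2 + c1 n ^+ 2.
  rewrite lt_neqAle addr_ge0 ?sqr_ge0// andbT eq_sym; apply: contra_neq n0 => h.
  move/eqP: h; rewrite paddr_eq0 ?sqr_ge0// !sqrf_eq0 => /andP[/eqP h0 /eqP h1].
  have h2 : c2 n = 0 by have := ng' 0; rewrite h0 h1; lc; lra.
  by apply: vec3P; rewrite ?h0 ?h1 ?h2 ?c00 ?c10 ?c20.
have gxy : g x = g y.
  have e1 := ng' x; have e2 := ng' y; rewrite /f in fxy.
  have E0 : (c0 (g x) - c0 (g y)) * (c0 n ^+ 2 + c1 n ^+ 2) = 0.
    transitivity (c0 n * ((c0 (g x) * c0 n + c1 (g x) * c1 n + c2 n) -
      (c0 (g y) * c0 n + c1 (g y) * c1 n + c2 n)) - c1 n * ((c1 (g x) * c0 n - c0 (g x) * c1 n)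
      - (c1 (g y) * c0 n - c0 (g y) * c1 n))); first ring.
    by rewrite e1 e2 fxy; ring.
  have E1 : (c1 (g x) - c1 (g y)) * (c0 n ^+ 2 + c1 n ^+ 2) = 0.
    transitivity (c1 n * ((c0 (g x) * c0 n + c1 (g x) * c1 n + c2 n) -
      (c0 (g y) * c0 n + c1 (g y) * c1 n + c2 n)) + c0 n * ((c1 (g x) * c0 n - c0 (g x) * c1 n)
      - (c1 (g y) * c0 n - c0 (g y) * c1 n))); first ring.
    by rewrite e1 e2 fxy; ring.
  move/eqP: E0; rewrite mulf_eq0 (gt_eqF nn1) orbF subr_eq0 => /eqP E0.
  move/eqP: E1; rewrite mulf_eq0 (gt_eqF nn1) orbF subr_eq0 => /eqP E1.
  by apply: vec3P; rewrite ?c2z.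
have [xy|yx|//] := ltgtP x y.
  by case: (ccc_inj cc xy _ gxy); move: yL; lc; lra.
by case: (ccc_inj cc yx _ (esym gxy)); move: xL; lc; lra.
Qed.

Section Orient.
Variables (o : V) (del r : R).
Hypotheses (ho : SK K o) (del0 : 0 < del) (hs : forall t, exists n, supp K g o del t n).
Hypotheses (r0 : 0 < r) (rL : 2 * r <= L) (rdel : 6 * r <= del) (Kr : 4 * (K * r ^+ 2) <= 1).

Let J (x y : R) : R := dot3 (g y - g x) (cross (N (g x)) (o - g x)).

(** [J x y = 0] puts [o], [g x] and [g y] on one geodesic. The support at [x] then places [g y] on
    the side of [o], at a fraction [l <= 1 / 6] of the way, and the support at [y] forbids [l > 0].
    The remaining antipodal case contradicts the smallness of [r]. *)
Lemma orient_neq0 (x y : R) : x < y -> y < x + r -> J x y != 0.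
Proof.
move=> xy yx; apply/eqP => J0.
have [K0' r0' rL' rd' d0'] := And5 K0 r0 rL rdel del0.
have yL : y < x + L by apply: (lt_le_trans yx); rewrite lerD2l; have := r0; have := rL; lra.
have gxy : g x <> g y := ccc_inj cc xy yL.
have [n [nn Nn np nd]] := hs x; have [m [mm Nm mp md]] := hs y.
have NN := nK_unit (gSK x).
pose T := frameT 1 (N (g x)) n.
have s1 : 1 * 1 = 1 :> R by rewrite mulr1.
pose D : V := g y - g x.
have nD : norm3 D <= r.
  by apply: (le_trans (ccc_lip K0 cc x y)); rewrite gtr0_norm ?subr_gt0//; move: yx; lc; lra.
have nD0 := norm3_ge0 D.
have KD : K * dot3 D D <= 1 / 4.
  rewrite -norm3_sq; have : norm3 D ^+ 2 <= r ^+ 2 by rewrite lerXn2r ?nnegrE// ltW.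
  by move=> h; move: (ler_wpM2l K0 h) Kr => h1 h2; move: h1 h2; lc; lra.
pose rr := dot3 D (N (g x)).
have rrE : rr = q * dot3 D D / 2 by rewrite /rr (SK_chord (gSK x) (gSK y)).
have qrr : q * rr = K * dot3 D D / 2 by rewrite rrE -{3}(sqK K0); field.
have J0' : dot3 D T * dot3 (o - g x) n = dot3 D n * dot3 (o - g x) T.
  have JE : J x y = dot3 D T * dot3 (o - g x) n - dot3 D n * dot3 (o - g x) T.
    rewrite /J -/D /T frameTE scale1r.
    have E (A B C P : V) : dot3 A (cross B C) * dot3 P C - dot3 A C * dot3 P (cross B C) =
        dot3 C C * dot3 A (cross B P) - dot3 B C * dot3 A (cross C P) by rewrite !vE; ring.
    by rewrite E nn Nn mul1r mul0r subr0.
  by apply/eqP; rewrite -subr_eq0 -JE J0.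
have h0 : 0 < dot3 (o - g x) n by move: nd; lc; lra.
pose l := dot3 D n / dot3 (o - g x) n.
have l0 : 0 <= l by apply: divr_ge0; [exact: np | exact: ltW].
have l6 : l <= 1 / 6.
  rewrite ler_pdivrMr//; apply: (@le_trans _ _ r); last (move: nd rd'; lc; lra).
  by apply: le_trans nD; have := dot_le D n; rewrite (norm3_unit nn) mulr1.
have ze0 : 0 <= q * dot3 (o - g x) (N (g x)).
  by rewrite (SK_chord (gSK x) ho) mulr_ge0 ?sqrtr_ge0// divr_ge0// mulr_ge0 ?sqrtr_ge0 ?dot_ge0.
have DE : D = l *: (o - g x) + (rr - l * dot3 (o - g x) (N (g x))) *: N (g x).
  rewrite {1}(frame_decomp s1 NN nn Nn D) -/T.
  rewrite [X in _ = _ *: X + _](frame_decomp s1 NN nn Nn (o - g x)) -/T.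
  have -> : dot3 D T = l * dot3 (o - g x) T.
    by rewrite /l mulrAC -J0' mulfK// lt0r_neq0.
  have -> : dot3 D n = l * dot3 (o - g x) n by rewrite /l divfK// lt0r_neq0.
  rewrite -/rr.
  generalize (dot3 (o - g x) T) (dot3 (o - g x) n) (dot3 (o - g x) (N (g x))) => a b c; generalize l rr T (N (g x)) => l' r' T' N'.
  by apply: vec3P; rewrite !vE; ring.
pose e := dot3 D m.
have e0 : e <= 0.
  have := mp x; rewrite -(opprB (g y)) dotNl -/D -/e; lc; lra.
have Nxm : dot3 (N (g x)) m = q * e.
  have -> : N (g x) = N (g y) - (N (g y) - N (g x)) by rewrite opprB addrC subrK.
  by rewrite nKB dotDl dotNl Nm dotZl -/D -/e; ring.
have oxm : dot3 (o - g x) m = dot3 (o - g y) m + e.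
  have -> : o - g x = (o - g y) + D by rewrite /D addrA subrK.
  by rewrite dotDl.
have eE : e * (1 - l - q * rr + l * (q * dot3 (o - g x) (N (g x)))) = l * dot3 (o - g y) m.
  have : e = l * (dot3 (o - g y) m + e) + (rr - l * dot3 (o - g x) (N (g x))) * (q * e).
    by have h := congr1 (fun v : V => dot3 v m) DE; rewrite /= (dotDl (l *: _)) (dotZl l) (dotZl (rr - _)) Nxm oxm in h.
  (lc; lra).
have f0 : 0 < 1 - l - q * rr + l * (q * dot3 (o - g x) (N (g x))).
  by have := mulr_ge0 l0 ze0; rewrite qrr; move: KD l6; lc; lra.
have le0 : l * dot3 (o - g y) m <= 0 by rewrite -eE mulr_le0_ge0// ltW.
have l00 : l = 0.
  have md0 : 0 < dot3 (o - g y) m by move: md; lc; lra.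
  by apply/eqP; rewrite eq_le l0 andbT -(pmulr_lle0 _ md0).
move: DE; rewrite l00 scale0r add0r mul0r subr0 => DE.
have [e1|[k0 e2]] := vertical (gSK x) (gSK y) DE; first by apply: gxy.
have : dot3 D D = rr ^+ 2 by rewrite DE !dE NN mulr1 expr2.
rewrite rrE => DD.
have Dn0 : dot3 D D != 0 by rewrite dot_eq0 subr_eq0; apply/eqP => h; apply: gxy.
have : K * dot3 D D = 4.
  apply: (mulIf Dn0); transitivity (4 * (q * dot3 D D / 2) ^+ 2); last by rewrite -DD.
  by rewrite -{1}(sqK K0); field.
(move: KD; lc; lra).
Qed.

Let A (x : R) : V := cross (N (g x)) (o - g x).

Lemma orient_lip (f : V -> R) : (forall u v, f (u - v) = f u - f v) ->
  (forall u, `|f u| <= norm3 u) -> continuous (fun x => f (A x)).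
Proof.
move=> fB fn; apply: (@lip_continuous _ _ 1) => x y; rewrite mul1r -fB.
have -> : A y - A x = cross (g y - g x) (N o) by apply: vec3P; rewrite /A !nKE !vE; ring.
apply: (le_trans (fn _)); apply: (le_trans (norm3_cross _ _)).
by rewrite (norm3_unit (nK_unit ho)) mulr1; exact: (ccc_lip K0 cc).
Qed.

Lemma J_continuous (f h : R -> R) : continuous f -> continuous h ->
  continuous (fun z => J (f z) (h z)).
Proof.
move=> cf ch.
have cA0 : continuous (fun x => c0 (A x)).
  by apply: orient_lip => [u v|u]; [rewrite c0D c0N | case: (coord_norm u)].
have cA1 : continuous (fun x => c1 (A x)).
  by apply: orient_lip => [u v|u]; [rewrite c1D c1N | case: (coord_norm u)].
have cA2 : continuous (fun x => c2 (A x)).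
  by apply: orient_lip => [u v|u]; [rewrite c2D c2N | case: (coord_norm u)].
have -> : (fun z => J (f z) (h z)) = (fun z => (c0 (g (h z)) - c0 (g (f z))) * c0 (A (f z)) +
    (c1 (g (h z)) - c1 (g (f z))) * c1 (A (f z)) + (c2 (g (h z)) - c2 (g (f z))) * c2 (A (f z))).
  by apply/funext => w; rewrite /J dotE !(c0D, c1D, c2D, c0N, c1N, c2N).
apply: (continuous_sum3 _ (continuous_compR cA0 cf) _ (continuous_compR cA1 cf) _ (continuous_compR cA2 cf)).
- exact: (continuous_subR (continuous_compR ccc_c0 ch) (continuous_compR ccc_c0 cf)).
- exact: (continuous_subR (continuous_compR ccc_c1 ch) (continuous_compR ccc_c1 cf)).
- exact: (continuous_subR (continuous_compR ccc_c2 ch) (continuous_compR ccc_c2 cf)).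
Qed.

(** [J x (x + w)] is continuous without zeros on the strip [0 < w < r]; any two of its points are
    joined by moves in [x] and in [w]. *)
Lemma orient_exists : exists2 s : R, s * s = 1 & forall x y : R, x < y -> y < x + r -> 0 < s * J x y.
Proof.
have w0 : 0 < r / 2 by rewrite divr_gt0.
have r0' := r0.
have Jn (x w : R) : 0 < w -> w < r -> J x (x + w) != 0.
  by move=> h1 h2; apply: orient_neq0; lra.
have ci : continuous (fun z : R => z) by apply: (@lip_continuous _ _ 1) => u v; rewrite mul1r.
have ck (w : R) : continuous (fun z : R => w).
  by apply: (@lip_continuous _ _ 0) => u v; rewrite mul0r subrr normr0.
have ca (w : R) : continuous (fun z : R => z + w).
  by apply: (@lip_continuous _ _ 1) => u v; rewrite mul1r (_ : v + w - (u + w) = v - u)//; ring.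
have cb (w : R) : continuous (fun z : R => w + z).
  by apply: (@lip_continuous _ _ 1) => u v; rewrite mul1r (_ : w + v - (w + u) = v - u)//; ring.
have J1 (x x' w : R) : 0 < w -> w < r -> x <= x' -> 0 < J x (x + w) * J x' (x' + w).
  move=> h1 h2 xx; apply: (@same_sign _ (fun x => J x (x + w))) => // [|z _].
    by apply: continuous_subspaceT; exact: (J_continuous ci (ca w)).
  exact: Jn.
have J2 (x w w' : R) : 0 < w -> w' < r -> w <= w' -> 0 < J x (x + w) * J x (x + w').
  move=> h1 h2 ww; apply: (@same_sign _ (fun w => J x (x + w))) => // [|z hz].
    by apply: continuous_subspaceT; exact: (J_continuous (ck x) (cb x)).
  by apply: Jn; lra.
have key (x w : R) : 0 < w -> w < r -> 0 < J 0 (0 + r / 2) * J x (x + w).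
  move=> h1 h2.
  have a1 : 0 < J 0 (0 + r / 2) * J x (x + r / 2).
    have [xx|xx] := leP 0 x; first by apply: J1 => //; lc; lra.
    by rewrite mulrC; apply: J1; move: xx; lc; lra.
  have a2 : 0 < J x (x + r / 2) * J x (x + w).
    have [ww|ww] := leP (r / 2) w; first exact: J2.
    by rewrite mulrC; apply: J2; move: ww; lc; lra.
  have a3 : 0 < J x (x + r / 2) ^+ 2 by rewrite exprn_even_gt0//= Jn//; lc; lra.
  rewrite -(pmulr_rgt0 _ a3); have := mulr_gt0 a1 a2.
  by rewrite (_ : J x (x + r / 2) ^+ 2 * (J 0 (0 + r / 2) * J x (x + w)) =
    J 0 (0 + r / 2) * J x (x + r / 2) * (J x (x + r / 2) * J x (x + w)))//; ring.
have J00 : J 0 (0 + r / 2) != 0 by apply: Jn; lra.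
exists (Num.sg (J 0 (0 + r / 2))); first by rewrite -expr2 sqr_sg J00.
move=> x y xy yx; have := key x (y - x); rewrite subr_gt0 xy (_ : x + (y - x) = y); last ring.
move=> /(_ isT) /(_ ltac:((move: yx; lc; lra))).
by move=> h; rewrite -sgr_gt0 sgrM sgr_id -sgrM sgr_gt0.
Qed.
End Orient.

Theorem curve_oval : exists o del s r, oval K g L o del s r.
Proof.
have [ o [del [ho del0 hs]]] := ccc_supports.
have q0 : 0 <= q := sqrtr_ge0 K.
(* One bound for each requirement of [ov_r]; the last gives [q * r <= 1 / 2]. *)
pose r := Num.min (L / 2) (Num.min (del / 6) (2 * (q + 1))^-1).
have q1 : 0 < 2 * (q + 1) by lra.
have r0 : 0 < r by rewrite !lt_min invr_gt0 q1 !divr_gt0.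
have r1 : r <= L / 2 by rewrite ge_min lexx.
have r2 : r <= del / 6 by rewrite !ge_min lexx orbT.
have r3 : r <= (2 * (q + 1))^-1 by rewrite !ge_min lexx !orbT.
have Kr : 4 * (K * r ^+ 2) <= 1.
  have qr : q * r <= 1 / 2.
    have : r * (2 * (q + 1)) <= 1 by rewrite -ler_pdivlMr// mul1r.
    nra.
  have qr0 : 0 <= q * r by rewrite mulr_ge0// ltW.
  have -> : K * r ^+ 2 = (q * r) ^+ 2 by rewrite exprMn (expr2 q) sqK.
  nra.
have rL : 2 * r <= L by move: r1; lc; lra.
have rd : 6 * r <= del by lra.
have [s ss hor] := orient_exists ho del0 hs r0 rL rd Kr.
exists o, del, s, r; split=> //.
- exact: (ccc_inj cc).
- exact: (ccc_dK cc).
- exact: (ccc_len cc).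
Qed.
End CurveOval.

(** * Charts and slopes of supporting lines *)

Section FrameDet.
Variable R : realType.
Local Notation V := (vec3 R).

Lemma frame_triple (s : R) (m n : V) (u1 u2 u3 v1 v2 v3 w1 w2 w3 : R) :
  s * s = 1 -> dot3 m m = 1 -> dot3 n n = 1 -> dot3 m n = 0 ->
  let T := frameT s m n in
  s * dot3 (u1 *: T + u2 *: n + u3 *: m)
    (cross (v1 *: T + v2 *: n + v3 *: m) (w1 *: T + w2 *: n + w3 *: m)) =
  - (u1 * (v2 * w3 - v3 * w2) - u2 * (v1 * w3 - v3 * w1) + u3 * (v1 * w2 - v2 * w1)).
Proof.
move=> ss mm nn mn T.
have TT : dot3 T T = 1 by exact: frameTT.
have hT : s * dot3 T (cross n m) = - 1.
  rewrite -TT {3}/T frameTE dotZr -mulrN; congr (_ * _); rewrite !vE; ring.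
have -> : dot3 (u1 *: T + u2 *: n + u3 *: m)
    (cross (v1 *: T + v2 *: n + v3 *: m) (w1 *: T + w2 *: n + w3 *: m)) =
  (u1 * (v2 * w3 - v3 * w2) - u2 * (v1 * w3 - v3 * w1) + u3 * (v1 * w2 - v2 * w1))
   * dot3 T (cross n m) by clearbody T; rewrite !vE; ring.
by rewrite mulrCA hT mulrN1.
Qed.

Lemma frame_orient (s : R) (m n u v : V) : dot3 n n = 1 -> dot3 m n = 0 ->
  s * dot3 u (cross m v) = dot3 u (frameT s m n) * dot3 v n - dot3 u n * dot3 v (frameT s m n).
Proof.
move=> nn mn; rewrite !frameTE !dotZr.
transitivity (s * (dot3 n n * dot3 u (cross m v) - dot3 m n * dot3 u (cross n v))).
  by rewrite nn mn; ring.
by rewrite !vE; ring.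
Qed.

(** Both sides equal [s * dot3 u (cross m0 n)]. It compares the components of [u] in the frames at
    two different points. *)
Lemma frame_change (s : R) (m0 d m n u : V) : s * s = 1 ->
  dot3 m0 d = 0 -> dot3 d d = 1 -> dot3 m m = 1 -> dot3 m n = 0 ->
  dot3 u (frameT s m n) * dot3 m m0 - dot3 u m * dot3 (frameT s m n) m0 =
  dot3 u (frameT s m0 d) * dot3 n d - dot3 u d * dot3 n (frameT s m0 d).
Proof.
move=> ss m0d dd mm mn; rewrite !frameTE !dE.
transitivity (s * (dot3 m m * dot3 u (cross m0 n) + dot3 m n * dot3 m0 (cross u m))).
  rewrite !vE; ring.
transitivity (s * (dot3 d d * dot3 u (cross m0 n) + dot3 m0 d * dot3 d (cross u n))).
  by rewrite mm mn dd m0d !mul0r.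
rewrite !vE; ring.
Qed.
(** [(A, B)] is the chord in chart coordinates and [dd'] its determinant with the first end point.
    Once [A > 0], the slope [B / A] of the chord separates the slopes of the supporting lines at its
    two ends. *)
Lemma slope_alg (de hd r' na nd' ma md' ux nu A B x1 x2 dd' : R) : 0 < de -> de <= hd ->
  6 * r' <= de -> `|na| <= 1 -> `|ma| <= 1 -> ux * dd' = x1 * B - x2 * A ->
  5 / 6 * de <= hd * nd' -> 5 / 6 * de <= hd * md' -> `|x1| <= r' / 2 -> `|x2| <= r' / 2 ->
  31 / 32 <= ux <= 1 -> 0 <= na * A + nd' * B -> ma * A + md' * B <= 0 ->
  0 < hd * A + (1 - nu) * dd' -> 0 <= nu <= 2 -> - na / nd' <= - ma / md'.
Proof.
move=> de0 hd0 rd na1 ma1 uxE n2 m2 X1 X2 /andP[X3 _] In Im orient /andP[z0 z2].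
have hd1 : 0 < hd by move: hd0; lc; lra.
have nd0 : 0 < nd' by rewrite -(pmulr_rgt0 _ hd1); move: n2; lc; lra.
have md0 : 0 < md' by rewrite -(pmulr_rgt0 _ hd1); move: m2; lc; lra.
(* If [A <= 0], the two supports bound [B] by a multiple of [A]; then [dd'] is too small to make the
   orientation positive. *)
have A0 : 0 < A.
  rewrite ltNge; apply/negP => A0.
  have [a1 a2] : - na * A >= A /\ - ma * A <= - A.
    by move: na1 ma1; rewrite !ler_norml => /andP[? ?] /andP[? ?]; split; nra.
  have c1 : hd * A <= 5 / 6 * de * B.
    have [B0|B0] := leP 0 B; first by apply: (@le_trans _ _ 0); [rewrite mulr_ge0_le0// ltW | rewrite mulr_ge0// mulr_ge0 ?ltW//; lra].
    apply: (@le_trans _ _ (hd * nd' * B)); last by rewrite ler_wnM2r// ltW.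
    by rewrite -mulrA ler_pM2l//; move: a1; lc; lra.
  have c2 : 5 / 6 * de * B <= - (hd * A).
    have [B0|B0] := leP B 0; first by apply: (@le_trans _ _ 0); [rewrite mulr_ge0_le0// mulr_ge0 ?ltW//; lra | rewrite oppr_ge0 mulr_ge0_le0// ltW].
    apply: (@le_trans _ _ (hd * md' * B)); first by rewrite ler_pM2r.
    by rewrite -mulrA -mulrN ler_pM2l//; lra.
  have aB : `|x1 * B| <= - (hd * A) / 10.
    apply: (@le_trans _ _ (de / 12 * `|B|)).
      by rewrite normrM ler_wpM2r//; move: X1 rd; lc; lra.
    have : `|B| * (5 / 6 * de) <= - (hd * A).
      by have [B0|B0] := leP 0 B; [rewrite ger0_norm|rewrite ltr0_norm]; rewrite ?B0//; move: c1 c2; lc; lra.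
    (lc; lra).
  have aA : `|x2 * A| <= - (hd * A) / 12.
    rewrite normrM (ler0_norm A0).
    apply: (@le_trans _ _ (hd / 12 * - A)); last (lc; lra).
    by rewrite ler_wpM2r ?oppr_ge0//; move: X2 hd0 rd; lc; lra.
  have hA : hd * A <= 0 by rewrite mulr_ge0_le0// ltW.
  have aD : `|dd'| <= - (hd * A) / 5.
    have : `|ux * dd'| <= - (hd * A) * (11 / 60).
      by rewrite uxE; apply: (le_trans (ler_normB _ _)); move: aA aB; lc; lra.
    rewrite normrM gtr0_norm; last (move: X3; lc; lra).
    have := normr_ge0 dd'; move: (`|dd'|) => D D0; nra.
  have : (1 - nu) * dd' <= `|dd'|.
    apply: (le_trans (ler_norm _)); rewrite normrM ler_piMl//.
    by rewrite ler_norml; move: z2; lc; lra.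
  (move: aD hA; lc; lra).
have l1 : - na / nd' <= B / A.
  by rewrite ler_pdivrMr// mulrAC ler_pdivlMr//; lra.
have l2 : B / A <= - ma / md'.
  by rewrite ler_pdivrMr// mulrAC ler_pdivlMr//; lra.
exact: le_trans l1 l2.
Qed.

Lemma cross_pole (K : R) (o x y : V) : cross (nK K x) (o - x) =
  cross (nK K y) (o - y) + cross (x - y) (nK K o).
Proof. by apply: vec3P; rewrite !nKE !vE; ring. Qed.
End FrameDet.

Section Chart.
Variables (R : realType) (K : R) (g : R -> vec3 R) (L : R) (o : vec3 R) (del s r : R).
Hypotheses (K0 : 0 <= K) (ov : oval K g L o del s r).
Local Notation V := (vec3 R).
Local Notation q := (Num.sqrt K).
Local Notation N := (nK K).
Local Notation sp := (supp K g o del).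

Lemma ov_lip (x y : R) : norm3 (g y - g x) <= `|y - x|.
Proof.
have hSK := ov_SK ov.
have [xy|yx] := leP x y.
  rewrite ger0_norm ?subr_ge0//; apply: le_trans (ov_dK ov xy); exact: dK_ge_norm.
rewrite distrC norm3BC ger0_norm ?subr_ge0; last exact: ltW.
by apply: le_trans (ov_dK ov (ltW yx)); exact: dK_ge_norm.
Qed.

Lemma ov_lip_le (x y e : R) : `|y - x| <= e -> norm3 (g y - g x) <= e.
Proof. exact: le_trans (ov_lip x y). Qed.

Lemma NB (x y : R) : N (g y) - N (g x) = - q *: (g y - g x).
Proof. exact: nKB. Qed.

Lemma ov_NN (x : R) : dot3 (N (g x)) (N (g x)) = 1.
Proof. exact: nK_unit (ov_SK ov x). Qed.

Lemma dot_N (x y : R) (n : V) : dot3 (N (g y)) n = 0 ->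
  dot3 (N (g x)) n = q * dot3 (g y - g x) n.
Proof.
move=> h; have -> : N (g x) = N (g y) - (N (g y) - N (g x)) by rewrite opprB addrC subrK.
by rewrite NB (dotDl (N (g y))) dotNl h dotZl; ring.
Qed.

(** [d] is the tangent direction at [g t] towards [o]. All supporting normals nearby have a positive
    component along it, so slopes relative to [d] stay finite. *)
Definition chart (t hd : R) (d : V) :=
  [/\ dot3 d d = 1, dot3 (N (g t)) d = 0, del <= hd &
      o - g t = hd *: d + dot3 (o - g t) (N (g t)) *: N (g t)].

Lemma chart_exists (t : R) : exists hd d, chart t hd d.
Proof.
have [n [nn Nn np nd]] := ov_supp ov t.
pose z := dot3 (o - g t) (N (g t)).
pose w : V := o - g t - z *: N (g t).
have wN : dot3 (N (g t)) w = 0.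
  by rewrite /w dotDr dotNr dotZr ov_NN (dotC (N (g t))) -/z; ring.
have wn : del <= dot3 w n.
  by rewrite /w dotDl dotNl dotZl Nn mulr0 subr0.
have del0 := ov_del ov.
have hw : del <= norm3 w.
  by apply: (le_trans wn); have := dot_le w n; rewrite (norm3_unit nn) mulr1.
have w0 : 0 < norm3 w by lra.
have w1 := lt0r_neq0 w0.
exists (norm3 w), ((norm3 w)^-1 *: w); split=> //.
- by rewrite dotZl dotZr -norm3_sq; field.
- by rewrite dotZr wN mulr0.
- by rewrite scalerA divff// scale1r /w -/z subrK.
Qed.

Lemma pole_height (x : R) : 0 <= q * dot3 (o - g x) (N (g x)) <= 2.
Proof.
have hx := ov_SK ov x; have ho := ov_o ov.
have h := SK_chord_le hx ho; rewrite norm3BC in h.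
have n0 := norm3_ge0 (o - g x).
have q0 := sqrtr_ge0 K.
rewrite (SK_chord hx ho) -norm3_sq.
have -> : q * (q * norm3 (o - g x) ^+ 2 / 2) = (q * norm3 (o - g x)) ^+ 2 / 2 by field.
have := mulr_ge0 q0 n0; move: h; set c := q * _ => h c0.
apply/andP; split; first by have := sqr_ge0 c; lra.
nra.
Qed.

(** The point [o] has height at least [del] over the line at [x]; replacing the base point [x] by
    [t] costs at most [r], which is at most [del / 6]. *)
Lemma chart_dir (t hd : R) (d : V) (x : R) (n : V) :
  chart t hd d -> `|x - t| <= r -> sp x n -> 5 / 6 * del <= hd * dot3 n d.
Proof.
move=> [dd Nd hd0 oE] xr [nn Nn np nd].
have hz := pole_height t.
have E : hd * dot3 n d = dot3 (o - g x) n
    + (1 - q * dot3 (o - g t) (N (g t))) * dot3 (g x - g t) n.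
  have -> : dot3 (o - g x) n = dot3 (o - g t) n - dot3 (g x - g t) n.
    by rewrite -dotNl -dotDl; congr dot3; apply: vec3P; rewrite !vE; ring.
  have h := congr1 (fun v : V => dot3 v n) oE.
  rewrite /= (dotDl (hd *: d)) (dotZl hd) (dotZl (dot3 _ _) (N (g t))) (dot_N _ Nn) in h.
  by rewrite h (dotC n d); ring.
have hl : `|dot3 (g x - g t) n| <= r.
  apply: (le_trans (cauchy _ _)); rewrite (norm3_unit nn) mulr1.
  exact: ov_lip_le.
have [r0 _ rd _] := ov_r ov.
rewrite E; move: hl hz; set A := dot3 (g x - g t) n; set z := q * _.
rewrite ler_norml => /andP[h1 h2] /andP[z0 z2].
nra.
Qed.

Lemma chart_move (t hd : R) (d : V) (x : R) : chart t hd d -> `|x - t| <= r / 2 ->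
  let W : V := g x - g t in
  [/\ `|dot3 W (frameT s (N (g t)) d)| <= r / 2, `|dot3 W d| <= r / 2
    & 31 / 32 <= 1 - q * dot3 W (N (g t)) <= 1].
Proof.
move=> [dd Nd hd0 oE] xr W.
have Wr : norm3 W <= r / 2 by exact: ov_lip_le.
have W0 := norm3_ge0 W.
have [r0 _ rd Kr] := ov_r ov.
split.
- apply: (le_trans (cauchy _ _)); rewrite (norm3_unit (frameTT (ov_s ov) (ov_NN t) dd Nd)) mulr1.
  exact: Wr.
- by apply: (le_trans (cauchy _ _)); rewrite (norm3_unit dd) mulr1.
have -> : q * dot3 W (N (g t)) = K * norm3 W ^+ 2 / 2.
  rewrite (SK_chord (ov_SK ov t) (ov_SK ov x)) -/W norm3_sq.
  transitivity (q * q * dot3 W W / 2); first by field.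
  by rewrite sqK.
have h : norm3 W ^+ 2 <= (r / 2) ^+ 2 by rewrite lerXn2r ?nnegrE//; lra.
have h1 := ler_wpM2l K0 h.
have h2 : 0 <= K * norm3 W ^+ 2 by rewrite mulr_ge0 ?sqr_ge0.
have h3 : K * (r / 2) ^+ 2 = K * r ^+ 2 / 4 by field.
apply/andP; split; move: Kr h1; lc; lra.
Qed.

(** In the gnomonic coordinates [x1 / (1 - q' * x3)] and [x2 / (1 - q' * x3)] geodesics are
    straight; this is the support function with the denominators cleared. The hypothesis says that
    the normal is tangent to S_K at the first point. *)
Lemma chart_supp (q' x1 x2 x3 y1 y2 y3 n1 n2 n3 : R) :
  n3 = q' * (x1 * n1 + x2 * n2 + x3 * n3) ->
  (1 - q' * x3) * ((y1 - x1) * n1 + (y2 - x2) * n2 + (y3 - x3) * n3) =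
  n1 * (y1 * (1 - q' * x3) - x1 * (1 - q' * y3)) + n2 * (y2 * (1 - q' * x3) - x2 * (1 - q' * y3)).
Proof.
move=> h.
have h' : (1 - q' * x3) * n3 = q' * (x1 * n1 + x2 * n2) by rewrite mulrBl mul1r {1}h; ring.
transitivity ((1 - q' * x3) * ((y1 - x1) * n1 + (y2 - x2) * n2) + (y3 - x3) * ((1 - q' * x3) * n3)).
  by ring.
by rewrite h'; ring.
Qed.

(** Slope of the line orthogonal to [n], in the axes [frameT s (N (g t)) d] and [d]. *)
Definition slope (t : R) (d n : V) : R := - dot3 n (frameT s (N (g t)) d) / dot3 n d.

(** In gnomonic coordinates the chord lies above both supporting lines, so its slope separates
    theirs. As this holds for all normals at both points, every selection of normals has a monotone
    slope. *)
Lemma slope_mono (t hd : R) (d : V) (x y : R) (n m : V) : chart t hd d ->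
  `|x - t| <= r / 2 -> `|y - t| <= r / 2 -> x < y -> y < x + r ->
  sp x n -> sp y m -> slope t d n <= slope t d m.
Proof.
move=> ch xt yt xy yxr spx spy.
have [r0 _ rd Kr] := ov_r ov; have del0 := ov_del ov.
have dx : `|x - t| <= r by move: xt; lc; lra.
have dy : `|y - t| <= r by move: yt; lc; lra.
have n2 := chart_dir ch dx spx; have m2 := chart_dir ch dy spy.
have [X1 X2 X3] := chart_move ch xt; have [Y1 Y2 Y3] := chart_move ch yt.
have [dd Nd hd0 oE] := ch.
have NN := ov_NN t.
have [nn Nn np nd] := spx; have [mm Nm mp md] := spy.
have := ov_or ov xy yxr.
have par := frame_parseval (ov_s ov) NN dd Nd.
have dec := frame_decomp (ov_s ov) NN dd Nd.
have tri := frame_triple _ _ _ _ _ _ _ _ _ (ov_s ov) NN dd Nd.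
rewrite /slope; set a := frameT s (N (g t)) d in X1 Y1 par dec tri *.
set N0 := N (g t) in X3 Y3 par dec tri Nd NN oE.
have aa : dot3 a a = 1 by exact: frameTT (ov_s ov) NN dd Nd.
have ad : dot3 a d = 0 by exact: frameTn.
have aN : dot3 a N0 = 0 by exact: frameTm.
clearbody a.
set Wx : V := g x - g t in X1 X2 X3; set Wy : V := g y - g t in Y1 Y2 Y3.
have DE : g y - g x = Wy - Wx by rewrite /Wy /Wx; apply: vec3P; rewrite !vE; ring.
have NxE : N (g x) = N0 - q *: Wx by rewrite /N0 /Wx !nKE; apply: vec3P; rewrite !vE; ring.
have oxE : o - g x = (o - g t) - Wx by rewrite /Wx; apply: vec3P; rewrite !vE; ring.
have Nxn0 := dot_N t Nn; have Nym0 := dot_N t Nm.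
rewrite -/Wx -/N0 in Nxn0; rewrite -/Wy -/N0 in Nym0.
clearbody Wx Wy.
pose x1 := dot3 Wx a; pose x2 := dot3 Wx d; pose x3 := dot3 Wx N0.
pose y1 := dot3 Wy a; pose y2 := dot3 Wy d; pose y3 := dot3 Wy N0.
pose z := dot3 (o - g t) N0.
have uE : g y - g x = (y1 - x1) *: a + (y2 - x2) *: d + (y3 - x3) *: N0.
  by rewrite DE [LHS]dec !(dotDl Wy) !(dotNl Wx).
have vE' : N (g x) = (- q * x1) *: a + (- q * x2) *: d + (1 - q * x3) *: N0.
  by rewrite NxE {1}(dec Wx) -/x1 -/x2 -/x3; apply: vec3P; rewrite !(c0D, c1D, c2D, c0N, c1N, c2N, c0Z, c1Z, c2Z); ring.
have wE : o - g x = (- x1) *: a + (hd - x2) *: d + (z - x3) *: N0.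
  rewrite oxE oE {1}(dec Wx) -/x1 -/x2 -/x3 -/z.
  by apply: vec3P; rewrite !(c0D, c1D, c2D, c0N, c1N, c2N, c0Z, c1Z, c2Z); ring.
rewrite {1}uE {1}vE' wE tri.
pose A := y1 * (1 - q * x3) - x1 * (1 - q * y3).
pose B := y2 * (1 - q * x3) - x2 * (1 - q * y3).
have -> : - ((y1 - x1) * (- q * x2 * (z - x3) - (1 - q * x3) * (hd - x2)) -
      (y2 - x2) * (- q * x1 * (z - x3) - (1 - q * x3) * - x1) +
      (y3 - x3) * (- q * x1 * (hd - x2) - - q * x2 * - x1)) =
   hd * A + (1 - q * z) * (x1 * y2 - x2 * y1) by rewrite /A /B; ring.
move=> orient.
have Nxn : dot3 n N0 = q * (x1 * dot3 n a + x2 * dot3 n d + x3 * dot3 n N0).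
  rewrite {1}(dotC n) Nxn0.
  by rewrite (par Wx n) -/x1 -/x2 -/x3; ring.
have Nym : dot3 m N0 = q * (y1 * dot3 m a + y2 * dot3 m d + y3 * dot3 m N0).
  rewrite {1}(dotC m) Nym0.
  by rewrite (par Wy m) -/y1 -/y2 -/y3; ring.
have In : 0 <= dot3 n a * A + dot3 n d * B.
  rewrite -(chart_supp y1 y2 y3 Nxn); apply: mulr_ge0; first by case/andP: X3 => X3 _; apply: le_trans X3; lc; lra.
  by have := np y; rewrite (par (g y - g x) n) DE !(dotDl Wy) !dotNl -/x1 -/x2 -/x3 -/y1 -/y2 -/y3.
have Im : dot3 m a * A + dot3 m d * B <= 0.
  have := mp x; rewrite -[g x - g y]opprB DE dotNl (par (Wy - Wx) m) !(dotDl Wy) !dotNl.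
  rewrite -/x1 -/x2 -/x3 -/y1 -/y2 -/y3 => h.
  have : 0 <= (1 - q * y3) * ((x1 - y1) * dot3 m a + (x2 - y2) * dot3 m d + (x3 - y3) * dot3 m N0).
    apply: mulr_ge0; first by case/andP: Y3 => Y3 _; apply: le_trans Y3; lc; lra.
    (lc; lra).
  rewrite (chart_supp x1 x2 x3 Nym) /A /B; lc; lra.
have hz := pole_height t; rewrite -/N0 -/z in hz.
move: n2 m2 X1 X2 X3 Y1 Y2 Y3 In Im orient hz.
rewrite -/x1 -/x2 -/x3 -/y1 -/y2 -/y3.
have na1 : `|dot3 n a| <= 1.
  by apply: (le_trans (cauchy _ _)); rewrite (norm3_unit nn) (norm3_unit aa) mulr1.
have ma1 : `|dot3 m a| <= 1.
  by apply: (le_trans (cauchy _ _)); rewrite (norm3_unit mm) (norm3_unit aa) mulr1.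
have uxE : (1 - q * x3) * (x1 * y2 - x2 * y1) = x1 * B - x2 * A by rewrite /A /B; ring.
by move=> n2 m2 X1 X2 X3 _ _ _; exact: (slope_alg del0 hd0 rd na1 ma1 uxE n2 m2 X1 X2 X3).
Qed.
End Chart.

(** * Closeness of normals and tangents *)

Section Tangent.
Variables (R : realType) (K : R) (g : R -> vec3 R) (L : R) (o : vec3 R) (del s r : R).
Hypotheses (K0 : 0 <= K) (ov : oval K g L o del s r).
Local Notation V := (vec3 R).
Local Notation q := (Num.sqrt K).
Local Notation N := (nK K).
Local Notation sp := (supp K g o del).
Local Notation tg x n := (frameT s (N (g x)) n).

Lemma eps_ge0 (a C : R) : 0 <= C -> (forall e : R, 0 < e -> - (C * e) <= a) -> 0 <= a.
Proof.
move=> C0 h; apply/ler_addgt0Pr => e e0.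
have C1 : 0 < C + 1 by lra.
have := h (e / (C + 1)) (divr_gt0 e0 C1).
have : C * (e / (C + 1)) <= e by rewrite mulrA ler_pdivrMr//; nra.
lra.
Qed.

Lemma dot_diff (u v n m : V) : dot3 m m = 1 ->
  `|dot3 u n - dot3 v m| <= norm3 u * norm3 (m - n) + norm3 (u - v).
Proof.
move=> mm.
have -> : dot3 u n - dot3 v m = - dot3 u (m - n) + dot3 (u - v) m by rewrite !vE; ring.
apply: (le_trans (ler_normD _ _)); rewrite normrN; apply: lerD; first exact: cauchy.
by apply: (le_trans (cauchy _ _)); rewrite (norm3_unit mm) mulr1.
Qed.

Lemma supp_limit (t : R) (n : V) :
  (forall e : R, 0 < e -> exists x m, [/\ sp x m, norm3 (g x - g t) <= e & norm3 (m - n) <= e]) ->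
  sp t n.
Proof.
move=> h.
have main (u : V) (c : R) : (forall x m, sp x m -> c <= dot3 (u - g x) m) -> c <= dot3 (u - g t) n.
  move=> hu; rewrite -subr_ge0; apply: (@eps_ge0 _ (norm3 (u - g t) + 1)) => [|e e0].
    by have := norm3_ge0 (u - g t); lra.
  have [x [m [spm gx mn]]] := h e e0.
  have [mm _ _ _] := spm.
  have := dot_diff (u - g t) (u - g x) n mm; have := hu x m spm.
  have -> : u - g t - (u - g x) = g x - g t by apply: vec3P; rewrite !vE; ring.
  rewrite ler_norml; have := ler_wpM2l (norm3_ge0 (u - g t)) mn.
  move: (norm3 (u - g t) * norm3 (m - n)) => A h1 h2 /andP[h3 _]; rewrite mulrDl; lra.
split.
- have [h1 h2] : norm3 n <= 1 /\ 1 <= norm3 n.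
    split; rewrite -subr_ge0; apply: (@eps_ge0 _ 1) => // e e0;
    have [x [m [[mm _ _ _] _ mn]]] := h e e0; have := norm3D (n - m) m; have := norm3D (m - n) n;
    rewrite !subrK (norm3_unit mm) (norm3BC n m); lra.
  have n1 : norm3 n = 1 by apply/eqP; rewrite eq_le h1.
  by rewrite -norm3_sq n1 expr1n.
- have Nt1 : norm3 (N (g t)) = 1 by exact: norm3_unit (ov_NN ov t).
  have q0 := sqrtr_ge0 K.
  have bd (e : R) : 0 < e -> `|dot3 (N (g t)) n| <= (1 + q) * e.
    move=> e0; have [x [m [[mm Nm _ _] gx mn]]] := h e e0.
    have := dot_diff (N (g t)) (N (g x)) n mm.
    rewrite Nm subr0 Nt1 mul1r NB norm3Z normrN (ger0_norm q0) (norm3BC (g t)) => hh.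
    by apply: (le_trans hh); have := ler_wpM2l q0 gx; lra.
  apply/eqP; rewrite -normr_eq0 eq_le normr_ge0 andbT.
  rewrite -oppr_ge0; apply: (@eps_ge0 _ (1 + q)) => [|e e0]; first lra.
  by rewrite lerN2 bd.
- by move=> u; apply: main => x m [_ _ h1 _]; exact: h1.
- by apply: main => x m [_ _ _ h1].
Qed.

Section NormalClose.
Variables (t hd : R) (d : V) (x y : R) (n m : V).
Hypotheses (ch : chart K g o del t hd d) (xt : `|x - t| <= r / 2) (yt : `|y - t| <= r / 2).
Hypotheses (nn : dot3 n n = 1) (Nn : dot3 (N (g x)) n = 0) (nd : 0 < dot3 n d) (spy : sp y m).
Local Notation sl := (slope K g s t d).
Local Notation E := (q * `|y - x| + `|sl m - sl n|).

Lemma supp_dir_gt0 : 0 < dot3 m d.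
Proof.
have [r0 _ rd _] := ov_r ov; have del0 := ov_del ov; have [_ _ hd0 _] := ch.
have := chart_dir K0 ov ch _ spy; rewrite (le_trans yt) => [/(_ isT) h|]; last lra.
have hd1 : 0 < hd by lra.
by rewrite -(pmulr_rgt0 _ hd1); lra.
Qed.

(** The analogue in S_K of [tan a - tan b = sin (a - b) / (cos a * cos b)]: it converts differences
    of slopes into rotations of the normal. The other terms account for the two different tangent
    planes. *)
Lemma normal_slope : dot3 m (tg x n) * dot3 (N (g x)) (N (g t)) =
  dot3 m (N (g x)) * dot3 (tg x n) (N (g t)) - (sl m - sl n) * (dot3 m d * dot3 n d).
Proof.
have [dd Nd hd0 _] := ch.
have h := frame_change m (ov_s ov) Nd dd (ov_NN ov x) Nn.
have md := supp_dir_gt0.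
have -> : (sl m - sl n) * (dot3 m d * dot3 n d) =
  - (dot3 m (frameT s (N (g t)) d) * dot3 n d - dot3 m d * dot3 n (frameT s (N (g t)) d)).
  by rewrite /slope; field; rewrite !lt0r_neq0.
by rewrite -h; ring.
Qed.

Lemma tgT : dot3 (tg x n) (tg x n) = 1. Proof. exact: frameTT (ov_s ov) (ov_NN ov x) nn Nn. Qed.

Lemma dot_unit_le1 (u v : V) : dot3 u u = 1 -> dot3 v v = 1 -> `|dot3 u v| <= 1.
Proof. by move=> uu vv; apply: (le_trans (cauchy _ _)); rewrite !norm3_unit// mulr1. Qed.

Lemma normal_N : `|dot3 m (N (g x))| <= q * `|y - x|.
Proof.
have [mm Nm _ _] := spy.
rewrite dotC (dot_N x Nm) normrM ger0_norm ?sqrtr_ge0// ler_wpM2l ?sqrtr_ge0//.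
by apply: (le_trans (cauchy _ _)); rewrite (norm3_unit mm) mulr1; exact: ov_lip K0 ov x y.
Qed.

Lemma NN_close : 31 / 32 <= dot3 (N (g x)) (N (g t)) <= 1.
Proof.
have [_ _ h] := chart_move K0 ov ch xt.
have -> : dot3 (N (g x)) (N (g t)) = 1 - q * dot3 (g x - g t) (N (g t)); last exact: h.
have -> : N (g x) = N (g t) - q *: (g x - g t) by rewrite !nKE; apply: vec3P; rewrite !vE; ring.
by rewrite (dotDl (N (g t))) dotNl dotZl (ov_NN ov).
Qed.

Lemma normal_T : `|dot3 m (tg x n)| <= 2 * E.
Proof.
have [mm Nm _ _] := spy; have [dd Nd _ _] := ch.
have h1 := normal_slope; have h2 := normal_N; have /andP[h3 _] := NN_close.
have h4 := dot_unit_le1 tgT (ov_NN ov t).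
have h5 := dot_unit_le1 mm dd; have h6 := dot_unit_le1 nn dd.
have h7 := mulr_ge0 (sqrtr_ge0 K) (normr_ge0 (y - x)).
have : `|dot3 m (tg x n) * dot3 (N (g x)) (N (g t))| <= E.
  rewrite h1; apply: (le_trans (ler_normB _ _)); apply: lerD.
    by rewrite normrM; apply: le_trans h2; rewrite ler_piMr.
  by rewrite !normrM ler_piMr// -[X in _ <= X]mulr1 ler_pM.
rewrite normrM [X in _ * X]gtr0_norm; last lra.
have := normr_ge0 (dot3 m (tg x n)); move: (`|dot3 m (tg x n)|) => A A0.
have : 0 <= E by rewrite addr_ge0.
move: E => E0; nra.
Qed.

(** Along the tangent and along [N (g x)] the vector [m] has components at most [2 * E] and [E]. The
    sign of the third one is decided by [w], since a negative one would give [dot3 m d <= 3 * E];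
    then [norm3 (m - n) ^+ 2] is at most [10 * E ^+ 2]. *)
Lemma normal_close (w : R) : w <= dot3 m d -> 3 * E < w ->
  0 <= dot3 m n /\ norm3 (m - n) <= 5 * E.
Proof.
move=> wm Ew.
have [mm Nm _ _] := spy; have [dd Nd _ _] := ch.
have h1 := normal_T; have h2 := normal_N.
have par := frame_parseval (ov_s ov) (ov_NN ov x) nn Nn.
have h4 := dot_unit_le1 dd tgT; have h5 := dot_unit_le1 dd (ov_NN ov x).
have h6 := dot_unit_le1 mm nn.
have e0 : 0 <= q * `|y - x| by rewrite mulr_ge0 ?sqrtr_ge0.
have e1 := normr_ge0 (sl m - sl n).
have mn0 : 0 <= dot3 m n.
  rewrite leNgt; apply/negP => mn.
  have : dot3 m d <= 3 * E.
    rewrite par.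
    have a1 : dot3 m (tg x n) * dot3 d (tg x n) <= 2 * E.
      apply: (le_trans (ler_norm _)); rewrite normrM; apply: le_trans h1.
      by rewrite ler_piMr.
    have a2 : dot3 m (N (g x)) * dot3 d (N (g x)) <= q * `|y - x|.
      apply: (le_trans (ler_norm _)); rewrite normrM; apply: le_trans h2.
      by rewrite ler_piMr.
    have a3 : dot3 m n * dot3 d n <= 0 by rewrite (dotC d) nmulr_rle0// ltW.
    lra.
  lra.
split=> //.
rewrite norm3_le; last by rewrite mulr_ge0// addr_ge0.
have -> : dot3 (m - n) (m - n) = 2 - 2 * dot3 m n.
  by rewrite !(dotDl, dotDr, dotNl, dotNr) mm nn (dotC n m); ring.
have : 1 = dot3 m (tg x n) ^+ 2 + dot3 m n ^+ 2 + dot3 m (N (g x)) ^+ 2.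
  by rewrite -mm par !expr2.
have b1 : dot3 m (tg x n) ^+ 2 <= (2 * E) ^+ 2.
  by rewrite -[X in X <= _]real_normK ?num_real// lerXn2r ?nnegrE ?mulr_ge0 ?addr_ge0.
have b2 : dot3 m (N (g x)) ^+ 2 <= E ^+ 2.
  rewrite -[X in X <= _]real_normK ?num_real// lerXn2r ?nnegrE ?addr_ge0//.
  by apply: (le_trans h2); rewrite lerDl.
move: b1 b2 h6 mn0; move: (dot3 m (tg x n)) (dot3 m n) (dot3 m (N (g x))) => A B C.
have : 0 <= E by rewrite addr_ge0.
move: E => E0 E00 b1 b2; rewrite ler_norml => /andP[_ B1] B0 h.
have : B ^+ 2 <= B by rewrite expr2 ler_piMr.
have := sqr_ge0 E0; rewrite !exprMn in b1 *; move: B1 b1 b2 h; lz; lra.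
Qed.
End NormalClose.

(** Chords in the window are almost parallel to the tangent at [x0], because the supports at both
    ends nearly agree with [n0]. So [dK] is at most [B] times the advance along this tangent, and
    [ov_len] extends this to the arc length. A vector no longer than [w - u] whose advance is at
    least [(1 - 10 * e ^+ 2) * (w - u)] deviates by at most [6 * e * (w - u)]. *)
Lemma tangent_control (x0 u0 v0 e dl : R) (n0 : V) : sp x0 n0 -> 0 <= e -> 0 <= dl -> 2 * dl < r ->
  norm3 (o - g x0) * e + dl <= del / 2 -> e <= 1 / 4 -> q * dl <= e ->
  (forall x, u0 <= x <= v0 -> `|x - x0| <= dl /\ exists2 m, sp x m & norm3 (m - n0) <= e) ->
  forall u w : R, u0 <= u -> u <= w -> w <= v0 ->
    norm3 (g w - g u - (w - u) *: tg x0 n0) <= 6 * e * (w - u).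
Proof.
move=> [nn Nn np nd] e0 dl0 dlr He e4 qd h.
have del0 := ov_del ov; have q0 := sqrtr_ge0 K; have hSK := ov_SK ov.
have NN0 := ov_NN ov x0.
have TT := tgT nn Nn.
have qe : K * dl ^+ 2 <= e ^+ 2.
  have -> : K * dl ^+ 2 = (q * dl) ^+ 2 by rewrite exprMn [q ^+ 2]expr2 sqK.
  by rewrite lerXn2r ?nnegrE ?mulr_ge0.
have step (u w : R) : u0 <= u -> u <= w -> w <= v0 ->
    [/\ (1 - 5 * e ^+ 2) * norm3 (g w - g u) <= dot3 (g w - g u) (tg x0 n0)
      & dK K (g u) (g w) <= (1 + 5 * e ^+ 2) * norm3 (g w - g u)].
  move=> u0u uw wv0.
  have [ux [m spm mn]] : `|u - x0| <= dl /\ exists2 m, sp u m & norm3 (m - n0) <= e.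
    by apply: h; rewrite u0u (le_trans uw).
  have [wx [m' spm' mn']] : `|w - x0| <= dl /\ exists2 m, sp w m & norm3 (m - n0) <= e.
    by apply: h; rewrite wv0 (le_trans u0u).
  have [mm Nm mp _] := spm; have [mm' Nm' mp' _] := spm'.
  pose D : V := g w - g u.
  have D0 := norm3_ge0 D.
  have Dw : norm3 D <= w - u by have := ov_lip K0 ov u w; rewrite ger0_norm// subr_ge0.
  have wu : w - u <= 2 * dl by move: ux wx; rewrite !ler_norml => /andP[? ?] /andP[? ?]; lra.
  have KD : K * norm3 D ^+ 2 <= 4 * e ^+ 2.
    apply: (@le_trans _ _ (K * (2 * dl) ^+ 2)).
      by rewrite ler_wpM2l// lerXn2r ?nnegrE//; move: Dw wu; lc; lra.
    by rewrite exprMn; move: qe; lc; lra.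
  have Dn : `|dot3 D n0| <= e * norm3 D.
    have a1 := mp w; have a2 := mp' u; rewrite -(opprB (g w)) dotNl in a2.
    rewrite -/D in a1 a2.
    have b1 : `|dot3 D m - dot3 D n0| <= e * norm3 D.
      rewrite -dotNr -dotDr; apply: (le_trans (cauchy _ _)); rewrite mulrC.
      by apply: ler_wpM2r.
    have b2 : `|dot3 D m' - dot3 D n0| <= e * norm3 D.
      rewrite -dotNr -dotDr; apply: (le_trans (cauchy _ _)); rewrite mulrC.
      by apply: ler_wpM2r.
    move: b1 b2 a1 a2; rewrite !ler_norml; move: (dot3 D m) (dot3 D m') (dot3 D n0) (e * norm3 D).
    by move=> A B C E /andP[h1 h2] /andP[h3 h4] h5 h6; apply/andP; split; move: h2 h3 h6; lz; lra.
  have DN : `|dot3 D (N (g x0))| <= 2 * e * norm3 D.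
    have -> : dot3 D (N (g x0)) = q * dot3 D D / 2 + q * dot3 D (g u - g x0).
      rewrite -(SK_chord (hSK u) (hSK w)) -/D -dotZr -dotDr; congr dot3.
      by rewrite !nKE; apply: vec3P; rewrite !vE; ring.
    rewrite -norm3_sq.
    have c1 : `|q * dot3 D (g u - g x0)| <= e * norm3 D.
      rewrite normrM ger0_norm//; apply: (@le_trans _ _ (q * (norm3 D * dl))).
        rewrite ler_wpM2l//; apply: (le_trans (cauchy _ _)); rewrite ler_wpM2l//.
        exact: (ov_lip_le K0 ov ux).
      by rewrite [norm3 D * _]mulrC mulrA ler_wpM2r.
    have c2 : `|q * norm3 D ^+ 2 / 2| <= e * norm3 D.
      rewrite ger0_norm; last by rewrite divr_ge0// mulr_ge0// sqr_ge0.
      have : q * norm3 D <= 2 * e.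
        by apply: (@le_trans _ _ (q * (2 * dl))); [rewrite ler_wpM2l//; (move: Dw wu; lc; lra)|(move: qd; lc; lra)].
      by rewrite expr2 mulrA => hh; have := ler_wpM2r D0 hh; lc; lra.
    by apply: (le_trans (ler_normD _ _)); move: c1 c2; lc; lra.
  have par := frame_parseval (ov_s ov) NN0 nn Nn D D.
  have T2 : (1 - 5 * e ^+ 2) * norm3 D ^+ 2 <= dot3 D (tg x0 n0) ^+ 2.
    have a1 : dot3 D n0 ^+ 2 <= (e * norm3 D) ^+ 2.
      by rewrite -[X in X <= _]real_normK ?num_real// lerXn2r ?nnegrE ?mulr_ge0.
    have a2 : dot3 D (N (g x0)) ^+ 2 <= (2 * e * norm3 D) ^+ 2.
      by rewrite -[X in X <= _]real_normK ?num_real// lerXn2r ?nnegrE ?mulr_ge0.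
    rewrite !exprMn in a1 a2; rewrite norm3_sq in a1 a2 *; rewrite -!expr2 in par; move: a1 a2 par; lc; lra.
  have e16 : e ^+ 2 <= 1 / 16.
    by have : e ^+ 2 <= (1 / 4) ^+ 2 by [rewrite lerXn2r ?nnegrE//; lra]; lc; lra.
  split.
    have [uw'|wu'] := ltP u w; last first.
      have -> : g w - g u = 0 by rewrite (@le_anti _ _ u w) ?subrr// uw.
      by rewrite norm3_0 mulr0 dot0l.
    (* The direction of travel comes from [ov_or]; [cross_pole] moves its base point from [u] to
       [x0] at the cost [dl]. *)
    rewrite -/D; have T0 : 0 <= dot3 D (tg x0 n0).
      rewrite leNgt; apply/negP => T0.
      have uwr : w < u + r by move: dlr wu; lc; lra.
      have := ov_or ov uw' uwr; rewrite -/D.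
      rewrite (cross_pole _ _ (g u) (g x0)).
      rewrite dotDr mulrDr.
      have s1 : `|s| = 1.
        have : `|s| ^+ 2 = 1 by rewrite real_normK ?num_real// expr2 (ov_s ov).
        by move/eqP; rewrite sqrf_eq1 => /orP[/eqP//|/eqP h0]; have := normr_ge0 s; move: h0; lc; lra.
      have b1 : s * dot3 D (cross (g u - g x0) (N o)) <= dl * norm3 D.
        apply: (le_trans (ler_norm _)); rewrite normrM s1 mul1r.
        apply: (le_trans (cauchy _ _)); rewrite mulrC ler_wpM2r//.
        apply: (le_trans (norm3_cross _ _)); rewrite (norm3_unit (nK_unit (ov_o ov))) mulr1.
        exact: (ov_lip_le K0 ov ux).
      have b2 : s * dot3 D (cross (N (g x0)) (o - g x0)) =
         dot3 D (tg x0 n0) * dot3 (o - g x0) n0 - dot3 D n0 * dot3 (o - g x0) (tg x0 n0).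
        exact: frame_orient.
      rewrite b2.
      have b3 : - (dot3 D n0 * dot3 (o - g x0) (tg x0 n0)) <= norm3 (o - g x0) * e * norm3 D.
        apply: (le_trans (ler_norm _)); rewrite normrN normrM mulrC -mulrA.
        apply: ler_pM => //; apply: (le_trans (cauchy _ _)); rewrite (norm3_unit TT) mulr1.
        exact: lexx.
      have b4 : dot3 D (tg x0 n0) * dot3 (o - g x0) n0 <= dot3 D (tg x0 n0) * del.
        by rewrite ler_nM2l.
      have b5 : norm3 (o - g x0) * e * norm3 D + dl * norm3 D <= del / 2 * norm3 D.
        by rewrite -mulrDl ler_wpM2r.
      move=> b6.
      have b7 : 0 < del * (dot3 D (tg x0 n0) + norm3 D / 2).
        by rewrite mulrDr; move: b1 b3 b4 b5 b6; lz; lra.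
      rewrite pmulr_rgt0// in b7.
      have b8 : dot3 D (tg x0 n0) ^+ 2 < (norm3 D / 2) ^+ 2.
        by rewrite -subr_gt0 subr_sqr mulr_gt0//; move: T0 D0 b7; lz; lra.
      have : (1 - 5 * e ^+ 2) * norm3 D ^+ 2 >= 1 / 2 * norm3 D ^+ 2.
        by rewrite ler_wpM2r ?sqr_ge0//; move: e16; lc; lra.
      have := sqr_ge0 (norm3 D); rewrite expr_div_n in b8; move: T2 b8; lc; lra.
    have f0 : 0 <= 1 - 5 * e ^+ 2 by move: e16; lc; lra.
    rewrite -(ler_pXn2r (_ : 0 < 2)%N) ?nnegrE ?mulr_ge0//.
    apply: le_trans T2; rewrite exprMn ler_wpM2r ?sqr_ge0// expr2 ler_piMl//.
    have := sqr_ge0 e; lc; lra.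
  apply: (le_trans (dK_le_norm K0 (hSK u) (hSK w))); rewrite -/D.
  have := ler_wpM2r D0 KD; rewrite [norm3 D ^+ 3]exprS mulrDl mul1r; lc; lra.
move=> u w u0u uw wv0.
have e16 : e ^+ 2 <= 1 / 16.
  by have : e ^+ 2 <= (1 / 4) ^+ 2 by [rewrite lerXn2r ?nnegrE//; lra]; lc; lra.
have f0 : 0 < 1 - 5 * e ^+ 2 by move: e16; lc; lra.
pose B := (1 + 5 * e ^+ 2) / (1 - 5 * e ^+ 2).
have ln : w - u <= B * dot3 (g w - g u) (tg x0 n0).
  apply: (ov_len ov uw) => u' w' h1 h2 h3.
  have [a1 a2] := step u' w' (le_trans u0u h1) h2 (le_trans h3 wv0).
  apply: (le_trans a2); rewrite /B -mulrA.
  have a3 : norm3 (g w' - g u') <= (1 - 5 * e ^+ 2)^-1 * dot3 (g w' - g u') (tg x0 n0).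
    by rewrite mulrC ler_pdivlMr// mulrC.
  by apply: ler_wpM2l a3; have := sqr_ge0 e; lc; lra.
rewrite norm3_le; last by rewrite !mulr_ge0 ?subr_ge0.
have Dw : norm3 (g w - g u) <= w - u by have := ov_lip K0 ov u w; rewrite ger0_norm// subr_ge0.
have D2 : dot3 (g w - g u) (g w - g u) <= (w - u) ^+ 2.
  by rewrite -norm3_sq lerXn2r ?nnegrE ?norm3_ge0// subr_ge0.
pose D : V := g w - g u; rewrite -/D in ln D2 *.
have -> : dot3 (D - (w - u) *: tg x0 n0) (D - (w - u) *: tg x0 n0) =
  dot3 D D - 2 * (w - u) * dot3 D (tg x0 n0) + (w - u) ^+ 2.
  clearbody D; rewrite !(dotDl, dotDr, dotNl, dotNr, dotZl, dotZr) TT (dotC _ D); ring.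
have lnl : (1 - 10 * e ^+ 2) * (w - u) <= dot3 D (tg x0 n0).
  move: ln; rewrite /B mulrAC ler_pdivlMr// => ln.
  have wu : 0 <= w - u by rewrite subr_ge0.
  have g0 : 0 < 1 + 5 * e ^+ 2 by have := sqr_ge0 e; lc; lra.
  rewrite -(ler_pM2l g0); apply: le_trans ln; rewrite mulrA (mulrC (w - u)) ler_wpM2r//.
  have := sqr_ge0 (e ^+ 2); rewrite (expr2 (e ^+ 2)); have := sqr_ge0 e; move: (e ^+ 2) => z; lz; lra.
have wu : 0 <= w - u by rewrite subr_ge0.
have := ler_wpM2l wu lnl; rewrite !exprMn => h1.
have h2 : (1 - 10 * e ^+ 2) * (w - u) ^+ 2 <= (w - u) * dot3 D (tg x0 n0).
  by apply: le_trans h1; rewrite expr2; lc; lra.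
have := mulr_ge0 (sqr_ge0 e) (sqr_ge0 (w - u)); move: D2 h1; lc; lra.
Qed.
End Tangent.

(** * Smooth points *)

Section Smooth.
Variables (R : realType) (K : R) (g : R -> vec3 R) (L : R) (o : vec3 R) (del s r : R).
Hypotheses (K0 : 0 <= K) (ov : oval K g L o del s r).
Local Notation V := (vec3 R).
Local Notation q := (Num.sqrt K).
Local Notation N := (nK K).
Local Notation sp := (supp K g o del).
Local Notation tg x n := (frameT s (N (g x)) n).
Local Notation mu := (@lebesgue_measure R).

Lemma small4 (a b c d : R) : 0 < a -> 0 < b -> 0 < c -> 0 < d ->
  exists x : R, [/\ 0 < x, x <= a, x <= b, x <= c & x <= d].
Proof.
move=> a0 b0 c0 d0; exists (Num.min (Num.min a b) (Num.min c d)).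
by rewrite !lt_min !ge_min !lexx a0 b0 c0 d0 !orbT.
Qed.

(** [n] is the right limit of the normals, the supporting normal of greatest slope at [t]. The frame
    [tg t n] then contains the right tangent, also at a corner. *)
Definition right_frame (t : R) (n : V) : Prop :=
  [/\ sp t n, forall m, sp t m -> 0 <= dot3 m (tg t n),
      forall e : R, 0 < e -> exists2 dl : R, 0 < dl &
        forall x m, t < x -> x < t + dl -> sp x m -> norm3 (m - n) <= e,
      forall e : R, 0 < e -> exists2 dl : R, 0 < dl &
        forall x y : R, t <= x -> x <= y -> y < t + dl ->
          norm3 (g y - g x - (y - x) *: tg t n) <= e * (y - x)
    & exists hd d, chart K g o del t hd d /\ forall x m, t < x -> x <= t + r / 2 -> sp x m ->
        slope K g s t d n <= slope K g s t d m].

(** By monotonicity the slopes to the right of [t] converge to their infimum [p], so the normals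
    converge to the one of slope [p], which supports by closedness. [tangent_control] then gives the
    tangent. *)
Lemma right_frame_exists (t : R) : exists n, right_frame t n.
Proof.
have [r0 rL rd Kr] := ov_r ov; have del0 := ov_del ov; have q0 := sqrtr_ge0 K.
have [hd [d ch]] := chart_exists ov t.
have [dd Nd hd0 _] := ch.
have hd1 : 0 < hd by lra.
pose sl := slope K g s t d.
pose a : V := tg t d.
have aa : dot3 a a = 1 by exact: frameTT (ov_s ov) (ov_NN ov t) dd Nd.
have ad : dot3 a d = 0 by exact: frameTn.
have aN : dot3 a (N (g t)) = 0 by exact: frameTm.
have win (x : R) : t <= x -> x <= t + r / 2 -> `|x - t| <= r / 2.
  by move=> h1 h2; rewrite ger0_norm; move: h1 h2; lc; lra.
have tt : `|t - t| <= r / 2 by rewrite subrr normr0; lra.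
have mono (x y : R) (m m' : V) : t <= x -> x < y -> y <= t + r / 2 -> sp x m -> sp y m' -> sl m <= sl m'.
  move=> h1 h2 h3; apply: (slope_mono K0 ov ch) => //; try apply: win; move: h1 h2 h3; lz; lra.
pose E : set R := [set p | exists x m, [/\ t < x, x <= t + r / 2, sp x m & p = sl m]].
have Elb m : sp t m -> lbound E (sl m).
  by move=> hm p [x [m' [h1 h2 h3 ->]]]; apply: (mono t x).
have [m1 sm1] := ov_supp ov (t + r / 2).
have [m0 sm0] := ov_supp ov t.
have E1 : E (sl m1) by exists (t + r / 2), m1; split=> //; lc; lra.
have hinf : has_inf E by split; [exists (sl m1) | exists (sl m0); exact: Elb].
pose p := inf E.
pose w : R := Num.sqrt (1 + p ^+ 2).
have w2 : w * w = 1 + p ^+ 2 by rewrite -expr2 sqr_sqrtr// addr_ge0 ?sqr_ge0.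
have w0 : 0 < w by rewrite sqrtr_gt0 ltr_pwDl ?sqr_ge0.
have w1 := lt0r_neq0 w0.
pose n : V := w^-1 *: (d - p *: a).
have nn : dot3 n n = 1.
  rewrite /n dotZl dotZr !(dotDl d) !(dotDr d) !dotNl !dotNr !(dotZl p) !(dotZr p) dd aa ad (dotC d a) ad.
  transitivity (w^-1 * (w^-1 * (w * w))); last by field.
  by rewrite w2; congr (_ * (_ * _)); ring.
have Nn : dot3 (N (g t)) n = 0.
  by rewrite /n dotZr (dotDr d) dotNr (dotZr p) Nd (dotC _ a) aN; ring.
have nd : dot3 n d = w^-1 by rewrite /n dotZl (dotDl d) dotNl (dotZl p) dd ad; ring.
have nd0 : 0 < dot3 n d by rewrite nd invr_gt0.
have sln : sl n = p.
  rewrite /sl /slope nd -/a /n dotZl (dotDl d) dotNl (dotZl p) aa (dotC d a) ad.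
  by field.
have ple x m : t < x -> x <= t + r / 2 -> sp x m -> p <= sl m.
  by move=> h1 h2 h3; apply: (ge_inf hinf.2); exists x, m.
have w3 : 0 < 5 / 6 * del / hd by rewrite !mulr_gt0 ?invr_gt0//; lra.
have close (e : R) : 0 < e -> exists2 dl : R, 0 < dl &
        forall x m, t < x -> x < t + dl -> sp x m -> norm3 (m - n) <= e.
  move=> e0.
  have [e1 [e10 e11 e12 _ _]] : exists x : R, [/\ 0 < x, x <= e / 10, x <= 5 / 6 * del / hd / 7, x <= e & x <= e].
    by apply: small4 => //; move: w3; lz; lra.
  have [_ [x0 [m' [h1 h2 h3 ->]]] h4] := inf_adherent e10 hinf.
  rewrite -/p in h4.
  have q1 : 0 < q + 1 by move: q0; lz; lra.
  have [dl [dl0 dl1 dl2 _ _]] : exists x : R, [/\ 0 < x, x <= x0 - t, x <= e1 / (q + 1), x <= e & x <= e].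
    by apply: small4 => //; [(move: h1; lz; lra) | rewrite divr_gt0].
  exists dl => // x m tx xd spm.
  have xr : x <= t + r / 2 by move: xd dl1 h2; lz; lra.
  have lo := ple x m tx xr spm.
  have up : sl m <= sl m' by apply: (mono x x0) => //; move: tx xd dl1; lz; lra.
  have qd : q * `|x - t| <= e1.
    rewrite gtr0_norm; last by move: tx; lz; lra.
    move: dl2 tx xd; rewrite ler_pdivlMr//; lc => dl2 tx xd; nra.
  have xw : `|x - t| <= r / 2 by apply: win => //; exact: ltW.
  have xw' : `|x - t| <= r by move: xw; lz; lra.
  have EE : q * `|x - t| + `|slope K g s t d m - slope K g s t d n| <= 2 * e1.
    by rewrite -/sl sln [`|sl m - p|]ger0_norm; move: lo up h4 qd; lz; lra.
  have [_ h5] := @normal_close _ _ _ _ _ _ _ _ K0 ov _ _ _ _ _ _ _ ch tt xw nn Nn nd0 spm (5 / 6 * del / hd)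
     ltac:(rewrite ler_pdivrMr// [_ * hd]mulrC; exact: (chart_dir K0 ov ch xw' spm)) ltac:((move: EE e12; lz; lra)).
  by apply: (le_trans h5); move: e11 EE; lz; lra.
have spn : sp t n.
  apply: (supp_limit ov) => e e0; have [dl dl0 hc] := close e e0.
  have [x [x0 x1 x2 _ _]] : exists x : R, [/\ 0 < x, x <= dl / 2, x <= e, x <= e & x <= e].
    by apply: small4 => //; lz; lra.
  have [m spm] := ov_supp ov (t + x).
  exists (t + x), m; split=> //; last by apply: hc spm; move: x1; lz; lra.
  by apply: (ov_lip_le K0 ov); rewrite addrC addKr ger0_norm//; lz; lra.
exists n; split=> //.
- move=> m spm.
  have := normal_slope K0 ov ch tt Nn nd0 spm.
  have [_ Nm _ _] := spm.
  rewrite (ov_NN ov) (dotC m (N _)) Nm mul0r mulr1 sub0r => ->.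
  have md0 := supp_dir_gt0 K0 ov ch tt spm.
  rewrite -mulNr; apply: mulr_ge0; last by rewrite ltW// mulr_gt0.
  by rewrite -/sl sln opprB subr_ge0; apply: lb_le_inf (Elb m spm); exists (sl m1).
- move=> e e0; have H0 := norm3_ge0 (o - g t); set H := norm3 _ in H0.
  have H1 : 0 < H + 1 by lc; lra.
  have [e1 [e10 e11 e12 e13 _]] : exists x : R, [/\ 0 < x, x <= e / 6, x <= 1 / 4, x <= del / 4 / (H + 1) & x <= e].
    by apply: small4 => //; rewrite ?divr_gt0.
  have [d1 d10 hc] := close e1 e10.
  have q1 : 0 < q + 1 by move: q0; lz; lra.
  have [dl [dl0 dl1 dl2 dl3 dl4]] : exists x : R,
      [/\ 0 < x, x <= d1 / 2, x <= r / 4, x <= del / 4 & x <= e1 / (q + 1)].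
    by apply: small4 => //; rewrite ?divr_gt0.
  exists dl => // x y tx xy ydl.
  have := @tangent_control _ _ _ _ _ _ _ _ K0 ov t t (t + dl) e1 dl n spn.
  have dlr : 2 * dl < r by move: dl2; lz; lra.
  move=> /(_ (ltW e10) (ltW dl0) dlr).
  have HE : H * e1 + dl <= del / 2.
    move: e13 dl3; rewrite ler_pdivlMr//; lc => e13 dl3; nra.
  have qE : q * dl <= e1 by move: dl4; rewrite ler_pdivlMr//; lc => dl4; nra.
  move=> /(_ HE e12 qE) hh.
  apply: (@le_trans _ _ (6 * e1 * (y - x))); last by rewrite ler_wpM2r ?subr_ge0//; move: e11; lz; lra.
  apply: hh => //; last by move: ydl; lz; lra.
  move=> z /andP[z1 z2]; split; first by rewrite ger0_norm; move: z1 z2; lz; lra.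
  have [zt|zt] := ltP t z; last first.
    by have -> : z = t by [apply: le_anti; rewrite zt z1]; exists n => //; rewrite subrr norm3_0 ltW.
  have [m spm] := ov_supp ov z; exists m => //; apply: hc spm => //; move: z2 dl1; lz; lra.
- exists hd, d; split=> // x m h1 h2 h3; rewrite -/sl sln; exact: ple h1 h2 h3.
Qed.

(** The Frenet equation [n' = - k T] to first order, uniformly over all supporting normals at nearby
    points, together with strict differentiability of [g]. *)
Definition smooth_at (t : R) (n : V) (k : R) : Prop :=
  [/\ sp t n, 0 <= k & forall e : R, 0 < e -> exists2 dl : R, 0 < dl &
     (forall y m, `|y - t| < dl -> sp y m -> norm3 (m - n + (k * (y - t)) *: tg t n) <= e * `|y - t|)
     /\ (forall u w : R, t - dl < u -> u <= w -> w < t + dl ->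
           norm3 (g w - g u - (w - u) *: tg t n) <= e * (w - u))].

Section SmoothPoint.
Variables (t hd : R) (d : V) (x l : R) (sel : R -> V).
Hypotheses (ch : chart K g o del t hd d) (spsel : forall y, sp y (sel y)).
Local Notation sl := (slope K g s t d).

(** The slope of any normal at [y] lies between the selected slopes at [y - h] and [y + h]; letting
    [h] tend to 0 transfers the expansion from the selection to all normals. *)
Lemma slope_expansion (e : R) : `|x - t| < r / 4 -> diff_at (sl \o sel) x l -> 0 <= l -> 0 < e ->
  exists2 dl : R, 0 < dl & forall y m, `|y - x| < dl -> sp y m ->
    `|y - t| <= r / 2 /\ `|sl m - sl (sel x) - l * (y - x)| <= e * `|y - x|.
Proof.
move=> xt df l0 e0; have [r0 _ _ _] := ov_r ov.
have [d1 d10 hd1] := df _ e0.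
exists (Num.min (d1 / 2) (r / 8)); first by rewrite lt_min !divr_gt0.
move=> y m; rewrite lt_min => /andP[y1 y2] spm.
have yt : `|y - t| <= 3 / 8 * r.
  have := ler_normD (y - x) (x - t); rewrite addrA subrK; lra.
split; first lra.
have hh (h : R) : 0 < h -> h < d1 / 2 -> h < r / 8 ->
    `|sl m - sl (sel x) - l * (y - x)| <= e * `|y - x| + (l + e) * h.
  move=> h0 h1 h2.
  have up : sl m <= sl (sel (y + h)).
    apply: (slope_mono K0 ov ch) spm (spsel _); try lra.
    have := ler_normD (y - t) h; rewrite (gtr0_norm h0) (_ : y - t + h = y + h - t); last ring.
    (move: h2 yt; lz; lra).
  have lo : sl (sel (y - h)) <= sl m.
    apply: (slope_mono K0 ov ch) (spsel _) spm; try lra.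
    have := ler_normB (y - t) h; rewrite (gtr0_norm h0) (_ : y - t - h = y - h - t); last ring.
    (move: h2 yt; lc; lra).
  have u1 := ler_normD (y - x) h; rewrite (gtr0_norm h0) (_ : y - x + h = y + h - x) in u1; last ring.
  have u2 := ler_normB (y - x) h; rewrite (gtr0_norm h0) (_ : y - x - h = y - h - x) in u2; last ring.
  have b1 := hd1 (y + h) ltac:((move: h1 u1 y1; lc; lra)); have b2 := hd1 (y - h) ltac:((move: h1 u2 y1; lc; lra)).
  rewrite /= in b1 b2.
  have b3 := ler_wpM2l (ltW e0) u1; have b4 := ler_wpM2l (ltW e0) u2.
  move: b1 b2; rewrite !ler_norml => /andP[_ b1] /andP[b2 _]; apply/andP; move: up lo b3 b4 b1 b2; lc => *; split; lra.
rewrite -subr_ge0; apply: (@eps_ge0 _ _ (l + e)) => [|e1 e10]; first (lc; lra).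
have [h [h0 h1 h2 h3 _]] : exists x : R, [/\ 0 < x, x <= d1 / 3, x <= r / 9, x <= e1 & x <= e1].
  by apply: small4; rewrite ?divr_gt0.
have := hh h h0 ltac:((move: h1; lz; lra)) ltac:((move: h2; lz; lra)).
have le0 : 0 <= l + e by lc; lra.
have := ler_wpM2l le0 h3; lc; lra.
Qed.

(** The curvature is the derivative [l] of the slope, corrected by the two factors of
    [normal_slope]: the product of the components along [d], which becomes a square in the limit,
    and the angle between the tangent planes at [x] and [t]. The remaining components of [m - n] are
    of second order. *)
Lemma smooth_point : `|x - t| < r / 4 -> diff_at (sl \o sel) x l -> 0 <= l ->
  smooth_at x (sel x) (l * dot3 (sel x) d ^+ 2 / dot3 (N (g x)) (N (g t))).
Proof.
move=> xt df l0; have [r0 _ rd _] := ov_r ov; have del0 := ov_del ov; have q0 := sqrtr_ge0 K.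
have spx := spsel x; set n := sel x in spx *.
have [nn Nn np nd'] := spx.
have [dd Nd hd0 _] := ch.
have hd1 : 0 < hd by lra.
have xt' : `|x - t| <= r / 2 by lra.
have nd := supp_dir_gt0 K0 ov ch xt' spx.
have nu := NN_close K0 ov ch xt'.
set nu_ := dot3 (N (g x)) (N (g t)) in nu *; case/andP: nu => nu1 nu2.
have nu0 : 0 < nu_ by move: nu1; lc; lra.
set k := l * _ / _.
have k0 : 0 <= k by rewrite divr_ge0 ?mulr_ge0 ?sqr_ge0// ltW.
pose C : R := q + l + 1.
have C0 : 0 < C by rewrite /C; lc; lra.
pose T : V := tg x n.
have TT : dot3 T T = 1 by exact: (frameTT (ov_s ov) (ov_NN ov x) nn Nn).
have w3 : 0 < 5 / 6 * del / hd by rewrite !mulr_gt0 ?invr_gt0//; lra.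
have [d1 d10 h1] := slope_expansion xt df l0 ltr01.
have [d2 [d20 d21 d22 d23 _]] : exists z : R, [/\ 0 < z, z <= d1, z <= 5 / 6 * del / hd / (4 * C), z <= r / 2 & z <= d1].
  by apply: small4 => //; rewrite ?divr_gt0// mulr_gt0.
have near (y : R) m : `|y - x| < d2 -> sp y m -> norm3 (m - n) <= 5 * C * `|y - x|.
  move=> yx spm; have [yt hy] := h1 y m (lt_le_trans yx d21) spm.
  have yx0 := normr_ge0 (y - x).
  have EE : q * `|y - x| + `|sl m - sl n| <= C * `|y - x|.
    have : `|sl m - sl n| <= `|sl m - sl n - l * (y - x)| + `|l * (y - x)|.
      by have := ler_normD (sl m - sl n - l * (y - x)) (l * (y - x)); rewrite subrK.
    rewrite normrM (ger0_norm l0) /C; rewrite -/n in hy; move: hy; lz; lra.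
  have ym : `|y - t| <= r by move: yt; lz; lra.
  have wm : 5 / 6 * del / hd <= dot3 m d.
    by rewrite ler_pdivrMr// [_ * hd]mulrC; exact: (chart_dir K0 ov ch ym spm).
  have w4 : 3 * (q * `|y - x| + `|sl m - sl n|) < 5 / 6 * del / hd.
    have : C * `|y - x| < C * (5 / 6 * del / hd / (4 * C)).
      by rewrite ltr_pM2l//; apply: lt_le_trans d22.
    have -> : C * (5 / 6 * del / hd / (4 * C)) = 5 / 6 * del / hd / 4 by field; rewrite !lt0r_neq0.
    by move: EE w3; lz; lra.
  have [_ h5] := @normal_close _ _ _ _ _ _ _ _ K0 ov _ _ _ _ _ _ _ ch xt' yt nn Nn nd spm _ wm w4.
  by apply: (le_trans h5); rewrite -mulrA ler_pM2l.
have mainN (e : R) : 0 < e -> exists2 dl : R, 0 < dl & forall y m, `|y - x| < dl -> sp y m ->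
    norm3 (m - n + (k * (y - x)) *: T) <= e * `|y - x|.
  move=> e0.
  have e40 : 0 < e / 4 by lz; lra.
  have [d3 d30 h3] := slope_expansion xt df l0 e40.
  pose C2 : R := 15 * q * C + 10 * l * C + 13 * C ^+ 2.
  have C20 : 0 <= C2 by rewrite /C2 !addr_ge0 ?mulr_ge0// ltW.
  have C21 : 0 < C2 + 1 by lz; lra.
  have [dl [dl0 dl1 dl2 dl3 _]] : exists z : R, [/\ 0 < z, z <= d3, z <= d2, z <= e / 2 / (C2 + 1) & z <= d3].
    by apply: small4 => //; rewrite ?divr_gt0.
  exists dl => // y m yx spm.
  have yx3 := lt_le_trans yx dl1; have yx2 := lt_le_trans yx dl2.
  have [yt hy] := h3 y m yx3 spm; have mn := near y m yx2 spm.
  have [mm Nm mp _] := spm.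
  pose h : R := `|y - x|.
  have h0 : 0 <= h := normr_ge0 _.
  have D1 : norm3 (g y - g x) <= h by exact: (ov_lip K0 ov x y).
  have mN : `|dot3 m (N (g x))| <= 5 * q * C * h ^+ 2.
    rewrite dotC (dot_N x Nm) normrM ger0_norm//.
    have : `|dot3 (g y - g x) m| <= 5 * C * h ^+ 2.
      have a1 := np y; have a2 := mp x; rewrite -(opprB (g y)) dotNl in a2.
      apply: (@le_trans _ _ `|dot3 (g y - g x) (m - n)|).
        move: a1 a2; lc => a1 a2; rewrite dotDr dotNr ler0_norm; last lra.
        by rewrite ler0_norm; move: a1 a2; lz; lra.
      apply: (le_trans (cauchy _ _)); rewrite expr2 mulrA [X in _ <= X]mulrC.
      by apply: ler_pM => //; rewrite ?norm3_ge0.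
    by move=> hx; have := ler_wpM2l q0 hx; lz; lra.
  have md1 := dot_unit_le1 mm dd; have nd1 := dot_unit_le1 nn dd.
  have Td1 := dot_unit_le1 TT (ov_NN ov t).
  have mT : `|dot3 m T + k * (y - x)| <= e / 2 * h + (10 * q * C + 10 * l * C) * h ^+ 2.
    have E : nu_ * (dot3 m T + k * (y - x)) = dot3 m (N (g x)) * dot3 T (N (g t))
       - (sl m - sl n - l * (y - x)) * (dot3 m d * dot3 n d)
       - l * (y - x) * dot3 n d * dot3 (m - n) d.
      rewrite mulrDr (mulrC nu_ (dot3 m T)) (normal_slope K0 ov ch yt Nn nd spm) -/T dotDl dotNl /k.
      by field; rewrite lt0r_neq0.
    have : `|nu_ * (dot3 m T + k * (y - x))| <= e / 4 * h + (5 * q * C + 5 * l * C) * h ^+ 2.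
      rewrite E.
      have a1 : `|dot3 m (N (g x)) * dot3 T (N (g t))| <= 5 * q * C * h ^+ 2.
        by rewrite normrM; apply: le_trans mN; rewrite ler_piMr.
      have a2 : `|(sl m - sl n - l * (y - x)) * (dot3 m d * dot3 n d)| <= e / 4 * h.
        rewrite normrM; apply: le_trans hy; rewrite ler_piMr// normrM -[X in _ <= X]mulr1.
        by rewrite ler_pM.
      have a3 : `|l * (y - x) * dot3 n d * dot3 (m - n) d| <= 5 * l * C * h ^+ 2.
        rewrite !normrM (ger0_norm l0) -/h.
        have a4 : `|dot3 (m - n) d| <= 5 * C * h.
          by apply: (le_trans (cauchy _ _)); rewrite (norm3_unit dd) mulr1.
        apply: (@le_trans _ _ (l * h * 1 * (5 * C * h))); last by rewrite expr2; lz; lra.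
        by apply: ler_pM => //; rewrite ?mulr_ge0//; apply: ler_pM => //; rewrite mulr_ge0.
      apply: (le_trans (ler_normB _ _)).
      have := ler_normB (dot3 m (N (g x)) * dot3 T (N (g t)))
         ((sl m - sl n - l * (y - x)) * (dot3 m d * dot3 n d)); move: a1 a2 a3; lz; lra.
    rewrite normrM (gtr0_norm nu0).
    have := normr_ge0 (dot3 m T + k * (y - x)); move: (`|dot3 m T + k * (y - x)|) => A A0 hA.
    have hA' : A / 2 <= nu_ * A by have := ler_wpM2r A0 nu1; move: A0; lz; lra.
    by move: hA hA' A0; lz; lra.
  have mn1 : `|dot3 m n - 1| <= 13 * C ^+ 2 * h ^+ 2.
    have -> : dot3 m n - 1 = - (norm3 (m - n) ^+ 2 / 2).
      by rewrite norm3_sq !(dotDl, dotDr, dotNl, dotNr) mm nn (dotC n m); field.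
    rewrite normrN ger0_norm; last by rewrite divr_ge0// sqr_ge0.
    have : norm3 (m - n) ^+ 2 <= (5 * C * h) ^+ 2.
      by rewrite lerXn2r ?nnegrE ?norm3_ge0 ?mulr_ge0// ltW.
    rewrite !exprMn; have := mulr_ge0 (sqr_ge0 C) (sqr_ge0 h); lz; lra.
  have -> : m - n + (k * (y - x)) *: T =
     (dot3 m T + k * (y - x)) *: T + (dot3 m n - 1) *: n + dot3 m (N (g x)) *: N (g x).
    have dec := frame_decomp (ov_s ov) (ov_NN ov x) nn Nn m; rewrite -/T in dec.
    rewrite {1}dec; move: (dot3 m T) (dot3 m n) (dot3 m (N (g x))) => A B C'.
    by clearbody T; apply: vec3P; rewrite !vE; ring.
  apply: (le_trans (norm3D _ _)).
  have := norm3D ((dot3 m T + k * (y - x)) *: T) ((dot3 m n - 1) *: n).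
  rewrite !norm3Z (norm3_unit TT) (norm3_unit nn) (norm3_unit (ov_NN ov x)) !mulr1 => a1.
  have a2 : C2 * h ^+ 2 <= e / 2 * h.
    rewrite expr2 mulrA ler_wpM2r//.
    have : h <= e / 2 / (C2 + 1) by apply: ltW; apply: lt_le_trans dl3.
    rewrite ler_pdivlMr//; move: C20 h0; lc => a3 a4 a5; nra.
  rewrite -/h; rewrite /C2 in a2; move: a1 a2 mT mn1 mN; lz; lra.
split=> // e e0.
have [d3 d30 h3] := mainN e e0.
have H0 := norm3_ge0 (o - g x); set H := norm3 (o - g x) in H0.
have H1 : 0 < H + 1 by lz; lra.
have [e1 [e10 e11 e12 e13 _]] : exists x : R, [/\ 0 < x, x <= e / 6, x <= 1 / 4, x <= del / 4 / (H + 1) & x <= e].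
  by apply: small4 => //; rewrite ?divr_gt0.
have q1 : 0 < q + 1 by move: q0; lz; lra.
have [d4 [d40 d41 d42 d43 d44]] : exists x : R,
    [/\ 0 < x, x <= d2 / 2, x <= r / 4, x <= del / 4 & x <= e1 / (q + 1)].
  by apply: small4 => //; rewrite ?divr_gt0.
have [dl [dl0 dl1 dl2 dl3 _]] : exists z : R, [/\ 0 < z, z <= d3, z <= d4, z <= e1 / (5 * C) & z <= d3].
  by apply: small4 => //; rewrite ?divr_gt0// mulr_gt0.
exists dl => //; split.
  by move=> y m yx; apply: h3; apply: lt_le_trans dl1.
move=> u w ut uw wt.
have := @tangent_control _ _ _ _ _ _ _ _ K0 ov x (x - dl) (x + dl) e1 dl n spx.
have dlr : 2 * dl < r by move: dl2 d42; lz; lra.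
move=> /(_ (ltW e10) (ltW dl0) dlr).
have HE : H * e1 + dl <= del / 2.
  move: e13 dl2 d43; rewrite ler_pdivlMr//; lc => e13 dl2 d43; nra.
have qE : q * dl <= e1.
  have : q * d4 <= e1 by move: d44; rewrite ler_pdivlMr//; lc => d44; nra.
  by apply: le_trans; rewrite ler_wpM2l.
move=> /(_ HE e12 qE) hh.
apply: (@le_trans _ _ (6 * e1 * (w - u))); last by rewrite ler_wpM2r ?subr_ge0//; move: e11; lz; lra.
apply: hh; [|by exact: ltW|by []|by exact: ltW].
move=> z /andP[z1 z2].
have zx : `|z - x| <= dl by rewrite ler_norml; apply/andP; move: z1 z2; lc => *; split; lra.
split=> //.
have [m spm] := ov_supp ov z; exists m => //.
apply: (le_trans (near z m _ spm)); first by apply: (le_lt_trans zx); move: dl2 d41; lz; lra.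
move: dl3; rewrite ler_pdivlMr ?mulr_gt0// => dl3.
have : 5 * C * `|z - x| <= 5 * C * dl by rewrite ler_pM2l// mulr_gt0.
by move: dl3; lz; lra.
Qed.
End SmoothPoint.
End Smooth.

Lemma derive_diff_at (R : realType) (f : R -> R) (x l : R) : is_derive x 1 f l -> diff_at f x l.
Proof.
move=> [df dE] e e0.
have : h^-1 *: (f (h *: (1 : R) + x) - f x) @[h --> (0 : R)^'] --> l by rewrite -dE; exact: df.
move=> /cvgrPdist_le /(_ _ e0); rewrite near_withinE => /nbhs_ballP[d /= d0 hd].
exists d => // y yx.
have [->|yx0] := eqVneq y x; first by rewrite !subrr mulr0 subrr normr0 mulr0.
have yx1 : y - x != 0 by rewrite subr_eq0.
have := hd (y - x); rewrite /ball /= sub0r normrN => /(_ yx yx1).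
rewrite /GRing.scale /= mulr1 subrK distrC => hh.
have -> : f y - f x - l * (y - x) = ((y - x)^-1 * (f y - f x) - l) * (y - x) by field.
by rewrite normrM ler_wpM2r.
Qed.

(** * Left limits and integration along the curve *)

Section LeftFrame.
Variables (R : realType) (K : R) (g : R -> vec3 R) (L : R) (o : vec3 R) (del s r : R).
Hypotheses (K0 : 0 <= K) (ov : oval K g L o del s r).
Local Notation V := (vec3 R).
Local Notation q := (Num.sqrt K).
Local Notation N := (nK K).
Local Notation sp := (supp K g o del).
Local Notation tg x n := (frameT s (N (g x)) n).

Lemma supp_rev (t : R) (n : V) : supp K (fun t => g (- t)) o del t n <-> sp (- t) n.
Proof.
by split=> -[h1 h2 h3 h4]; split=> // u; have := h3 (- u); rewrite ?opprK.
Qed.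

Lemma frameTNs (m n : V) : frameT (- s) m n = - frameT s m n.
Proof. by rewrite !frameTE scaleNr. Qed.

Lemma left_frame_exists (t : R) : exists n,
  [/\ sp t n, forall m, sp t m -> dot3 m (tg t n) <= 0,
      forall e : R, 0 < e -> exists2 dl : R, 0 < dl &
        forall x m, t - dl < x -> x < t -> sp x m -> norm3 (m - n) <= e
    & forall e : R, 0 < e -> exists2 dl : R, 0 < dl &
        forall x y : R, t - dl < x -> x <= y -> y <= t ->
          norm3 (g y - g x - (y - x) *: tg t n) <= e * (y - x)].
Proof.
have [n [h1 h2 h3 h4 _]] := right_frame_exists K0 (oval_rev K0 ov) (- t).
exists n; split.
- by move/supp_rev: h1; rewrite opprK.
- move=> m; rewrite -{1}[t]opprK => /supp_rev /h2; rewrite opprK frameTNs dotNr; lra.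
- move=> e /h3[dl dl0 hh]; exists dl => // x m h5 h6 h7.
  by apply: (hh (- x)); [lra|lra|apply/supp_rev; rewrite opprK].
move=> e /h4[dl dl0 hh]; exists dl => // x y h5 h6 h7.
have := hh (- y) (- x) ltac:(lra) ltac:(lra) ltac:(lra).
rewrite !opprK frameTNs -norm3N [- x + y]addrC.
have -> : - (g x - g y - (y - x) *: - tg t n) = g y - g x - (y - x) *: tg t n.
  by apply: vec3P; rewrite !vE; ring.
by [].
Qed.

Lemma diff_first_order (phi : R -> R) (F : V -> R) (DF T : V) (M l e x y : R) (p p' : V) :
  F p' - F p - dot3 (p' - p) DF <= M * dot3 (p' - p) (p' - p) -> 0 <= M ->
  `|phi y - phi x - l * (y - x)| <= e * `|y - x| ->
  norm3 (p' - p - (y - x) *: T) <= e * `|y - x| -> norm3 (p' - p) <= `|y - x| ->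
  (F p' - phi y) - (F p - phi x) <= (dot3 T DF - l) * (y - x)
    + (e * (norm3 DF + 1) + M * `|y - x|) * `|y - x|.
Proof.
move=> hF M0 hp hT hl.
have h1 : dot3 (p' - p) DF <= (y - x) * dot3 T DF + e * `|y - x| * norm3 DF.
  have -> : dot3 (p' - p) DF = (y - x) * dot3 T DF + dot3 (p' - p - (y - x) *: T) DF.
    by rewrite [dot3 (_ - _ *: _) _]dotDl dotNl dotZl; ring.
  rewrite lerD2l; apply: (le_trans (dot_le _ _)); apply: ler_wpM2r hT; exact: norm3_ge0.
have h2 : M * dot3 (p' - p) (p' - p) <= M * `|y - x| * `|y - x|.
  rewrite -norm3_sq -mulrA ler_wpM2l// expr2 ler_pM ?norm3_ge0//.
move: hp; rewrite ler_norml => /andP[hp _].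
move: hF h1 h2 hp; lc; lra.
Qed.

(** Both one-sided tangents at a point belong to supporting normals, so a bound over all of them
    controls the Dini slopes and [dini_le] integrates it across corners. [M] bounds the quadratic
    remainder of [F]. *)
Lemma curve_dini (F : V -> R) (DF : V -> V) (M : R) (phi dphi : R -> R) (a b C : R) :
  a <= b -> 0 <= M -> (forall p v, `|F v - F p - dot3 (v - p) (DF p)| <= M * dot3 (v - p) (v - p)) ->
  (forall y : R, a <= y -> y <= b -> diff_at phi y (dphi y)) ->
  (forall y m, a <= y -> y <= b -> sp y m -> dot3 (tg y m) (DF (g y)) - dphi y <= C) ->
  (F (g b) - phi b) - (F (g a) - phi a) <= C * (b - a).
Proof.
move=> ab M0 hF hp hC.
apply: (@dini_le _ (fun y => F (g y) - phi y) a b C ab) => x /andP[ax xb] e e0.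
pose D := norm3 (DF (g x)) + 1.
have D0 : 0 < D by have := norm3_ge0 (DF (g x)); rewrite /D; lc; lra.
have e1 : 0 < e / 2 / D by rewrite !divr_gt0.
have [d1 d10 h1] := hp x ax xb _ e1.
have [n [spn _ _ tn _]] := right_frame_exists K0 ov x.
have [d2 d20 h2] := tn _ e1.
have [n' [spn' _ _ tn']] := left_frame_exists x.
have [d3 d30 h3] := tn' _ e1.
have M1 : 0 < M + 1 by lc; lra.
have [d4 [d40 d41 d42 d43 d44]] := small4 d10 d20 d30 (divr_gt0 (divr_gt0 e0 (ltr0n _ 2)) M1).
exists d4 => // y /andP[ay yb]; split=> /andP[xy yx].
  have yx0 : 0 < y - x by rewrite subr_gt0.
  have nyx : `|y - x| = y - x by rewrite gtr0_norm.
  have := @diff_first_order phi F (DF (g x)) (tg x n) M (dphi x) (e / 2 / D) x y (g x) (g y) (le_trans (ler_norm _) (hF _ _)) M0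
    (h1 y _) _ (ov_lip K0 ov x y); rewrite nyx.
  move=> /(_ ltac:(move: yx d41; lz; lra)) /(_ (h2 x y (lexx _) (ltW xy) ltac:(move: yx d42; lz; lra))) hh.
  apply: (le_trans hh); rewrite -mulrDl ler_pM2r//.
  have a1 := hC x n ax xb spn.
  have a2 : M * (y - x) <= e / 2.
    have : (y - x) * (M + 1) <= e / 2 by rewrite -ler_pdivlMr//; move: yx d44; lz; lra.
    by move: yx0; lz; lra.
  have a3 : e / 2 / D * D = e / 2 by rewrite divfK// lt0r_neq0.
  by rewrite -/D a3; move: a1 a2; lz; lra.
have yx0 : 0 < x - y by rewrite subr_gt0.
have nyx : `|y - x| = x - y by rewrite distrC gtr0_norm.
have hN : - F (g y) - - F (g x) - dot3 (g y - g x) (- DF (g x)) <= M * dot3 (g y - g x) (g y - g x).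
  by apply: le_trans (hF (g x) (g y)); rewrite dotNr -normrN; apply: le_trans (ler_norm _); lz; lra.
have := @diff_first_order (fun y => - phi y) (fun p => - F p) (- DF (g x)) (tg x n') M (- dphi x) (e / 2 / D) x y (g x) (g y) hN M0
   _ _ (ov_lip K0 ov x y); rewrite nyx.
have a0 : `|- phi y - - phi x - - dphi x * (y - x)| <= e / 2 / D * (x - y).
  have := h1 y; rewrite -nyx => /(_ ltac:(rewrite nyx; move: xy d41; lz; lra)).
  by rewrite -normrN; congr (`|_| <= _); ring.
have a1 : norm3 (g y - g x - (y - x) *: tg x n') <= e / 2 / D * (x - y).
  have := h3 y x ltac:(move: xy d43; lz; lra) (ltW yx) (lexx _).
  by rewrite -norm3N; congr (norm3 _ <= _); apply: vec3P; rewrite !vE; ring.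
move=> /(_ a0 a1) hh; rewrite norm3N dotNr -/D in hh.
have a3 : e / 2 / D * D = e / 2 by rewrite divfK// lt0r_neq0.
have a4 : M * (x - y) <= e / 2.
  have : (x - y) * (M + 1) <= e / 2 by rewrite -ler_pdivlMr//; move: xy d44; lz; lra.
  by move: yx0; lz; lra.
have a5 := hC x n' ax xb spn'.
have : F (g x) - phi x - (F (g y) - phi y) <=
    (dot3 (tg x n') (DF (g x)) - dphi x + (e / 2 + M * (x - y))) * (x - y).
  by move: hh; rewrite a3; lz; lra.
move=> h; apply: (le_trans h); rewrite ler_pM2r//.
by move: a4 a5; lz; lra.
Qed.
End LeftFrame.

(** * Expansions at a smooth point *)

Section Expansion.
Variables (R : realType) (K : R) (g : R -> vec3 R) (L : R) (o : vec3 R) (del s r : R).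
Hypotheses (K0 : 0 <= K) (ov : oval K g L o del s r).
Local Notation V := (vec3 R).
Local Notation q := (Num.sqrt K).
Local Notation N := (nK K).
Local Notation sp := (supp K g o del).
Local Notation tg x n := (frameT s (N (g x)) n).
Variables (t0 k : R) (n : V).
Hypothesis (sm : smooth_at K g o del s t0 n k).
Local Notation T := (tg t0 n).
(** The acceleration of [g] in the ambient space: the geodesic curvature vector plus the normal
    curvature vector of S_K. *)
Definition accel : V := k *: n + q *: N (g t0).
Local Notation w := accel.

Lemma accel_sq : dot3 w w = k ^+ 2 + K.
Proof.
have [[nn Nn _ _] _ _] := sm; rewrite /accel !(dotDl, dotDr, dotZl, dotZr) nn (ov_NN ov) (dotC n) Nn.
by rewrite !mulr0 addr0 add0r !mulr1 sqK// expr2.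
Qed.

Lemma accelT : dot3 T w = 0.
Proof.
have [[nn Nn _ _] _ _] := sm.
by rewrite /accel dotDr !dotZr (frameTn _ _ _) (frameTm _ _ _) !mulr0 addr0.
Qed.

Lemma TT1 : dot3 T T = 1.
Proof. by have [[nn Nn _ _] _ _] := sm; exact: (frameTT (ov_s ov) (ov_NN ov t0) nn Nn). Qed.

Lemma norm_s : `|s| = 1.
Proof.
have : `|s| ^+ 2 = 1 by rewrite real_normK ?num_real// expr2 (ov_s ov).
by move/eqP; rewrite sqrf_eq1 => /orP[/eqP//|/eqP h0]; have := normr_ge0 s; lra.
Qed.

(** The product rule for [s *: cross (N (g y)) m], from [N' = - q T] and [n' = - k T]. *)
Lemma smooth_tangent (e : R) : 0 < e -> exists2 dl : R, 0 < dl &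
  forall y m, `|y - t0| < dl -> sp y m -> norm3 (tg y m - T - (y - t0) *: w) <= e * `|y - t0|.
Proof.
move=> e0; have [[nn Nn _ _] k0 hs] := sm; have q0 := sqrtr_ge0 K.
have C0 : 0 < 2 * q + 1 by lra.
have [d1 d10 [h1 h2]] := hs _ (divr_gt0 e0 C0).
exists (Num.min d1 1); first by rewrite lt_min d10 ltr01.
move=> y m; rewrite lt_min => /andP[y1 y2] spm.
have [mm Nm _ _] := spm.
pose e1 := e / (2 * q + 1); pose h := y - t0; rewrite -/e1 in h1 h2.
have e10 : 0 < e1 by rewrite divr_gt0.
pose E1 : V := m - n + (k * h) *: T.
pose E2 : V := - q *: (g y - g t0 - h *: T).
have E1n : norm3 E1 <= e1 * `|h| by exact: h1.
have E2n : norm3 E2 <= q * (e1 * `|h|).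
  rewrite norm3Z normrN (ger0_norm q0) ler_wpM2l// /h.
  have [ty|ty] := leP t0 y.
    rewrite [X in _ * X]ger0_norm ?subr_ge0//; apply: h2 => //; [(lc; lra)|].
    by move: y1; rewrite ger0_norm ?subr_ge0//; lc; lra.
  rewrite [X in _ * X]ltr0_norm ?subr_lt0// -norm3N.
  have := h2 y t0 _ (ltW ty) ltac:((lc; lra)); rewrite (opprB y t0).
  have -> : - (g y - g t0 - (y - t0) *: T) = g t0 - g y - (t0 - y) *: T.
    by apply: vec3P; rewrite !vE; ring.
  by apply; move: y1; rewrite ltr0_norm ?subr_lt0//; lc; lra.
have NE : N (g y) = N (g t0) - (q * h) *: T + E2.
  by rewrite /E2 !nKE; apply: vec3P; rewrite !vE; ring.
have mE : m = n - (k * h) *: T + E1 by rewrite /E1; apply: vec3P; rewrite !vE; ring.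
have i1 : s *: cross (N (g t0)) T = - n.
  rewrite frameTE; apply/eqP; rewrite -subr_eq0 opprK; apply/eqP.
  have -> : s *: cross (N (g t0)) (s *: cross (N (g t0)) n) + n =
    (s * s * dot3 (N (g t0)) n) *: N (g t0) + (1 - s * s * dot3 (N (g t0)) (N (g t0))) *: n.
    by apply: vec3P; rewrite !vE; ring.
  by rewrite Nn (ov_s ov) (ov_NN ov) !mul1r subrr !scale0r addr0.
have i2 : s *: cross T n = - N (g t0).
  rewrite frameTE; apply/eqP; rewrite -subr_eq0 opprK; apply/eqP.
  have -> : s *: cross (s *: cross (N (g t0)) n) n + N (g t0) =
    (s * s * dot3 (N (g t0)) n) *: n + (1 - s * s * dot3 n n) *: N (g t0).
    by apply: vec3P; rewrite !vE; ring.
  by rewrite Nn nn (ov_s ov) !mul1r subrr !scale0r addr0.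
have -> : tg y m - T - h *: w =
   s *: (cross (N (g t0)) E1 - (q * h) *: cross T E1 + cross E2 m).
  have -> : tg y m = T - (k * h) *: (s *: cross (N (g t0)) T) - (q * h) *: (s *: cross T n)
      + s *: (cross (N (g t0)) E1 - (q * h) *: cross T E1 + cross E2 m).
    have TE : T = s *: cross (N (g t0)) n by rewrite frameTE.
    rewrite (frameTE _ (N (g y))) {1}TE.
    have -> : cross (N (g y)) m =
        cross (N (g t0) - (q * h) *: T) (n - (k * h) *: T + E1) + cross E2 m.
      rewrite -mE {1}NE; generalize (N (g t0)) T E2 => A B C.
      by apply: vec3P; rewrite !vE; ring.
    by clearbody E1 E2; generalize T => A; apply: vec3P; rewrite !vE; ring.
  rewrite i1 i2 /accel; generalize (s *: (cross (N (g t0)) E1 - (q * h) *: cross T E1 + cross E2 m)) T => A B; apply: vec3P; rewrite !vE; ring.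
rewrite norm3Z norm_s mul1r.
have T1 := norm3_unit TT1.
have b1 : norm3 (cross (N (g t0)) E1) <= e1 * `|h|.
  by apply: (le_trans (norm3_cross _ _)); rewrite (norm3_unit (ov_NN ov t0)) mul1r.
have b2 : norm3 ((q * h) *: cross T E1) <= q * (e1 * `|h|).
  rewrite norm3Z normrM (ger0_norm q0) -mulrA ler_wpM2l//.
  apply: (@le_trans _ _ (1 * (e1 * `|h|))); last by rewrite mul1r.
  apply: ler_pM => //; rewrite ?norm3_ge0//; first exact: ltW.
  by apply: (le_trans (norm3_cross _ _)); rewrite T1 mul1r.
have b3 : norm3 (cross E2 m) <= q * (e1 * `|h|).
  by apply: (le_trans (norm3_cross _ _)); rewrite (norm3_unit mm) mulr1.
apply: (le_trans (norm3D _ _)).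
have := norm3B (cross (N (g t0)) E1) ((q * h) *: cross T E1) => b4.
have -> : e * `|h| = (1 + 2 * q) * (e1 * `|h|) by rewrite /e1; field; rewrite lt0r_neq0.
by move: b1 b2 b3 b4; lz; lra.
Qed.

(** The error vector [E] is its own test vector: integrating [smooth_tangent] against it bounds
    [norm3 E ^+ 2] by [norm3 E] times the desired bound. *)
Lemma position_expansion (e : R) : 0 < e -> exists2 dl : R, 0 < dl & forall y : R, `|y - t0| < dl ->
  norm3 (g y - g t0 - (y - t0) *: T - ((y - t0) ^+ 2 / 2) *: w) <= e * (y - t0) ^+ 2.
Proof.
move=> e0; have [dl dl0 hd] := smooth_tangent e0; exists dl => // y yd.
set E := (X in norm3 X).
have dphi (u : V) (z : R) : diff_at (fun z => (z - t0) * dot3 T u + (z - t0) ^+ 2 / 2 * dot3 w u) z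
    (dot3 T u + (z - t0) * dot3 w u).
  apply: derive_diff_at; apply: is_derive_eq; rewrite !scaler0 ?scaler1 /GRing.scale /=; by field.
have hF (u p v : V) : `|dot3 v u - dot3 p u - dot3 (v - p) u| <= 0 * dot3 (v - p) (v - p).
  by rewrite mul0r dotDl dotNl subrr normr0.
have key (a b : R) (u : V) : a <= b -> t0 - dl < a -> b < t0 + dl -> `|a - t0| <= `|y - t0| -> `|b - t0| <= `|y - t0| ->
    dot3 (g b) u - ((b - t0) * dot3 T u + (b - t0) ^+ 2 / 2 * dot3 w u) -
    (dot3 (g a) u - ((a - t0) * dot3 T u + (a - t0) ^+ 2 / 2 * dot3 w u))
    <= e * `|y - t0| * norm3 u * (b - a).
  move=> ab a1 b1 a2 b2.
  apply: (@curve_dini _ _ _ _ _ _ _ _ K0 ov (fun p => dot3 p u) (fun=> u) 0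
    (fun z => (z - t0) * dot3 T u + (z - t0) ^+ 2 / 2 * dot3 w u)
    (fun z => dot3 T u + (z - t0) * dot3 w u)) => //.
  move=> z m az zb spm.
  have zy : `|z - t0| <= `|y - t0|.
    rewrite ler_norml; move: a2 b2; rewrite !ler_norml => /andP[? ?] /andP[? ?]; apply/andP; split; lra.
  have zd : `|z - t0| < dl by rewrite ltr_norml; apply/andP; split; move: a1 az b1 zb; lc; lra.
  have h := hd z m zd spm.
  have -> : dot3 (tg z m) u - (dot3 T u + (z - t0) * dot3 w u) = dot3 (tg z m - T - (z - t0) *: w) u.
    by rewrite !(dotDl, dotNl, dotZl); ring.
  apply: (le_trans (dot_le _ _)); rewrite ler_wpM2r ?norm3_ge0//.
  by apply: (le_trans h); rewrite ler_pM2l.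
have E2 : dot3 E E <= e * (y - t0) ^+ 2 * norm3 E.
  have EE (u : V) : dot3 E u = dot3 (g y) u - ((y - t0) * dot3 T u + (y - t0) ^+ 2 / 2 * dot3 w u) - dot3 (g t0) u.
    by rewrite /E !(dotDl, dotNl, dotZl); ring.
  have z0 : `|t0 - t0| <= `|y - t0| by rewrite subrr normr0.
  move: yd; rewrite ltr_norml => /andP[y1 y2].
  have [ty|ty] := leP t0 y.
    have := key t0 y E ty ltac:((lc; lra)) ltac:((move: y2; lc; lra)) z0 (lexx _).
    rewrite EE ger0_norm ?subr_ge0// subrr expr0n /= !mul0r addr0 subr0 expr2.
    by move=> h; apply: (le_trans h); rewrite le_eqVlt; apply/orP; left; apply/eqP; ring.
  have := key y t0 (- E) (ltW ty) ltac:((move: y1; lc; lra)) ltac:((lc; lra)) (lexx _) z0.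
  rewrite EE ltr0_norm ?subr_lt0// subrr expr0n /= !mul0r addr0 subr0 norm3N !dotNr expr2.
  have -> : e * - (y - t0) * norm3 E * (t0 - y) = e * ((y - t0) * (y - t0)) * norm3 E by ring.
  by move=> h; apply: le_trans h; rewrite le_eqVlt; apply/orP; left; apply/eqP; ring.
have [->|En] := eqVneq E 0; first by rewrite norm3_0 mulr_ge0 ?sqr_ge0// ltW.
have En0 : 0 < norm3 E by rewrite norm3_gt0.
by rewrite -(ler_pM2r En0) -expr2 norm3_sq.
Qed.

(** First order information suffices for a second order statement, because [2 - 2 * dot3 Tx Ty] is
    the square of [Tx - Ty]. *)
Lemma tangent_product (e : R) : 0 < e -> exists2 dl : R, 0 < dl & forall (a b x y : R) (m m' : V),
  a <= t0 -> t0 <= b -> b - a < dl -> a <= x -> x <= b -> a <= y -> y <= b -> sp x m -> sp y m' ->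
  `|dot3 (tg x m) (tg y m') - (1 - (k ^+ 2 + K) * (x - y) ^+ 2 / 2)| <= e * (b - a) ^+ 2.
Proof.
move=> e0; have w0 := norm3_ge0 w.
have C0 : 0 < 2 * norm3 w + 2 by lra.
have [e1 [e10 e11 e12 _ _]] := small4 ltr01 (divr_gt0 e0 C0) ltr01 ltr01.
have [dl dl0 hd] := smooth_tangent e10; exists dl => // a b x y m m' a0 b0 ab ax xb ay yb sx sy.
have [mm Nm _ _] := sx; have [mm' Nm' _ _] := sy.
pose l := b - a; have l0 : 0 <= l by rewrite /l; move: ax xb; lc; lra.
have xd : `|x - t0| <= l by rewrite ler_norml /l; apply/andP; split; move: a0 ax b0 xb; lz; lra.
have yd : `|y - t0| <= l by rewrite ler_norml /l; apply/andP; split; move: a0 ay b0 yb; lz; lra.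
have xyl : `|x - y| <= l by rewrite ler_norml /l; apply/andP; split; move: ax ay xb yb; lz; lra.
have h1 := hd x m (le_lt_trans xd ab) sx; have h2 := hd y m' (le_lt_trans yd ab) sy.
have TTx : dot3 (tg x m) (tg x m) = 1 by exact: (frameTT (ov_s ov) (ov_NN ov x) mm Nm).
have TTy : dot3 (tg y m') (tg y m') = 1 by exact: (frameTT (ov_s ov) (ov_NN ov y) mm' Nm').
pose Er : V := (tg x m - T - (x - t0) *: w) - (tg y m' - T - (y - t0) *: w).
have DE : tg x m - tg y m' = (x - y) *: w + Er.
  rewrite /Er; move: (tg x m) (tg y m') T w => A B C D; apply: vec3P; rewrite !vE; ring.
have En : norm3 Er <= 2 * e1 * l.
  apply: (le_trans (norm3B _ _)).
  have a1 := ler_wpM2l (ltW e10) xd; have a2 := ler_wpM2l (ltW e10) yd.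
  by move: h1 h2 a1 a2; lz; lra.
have E0 := norm3_ge0 Er.
have E1 : dot3 (tg x m) (tg y m') - (1 - (k ^+ 2 + K) * (x - y) ^+ 2 / 2) =
   - ((x - y) * dot3 w Er) - norm3 Er ^+ 2 / 2.
  have : dot3 (tg x m - tg y m') (tg x m - tg y m') = 2 - 2 * dot3 (tg x m) (tg y m').
    by rewrite !(dotDl (tg x m)) !(dotDr (tg x m)) !dotNl !dotNr TTx TTy (dotC (tg y m')); ring.
  rewrite DE; clearbody Er.
  have sqD (c : R) (u v : V) : dot3 (c *: u + v) (c *: u + v) = c * c * dot3 u u + 2 * c * dot3 u v + dot3 v v.
    by rewrite !vE; ring.
  rewrite sqD accel_sq norm3_sq => hh.
  have -> : dot3 (tg x m) (tg y m') = 1 - ((x - y) * (x - y) * (k ^+ 2 + K) + 2 * (x - y) * dot3 w Er +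
      dot3 Er Er) / 2 by move: hh; lc; lra.
  by field.
rewrite E1; apply: (le_trans (ler_normB _ _)); rewrite normrN.
have b1 : `|(x - y) * dot3 w Er| <= l * (norm3 w * (2 * e1 * l)).
  rewrite normrM ler_pM//; apply: (le_trans (cauchy _ _)); rewrite ler_wpM2l//.
have b2 : `|norm3 Er ^+ 2 / 2| <= 2 * e1 * l ^+ 2.
  rewrite ger0_norm; last by rewrite divr_ge0// sqr_ge0.
  have : norm3 Er ^+ 2 <= (2 * e1 * l) ^+ 2 by rewrite lerXn2r ?nnegrE ?mulr_ge0// ltW.
  have : e1 ^+ 2 <= e1 by rewrite expr2 ler_piMr// ltW.
  rewrite !exprMn => c1 c2; have := ler_wpM2r (sqr_ge0 l) c1; move: c2; lc; lra.
have b3 : (2 * norm3 w + 2) * e1 <= e by rewrite mulrC -ler_pdivlMr.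
have := ler_wpM2r (sqr_ge0 l) b3.
by move: b1 b2; rewrite -/l !expr2; lc; lra.
Qed.

(** The squared chord is the double integral of [dot3 Tx Ty], so [tangent_product] yields its term
    of order 4. The factor [1 / 12] is the integral of [(x - y) ^+ 2 / 2] over the unit square. *)
Lemma chord_expansion (e : R) : 0 < e -> exists2 dl : R, 0 < dl & forall a b : R,
  a <= t0 -> t0 <= b -> b - a < dl ->
  `|dot3 (g b - g a) (g b - g a) - ((b - a) ^+ 2 - (k ^+ 2 + K) * (b - a) ^+ 4 / 12)| <= e * (b - a) ^+ 4.
Proof.
move=> e0; have e20 : 0 < e / 2 by lra.
have [dl dl0 hd] := tangent_product e20; exists dl => // a b at0 t0b ab.
set rho := k ^+ 2 + K in hd *.
pose l := b - a; have l0 : 0 <= l by rewrite /l; lra.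
have hF (u p v : V) : `|dot3 v u - dot3 p u - dot3 (v - p) u| <= 0 * dot3 (v - p) (v - p).
  by rewrite mul0r dotDl dotNl subrr normr0.
have B (y : R) m : a <= y -> y <= b -> sp y m ->
    `|dot3 (g y - g a) (tg y m) - ((y - a) - rho * (y - a) ^+ 3 / 6)| <= e / 2 * l ^+ 2 * (y - a).
  move=> ay yb spy.
  have df (sg z : R) : diff_at (fun z => sg * (z + rho * (y - z) ^+ 3 / 6)) z (sg * (1 - rho * (y - z) ^+ 2 / 2)).
    apply: derive_diff_at; apply: is_derive_eq; rewrite !scaler0 ?scaler1 /GRing.scale /=; by field.
  have kk (sg : R) : `|sg| = 1 -> dot3 (g y) (sg *: tg y m) - sg * (y + rho * (y - y) ^+ 3 / 6)
     - (dot3 (g a) (sg *: tg y m) - sg * (a + rho * (y - a) ^+ 3 / 6)) <= e / 2 * l ^+ 2 * (y - a).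
    move=> sg1.
    apply: (@curve_dini _ _ _ _ _ _ _ _ K0 ov (fun p => dot3 p (sg *: tg y m)) (fun=> sg *: tg y m) 0
      (fun z => sg * (z + rho * (y - z) ^+ 3 / 6)) (fun z => sg * (1 - rho * (y - z) ^+ 2 / 2))) => //.
    move=> z m' az zy spz; rewrite dotZr -mulrBr.
    apply: (le_trans (ler_norm _)); rewrite normrM sg1 mul1r.
    have := hd a b z y m' m at0 t0b ab az (le_trans zy yb) ay yb spz spy.
    by rewrite -[(z - y) ^+ 2]sqrrN (opprB z y).
  have k1 := kk 1 (normr1 _); have k2 := kk (- 1) ltac:(by rewrite normrN normr1).
  rewrite !scale1r !scaleN1r !dotNr subrr expr0n /= in k1 k2.
  rewrite dotDl dotNl ler_norml; apply/andP; split; move: k1 k2; lz; lra.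
pose F := fun p : V => dot3 (p - g a) (p - g a).
have hF2 (sg : R) : `|sg| = 1 -> forall p v : V, `|sg * F v - sg * F p - dot3 (v - p) ((sg * 2) *: (p - g a))| <= 1 * dot3 (v - p) (v - p).
  move=> sg1 p v; have -> : sg * F v - sg * F p - dot3 (v - p) ((sg * 2) *: (p - g a)) = sg * dot3 (v - p) (v - p).
    by rewrite /F !vE; ring.
  by rewrite normrM sg1 mul1r ger0_norm ?dot_ge0// mul1r.
have df (sg z : R) : diff_at (fun z => sg * ((z - a) ^+ 2 - rho * (z - a) ^+ 4 / 12)) z
     (sg * (2 * (z - a) - rho * (z - a) ^+ 3 / 3)).
  apply: derive_diff_at; apply: is_derive_eq; rewrite !scaler0 ?scaler1 /GRing.scale /=; by field.
have fin (sg : R) : `|sg| = 1 -> sg * F (g b) - sg * ((b - a) ^+ 2 - rho * (b - a) ^+ 4 / 12)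
   - (sg * F (g a) - sg * ((a - a) ^+ 2 - rho * (a - a) ^+ 4 / 12)) <= e * l ^+ 3 * (b - a).
  move=> sg1.
  apply: (@curve_dini _ _ _ _ _ _ _ _ K0 ov (fun p => sg * F p) (fun p => (sg * 2) *: (p - g a)) 1
      (fun z => sg * ((z - a) ^+ 2 - rho * (z - a) ^+ 4 / 12))
      (fun z => sg * (2 * (z - a) - rho * (z - a) ^+ 3 / 3))) => //; [(move: at0 t0b; lc; lra)|exact: hF2|].
  move=> z m az zb spz.
  have -> : dot3 (tg z m) ((sg * 2) *: (g z - g a)) - sg * (2 * (z - a) - rho * (z - a) ^+ 3 / 3) =
    sg * (2 * (dot3 (g z - g a) (tg z m) - ((z - a) - rho * (z - a) ^+ 3 / 6))).
    by rewrite dotZr (dotC (tg z m)); field.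
  apply: (le_trans (ler_norm _)); rewrite normrM sg1 mul1r normrM ger0_norm//.
  have b1 := B z m az zb spz.
  have zl : z - a <= l by rewrite /l lerD2r.
  have el : 0 <= e * l ^+ 2 by rewrite mulr_ge0 ?sqr_ge0// ltW.
  have := ler_wpM2l el zl; rewrite [l ^+ 3]exprS; move: b1; lc; lra.
have F0 : F (g a) = 0 by rewrite /F subrr dot0l.
have k1 := fin 1 (normr1 _); have k2 := fin (- 1) ltac:(by rewrite normrN normr1).
rewrite F0 subrr !expr0n /= in k1 k2; rewrite -/l in k1 k2 *.
have e4 : e * l ^+ 3 * l = e * l ^+ 4 by rewrite -mulrA -exprSr.
rewrite e4 in k1 k2; rewrite /F in k1 k2.
rewrite ler_norml; apply/andP; split; move: k1 k2; lz; lra.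
Qed.
End Expansion.

(** * Arcs and circles of constant curvature *)

Section Arcs.
Variable R : realType.
Local Notation V := (vec3 R).

Lemma pi_bounds : 2 <= pi :> R /\ pi < 4 :> R.
Proof. by have /andP[_ h] := @pihalf_02 R; split; [exact: pi_ge2 | lra]. Qed.

(** Taylor bounds decide the case [x < 2]; beyond it the cosine is negative, as [pi / 2 < 2]. *)
Lemma cos_lt_sinc (x : R) : 0 < x -> x <= pi -> x * cos x < sin x.
Proof.
move=> x0 xpi; have [p2 p4] := pi_bounds.
have [x2|x2] := ltP x 2.
  have h1 := sin_ge_taylor (ltW x0); have h2 := cos_le_taylor (ltW x0).
  have := ler_wpM2l (ltW x0) h2.
  have : 0 < x ^+ 3 * (8 - x ^+ 2).
    rewrite mulr_gt0 ?exprn_gt0//.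
    have : x ^+ 2 < 2 ^+ 2 by rewrite ltr_sqr ?nnegrE//; lra.
    lra.
  have -> : x * (1 - x ^+ 2 / 2 + x ^+ 4 / 24) = x - x ^+ 3 / 6 - x ^+ 3 * (8 - x ^+ 2) / 24 by field.
  lra.
have s0 : 0 <= sin x by apply: sin_ge0_pi; rewrite xpi andbT ltW.
have c0 : cos x < 0.
  rewrite -(@cos_pihalf R) ltr_cos ?in_itv /=; apply/andP || idtac; try (apply/andP; split); move: p2 p4 x2 xpi; lc; lra.
by apply: lt_le_trans s0; rewrite pmulr_rlt0.
Qed.

(** [sin x / x] decreases on []0, pi]]: the tangent of sine at [x] stays above it and, by
    [cos_lt_sinc], is less steep than the line through the origin. *)
Lemma sinc_lt (x y : R) : 0 < x -> x < y -> y <= pi -> x * sin y < y * sin x.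
Proof.
move=> x0 xy ypi.
have c0 := cos_lt_sinc x0 (le_trans (ltW xy) ypi).
have := @deriv_ge0_le _ (fun u : R => u * sin x - x * sin u - (sin x - x * cos x) * (u - x))
  (fun u : R => x * cos x - x * cos u) x y (ltW xy).
have h (u : R) : x <= u <= y -> is_derive u 1 (fun u : R => u * sin x - x * sin u - (sin x - x * cos x) * (u - x)) (x * cos x - x * cos u).
  move=> _; apply: is_derive_eq; rewrite !scaler0 ?scaler1 /GRing.scale /=; by ring.
move=> /(_ h) h1.
have : x * sin x - x * sin x - (sin x - x * cos x) * (x - x) <= y * sin x - x * sin y - (sin x - x * cos x) * (y - x).
  apply: h1 => u /andP[xu uy]; rewrite subr_ge0 ler_pM2l//.
  move: xu; rewrite le_eqVlt => /orP[/eqP->//|xu].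
  by rewrite ltW// ltr_cos ?in_itv /=; [|apply/andP; split; (move: xy ypi; lc; lra)|apply/andP; split; (move: uy xu ypi; lc; lra)].
have : 0 < (sin x - x * cos x) * (y - x) by rewrite mulr_gt0 ?subr_gt0.
lra.
Qed.

(** Euclidean chord of an arc of length [l] on a circle of radius [1 / r]. An arc of geodesic
    curvature [k] has [r = Num.sqrt (k ^+ 2 + K)]. *)
Definition carc (r l : R) : R := 2 / r * sin (r * l / 2).

Lemma carcE (r l : R) : carc r l = 2 * sin (r * l / 2) / r.
Proof. by rewrite /carc mulrAC. Qed.

Lemma carc_half (r l : R) : 0 < r -> 0 < l -> r * l <= 2 * pi -> 0 < r * l / 2 <= pi.
Proof. by move=> r0 l0 h; have := mulr_gt0 r0 l0; lra. Qed.

Lemma carc_ge0 (r l : R) : 0 < r -> 0 < l -> r * l <= 2 * pi -> 0 <= carc r l.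
Proof.
move=> r0 l0 h; have /andP[h1 h2] := carc_half r0 l0 h.
apply: mulr_ge0; first by rewrite divr_ge0// ltW.
by apply: sin_ge0_pi; rewrite h2 andbT ltW.
Qed.

Lemma carc_decr (r1 r2 l : R) : 0 < l -> 0 < r1 -> r1 < r2 -> r2 * l <= 2 * pi ->
  carc r2 l < carc r1 l.
Proof.
move=> l0 r10 r12 h.
have r20 : 0 < r2 by lra.
have h1 : 0 < r1 * l / 2 by have := mulr_gt0 r10 l0; lra.
have h2 : r1 * l / 2 < r2 * l / 2 by have := ltr_pM2r l0 r1 r2; rewrite r12; lra.
have h3 : r2 * l / 2 <= pi by lra.
have := sinc_lt h1 h2 h3.
have l2 : 0 < l / 2 by lra.
have -> : r1 * l / 2 * sin (r2 * l / 2) = l / 2 * (r1 * sin (r2 * l / 2)) by ring.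
have -> : r2 * l / 2 * sin (r1 * l / 2) = l / 2 * (r2 * sin (r1 * l / 2)) by ring.
rewrite ltr_pM2l// /carc => hh.
rewrite -subr_gt0.
have -> : 2 / r1 * sin (r1 * l / 2) - 2 / r2 * sin (r2 * l / 2) =
  2 / (r1 * r2) * (r2 * sin (r1 * l / 2) - r1 * sin (r2 * l / 2)) by field; rewrite !lt0r_neq0.
by rewrite mulr_gt0 ?subr_gt0// divr_gt0 ?mulr_gt0.
Qed.

Lemma carc_lt (r l : R) : 0 < r -> 0 < l -> r * l <= 2 * pi -> carc r l < l.
Proof.
move=> r0 l0 h; have /andP[h1 h2] := carc_half r0 l0 h; have [p2 p4] := pi_bounds.
rewrite carcE ltr_pdivrMr//.
set x := r * l / 2 in h1 h2 *.
suff : sin x < x by rewrite /x; lra.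
apply: (le_lt_trans (sin_le_taylor (ltW h1))).
have x2 : x ^+ 2 < 4 ^+ 2 by rewrite ltr_sqr ?nnegrE//; lra.
have x3 : 0 < x ^+ 3 by rewrite exprn_gt0.
have -> : x ^+ 5 = x ^+ 3 * x ^+ 2 by rewrite -exprD.
have := ltr_pM2l x3 (x ^+ 2) (4 ^+ 2); rewrite x2; lra.
Qed.

Lemma carc_sq_ge (r l : R) : 0 < r -> 0 < l -> r * l <= 2 ->
  l ^+ 2 - r ^+ 2 * l ^+ 4 / 12 <= carc r l ^+ 2.
Proof.
move=> r0 l0 rl; have rl0 := mulr_gt0 r0 l0.
pose u := (r * l) ^+ 2.
have u4 : u <= 2 ^+ 2 by rewrite /u ler_sqr ?nnegrE// ltW.
have u0 : 0 <= u := sqr_ge0 _.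
have x0 : 0 <= r * l / 2 by lra.
have h : l * (1 - u / 24) <= carc r l.
  have := sin_ge_taylor x0 => hs.
  rewrite carcE ler_pdivlMr//.
  have -> : l * (1 - u / 24) * r = 2 * (r * l / 2 - (r * l / 2) ^+ 3 / 6) by rewrite /u; field.
  by rewrite ler_pM2l.
have h0 : 0 <= l * (1 - u / 24) by rewrite mulr_ge0 ?ltW//; lra.
have : (l * (1 - u / 24)) ^+ 2 <= carc r l ^+ 2 by rewrite lerXn2r ?nnegrE// (le_trans h0).
apply: le_trans; rewrite -subr_ge0.
have -> : (l * (1 - u / 24)) ^+ 2 - (l ^+ 2 - r ^+ 2 * l ^+ 4 / 12) = (l * u / 24) ^+ 2 by rewrite /u; field.
exact: sqr_ge0.
Qed.

Lemma carc_sq_le (r l : R) : 0 < r -> 0 < l -> r * l <= 1 ->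
  carc r l ^+ 2 <= l ^+ 2 - r ^+ 2 * l ^+ 4 / 12 + r ^+ 4 * l ^+ 6.
Proof.
move=> r0 l0 rl; have rl0 := mulr_gt0 r0 l0; have [p2 _] := pi_bounds.
pose u := (r * l) ^+ 2.
have u1 : u <= 1 ^+ 2 by rewrite /u ler_sqr ?nnegrE// ltW.
have u0 : 0 <= u := sqr_ge0 _.
have x0 : 0 <= r * l / 2 by lra.
have h : carc r l <= l * (1 - u / 24 + u ^+ 2 / 24 / 80).
  have := sin_le_taylor x0 => hs.
  rewrite carcE ler_pdivrMr//.
  have -> : l * (1 - u / 24 + u ^+ 2 / 24 / 80) * r =
    2 * (r * l / 2 - (r * l / 2) ^+ 3 / 6 + (r * l / 2) ^+ 5 / 120) by rewrite /u; field.
  by rewrite ler_pM2l.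
have h0 : 0 <= carc r l by apply: carc_ge0 => //; lra.
have : carc r l ^+ 2 <= (l * (1 - u / 24 + u ^+ 2 / 24 / 80)) ^+ 2.
  by move: h; move: (l * _) => U h; rewrite lerXn2r ?nnegrE// (le_trans h0).
move=> hh; apply: (le_trans hh); rewrite exprMn.
have -> : l ^+ 2 - r ^+ 2 * l ^+ 4 / 12 + r ^+ 4 * l ^+ 6 = l ^+ 2 * (1 - u / 12 + u ^+ 2) by rewrite /u; field.
rewrite ler_wpM2l ?sqr_ge0//.
have u2 : u ^+ 2 <= u by rewrite expr2 ler_piMr//; move: u1; lc; lra.
have u3 : 0 <= u ^+ 2 := sqr_ge0 _.
pose a := u / 24 - u ^+ 2 / 24 / 80.
have a2 : a ^+ 2 <= (u / 24) ^+ 2 by rewrite lerXn2r ?nnegrE /a; move: u2 u3; lz; lra.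
have -> : 1 - u / 24 + u ^+ 2 / 24 / 80 = 1 - a by rewrite /a; ring.
rewrite sqrrB expr_div_n in a2 *; rewrite /a in a2 *; move: a2; lc; lra.
Qed.

Section Solve.
Variables (K l c : R).
Hypotheses (K0 : 0 <= K) (l0 : 0 < l) (c0 : 0 <= c) (qc : Num.sqrt K * c <= 2).
Local Notation q := (Num.sqrt K).

Lemma arc_chordE (k : R) : k ^+ 2 + K != 0 ->
  arc_chord K k l = dist_of_chord K (carc (Num.sqrt (k ^+ 2 + K)) l).
Proof.
move=> h; rewrite /arc_chord (negbTE h) /carc; congr dist_of_chord.
have r0 : Num.sqrt (k ^+ 2 + K) != 0.
  by rewrite sqrtr_eq0 -ltNge lt_neqAle eq_sym h addr_ge0 ?sqr_ge0.
by congr (_ * sin _); field.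
Qed.

Lemma cgc_carc (k : R) : cgc_arc K l (dist_of_chord K c) k -> 0 < k ^+ 2 + K ->
  carc (Num.sqrt (k ^+ 2 + K)) l = c.
Proof.
move=> [k0 kl]; move=> + h; rewrite arc_chordE ?lt0r_neq0// => hh.
have r0 : 0 < Num.sqrt (k ^+ 2 + K) by rewrite sqrtr_gt0.
rewrite mulrC in kl.
have a0 := carc_ge0 r0 l0 kl.
apply: (doc_inj K0) hh => //.
rewrite /carc mulrA -[X in _ <= X]mulr1.
have qr : q <= Num.sqrt (k ^+ 2 + K) by rewrite ler_wsqrtr// lerDr sqr_ge0.
have q0 := sqrtr_ge0 K.
apply: (@le_trans _ _ (q * (2 / Num.sqrt (k ^+ 2 + K)))).
  by rewrite ler_piMr ?sin_le1// mulr_ge0 ?divr_ge0 ?sqrtr_ge0.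
by rewrite mulr1 mulrCA -[X in _ <= X]mulr1 ler_pM2l// ler_pdivrMr// mul1r.
Qed.

Lemma cgc_flat (k : R) : cgc_arc K l (dist_of_chord K c) k -> k ^+ 2 + K = 0 -> c = l.
Proof.
move=> [k0 kl hd] h; move: hd; rewrite /arc_chord h eqxx => ->.
have Kz : K = 0 by move: (sqr_ge0 k) K0; lra.
by rewrite /dist_of_chord Kz eqxx.
Qed.

Lemma cgc_lower (k r : R) : cgc_arc K l (dist_of_chord K c) k -> 0 < r -> r * l <= 2 * pi ->
  c <= carc r l -> r <= Num.sqrt (k ^+ 2 + K).
Proof.
move=> hk r0 rl cr.
have : 0 <= k ^+ 2 + K by rewrite addr_ge0 ?sqr_ge0.
rewrite le_eqVlt => /orP[/eqP/esym h|h].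
  have := cgc_flat hk h; have := carc_lt r0 l0 rl; lra.
rewrite leNgt; apply/negP => kr.
have := @carc_decr _ _ _ l0 _ kr rl; rewrite sqrtr_gt0 h (cgc_carc hk h) => /(_ isT); lra.
Qed.

Lemma cgc_upper (k r : R) : cgc_arc K l (dist_of_chord K c) k -> 0 < r ->
  carc r l <= c -> Num.sqrt (k ^+ 2 + K) <= r.
Proof.
move=> hk r0 cr.
have : 0 <= k ^+ 2 + K by rewrite addr_ge0 ?sqr_ge0.
rewrite le_eqVlt => /orP[/eqP/esym h|h]; first by rewrite h sqrtr0 ltW.
rewrite leNgt; apply/negP => kr.
have [_ kl _] := hk; rewrite mulrC in kl.
have := carc_decr l0 r0 kr kl; rewrite (cgc_carc hk h); lra.
Qed.

(** Intermediate values between [r], where the chord is at least [c], and the full circle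
    [2 * pi / l], whose chord is 0. [K <= r ^+ 2] makes the resulting radius that of a circle in
    S_K. *)
Lemma cgc_exists (r : R) : 0 < r -> K <= r ^+ 2 -> r * l <= 2 * pi -> c <= carc r l ->
  exists k, cgc_arc K l (dist_of_chord K c) k.
Proof.
move=> r0 Kr rl cr; have pi0 := pi_gt0 R.
have rb : r <= 2 * pi / l by rewrite ler_pdivlMr.
have [z] : exists2 z : R, z \in `[r, 2 * pi / l] & 2 * sin (z * (l / 2)) - z * c = 0.
  apply: IVT => //.
    apply: continuous_subspaceT; apply: continuous_subR.
      apply: (@continuous_compR _ (fun z => 2 * sin z) (fun z => z * (l / 2))) => z.
        by apply: cvgM; [exact: cvg_cst | exact: continuous_sin].
      by apply: cvgM; [exact: cvg_id | exact: cvg_cst].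
    by move=> z; apply: cvgM; [exact: cvg_id | exact: cvg_cst].
  have f1 : 0 <= 2 * sin (r * (l / 2)) - r * c.
    move: cr; rewrite carcE ler_pdivlMr// (mulrA r l) => h; rewrite subr_ge0; lra.
  have f2 : 2 * sin (2 * pi / l * (l / 2)) - 2 * pi / l * c <= 0.
    have -> : 2 * pi / l * (l / 2) = pi by field; rewrite lt0r_neq0.
    by rewrite sinpi mulr0 sub0r oppr_le0 mulr_ge0// divr_ge0 ?mulr_ge0// ltW.
  by rewrite ge_min le_max f1 f2 orbT.
rewrite in_itv /= => /andP[rz zb] hz.
have z0 : 0 < z by lra.
have zK : 0 <= z ^+ 2 - K.
  by rewrite subr_ge0 (le_trans Kr)// lerXn2r// nnegrE ltW.
pose k := Num.sqrt (z ^+ 2 - K).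
have kz : k ^+ 2 + K = z ^+ 2 by rewrite sqr_sqrtr// subrK.
have z2 : 0 < z ^+ 2 by rewrite exprn_gt0.
exists k; split; first exact: sqrtr_ge0.
  by rewrite kz sqrtr_sqr gtr0_norm// mulrC -ler_pdivlMr.
rewrite arc_chordE ?kz ?lt0r_neq0// sqrtr_sqr gtr0_norm//; congr dist_of_chord.
rewrite carcE -(mulrA z l); have -> : 2 * sin (z * (l / 2)) = z * c by lra.
by rewrite mulrAC divff ?mul1r// lt0r_neq0.
Qed.
End Solve.
End Arcs.

(** * Circumscribed circles and comparison triangles *)

Section ChiPts.
Variables (R : realType) (K : R).
Hypothesis K0 : 0 <= K.
Local Notation V := (vec3 R).
Local Notation q := (Num.sqrt K).

Lemma circ_inv_sqE (x y z : V) : circ_inv_sq x y z =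
  (2 * (dot3 (y - x) (y - x) * dot3 (z - x) (z - x) + dot3 (z - x) (z - x) * dot3 (z - y) (z - y)
        + dot3 (y - x) (y - x) * dot3 (z - y) (z - y))
   - dot3 (y - x) (y - x) ^+ 2 - dot3 (z - x) (z - x) ^+ 2 - dot3 (z - y) (z - y) ^+ 2)
  / (dot3 (y - x) (y - x) * dot3 (z - x) (z - x) * dot3 (z - y) (z - y)).
Proof.
rewrite /circ_inv_sq; congr (_ / _).
have -> : dot3 (y - x) (z - x) = (dot3 (y - x) (y - x) + dot3 (z - x) (z - x) - dot3 (z - y) (z - y)) / 2.
  by rewrite !vE; field.
by field.
Qed.

Lemma dK_inj_chord (x y x' y' : V) : SK K x -> SK K y -> SK K x' -> SK K y' ->
  dK K x y = dK K x' y' -> dot3 (y - x) (y - x) = dot3 (y' - x') (y' - x').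
Proof.
move=> hx hy hx' hy' h.
have := doc_inj K0 (norm3_ge0 _) (SK_chord_le hx hy) (norm3_ge0 _) (SK_chord_le hx' hy') h.
by rewrite norm3BC (norm3BC x') -!norm3_sq => ->.
Qed.

(** Three points of the curve are their own comparison triangle, so [xget] does not fall back to its
    default. The curvature depends on the chords only, and these are determined by the intrinsic
    distances. *)
Lemma chi_ptsE (g : R -> V) (a b c : R) : (forall t, SK K (g t)) ->
  chi_pts K g a b c = circle_gcurv K (g a) (g b) (g c).
Proof.
move=> gSK; rewrite /chi_pts /chiK.
have hex : comparison_triangle K (dK K (g a) (g b)) (dK K (g b) (g c)) (dK K (g c) (g a)) (g a, g b, g c).
  by split.
have := xgetPex (0, 0, 0) (ex_intro _ _ hex).
case: (xget _ _) => -[x y] z /= [[hx hy hz] [h1 h2 h3]].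
rewrite /circle_gcurv !circ_inv_sqE; congr (Num.sqrt (_ - _)).
rewrite (dK_inj_chord hx hy (gSK a) (gSK b) h1) (dK_inj_chord hy hz (gSK b) (gSK c) h2).
have := dK_inj_chord hz hx (gSK c) (gSK a) h3.
by rewrite -norm3_sq norm3BC norm3_sq -[in RHS]norm3_sq norm3BC norm3_sq => ->.
Qed.

Lemma circ_inv_sq_mid (x y z : V) : circ_inv_sq x y z =
  4 * dot3 (cross (z - y) (x - y)) (cross (z - y) (x - y)) /
  (dot3 (z - y) (z - y) * dot3 (x - y) (x - y) * dot3 (z - x) (z - x)).
Proof.
rewrite /circ_inv_sq; congr (_ / _); rewrite !vE; ring.
Qed.

Lemma sqrt_close (u k e : R) : 0 <= k -> 0 <= e -> `|u - k ^+ 2| <= e ^+ 2 -> `|Num.sqrt u - k| <= e.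
Proof.
move=> k0 e0 h.
have [u0|u0] := leP u 0.
  rewrite ler0_sqrtr// sub0r normrN ger0_norm//.
  rewrite -(ler_pXn2r (_ : 0 < 2)%N) ?nnegrE//.
  by move: h; rewrite ler_norml => /andP[h _]; lra.
have v0 := sqrtr_ge0 u; have vu : Num.sqrt u ^+ 2 = u by rewrite sqr_sqrtr// ltW.
rewrite -(ler_pXn2r (_ : 0 < 2)%N) ?nnegrE//; apply: le_trans h; rewrite -{2}vu.
move: (Num.sqrt u) v0 => v v0.
rewrite subr_sqr normrM expr2 ler_wpM2l// [X in _ <= X]ger0_norm ?addr_ge0//.
by rewrite ler_norml; apply/andP; split; lra.
Qed.

End ChiPts.

(** * The two limit curvatures at a smooth point *)

Section Limits.
Variables (R : realType) (K : R) (g : R -> vec3 R) (L : R) (o : vec3 R) (del s r : R).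
Hypotheses (K0 : 0 <= K) (ov : oval K g L o del s r).
Local Notation V := (vec3 R).
Local Notation q := (Num.sqrt K).
Local Notation N := (nK K).
Local Notation sp := (supp K g o del).
Local Notation tg x n := (frameT s (N (g x)) n).
Variables (t0 k : R) (n : V).
Hypothesis (sm : smooth_at K g o del s t0 n k).
Local Notation T := (tg t0 n).
Local Notation w := (accel K g t0 k n).

Lemma dK_chord (a b : R) : dK K (g a) (g b) = dist_of_chord K (norm3 (g b - g a)).
Proof. by rewrite /dK norm3BC. Qed.

Lemma chord_q (a b : R) : q * norm3 (g b - g a) <= 2.
Proof. exact: (SK_chord_le (ov_SK ov b) (ov_SK ov a)). Qed.

(** For [K > 0] the great circle, [r = q], has a long enough chord: this is [ov_dK] in terms of
    sines. For [K = 0] and [c < l] a circle of small curvature [r1] does, since [carc r1 l] falls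
    short of [l] by at most [r1 ^+ 2 * l ^+ 3 / 24]; [c = l] is a segment. *)
Lemma short_arc_solution (a b : R) : a < b -> q * (b - a) <= pi ->
  exists k', cgc_arc K (b - a) (dK K (g a) (g b)) k'.
Proof.
move=> ab qab; have l0 : 0 < b - a by rewrite subr_gt0.
have c0 := norm3_ge0 (g b - g a); have qc := chord_q a b.
have cl : norm3 (g b - g a) <= b - a.
  by have := ov_lip K0 ov a b; rewrite ger0_norm// ltW.
have dl := ov_dK ov (ltW ab).
move: dl; rewrite dK_chord; set c := norm3 _ in c0 qc cl *; set l := b - a in qab l0 cl * => dl.
have [p2 p4] := pi_bounds R.
have [Kz|Kn] := eqVneq K 0.
  move: cl; rewrite le_eqVlt => /orP[/eqP cl|cl].
    exists 0; split=> //; first by rewrite Kz expr0n /= addr0 sqrtr0 mulr0; lra.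
    by rewrite /arc_chord /dist_of_chord Kz expr0n /= addr0 eqxx cl.
  have l3 : 0 < l ^+ 3 by rewrite exprn_gt0.
  have lc0 : 0 < l - c by lra.
  have [r1 [r10 r11 r12 r13 _]] := small4 ltr01 (divr_gt0 (mulr_gt0 (ltr0n R 24) lc0) l3) (divr_gt0 (ltr0n R 2) l0) ltr01.
  have r1l : r1 * l <= 2 by rewrite -ler_pdivlMr.
  apply: (cgc_exists K0 l0 c0 r10) => //; first by rewrite Kz sqr_ge0.
    by move: p2 r1l; lc; lra.
  have rl0 : 0 <= r1 * l / 2 by have := mulr_gt0 r10 l0; lc; lra.
  rewrite carcE ler_pdivlMr//.
  have hs := sin_ge_taylor rl0.
  have r1s : r1 ^+ 2 <= r1 by rewrite expr2 ler_piMr// ltW.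
  have h1 : r1 ^+ 2 * l ^+ 3 <= 24 * (l - c).
    by apply: (@le_trans _ _ (r1 * l ^+ 3)); [rewrite ler_wpM2r// ltW | rewrite -ler_pdivlMr].
  have h2 := ler_wpM2r (ltW r10) h1.
  have e1 : 2 * (r1 * l / 2 - (r1 * l / 2) ^+ 3 / 6) = r1 * l - r1 ^+ 2 * l ^+ 3 * r1 / 24 by field.
  move: hs h2 e1; lc; lra.
have q0 := q_gt0 K0 Kn.
apply: (cgc_exists K0 l0 c0 q0) => //; first by rewrite sqr_sqrtr.
  by lra.
rewrite carcE ler_pdivlMr//.
have xi : 0 <= q * c / 2 <= 1 by apply/andP; split; [rewrite divr_ge0// mulr_ge0// ltW|lra].
have [a0 a1 a2] := asin_itv xi.
have a3 : asin (q * c / 2) <= q * l / 2.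
  by move: dl; rewrite /dist_of_chord (negbTE Kn) mulrAC ler_pdivrMr//; lc; lra.
have a4 : sin (asin (q * c / 2)) <= sin (q * l / 2).
  move: a3; rewrite le_eqVlt => /orP[/eqP->//|a3].
  rewrite ltW// ltr_sin ?in_itv /=; [by []|apply/andP; split; (move: a1 a0; lz; lra)|apply/andP; split; (move: a1 a3 qab a0; lz; lra)].
rewrite a2 in a4; move: a4; lc; lra.
Qed.

(** The arc is compared with arcs of curvature [k + e / 2] and [k - e / 2]. Their squared chords
    differ from that of curvature [k] by [A * l ^+ 4 / 12], or its analogue below, plus smaller
    terms, and [chord_expansion] is precise enough to see the difference. *)
Lemma kappa_lim : kappa_sigma_lim K g t0 k.
Proof.
move=> e e0; have [spn k0 _] := sm; have pi0 := pi_gt0 R; have q0 := sqrtr_ge0 K.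
have [p2 p4] := pi_bounds R.
pose rp2 := (k + e / 2) ^+ 2 + K; pose rp := Num.sqrt rp2.
have rp20 : 0 < rp2 by rewrite /rp2 ltr_pwDl// exprn_gt0//; lra.
have rp0 : 0 < rp by rewrite sqrtr_gt0.
have rpE : rp ^+ 2 = rp2 by rewrite sqr_sqrtr// ltW.
pose A := k * e + e ^+ 2 / 4.
have A0 : 0 < A by rewrite /A ltr_wpDl ?mulr_ge0 ?divr_gt0 ?exprn_gt0// ltW.
(* The lower comparison needs a positive curvature [k - e / 2]; otherwise the lower bound is trivial
   and [e1] only has to satisfy the upper one. *)
have Bex : exists2 e1 : R, 0 < e1 & e1 <= A / 24 /\ (e / 2 < k -> e1 <= (k * e - e ^+ 2 / 4) / 12).
  have [ek|ek] := ltP (e / 2) k; last by exists (A / 24); rewrite ?divr_gt0.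
  have B0 : 0 < k * e - e ^+ 2 / 4.
    by rewrite expr2; have := ltr_pM2r e0 (e / 2) k; rewrite ek; have := mulr_gt0 e0 e0; lc; lra.
  have [e1 [h1 h2 h3 _ _]] := small4 (divr_gt0 A0 (ltr0n R 24)) (divr_gt0 B0 (ltr0n R 12)) e0 e0.
  by exists e1.
have [e1 e10 [e1A e1B]] := Bex.
have [d1 d10 hc] := chord_expansion K0 ov sm e10.
have rp4 : 0 < rp ^+ 4 by rewrite exprn_gt0.
have q1 : 0 < q + 1 by lc; lra.
have [d [d0 d1' d2 d3 d4]] := small4 d10 (divr_gt0 (divr_gt0 A0 (ltr0n R 24)) rp4) ltr01 (divr_gt0 ltr01 (addr_gt0 rp0 q1)).
exists d; split=> // a b at0 t0b ab0 abd.
set l := b - a in ab0 abd *.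
have ab : a < b by rewrite -subr_gt0.
have rql : (rp + (q + 1)) * l < 1.
  rewrite mulrC -ltr_pdivlMr; last exact: addr_gt0.
  exact: lt_le_trans abd d4.
have rpl0 := mulr_gt0 rp0 ab0; have ql0 := mulr_ge0 q0 (ltW ab0).
have rpl : rp * l <= 1 by move: rql; rewrite !mulrDl; move: ql0; lz; lra.
have ql : q * l <= pi by move: rql; rewrite !mulrDl; move: p2 rpl0; lz; lra.
have hex := short_arc_solution ab ql.
have := xgetPex 0 hex; rewrite -/(kappaK K (b - a) (dK K (g a) (g b))) -/(kappa_arc K g a b).
set k' := kappa_arc _ _ _ _; rewrite dK_chord -/l => hk'.
have c0 := norm3_ge0 (g b - g a); have qc := chord_q a b.
have hch := hc a b at0 t0b (lt_le_trans abd d1'); rewrite -norm3_sq -/l in hch.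
set c := norm3 (g b - g a) in hk' c0 qc hch.
have [k0' _ _] := hk'.
have l4 : 0 < l ^+ 4 by rewrite exprn_gt0.
move: hch; rewrite ler_norml => /andP[hc1 hc2].
have up : k' <= k + e / 2.
  have cu : carc rp l <= c.
    rewrite -(ler_pXn2r (_ : 0 < 2)%N) ?nnegrE//; last by apply: carc_ge0 => //; move: p2 rql ql0; lz; lra.
    apply: (le_trans (carc_sq_le rp0 ab0 rpl)).
    have h1 : rp ^+ 4 * l ^+ 6 <= A / 24 * l ^+ 4.
      have -> : rp ^+ 4 * l ^+ 6 = rp ^+ 4 * l ^+ 2 * l ^+ 4 by rewrite -mulrA -exprD.
      rewrite ler_pM2r//.
      have : l * rp ^+ 4 <= A / 24 by rewrite -ler_pdivlMr//; exact/ltW/(lt_le_trans abd).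
      apply: le_trans; rewrite mulrC ler_pM2r// expr2 ler_piMr// ltW//.
      exact: lt_le_trans abd d3.
    have h2 := ler_wpM2r (ltW l4) e1A.
    have h3 : rp ^+ 2 * l ^+ 4 = (k ^+ 2 + K) * l ^+ 4 + A * l ^+ 4.
      by rewrite rpE /rp2 /A; field.
    by rewrite h3; move: h1 h2 hc1; lz; lra.
  have := cgc_upper K0 ab0 c0 qc hk' rp0 cu.
  rewrite /rp ler_sqrt; last exact: ltW.
  rewrite lerD2r => h; rewrite -(ler_pXn2r (_ : 0 < 2)%N) ?nnegrE//; lz; lra.
have lo : k - e / 2 <= k'.
  have [ek|ek] := ltP (e / 2) k; last by move: ek; lz; lra.
  pose rm2 := (k - e / 2) ^+ 2 + K; pose rm := Num.sqrt rm2.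
  have rm20 : 0 < rm2 by rewrite /rm2 ltr_pwDl// exprn_gt0//; move: ek; lz; lra.
  have rm0 : 0 < rm by rewrite sqrtr_gt0.
  have rmE : rm ^+ 2 = rm2 by rewrite sqr_sqrtr// ltW.
  have rmp : rm <= rp.
    rewrite ler_wsqrtr// lerD2r lerXn2r ?nnegrE//; move: ek k0 e0; lz; lra.
  have rml : rm * l <= 1 by apply: le_trans rpl; rewrite ler_pM2r.
  have cl : c <= carc rm l.
    rewrite -(ler_pXn2r (_ : 0 < 2)%N) ?nnegrE//; last by apply: carc_ge0 => //; move: p2 rml; lz; lra.
    apply: le_trans (carc_sq_ge rm0 ab0 _); last by move: rml; lz; lra.
    have h2 := ler_wpM2r (ltW l4) (e1B ek).
    have h3 : rm ^+ 2 * l ^+ 4 = (k ^+ 2 + K) * l ^+ 4 - (k * e - e ^+ 2 / 4) * l ^+ 4.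
      by rewrite rmE /rm2; field.
    by rewrite h3; move: h2 hc2; lz; lra.
  have rml' : rm * l <= 2 * pi by move: p2 rml; lz; lra.
  have := cgc_lower K0 ab0 c0 qc hk' rm0 rml' cl.
  rewrite /rm ler_sqrt; last by rewrite addr_ge0 ?sqr_ge0.
  rewrite lerD2r => h; rewrite -(ler_pXn2r (_ : 0 < 2)%N) ?nnegrE//; move: ek; lz; lra.
by rewrite ltr_norml; apply/andP; split; move: up lo; lz; lra.
Qed.

(** With [P] and [M] the chords from [g t0], the inverse circumradius is [2 * norm3 (cross P M)]
    over the product of the sides. Numerator and denominator both have the leading factor
    [D0 = a * b * (a + b)], and all errors are multiples of [e1 * D0], so the estimate is uniform in
    [a / b]; the quotient tends to [norm3 w]. *)
Lemma chi_bounds (a b e1 C : R) : C = 16 + 12 * norm3 w -> 0 < a -> a <= 1 -> 0 < b -> b <= 1 -> 0 < e1 -> e1 <= 1 / 8 ->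
  norm3 (g (t0 + b) - g t0 - b *: T - (b ^+ 2 / 2) *: w) <= e1 * b ^+ 2 ->
  norm3 (g (t0 - a) - g t0 + a *: T - (a ^+ 2 / 2) *: w) <= e1 * a ^+ 2 ->
  `|circ_inv_sq (g (t0 - a)) (g t0) (g (t0 + b)) - (k ^+ 2 + K)| <= e1 * C * (2 * norm3 w + C).
Proof.
move=> CE a0 a1 b0 b1 e10 e18 hP hM.
pose P : V := g (t0 + b) - g t0; pose M : V := g (t0 - a) - g t0.
pose eb : V := P - b *: T - (b ^+ 2 / 2) *: w; pose ea : V := M + a *: T - (a ^+ 2 / 2) *: w.
rewrite -/P -/eb in hP; rewrite -/M -/ea in hM.
have TT := TT1 ov sm; have Tw := accelT sm; have ww := accel_sq K0 ov sm.
have w0 := norm3_ge0 w; set rho := norm3 w in CE w0 *.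
have T1 := norm3_unit TT.
have Pb : norm3 P <= b by have := ov_lip K0 ov t0 (t0 + b); rewrite addrAC subrr add0r gtr0_norm.
have Ma : norm3 M <= a by have := ov_lip K0 ov t0 (t0 - a); rewrite addrAC subrr add0r normrN gtr0_norm.
have PM : norm3 (P - M) <= a + b.
  by apply: (le_trans (norm3B _ _)); move: Pb Ma; lc; lra.
have PE : P = b *: T + (b ^+ 2 / 2) *: w + eb.
  by rewrite /eb; generalize P T w => A B D; apply: vec3P; rewrite !vE; ring.
have ME : M = - a *: T + (a ^+ 2 / 2) *: w + ea.
  by rewrite /ea; generalize M T w => A B D; apply: vec3P; rewrite !vE; ring.
have PT : b * (1 - e1) <= dot3 P T.
  have -> : dot3 P T = b + dot3 eb T by rewrite PE !(dotDl (_ + _)) (dotDl (b *: T)) !dotZl TT (dotC w) Tw; ring.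
  have := dot_ge eb T; rewrite T1 mulr1.
  have : e1 * b ^+ 2 <= e1 * b by rewrite ler_pM2l// expr2 ler_piMr// ltW.
  by move: hP; lc; lra.
have MT : a * (1 - e1) <= - dot3 M T.
  have -> : dot3 M T = - a + dot3 ea T by rewrite ME !(dotDl (_ + _)) (dotDl (- a *: T)) !dotZl TT (dotC w) Tw; ring.
  have := dot_le ea T; rewrite T1 mulr1.
  have : e1 * a ^+ 2 <= e1 * a by rewrite ler_pM2l// expr2 ler_piMr// ltW.
  by move: hM; lc; lra.
have nle (u : V) : dot3 u T <= norm3 u by have := dot_le u T; rewrite T1 mulr1.
have P1 : b * (1 - e1) <= norm3 P by exact: le_trans (nle P).
have M1 : a * (1 - e1) <= norm3 M.
  by apply: (le_trans MT); rewrite -norm3N -dotNl nle.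
have PM1 : (a + b) * (1 - e1) <= norm3 (P - M).
  by apply: le_trans (nle _); rewrite dotDl dotNl; move: PT MT; lc; lra.
pose D0 := a * b * (a + b).
have D00 : 0 < D0 by rewrite !mulr_gt0 ?addr_gt0.
pose S := norm3 P * norm3 M * norm3 (P - M).
have e19 : 0 < 1 - e1 by move: e18; lc; lra.
have S1 : D0 * (1 - e1) ^+ 3 <= S.
  have -> : D0 * (1 - e1) ^+ 3 = b * (1 - e1) * (a * (1 - e1)) * ((a + b) * (1 - e1)) by rewrite /D0; ring.
  have pb := mulr_ge0 (ltW b0) (ltW e19); have pa := mulr_ge0 (ltW a0) (ltW e19).
  have pab := mulr_ge0 (addr_ge0 (ltW a0) (ltW b0)) (ltW e19).
  apply: (ler_pM (mulr_ge0 pb pa) pab _ PM1); exact: (ler_pM pb pa P1 M1).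
have S2 : S <= D0.
  rewrite /S /D0 (mulrC a b); apply: ler_pM; rewrite ?mulr_ge0 ?norm3_ge0//.
  by apply: ler_pM; rewrite ?norm3_ge0.
pose X : V := cross P M - (D0 / 2) *: cross T w.
have ab2 : a * b <= a + b.
  by have : a * b <= a * 1 by [rewrite ler_pM2l]; lc; lra.
have Xn : norm3 X <= (2 + rho / 2) * e1 * D0.
  have -> : X = b *: cross T ea + (b ^+ 2 / 2) *: cross w ea + cross eb M.
    have -> : X = cross (b *: T + (b ^+ 2 / 2) *: w) (- a *: T + (a ^+ 2 / 2) *: w + ea) + cross eb M - (D0 / 2) *: cross T w.
      rewrite -ME /X {1}PE; generalize eb M T w => A B D E; congr (_ - _); apply: vec3P; rewrite !vE; ring.
    by rewrite /D0; generalize eb ea M T w => A A' B D E; apply: vec3P; rewrite !vE; field.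
  have c1 : norm3 (b *: cross T ea) <= e1 * D0.
    rewrite norm3Z (gtr0_norm b0); apply: (@le_trans _ _ (b * (e1 * a ^+ 2))).
      by rewrite ler_pM2l//; apply: (le_trans (norm3_cross _ _)); rewrite T1 mul1r.
    rewrite /D0 expr2; have := mulr_ge0 (mulr_ge0 (ltW e10) (ltW a0)) (mulr_ge0 (ltW b0) (ltW b0)); lc; lra.
  have c2 : norm3 ((b ^+ 2 / 2) *: cross w ea) <= rho / 2 * e1 * D0.
    rewrite norm3Z ger0_norm ?divr_ge0 ?sqr_ge0//; apply: (@le_trans _ _ (b ^+ 2 / 2 * (rho * (e1 * a ^+ 2)))).
      rewrite ler_wpM2l ?divr_ge0 ?sqr_ge0//; apply: (le_trans (norm3_cross _ _)).
      by rewrite ler_wpM2l.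
    have -> : b ^+ 2 / 2 * (rho * (e1 * a ^+ 2)) = rho / 2 * e1 * (a * b) * (a * b) by field.
    have -> : rho / 2 * e1 * D0 = rho / 2 * e1 * (a * b) * (a + b) by rewrite /D0; field.
    by rewrite ler_wpM2l// !mulr_ge0// ltW.
  have c3 : norm3 (cross eb M) <= e1 * D0.
    apply: (le_trans (norm3_cross _ _)); apply: (@le_trans _ _ (e1 * b ^+ 2 * a)).
      by apply: ler_pM; rewrite ?norm3_ge0.
    rewrite /D0 expr2; have := mulr_ge0 (mulr_ge0 (ltW e10) (ltW b0)) (mulr_ge0 (ltW a0) (ltW a0)); lc; lra.
  apply: (le_trans (norm3D _ _)); have := norm3D (b *: cross T ea) ((b ^+ 2 / 2) *: cross w ea).
  by move: c1 c2 c3; lc; lra.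
have Tw1 : norm3 (cross T w) = rho.
  rewrite /norm3; have -> : dot3 (cross T w) (cross T w) = dot3 T T * dot3 w w - dot3 T w ^+ 2.
    by generalize T w => A B; rewrite !vE; ring.
  by rewrite TT Tw expr0n /= subr0 mul1r.
pose Q := norm3 (cross P M).
have Q1 : Q <= D0 / 2 * rho + (2 + rho / 2) * e1 * D0.
  have -> : Q = norm3 ((D0 / 2) *: cross T w + X) by rewrite /X addrC subrK.
  apply: (le_trans (norm3D _ _)); rewrite norm3Z Tw1 gtr0_norm ?divr_gt0//.
  by move: Xn; lc; lra.
have Q2 : D0 / 2 * rho - (2 + rho / 2) * e1 * D0 <= Q.
  have : norm3 ((D0 / 2) *: cross T w) <= Q + norm3 X.
    have -> : (D0 / 2) *: cross T w = cross P M - X by rewrite /X opprB addrC subrK.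
    exact: norm3B.
  rewrite norm3Z Tw1 gtr0_norm ?divr_gt0//.
  by move: Xn; lc; lra.
have S0 : 0 < S by apply: lt_le_trans S1; rewrite mulr_gt0// exprn_gt0.
have -> : circ_inv_sq (g (t0 - a)) (g t0) (g (t0 + b)) = (2 * Q / S) ^+ 2.
  rewrite circ_inv_sq_mid -/P -/M.
  have -> : g (t0 + b) - g (t0 - a) = P - M by rewrite /P /M; apply: vec3P; rewrite !vE; ring.
  by rewrite expr_div_n exprMn /S !exprMn /Q !norm3_sq; congr (_ / _); ring.
pose Y := 2 * Q / S.
have Q0 : 0 <= Q := norm3_ge0 _.
have Y1 : rho - C * e1 <= Y.
  rewrite /Y ler_pdivlMr//.
  have [h|h] := leP (rho - C * e1) 0.
    by apply: (@le_trans _ _ 0); [rewrite mulr_le0_ge0// ltW | rewrite mulr_ge0].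
  apply: (@le_trans _ _ ((rho - C * e1) * D0)); first by rewrite ler_pM2l.
  have := mulr_ge0 (ltW e10) (ltW D00); have := mulr_ge0 (mulr_ge0 (ltW e10) (ltW D00)) w0.
  by move: Q2; rewrite CE; lc; lra.
have Y2 : Y <= rho + C * e1.
  rewrite /Y ler_pdivrMr//.
  apply: (@le_trans _ _ ((rho + C * e1) * (D0 * (1 - e1) ^+ 3))); last first.
    by rewrite ler_wpM2l// addr_ge0// mulr_ge0 ?ltW// CE; move: w0; lz; lra.
  have -> : (rho + C * e1) * (D0 * (1 - e1) ^+ 3) = D0 * ((rho + C * e1) * (1 - e1) ^+ 3) by ring.
  apply: (@le_trans _ _ (D0 * (rho + (4 + rho) * e1))); first by move: Q1; lc; lra.
  rewrite ler_pM2l//.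
  have e3 : 1 - 3 * e1 <= (1 - e1) ^+ 3.
    rewrite -subr_ge0; have -> : (1 - e1) ^+ 3 - (1 - 3 * e1) = e1 ^+ 2 * (3 - e1) by ring.
    by rewrite mulr_ge0 ?sqr_ge0//; move: e18; lc; lra.
  have rC : 0 <= rho + C * e1 by rewrite addr_ge0// mulr_ge0 ?ltW// CE; move: w0; lz; lra.
  apply: le_trans (ler_wpM2l rC e3).
  have : C * e1 * e1 <= C * e1 * (1 / 8).
    by rewrite ler_wpM2l// mulr_ge0 ?ltW// CE; move: w0; lz; lra.
  have := mulr_ge0 (ltW e10) w0.
  by rewrite CE; move: e10 => ee; lc; lra.
have rho2 : rho ^+ 2 = k ^+ 2 + K by rewrite norm3_sq.
rewrite -/Y -rho2 subr_sqr normrM.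
have C0 : 0 <= C by rewrite CE; move: w0; lc; lra.
have Y0 : 0 <= Y by apply: divr_ge0; [rewrite mulr_ge0 | exact: ltW].
apply: ler_pM => //; first by rewrite mulrC ler_norml; apply/andP; split; move: Y1 Y2; lz; lra.
rewrite ger0_norm ?addr_ge0//.
have : C * e1 <= C * 1 by rewrite ler_wpM2l//; move: e18; lc; lra.
by move: Y2; lc; lra.
Qed.

Lemma chi_lim : chi_sigma_lim K g t0 k.
Proof.
move=> e e0; have [_ k0 _] := sm.
have w0 := norm3_ge0 w.
pose C := 16 + 12 * norm3 w.
pose D := C * (2 * norm3 w + C) + 1.
have C0 : 0 <= C by rewrite /C; lra.
have D0 : 0 < D by rewrite /D ltr_wpDl// mulr_ge0// addr_ge0// mulr_ge0.
have e2 : 0 < (e / 2) ^+ 2 by rewrite exprn_gt0//; lra.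
have [e1 [e10 e11 e12 _ _]] := small4 (divr_gt0 ltr01 (ltr0n R 8)) (divr_gt0 e2 D0) ltr01 ltr01.
have [d d0 hd] := position_expansion K0 ov sm e10.
exists (Num.min d 1); split; first by rewrite lt_min d0 ltr01.
move=> a b a0; rewrite lt_min => /andP[ad a1] b0; rewrite lt_min => /andP[bd b1].
have hP := hd (t0 + b); rewrite addrAC subrr add0r gtr0_norm// in hP.
have hM := hd (t0 - a); rewrite addrAC subrr add0r normrN gtr0_norm// sqrrN scaleNr opprK in hM.
have h := chi_bounds (erefl C) a0 (ltW a1) b0 (ltW b1) e10 e11 (hP bd) (hM ad).
rewrite (chi_ptsE K0 _ _ _ (ov_SK ov)) /circle_gcurv.
apply: (@le_lt_trans _ _ (e / 2)); last by lz; lra.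
apply: sqrt_close => //; first (lz; lra).
have -> : circ_inv_sq (g (t0 - a)) (g t0) (g (t0 + b)) - K - k ^+ 2 =
  circ_inv_sq (g (t0 - a)) (g t0) (g (t0 + b)) - (k ^+ 2 + K) by ring.
apply: (le_trans h).
have : e1 * D <= (e / 2) ^+ 2 by rewrite -ler_pdivlMr.
rewrite /D; move: e10; lz; lra.
Qed.
End Limits.

(** * Null sets under reflection and translation *)

Section Negligible.
Variable R : realType.
Local Notation mu := (@lebesgue_measure R).

Lemma negligible_opp (A : set R) : mu.-negligible A -> mu.-negligible [set x | A (- x)].
Proof.
move=> [B [mB B0 AB]]; exists ((-%R : _ -> measurableTypeR R) @^-1` B); split.
- rewrite -[X in measurable X]setTI.
  exact: (measurable_realfun.oppr_measurable measurableT).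
- exact: etrans (lebesgue_measureN mB) B0.
- by move=> x /AB.
Qed.

(** The translated measure agrees with Lebesgue measure on half-open intervals, hence everywhere. *)
Lemma negligible_shift (A : set R) (c : R) : mu.-negligible A -> mu.-negligible [set x | A (x + c)].
Proof.
move=> [B [mB B0 AB]].
pose f := (fun x => x + c) : measurableTypeR R -> measurableTypeR R.
have mf : measurable_fun setT f.
  by apply: measurable_realfun.measurable_funD; [exact: measurable_id | exact: measurable_cst].
exists (f @^-1` B); split.
- by rewrite -[X in measurable X]setTI; exact: mf.
- have h : mu B = pushforward mu f B.
    apply: (@lebesgue_measure_unique R (pushforward mu f)) => //= _ [[a b]] _ <-.
    rewrite /pushforward.
    have -> : f @^-1` [set` `]a, b] ] = [set` `]a - c, b - c] ].
      by apply/seteqP; split=> x /=; rewrite /f !in_itv /= ltrBlDr lerBrDr.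
    rewrite !lebesgue_measure_itv /= !lte_fin ltrD2r; case: ifP => // _.
    by rewrite -!EFinB; congr (_%:E); ring.
  by move: B0; rewrite h.
- by move=> x /AB.
Qed.
End Negligible.

(** * Smooth points have full measure *)

Section AeSmooth.
Variables (R : realType) (K : R) (g : R -> vec3 R) (L : R) (o : vec3 R) (del s r : R).
Hypotheses (K0 : 0 <= K) (ov : oval K g L o del s r).
Local Notation V := (vec3 R).
Local Notation q := (Num.sqrt K).
Local Notation N := (nK K).
Local Notation sp := (supp K g o del).
Local Notation tg x n := (frameT s (N (g x)) n).
Local Notation mu := (@lebesgue_measure R).
Local Notation smooth := (smooth_at K g o del s).

Lemma sel_exists : exists sel : R -> V, forall y, sp y (sel y).
Proof. by have [f hf] := boolp.choice (ov_supp ov); exists f. Qed.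

Lemma slope_sel_mono (t hd : R) (d : V) (sel : R -> V) (x y : R) : chart K g o del t hd d ->
  (forall y, sp y (sel y)) -> t - r / 4 <= x -> x <= y -> y <= t + r / 4 ->
  slope K g s t d (sel x) <= slope K g s t d (sel y).
Proof.
move=> ch hs tx xy yt; have [r0 _ _ _] := ov_r ov.
move: xy; rewrite le_eqVlt => /orP[/eqP->//|xy].
by apply: (slope_mono K0 ov ch) (hs x) (hs y); rewrite ?ler_norml; try (apply/andP; split); move: tx xy yt; lc; lra.
Qed.

Lemma ae_diff_slope (t hd : R) (d : V) (sel : R -> V) : chart K g o del t hd d ->
  (forall y, sp y (sel y)) ->
  mu.-negligible [set x | t - r / 4 < x < t + r / 4 /\
    ~ exists2 l : R, 0 <= l & diff_at (slope K g s t d \o sel) x l].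
Proof.
move=> ch hs; have [r0 _ _ _] := ov_r ov.
have mono := slope_sel_mono ch hs.
have cd : t - r / 4 < t + r / 4 by lra.
have pos (x l : R) : t - r / 4 < x < t + r / 4 -> diff_at (slope K g s t d \o sel) x l -> 0 <= l.
  move=> /andP[x1 x2] dl; rewrite leNgt; apply/negP => l0.
  have nl : 0 < - l / 2 by lra.
  have [d1 d10 hd1] := dl _ nl.
  have x20 : 0 < t + r / 4 - x by lra.
  have [h [h0 h1 h2 _ _]] := small4 d10 x20 d10 d10.
  have e1 : x + h / 2 - x = h / 2 by ring.
  have h20 : 0 < h / 2 by lc; lra.
  have := hd1 (x + h / 2); rewrite /= e1 (gtr0_norm h20) => /(_ ltac:((move: h1; lc; lra))).
  have := mono x (x + h / 2) ltac:((move: x1; lc; lra)) ltac:((lc; lra)) ltac:((move: h2; lc; lra)).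
  move: (slope K g s t d (sel x)) (slope K g s t d (sel (x + h / 2))) => A B AB.
  rewrite ler_norml => /andP[_]; have := mulr_gt0 nl h0; move: AB; lc; lra.
apply: negligibleS (monotone_ae_diff cd mono) => x /= [xr h]; split=> // -[l dl]; apply: h.
by exists l => //; exact: pos xr dl.
Qed.

Lemma window_smooth (t hd : R) (d : V) (sel : R -> V) : chart K g o del t hd d ->
  (forall y, sp y (sel y)) ->
  mu.-negligible [set x | t - r / 4 < x < t + r / 4 /\ ~ exists n k, smooth x n k].
Proof.
move=> ch hs; apply: negligibleS (ae_diff_slope ch hs) => x /= [xr h]; split=> // -[l l0 dl]; apply: h.
have xt : `|x - t| < r / 4 by rewrite ltr_norml; lra.
by exists (sel x); eexists; exact: (smooth_point K0 ov ch hs xt dl l0).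
Qed.

Lemma ae_smooth : ae_on L (fun t => exists n k, smooth t n k).
Proof.
have [r0 _ _ _] := ov_r ov; have [sel hs] := sel_exists.
have r4 : 0 < r / 4 by lra.
pose F (i : nat) : set R := [set x | i%:R * (r / 4) - r / 4 < x < i%:R * (r / 4) + r / 4 /\
  ~ exists n k, smooth x n k].
have hF i : mu.-negligible (F i).
  by have [hd [d ch]] := chart_exists ov (i%:R * (r / 4)); exact: window_smooth ch hs.
have key (x : R) : 0 <= x -> exists i : nat, i%:R * (r / 4) - r / 4 < x < i%:R * (r / 4) + r / 4.
  move=> x0; exists (Num.truncn (x / (r / 4))).
  have xr : 0 <= x / (r / 4) by rewrite divr_ge0// ltW.
  have := truncn_itv xr; move: (Num.truncn _) => i /andP[].
  rewrite -[i.+1%:R]natr1 ler_pdivlMr// ltr_pdivrMr// mulrDl mul1r.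
  move: (i%:R * (r / 4)) => A h1 h2; lra.
apply: negligibleS (negligible_bigcup hF) => x /= [/andP[x0 xL] h].
by have [i hi] := key x x0; exists i.
Qed.

Lemma kappa_lim_unique (t l l' : R) : kappa_sigma_lim K g t l -> kappa_sigma_lim K g t l' -> l = l'.
Proof.
move=> h h'; apply/eqP; rewrite -subr_eq0 -normr_le0; apply/ler_addgt0Pr => e e0; rewrite add0r.
have e2 : 0 < e / 2 by lra.
have [d [d0 hd]] := h _ e2; have [d' [d0' hd']] := h' _ e2.
have [z [z0 z1 z2 _ _]] := small4 d0 d0' d0 d0'.
have a1 := hd t (t + z / 2) ltac:((lc; lra)) ltac:((lc; lra)) ltac:((lc; lra)) ltac:((move: z1; lc; lra)).
have a2 := hd' t (t + z / 2) ltac:((lc; lra)) ltac:((lc; lra)) ltac:((lc; lra)) ltac:((move: z2; lc; lra)).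
rewrite distrC in a1.
have := ler_normD (l - kappa_arc K g t (t + z / 2)) (kappa_arc K g t (t + z / 2) - l').
by rewrite addrA subrK; move: a1 a2; lc; lra.
Qed.

Lemma chi_lim_unique (t l l' : R) : chi_sigma_lim K g t l -> chi_sigma_lim K g t l' -> l = l'.
Proof.
move=> h h'; apply/eqP; rewrite -subr_eq0 -normr_le0; apply/ler_addgt0Pr => e e0; rewrite add0r.
have e2 : 0 < e / 2 by lra.
have [d [d0 hd]] := h _ e2; have [d' [d0' hd']] := h' _ e2.
have [z [z0 z1 z2 _ _]] := small4 d0 d0' d0 d0'.
have a1 := hd (z / 2) (z / 2) ltac:((lc; lra)) ltac:((move: z1; lc; lra)) ltac:((lc; lra)) ltac:((move: z1; lc; lra)).
have a2 := hd' (z / 2) (z / 2) ltac:((lc; lra)) ltac:((move: z2; lc; lra)) ltac:((lc; lra)) ltac:((move: z2; lc; lra)).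
rewrite distrC in a1.
have := ler_normD (l - chi_pts K g (t - z / 2) t (t + z / 2)) (chi_pts K g (t - z / 2) t (t + z / 2) - l').
by rewrite addrA subrK; move: a1 a2; lc; lra.
Qed.

Lemma ae_kappa_chi (kappa : R) :
  ae_on L (fun t => exists l, kappa_sigma_lim K g t l /\ kappa <= l) <->
  ae_on L (fun t => exists l, chi_sigma_lim K g t l /\ kappa <= l).
Proof.
split=> hA; apply: negligibleS (negligibleU hA ae_smooth) => t /= [tL h].
  have [[n [k sm]]|ns] := pselect (exists n k, smooth t n k); last by right.
  left; split=> // -[l [hl kl]]; apply: h; exists l; split=> //.
  by rewrite (kappa_lim_unique hl (kappa_lim K0 ov sm)); exact: (chi_lim K0 ov sm).
have [[n [k sm]]|ns] := pselect (exists n k, smooth t n k); last by right.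
left; split=> // -[l [hl kl]]; apply: h; exists l; split=> //.
by rewrite (chi_lim_unique hl (chi_lim K0 ov sm)); exact: (kappa_lim K0 ov sm).
Qed.

(** On the whole line instead of one period, because the windows of the local arguments may cross
    the ends of a period. At points that are not smooth the condition is void; they form a null
    set. *)
Definition ae_curv (kappa : R) : Prop :=
  mu.-negligible [set t | ~ forall n k, smooth t n k -> kappa <= k].

Lemma smooth_shift (c : R) : (forall x, g (x + c) = g x) -> forall (t : R) (n : V) (k : R),
  smooth (t + c) n k -> smooth t n k.
Proof.
move=> per t n k [h1 h2 h3].
have spc y m : sp (y + c) m <-> sp y m by rewrite /supp per.
split=> //; first exact/spc.
move=> e /h3[dl dl0 [h4 h5]]; exists dl => //.
rewrite per in h4 h5; split.
  move=> y m yt spm; have := h4 (y + c) m.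
  have -> : y + c - (t + c) = y - t by ring.
  by move=> /(_ yt); apply; exact/spc.
move=> u w h6 h7 h8; have := h5 (u + c) (w + c).
rewrite !per; have -> : w + c - (u + c) = w - u by ring.
by apply; move: h6 h7 h8; lc; lra.
Qed.

Lemma per_nat (i : nat) (x : R) : g (x + i%:R * L) = g x.
Proof.
elim: i => [|i IH]; first by rewrite mul0r addr0.
by rewrite -natr1 mulrDl mul1r addrA (ov_per ov) IH.
Qed.

Lemma per_natN (i : nat) (x : R) : g (x - i%:R * L) = g x.
Proof. by rewrite -[in RHS](subrK (i%:R * L) x) per_nat. Qed.

Lemma ae_curv_of_lim (kappa : R) :
  ae_on L (fun t => exists l, kappa_sigma_lim K g t l /\ kappa <= l) -> ae_curv kappa.
Proof.
move=> hA; have L0 := ov_L ov.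
pose Z : set R := [set t | 0 <= t <= L /\ ~ exists l, kappa_sigma_lim K g t l /\ kappa <= l].
pose F (i : nat) : set R := [set t | Z (t + i%:R * L)] `|` [set t | Z (t - i%:R * L)].
have hF i : mu.-negligible (F i).
  by apply: negligibleU; [exact: negligible_shift | exact: (@negligible_shift _ _ (- _))].
have key (c t : R) : (forall x, g (x - c) = g x) -> 0 <= t + c <= L ->
    ~ (forall n k, smooth t n k -> kappa <= k) -> Z (t + c).
  move=> per tL hB; split=> // -[l [hl kl]]; apply: hB => n k sm.
  have sm' : smooth (t + c) n k by apply: (smooth_shift per); rewrite addrK.
  by rewrite -(kappa_lim_unique hl (kappa_lim K0 ov sm')).
have key2 (x : R) : exists i : nat, 0 <= x - i%:R * L <= L \/ 0 <= x + i%:R * L <= L.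
  have /andP[h1 h2] := floor_itv (x / L).
  rewrite ler_pdivlMr// in h1; rewrite intrD ltr_pdivrMr// mulrDl mul1r in h2.
  move: h1 h2; case: (Num.floor (x / L)) => i.
    rewrite -[(Posz i)%:~R]/(i%:R : R) => h1 h2; exists i; left; move: h1 h2.
    by move: (i%:R * L) => A; lra.
  rewrite -[(Negz i)%:~R]/(- (i.+1%:R) : R) mulNr => h1 h2; exists i.+1; right; move: h1 h2.
  by move: (i.+1%:R * L) => A; lra.
apply: negligibleS (negligible_bigcup hF) => x /= hx.
have [i [h|h]] := key2 x; exists i => //.
  by right; apply: (key (- _)) h hx => y; rewrite opprK per_nat.
by left; apply: key h hx => y; rewrite per_natN.
Qed.
End AeSmooth.

(** * Turning of the normal *)

Section Turning.
Variables (R : realType) (K : R) (g : R -> vec3 R) (L : R) (o : vec3 R) (del s r : R).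
Hypotheses (K0 : 0 <= K) (ov : oval K g L o del s r).
Local Notation V := (vec3 R).
Local Notation q := (Num.sqrt K).
Local Notation N := (nK K).
Local Notation sp := (supp K g o del).
Local Notation tg x n := (frameT s (N (g x)) n).
Local Notation mu := (@lebesgue_measure R).
Local Notation grev := (fun t : R => g (- t)).

Lemma smooth_rev (t : R) (n : V) (k : R) :
  smooth_at K grev o del (- s) t n k -> smooth_at K g o del s (- t) n k.
Proof.
move=> [h1 h2 h3]; split=> //; first exact/supp_rev.
move=> e /h3[dl dl0 [h4 h5]]; exists dl => //; split.
  move=> y m yt spm.
  have := h4 (- y) m; rewrite -normrN opprB opprK [t + y]addrC; rewrite opprK in yt.
  move=> /(_ yt) /(_ ltac:(by apply/supp_rev; rewrite opprK)).
  rewrite opprK frameTNs.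
  by have -> : (k * (- y - t)) *: - tg (- t) n = (k * (y + t)) *: tg (- t) n
    by rewrite scalerN -scaleNr; congr (_ *: _); ring.
move=> u w h6 h7 h8; have := h5 (- w) (- u) ltac:((move: h8; lc; lra)) ltac:((move: h7; lc; lra)) ltac:((move: h6; lc; lra)).
rewrite !opprK frameTNs -norm3N [- u + w]addrC.
by have -> : - (g u - g w - (w - u) *: - tg (- t) n) = g w - g u - (w - u) *: tg (- t) n
  by apply: vec3P; rewrite !vE; ring.
Qed.

Lemma ae_curv_rev (kappa : R) : ae_curv K g o del s kappa -> ae_curv K grev o del (- s) kappa.
Proof.
move=> /negligible_opp; apply: negligibleS => t /= h h'; apply: h => n k sm.
exact: h' (smooth_rev sm).
Qed.

Lemma NN_exact (x t : R) : dot3 (N (g x)) (N (g t)) = 1 - K * norm3 (g x - g t) ^+ 2 / 2.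
Proof.
have -> : N (g x) = N (g t) - q *: (g x - g t) by rewrite !nKE; apply: vec3P; rewrite !vE; ring.
rewrite (dotDl (N (g t))) dotNl dotZl (ov_NN ov) (SK_chord (ov_SK ov t) (ov_SK ov x)) norm3_sq.
congr (1 - _); transitivity (q * q * dot3 (g x - g t) (g x - g t) / 2); first by field.
by rewrite sqK.
Qed.

(** [th] is a relative error to be spent in [slope_growth]: twice on each side for the components
    along [d], and once more for the angle between tangent planes, hence the powers 2 and 3. *)
Lemma turning_consts (kappa e : R) : 0 < e -> e < kappa ->
  exists th : R, [/\ 0 < th, th <= 1 / 2 & (kappa - e / 2) * (1 + th) ^+ 2 < kappa * (1 - th) ^+ 3].
Proof.
move=> e0 ek; have k0 : 0 < kappa by lra.
have [th [h0 h1 h2 _ _]] := small4 (divr_gt0 ltr01 (ltr0n R 2)) (divr_gt0 e0 (mulr_gt0 (ltr0n R 13) k0)) e0 e0.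
exists th; split=> //.
have h3 : th * (13 * kappa) <= e by rewrite -ler_pdivlMr// mulr_gt0.
have a1 : (1 + th) ^+ 2 <= 1 + 3 * th by rewrite expr2; nra.
have a2 : 1 - 3 * th <= (1 - th) ^+ 3.
  rewrite -subr_ge0; have -> : (1 - th) ^+ 3 - (1 - 3 * th) = th ^+ 2 * (3 - th) by ring.
  by rewrite mulr_ge0 ?sqr_ge0//; lra.
have ke : 0 < kappa - e / 2 by lra.
have b1 := ler_wpM2l (ltW ke) a1; have b2 := ler_wpM2l (ltW k0) a2.
apply: (le_lt_trans b1); apply: lt_le_trans b2.
have := mulr_gt0 e0 h0; lra.
Qed.

Section LocalTurn.
Variables (kappa e t : R) (n : V).
Hypotheses (hk : ae_curv K g o del s kappa) (e0 : 0 < e) (ek : e < kappa) (rf : right_frame K g o del s r t n).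

(** By [smooth_point], curvature at least [kappa] means a slope derivative above [b0] at almost
    every point of the window. [ae_slope_growth] integrates this, singular growth included. *)
Lemma slope_growth : exists hd d th dl e1 D b0,
  [/\ [/\ chart K g o del t hd d, 0 < th, th <= 1 / 2, D = dot3 n d & 0 < D],
      [/\ 0 < b0, b0 * (D ^+ 2 * (1 - th) ^+ 2) = kappa - e / 2, 0 < dl & dl <= r / 4],
      [/\ 0 < e1, e1 <= e, q * (2 * e1) <= e / 2 & forall x m, t < x -> x < t + dl -> sp x m ->
          norm3 (m - n) <= e1 /\ D * (1 - th) <= dot3 m d],
      forall x m, t < x -> x < t + dl -> sp x m -> slope K g s t d n <= slope K g s t d m
    & forall (z y : R) (mz my : V), t < z -> z < y -> y < t + dl -> sp z mz -> sp y my ->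
        b0 * (y - z) <= slope K g s t d my - slope K g s t d mz].
Proof.
have [spn _ close _ [hd [d [ch plo]]]] := rf.
have [nn Nn _ _] := spn; have [dd Nd _ _] := ch.
have [r0 _ rd _] := ov_r ov; have q0 := sqrtr_ge0 K; have K0' := K0; have e0' := e0; have ek' := ek.
have tt : `|t - t| <= r / 2 by rewrite subrr normr0; lra.
pose D := dot3 n d.
have D0 : 0 < D := supp_dir_gt0 K0 ov ch tt spn.
have [th [th0 th1 thk]] := turning_consts e0 ek.
have q1 : 0 < 4 * (q + 1) by lc; lra.
have [e1 [e10 e11 e12 e13 _]] := small4 (mulr_gt0 th0 D0) e0 (divr_gt0 e0 q1) e0.
have [d1 d10 hd1] := close _ e10.
have K1 : 0 < K + 1 by lc; lra.
have [dl [dl0 dl1 dl2 dl3 dl4]] := small4 d10 (divr_gt0 r0 (ltr0n R 4)) (divr_gt0 th0 K1) ltr01.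
have near x m : t < x -> x < t + dl -> sp x m -> norm3 (m - n) <= e1 by move=> h1 h2; apply: hd1 => //; move: h2 dl1; lc; lra.
have dirb x m : t < x -> x < t + dl -> sp x m -> D * (1 - th) <= dot3 m d /\ dot3 m d <= D * (1 + th).
  move=> h1 h2 h3; have := near x m h1 h2 h3 => h4.
  have : `|dot3 (m - n) d| <= e1.
    by apply: (le_trans (cauchy _ _)); rewrite (norm3_unit dd) mulr1.
  rewrite dotDl dotNl -/D ler_norml => /andP[h5 h6]; move: h5 h6 e11; lc => *; split; lra.
have w0 : 0 < D ^+ 2 * (1 - th) ^+ 2 by rewrite mulr_gt0 ?exprn_gt0//; move: th1; lc; lra.
pose b0 := (kappa - e / 2) / (D ^+ 2 * (1 - th) ^+ 2).
have b00 : 0 < b0 by rewrite divr_gt0//; move: ek'; lz; lra.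
have b0E : b0 * (D ^+ 2 * (1 - th) ^+ 2) = kappa - e / 2 by rewrite /b0 divfK// lt0r_neq0.
have [sel hs] := sel_exists ov.
have mono := slope_sel_mono K0 ov ch hs.
pose f := slope K g s t d \o sel.
have gr (z y : R) : t < z -> z <= y -> y < t + dl -> b0 * (y - z) <= f y - f z.
  move=> tz zy yt; apply: ae_slope_growth => //.
    by move=> x x' h1 h2 h3; apply: mono => //; move: h1 h3 tz yt dl2; lz; lra.
  have stp (x : R) : z < x < y -> (exists2 l : R, 0 <= l & diff_at f x l) ->
     (forall n k, smooth_at K g o del s x n k -> kappa <= k) -> exists2 l : R, diff_at f x l & b0 < l.
    move=> /andP[zx xy] [l l0 df] hx; exists l => //.
    have xt : `|x - t| < r / 4 by rewrite gtr0_norm; move: zx xy tz yt dl2; lz; lra.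
    have := hx _ _ (smooth_point K0 ov ch hs xt df l0).
    have tx : t < x := lt_trans tz zx.
    have xdl : x < t + dl := lt_trans xy yt.
    have [w1 w2] := dirb x (sel x) tx xdl (hs x).
    have nuE := NN_exact x t.
    have W1 : norm3 (g x - g t) <= x - t by have := ov_lip K0 ov t x; rewrite gtr0_norm ?subr_gt0.
    have W0 := norm3_ge0 (g x - g t).
    have Kth : K * norm3 (g x - g t) ^+ 2 <= th.
      have a1 : norm3 (g x - g t) ^+ 2 <= dl.
        by rewrite expr2; apply: (@le_trans _ _ (norm3 (g x - g t) * 1)); [apply: ler_wpM2l => // | ]; move: W1 xdl dl4; lz; lra.
      have a2 := ler_wpM2l K0 a1.
      have a3 : dl * (K + 1) <= th by rewrite -ler_pdivlMr.
      by move: a2 a3; lz; lra.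
    have nu1 : 1 - th <= dot3 (N (g x)) (N (g t)) by rewrite nuE; move: Kth; lz; lra.
    have nu0 : 0 < dot3 (N (g x)) (N (g t)) by move: nu1 th1; lz; lra.
    rewrite ler_pdivlMr// => hl.
    rewrite ltNge; apply/negP => lb.
    have k0 : 0 < kappa := lt_trans e0 ek.
    have c1 := ler_wpM2l (ltW k0) nu1.
    have c2 : dot3 (sel x) d ^+ 2 <= (D * (1 + th)) ^+ 2.
      have d0 : 0 <= D * (1 - th) by rewrite mulr_ge0 ?(ltW D0)//; move: th1; lz; lra.
      by rewrite lerXn2r ?nnegrE//; move: d0 w1 w2; lz; lra.
    have c3 : l * dot3 (sel x) d ^+ 2 <= b0 * (D * (1 + th)) ^+ 2.
      by rewrite ler_pM// sqr_ge0.
    have c4 : kappa * (1 - th) <= b0 * (D * (1 + th)) ^+ 2 by move: c1 c3 hl; lz; lra.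
    have t2 : 0 <= (1 - th) ^+ 2 := sqr_ge0 _.
    have c5 := ler_wpM2r t2 c4.
    have c6 : b0 * (D * (1 + th)) ^+ 2 * (1 - th) ^+ 2 = (kappa - e / 2) * (1 + th) ^+ 2.
      by rewrite -b0E; ring.
    have c7 : kappa * (1 - th) * (1 - th) ^+ 2 = kappa * (1 - th) ^+ 3 by ring.
    by move: c5 thk; rewrite c6 c7; lz; lra.
  apply: negligibleS (negligibleU hk (ae_diff_slope K0 ov ch hs)) => x /= [zxy nl].
  have [hx|hx] := pselect (forall n k, smooth_at K g o del s x n k -> kappa <= k); last by left.
  have [hx'|hx'] := pselect (exists2 l : R, 0 <= l & diff_at f x l).
    by case: nl; exact: stp zxy hx' hx.
  by right; split=> //; case/andP: zxy => h1 h2; apply/andP; split; [apply: le_lt_trans h1; move: tz; lz; lra | apply: (lt_le_trans h2); move: yt dl2; lz; lra].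
have win (x : R) : t < x -> x < t + dl -> `|x - t| <= r / 2.
  by move=> h1 h2; rewrite gtr0_norm; move: h1 h2 dl2; lz; lra.
have smono (x y : R) (m m' : V) : t < x -> x < y -> y < t + dl -> sp x m -> sp y m' ->
    slope K g s t d m <= slope K g s t d m'.
  by move=> h1 h2 h3; apply: (slope_mono K0 ov ch) => //; try apply: win; move: h1 h2 h3 dl2; lz; lra.
have plo' x m : t < x -> x < t + dl -> sp x m -> slope K g s t d n <= slope K g s t d m.
  by move=> h1 h2; apply: plo => //; move: h2 dl2; lz; lra.
(* The growth is known for the selected normals at [z + eta] and [y - eta]; monotonicity passes to
   arbitrary normals at [z] and [y]. *)
have pairs (z y : R) (mz my : V) : t < z -> z < y -> y < t + dl -> sp z mz -> sp y my ->
        b0 * (y - z) <= slope K g s t d my - slope K g s t d mz.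
  move=> tz zy yt spz spy; rewrite -subr_ge0; apply: (@eps_ge0 _ _ (2 * b0)) => [|eta eta0]; first by rewrite mulr_ge0// ltW.
  have := smono z y mz my tz zy yt spz spy.
  have [h|h] := leP (y - z) (2 * eta).
    by have := ler_wpM2l (ltW b00) h; lc; lra.
  have [u1 u2 u3 u4 u5] : [/\ t < z + eta, z < z + eta, z + eta < y - eta, y - eta < y & y - eta < t + dl] by move: h tz zy yt eta0; lc => *; split; lra.
  have := gr (z + eta) (y - eta) u1 (ltW u3) u5.
  have := smono z (z + eta) mz (sel (z + eta)) tz u2 (lt_trans u3 u5) spz (hs _).
  have := smono (y - eta) y (sel (y - eta)) my (lt_trans u1 u3) u4 yt (hs _) spy.
  by rewrite /f /=; lz; lra.
exists hd, d, th, dl, e1, D, b0; split=> //; split=> //.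
- have : e1 * (4 * (q + 1)) <= e by rewrite -ler_pdivlMr.
  by have := mulr_ge0 q0 (ltW e10); lz; lra.
- by move=> x m h1 h2 h3; split; [exact: near h3 | case: (dirb x m h1 h2 h3)].
Qed.

(** Lower bounds for the turning of the normal and for the descent of the curve, to the right of
    every point, corners included. The turning has no upper bound of order [y - t]: it is only known
    to be small. *)
Lemma local_turn : exists2 dl : R, 0 < dl & forall y m, t < y -> y < t + dl -> sp y m ->
  [/\ norm3 (m - n) <= e, (kappa - e) * (y - t) <= - dot3 m (tg t n),
      (kappa - e) * (y - t) ^+ 2 / 2 <= - dot3 (g y - g t) m
    & norm3 (g y - g t - (y - t) *: tg t n) <= e * (y - t)].
Proof.
have [hd [d [th [dl [e1 [D [b0 [[ch th0 th1 DE D0] [b00 b0E dl0 dlr] [e10 e11 qe1 near] plo pairs]]]]]]]] := slope_growth.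
have [spn _ _ tan _] := rf.
have [nn Nn _ _] := spn; have [dd Nd _ _] := ch.
have [r0 _ rd _] := ov_r ov; have q0 := sqrtr_ge0 K; have K0' := K0; have e0' := e0; have ek' := ek.
have [d2 d20 htan] := tan _ e0.
exists (Num.min dl d2); first by rewrite lt_min dl0 d20.
move=> y m ty; rewrite -ltrBlDl lt_min => /andP[y1 y2] spm.
have ydl : y < t + dl by move: y1; lc; lra.
have yd2 : y < t + d2 by move: y2; lc; lra.
have [mn mD] := near y m ty ydl spm.
have [mm Nm mp _] := spm.
have win (x : R) : t < x -> x < t + dl -> `|x - t| <= r / 2.
  by move=> h1 h2; rewrite gtr0_norm; move: h1 h2 dlr; lz; lra.
have tt : `|t - t| <= r / 2 by rewrite subrr normr0; lc; lra.
have kb : kappa - e / 2 <= b0 * (D * (1 - th) * D).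
  rewrite -b0E ler_pM2l//.
  have -> : D * (1 - th) * D = D ^+ 2 * (1 - th) by ring.
  by rewrite ler_pM2l ?exprn_gt0// expr2 ler_piMr//; move: th1; lz; lra.
split.
- exact: le_trans mn e11.
- have sl0 : b0 * (y - t) <= slope K g s t d m - slope K g s t d n.
    rewrite -subr_ge0; apply: (@eps_ge0 _ _ b0) => [|eta eta0]; first by rewrite ltW.
    have := plo y m ty ydl spm.
    have [h|h] := leP (y - t) eta.
      by have := ler_wpM2l (ltW b00) h; lc; lra.
    have [u1 u2 u3] : [/\ t < t + eta, t + eta < y & t + eta < t + dl] by move: h ydl; lc => *; split; lra.
    have [mz spz] := ov_supp ov (t + eta).
    have := plo (t + eta) mz u1 u3 spz.
    have := pairs (t + eta) y mz m u1 u2 ydl spz spm.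
    by lz; lra.
  have := normal_slope K0 ov ch (win y ty ydl) Nn _ spm; rewrite -DE => /(_ D0).
  rewrite (ov_NN ov) mulr1 (frameTm _ _ _) mulr0 sub0r => ->; rewrite opprK.
  have yt0 : 0 < y - t by rewrite subr_gt0.
  apply: (@le_trans _ _ (b0 * (y - t) * (D * (1 - th) * D))).
    by rewrite mulrAC ler_pM2r//; move: kb; lz; lra.
  have p1 : 0 <= b0 * (y - t) by rewrite mulr_ge0// ltW.
  have p2 : 0 <= D * (1 - th) * D by rewrite !mulr_ge0 ?(ltW D0)//; move: th1; lz; lra.
  exact: (ler_pM p1 p2 sl0 (ler_wpM2r (ltW D0) mD)).
(* The tangent at [z] descends relative to [m] at least in proportion to [y - z]; integrating over
   [z] gives the quadratic bound. *)
- have key (z : R) mz : t < z -> z < y -> sp z mz -> dot3 (tg z mz) m <= - ((kappa - e) * (y - z)).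
    move=> tz zy spz.
    have zdl : z < t + dl := lt_trans zy ydl.
    have [mzn mzD] := near z mz tz zdl spz.
    have [zz Nz zp _] := spz.
    have mzd := supp_dir_gt0 K0 ov ch (win z tz zdl) spz.
    have := normal_slope K0 ov ch (win y ty ydl) Nz mzd spm.
    have pr := pairs z y mz m tz zy ydl spz spm.
    have yz0 : 0 < y - z by rewrite subr_gt0.
    have mN : `|dot3 m (N (g z))| <= e / 2 * (y - z).
      rewrite dotC (dot_N z Nm) normrM (ger0_norm q0).
      apply: (@le_trans _ _ (q * (2 * e1 * (y - z)))); last by rewrite mulrA ler_pM2r.
      rewrite ler_wpM2l//.
      have a1 := zp y; have a2 := mp z; rewrite -(opprB (g y)) dotNl in a2.
      apply: (@le_trans _ _ `|dot3 (g y - g z) (m - mz)|).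
        rewrite dotDr dotNr ler0_norm; last by move: a2; lz; lra.
        by rewrite ler0_norm; move: a1 a2; lz; lra.
      apply: (le_trans (cauchy _ _)); rewrite mulrC; apply: ler_pM; rewrite ?norm3_ge0//.
        have -> : m - mz = (m - n) - (mz - n) by apply: vec3P; rewrite !vE; ring.
        by apply: (le_trans (norm3B _ _)); move: mn mzn; lz; lra.
      by have := ov_lip K0 ov z y; rewrite gtr0_norm.
    have TN : `|dot3 (tg z mz) (N (g t))| <= 1.
      by apply: dot_unit_le1; [exact: (frameTT (ov_s ov) (ov_NN ov z) zz Nz) | exact: (ov_NN ov t)].
    have b1 : dot3 m (N (g z)) * dot3 (tg z mz) (N (g t)) <= e / 2 * (y - z).
      apply: (le_trans (ler_norm _)); rewrite normrM; apply: le_trans mN.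
      by rewrite ler_piMr.
    have b2 : (kappa - e / 2) * (y - z) <= (slope K g s t d m - slope K g s t d mz) * (dot3 m d * dot3 mz d).
      have -> : (kappa - e / 2) * (y - z) = b0 * (y - z) * (D * (1 - th) * (D * (1 - th))) by rewrite -b0E; ring.
      have p1 : 0 <= D * (1 - th) by rewrite mulr_ge0 ?(ltW D0)//; move: th1; lz; lra.
      have p3 : 0 <= b0 * (y - z) by rewrite mulr_ge0// ltW.
      exact: (ler_pM p3 (mulr_ge0 p1 p1) pr (ler_pM p1 p1 mD mzD)).
    have nuE := NN_exact z t.
    have nu1 : dot3 (N (g z)) (N (g t)) <= 1.
      by rewrite nuE lerBlDr lerDl divr_ge0// mulr_ge0 ?sqr_ge0.
    have nu0 : 0 < dot3 (N (g z)) (N (g t)).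
      by have /andP[h _] := NN_close K0 ov ch (win z tz zdl); move: h; lz; lra.
    rewrite (dotC (tg z mz) m); move=> E.
    have E1 : dot3 m (tg z mz) * dot3 (N (g z)) (N (g t)) <= - ((kappa - e) * (y - z)).
      by rewrite E; move: b1 b2; lz; lra.
    have X0 : 0 <= (kappa - e) * (y - z) by rewrite mulr_ge0 ?(ltW yz0)//; move: ek'; lz; lra.
    rewrite leNgt; apply/negP => h.
    have := ltr_pM2r nu0 (- ((kappa - e) * (y - z))) (dot3 m (tg z mz)); rewrite h => h1.
    have := ler_wpM2l X0 nu1; move: h1 E1; lz; lra.
  have yt0 : 0 < y - t by rewrite subr_gt0.
  have ke0 : 0 < kappa - e by rewrite subr_gt0.
  (* [key] holds strictly between [t] and [y], so margins [eta] are cut off; on them the curve moves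
     by at most [eta]. *)
  rewrite -subr_ge0; apply: (@eps_ge0 _ _ ((kappa - e) * (y - t) + 2)) => [|eta eta0].
    by rewrite addr_ge0// mulr_ge0// ltW.
  have [h|h] := leP (y - t) (2 * eta).
    have a2 := mp t; rewrite -(opprB (g y)) dotNl in a2.
    have ke1 : 0 <= (kappa - e) * (y - t) by rewrite mulr_ge0// ltW.
    have := ler_wpM2l ke1 h; rewrite expr2; move: a2; lz; lra.
  have := @curve_dini _ _ _ _ _ _ _ _ K0 ov (fun p => dot3 p m) (fun=> m) 0
     (fun z => (kappa - e) * (y - z) ^+ 2 / 2) (fun z => - ((kappa - e) * (y - z)))
     (t + eta) (y - eta) 0 ltac:(move: h; lz; lra) (lexx _).
  have hF (p v : V) : `|dot3 v m - dot3 p m - dot3 (v - p) m| <= 0 * dot3 (v - p) (v - p).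
    by rewrite mul0r dotDl dotNl subrr normr0.
  have df (z : R) : diff_at (fun z => (kappa - e) * (y - z) ^+ 2 / 2) z (- ((kappa - e) * (y - z))).
    apply: derive_diff_at; apply: is_derive_eq; rewrite !scaler0 ?scaler1 /GRing.scale /=; by field.
  move=> /(_ hF (fun z _ _ => df z)) hh.
  have {}hh : dot3 (g (y - eta)) m - (kappa - e) * (y - (y - eta)) ^+ 2 / 2 -
    (dot3 (g (t + eta)) m - (kappa - e) * (y - (t + eta)) ^+ 2 / 2) <= 0.
    rewrite -[X in _ <= X](mul0r (y - eta - (t + eta))); apply: hh => z mz h1 h2 spz.
    by rewrite opprK; have := key z mz ltac:(move: h1; lz; lra) ltac:(move: h2; lz; lra) spz; lc; lra.
  have lip (a b : R) : a <= b -> dot3 (g b) m - dot3 (g a) m <= b - a.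
    move=> ab; rewrite -dotNl -dotDl; apply: (le_trans (dot_le _ _)); rewrite (norm3_unit mm) mulr1.
    by have := ov_lip K0 ov a b; rewrite ger0_norm// subr_ge0.
  have l1 := lip (y - eta) y ltac:(lc; lra); have l2 := lip t (t + eta) ltac:(lc; lra).
  rewrite dotDl dotNl; move: hh l1 l2.
  have -> : y - (y - eta) = eta by ring.
  have -> : (y - (t + eta)) ^+ 2 = (y - t) ^+ 2 - 2 * eta * (y - t) + eta ^+ 2 by ring.
  by lc; lra.
- have := htan t y (lexx _) (ltW ty) yd2.
  by [].
Qed.
End LocalTurn.
End Turning.

(** * The rolling theorem *)

Section RollingAlg.
Variable R : realType.

(** For [tau = k1 * h], [th = tau ^+ 2 / 2], [b = k1 * h ^+ 2 / 2], [a = h * tau - b] and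
    [D2 = h ^+ 2] the expression is [(k1 - m0) * (P - lam * k1) * h ^+ 2 / 2]. Up to relative errors
    [e] this is the worst case: more descent [b] lowers the value because of [PG], more turning
    [tau] because of [mk]. *)
Lemma second_order_neg (k1 m0 lam P e h tau th a b beta eta D2 AP : R) : P <= AP -> 0 <= AP ->
  0 < h -> 0 < e -> e <= 1 / 2 -> 0 < lam -> 0 <= m0 -> 0 <= a -> 0 <= b -> 0 <= th -> 0 <= tau ->
  th <= e ^+ 2 / 2 -> tau ^+ 2 / 2 <= th -> 0 <= beta -> beta <= h -> eta <= e ->
  b * (1 - eta) = beta * tau - (1 - th) * a ->
  k1 * h ^+ 2 / 2 <= b -> k1 * h <= tau -> D2 <= h ^+ 2 -> (1 - 2 * e) * h ^+ 2 <= D2 ->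
  m0 * (1 + e) <= k1 -> P <= m0 * lam * (1 - e) ->
  (k1 - m0) * (P - lam * k1) + e * (3 * m0 * lam * k1 + 2 * m0 * AP) < 0 ->
  - lam * th + P * b + m0 * lam * a - m0 / 2 * P * D2 < 0.
Proof.
move=> PAP AP0 h0 e0 e2 l0 m00 a0 b0 th0 tau0 the tauth be0 beh ete rel bk tk D2h D2l mk PG fin.
have ht0 : 0 <= h * tau by rewrite mulr_ge0// ltW.
have th1 : th <= 1 / 2 by apply: (le_trans the); rewrite expr2; nra.
have bt : beta * tau <= h * tau by rewrite ler_wpM2r.
have be1 : 0 <= b * (1 - eta) by rewrite mulr_ge0//; move: e2 ete; lc; lra.
have a2 : a <= 2 * (h * tau) by nra.
have tha : th * a <= e * (h * tau).
  apply: (@le_trans _ _ (e ^+ 2 / 2 * (2 * (h * tau)))); first by rewrite ler_pM.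
  have -> : e ^+ 2 / 2 * (2 * (h * tau)) = e * (e * (h * tau)) by field.
  rewrite ler_pM2l//; nra.
have a3 : a <= (1 + e) * (h * tau) - (1 - e) * b.
  have : b * (1 - e) <= b * (1 - eta) by rewrite ler_wpM2l//; move: ete; lc; lra.
  nra.
have ml0 : 0 <= m0 * lam by rewrite mulr_ge0// ltW.
have s1 := ler_wpM2l ml0 a3.
have G0 : 0 <= m0 * lam * (1 - e) - P by move: PG; lc; lra.
have s2 := ler_wpM2l G0 bk.
have s3 := ler_wpM2l (ltW l0) tauth.
have s4 : - lam * (tau ^+ 2 / 2) + m0 * lam * ((1 + e) * (h * tau)) <=
    h ^+ 2 * (- lam * k1 ^+ 2 / 2 + m0 * lam * (1 + e) * k1).
  rewrite -subr_ge0.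
  have -> : h ^+ 2 * (- lam * k1 ^+ 2 / 2 + m0 * lam * (1 + e) * k1) -
     (- lam * (tau ^+ 2 / 2) + m0 * lam * ((1 + e) * (h * tau))) =
     lam / 2 * ((tau - k1 * h) * (tau + k1 * h - 2 * (m0 * (1 + e)) * h)) by field.
  apply: mulr_ge0; first (lc; lra).
  apply: mulr_ge0; first (move: tk; lc; lra).
  have := ler_wpM2r (ltW h0) mk; move: tk; lc; lra.
have s5 : - (m0 / 2 * P * D2) <= - (m0 / 2 * P * h ^+ 2) + e * m0 * AP * h ^+ 2.
  have d1 : 0 <= h ^+ 2 - D2 by move: D2h; lc; lra.
  have d2 : h ^+ 2 - D2 <= 2 * e * h ^+ 2 by move: D2l; lc; lra.
  have d3 : m0 / 2 * P * (h ^+ 2 - D2) <= m0 / 2 * AP * (2 * e * h ^+ 2).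
    apply: (@le_trans _ _ (m0 / 2 * AP * (h ^+ 2 - D2))).
      by rewrite ler_wpM2r// ler_wpM2l ?divr_ge0.
    by rewrite ler_wpM2l// mulr_ge0// divr_ge0.
  (move: d3; lc; lra).
have h20 : 0 < h ^+ 2 by rewrite exprn_gt0.
have := ltr_pM2l h20 ((k1 - m0) * (P - lam * k1) + e * (3 * m0 * lam * k1 + 2 * m0 * AP)) 0.
rewrite fin mulr0 => s6.
rewrite (expr2 k1) in s4.
move: s1 s2 s3 s4 s5 s6; lc => s1 s2 s3 s4 s5 s6; lra.
Qed.

(** The first term is at most [- Q * (k - e - m0) * h]; every other positive contribution is of
    order [e * h]. *)
Lemma first_order_neg (k m0 lam P Q e h tau th a b beta D2 C : R) :
  0 < h -> 0 < e -> h <= e -> 0 <= lam -> 0 <= m0 -> 0 < Q -> 0 <= th -> 0 <= a -> 0 <= b ->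
  a <= e * h -> b <= e * h -> beta <= h -> (k - e) * h <= tau -> 0 <= D2 -> D2 <= h ^+ 2 ->
  - C <= P -> P <= C -> e * (Q + C + m0 * lam + m0 * C) < Q * (k - m0) ->
  - Q * (tau - m0 * beta) - lam * th + P * b + m0 * lam * a - m0 / 2 * P * D2 < 0.
Proof.
move=> h0 e0 he l0 m00 Q0 th0 a0 b0 ah bh beh tk D20 D2h P1 P2 fin.
have C0 : 0 <= C by move: P1 P2; lc; lra.
have s1 : P * b <= C * (e * h) by apply: (@le_trans _ _ (C * b)); [rewrite ler_wpM2r | rewrite ler_wpM2l].
have s2 : m0 * lam * a <= m0 * lam * (e * h) by rewrite ler_wpM2l// mulr_ge0.
have s3 : - (m0 / 2 * P * D2) <= m0 * C * (e * h).
  have : - P * D2 <= C * (e * h).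
    apply: (@le_trans _ _ (C * D2)); first by rewrite ler_wpM2r//; move: P1; lc; lra.
    rewrite ler_wpM2l//; apply: (le_trans D2h); by rewrite expr2 ler_wpM2r ?(ltW h0).
  move=> h1; have m20 : 0 <= m0 / 2 by lc; lra.
  have := ler_wpM2l m20 h1; have := mulr_ge0 m00 (mulr_ge0 C0 (mulr_ge0 (ltW e0) (ltW h0))); lc; lra.
have s4 : - Q * (tau - m0 * beta) <= - Q * ((k - e - m0) * h).
  rewrite !mulNr lerN2 ler_pM2l//; have := ler_wpM2l m00 beh; move: tk; lc; lra.
have s5 := mulr_ge0 l0 th0.
have s6 := ltr_pM2r h0 (e * (Q + C + m0 * lam + m0 * C)) (Q * (k - m0)); rewrite fin in s6.
move: s1 s2 s3 s4 s5 s6; lc => s1 s2 s3 s4 s5 s6; lra.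
Qed.

End RollingAlg.

(** * Variation of the disc inequality *)

Section NoMin.
Variables (R : realType) (K : R) (g : R -> vec3 R) (L : R) (o : vec3 R) (del s r : R).
Hypotheses (K0 : 0 <= K) (ov : oval K g L o del s r).
Local Notation V := (vec3 R).
Local Notation q := (Num.sqrt K).
Local Notation N := (nK K).
Local Notation sp := (supp K g o del).
Local Notation tg x n := (frameT s (N (g x)) n).

(** Nonnegative when [g u] lies in the disc of curvature [m0] tangent at [g t] with inner normal
    [n]. *)
Definition roll (m0 u t : R) (n : V) : R :=
  dot3 (g u - g t) n - m0 / 2 * dot3 (g u - g t) (g u - g t).

Section Local.
Variables (kappa m0 u t : R).
Hypotheses (hk : ae_curv K g o del s kappa) (m00 : 0 <= m0) (mk : m0 < kappa).

(** An exact identity, no expansion: [P] is the product of the unit normals at [g u] and [g t], and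
    the remaining factors are the variables of [first_order_neg] and [second_order_neg]. *)
Lemma roll_change (n : V) (y : R) (m : V) : sp t n -> sp y m ->
  let v : V := g u - g t in let D : V := g y - g t in
  let x := dot3 v v in let P := 1 - K * x / 2 in
  roll m0 u y m - roll m0 u t n =
  - dot3 v (tg t n) * (- dot3 m (tg t n) - m0 * dot3 D (tg t n)) - dot3 v n * (1 - dot3 m n)
  + P * - dot3 D m + m0 * dot3 v n * dot3 D n - m0 / 2 * P * dot3 D D.
Proof.
move=> [nn Nn _ _] [mm Nm _ _] v D x P.
have par := frame_parseval (ov_s ov) (ov_NN ov t) nn Nn.
have vN : dot3 v (N (g t)) = q * x / 2 by rewrite (SK_chord (ov_SK ov t) (ov_SK ov u)).
have DN : dot3 D (N (g t)) = q * dot3 D D / 2 by rewrite (SK_chord (ov_SK ov t) (ov_SK ov y)).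
have mN : dot3 m (N (g t)) = q * dot3 D m by rewrite dotC (dot_N t Nm).
rewrite /roll; have -> : g u - g y = v - D by rewrite /v /D; apply: vec3P; rewrite !vE; ring.
rewrite -/v -/x; have vm := par v m; have vD := par v D; rewrite vN mN in vm; rewrite vN DN in vD.
clearbody v D.
rewrite !(dotDl v) !(dotDr v) !dotNl !dotNr (dotC D v) -/x vm vD.
have -> : P = 1 - q * q * x / 2 by rewrite /P sqK.
by field.
Qed.

(** A small step to the right lowers [roll], at first order if [Q > 0] and at second order if
    [Q = 0]. In the second case [roll < 0] is what makes [P - lam * kappa] negative. *)
Lemma no_min_frame (n : V) : right_frame K g o del s r t n -> 0 <= dot3 (g u - g t) (tg t n) ->
  roll m0 u t n < 0 -> (forall y m, sp y m -> roll m0 u t n <= roll m0 u y m) -> False.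
Proof.
move=> rf Q0 H0 Hmin; have [spn _ _ _ _] := rf.
have [nn Nn np _] := spn; have q0 := sqrtr_ge0 K.
have mk' := mk; have m00' := m00; have K0' := K0.
pose v : V := g u - g t; pose x : R := dot3 v v; pose P : R := 1 - K * x / 2.
pose lam := dot3 v n; pose Q := dot3 v (tg t n); rewrite -/v -/Q in Q0.
have lam0 : 0 <= lam := np u.
have x0 : 0 <= x := dot_ge0 v.
have TT : dot3 (tg t n) (tg t n) = 1 by exact: (frameTT (ov_s ov) (ov_NN ov t) nn Nn).
have par := frame_parseval (ov_s ov) (ov_NN ov t) nn Nn.
have xE : x = Q ^+ 2 + lam ^+ 2 + K * x ^+ 2 / 4.
  rewrite {1}/x par (SK_chord (ov_SK ov t) (ov_SK ov u)) -/v -/x -/Q -/lam.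
  transitivity (Q ^+ 2 + lam ^+ 2 + q * q * x ^+ 2 / 4); first by field.
  by rewrite sqK.
have km : 0 < kappa - m0 by lra.
have k0 : 0 < kappa by lra.
have data (e : R) : 0 < e -> e <= 1 / 2 -> e < kappa -> exists h tau th a b beta eta D2 : R,
   [/\ [/\ 0 < h, h <= e, 0 <= th, th <= e ^+ 2 / 2 & tau ^+ 2 / 2 <= th],
       [/\ 0 <= a, a <= e * h, 0 <= b & b <= e * h],
       [/\ 0 <= beta, beta <= h, eta <= e & b * (1 - eta) = beta * tau - (1 - th) * a],
       [/\ (kappa - e) * h ^+ 2 / 2 <= b, (kappa - e) * h <= tau, D2 <= h ^+ 2 & (1 - 2 * e) * h ^+ 2 <= D2] &
       0 <= - Q * (tau - m0 * beta) - lam * th + P * b + m0 * lam * a - m0 / 2 * P * D2].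
  move=> e0 e2 ek.
  have [dl dl0 hl] := local_turn K0 ov hk e0 ek rf.
  have K1 : 0 < K + 1 by lc; lra.
  have [h [h0 h1 h2 h3 _]] := small4 (divr_gt0 dl0 (ltr0n R 2)) e0 (divr_gt0 e0 K1) e0.
  have [m spm] := ov_supp ov (t + h).
  have [mn tk bk Dh] := hl (t + h) m ltac:((lz; lra)) ltac:((move: h1; lz; lra)) spm.
  have hE : t + h - t = h by ring.
  rewrite hE in tk bk Dh.
  have [mm Nm mp _] := spm.
  pose D : V := g (t + h) - g t; rewrite -/D in bk Dh.
  pose tau : R := - dot3 m (tg t n); pose th : R := 1 - dot3 m n; pose a : R := dot3 D n; pose b : R := - dot3 D m.
  pose beta := dot3 D (tg t n); pose eta := K * dot3 D D / 2; pose D2 := dot3 D D.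
  have Dl : norm3 D <= h by have := ov_lip K0 ov t (t + h); rewrite hE gtr0_norm.
  have D0 := norm3_ge0 D.
  have D2h : D2 <= h ^+ 2 by rewrite /D2 -norm3_sq lerXn2r ?nnegrE// ltW.
  have a0 : 0 <= a := np _.
  have b0 : 0 <= b by have := mp t; rewrite -(opprB (g (t + h))) dotNl.
  have bth : beta <= h by apply: le_trans Dl; have := dot_le D (tg t n); rewrite (norm3_unit TT) mulr1.
  have bth1 : (1 - e) * h <= beta.
    have : - (e * h) <= dot3 (D - h *: tg t n) (tg t n).
      by apply: le_trans (dot_ge _ _); rewrite (norm3_unit TT) mulr1 lerN2.
    by rewrite dotDl dotNl dotZl TT -/beta; lz; lra.
  have nE : norm3 (m - n) ^+ 2 = 2 * th.
    by rewrite norm3_sq !(dotDl, dotDr, dotNl, dotNr) mm nn (dotC n m) /th; ring.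
  have th0 : 0 <= th by have := sqr_ge0 (norm3 (m - n)); rewrite nE; lz; lra.
  have the : th <= e ^+ 2 / 2.
    have : norm3 (m - n) ^+ 2 <= e ^+ 2 by rewrite lerXn2r ?nnegrE ?norm3_ge0// ltW.
    by rewrite nE; lz; lra.
  have mN : dot3 m (N (g t)) = q * dot3 D m by rewrite dotC (dot_N t Nm).
  have taut : tau ^+ 2 / 2 <= th.
    have e1 : 1 = tau ^+ 2 + (1 - th) ^+ 2 + dot3 m (N (g t)) ^+ 2.
      by rewrite -[LHS]mm par /tau /th; ring.
    have := sqr_ge0 (dot3 m (N (g t))); have := sqr_ge0 th; move: e1.
    by rewrite sqrrB; lc; move: (dot3 m (N (g t)) ^+ 2) (tau ^+ 2) (th ^+ 2) => A B C; lz; lra.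
  have Dn : a + b <= e * h.
    have -> : a + b = - dot3 D (m - n) by rewrite dotDr dotNr /a /b; ring.
    rewrite -dotNl; apply: (le_trans (dot_le _ _)); rewrite norm3N mulrC.
    by apply: ler_pM => //; rewrite norm3_ge0.
  have rel : b * (1 - eta) = beta * tau - (1 - th) * a.
    have e1 : dot3 D m = - (beta * tau) + a * (1 - th) - q * D2 / 2 * (q * b).
      by rewrite par mN (SK_chord (ov_SK ov t) (ov_SK ov _)) -/D /beta /tau /a /th /b /D2; ring.
    have e2' : b = beta * tau - a * (1 - th) + q * q * D2 / 2 * b.
      by rewrite {1}/b e1; ring.
    rewrite sqK// in e2'; rewrite /eta -/D2; move: e2'; lz; lra.
  have etae : eta <= e.
    have a1 : D2 <= h.
      apply: (le_trans D2h); rewrite expr2 -[X in _ <= X]mulr1 ler_pM2l//; move: h2 e2; lz; lra.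
    have a2 : h * (K + 1) <= e by rewrite -ler_pdivlMr.
    have := ler_wpM2l K0 a1; have := mulr_ge0 K0 (dot_ge0 D); rewrite /eta -/D2; move: a2 H0; lz; lra.
  have D2l : (1 - 2 * e) * h ^+ 2 <= D2.
    apply: (@le_trans _ _ (((1 - e) * h) ^+ 2)).
      by rewrite exprMn ler_wpM2r ?sqr_ge0//; have := sqr_ge0 e; rewrite sqrrB; lz; lra.
    have : beta ^+ 2 <= D2 by have := cauchy_sq D (tg t n); rewrite TT mulr1.
    apply: le_trans; rewrite lerXn2r ?nnegrE//; first by rewrite mulr_ge0 ?(ltW h0)//; move: e2; lz; lra.
    by apply: le_trans bth1; rewrite mulr_ge0 ?(ltW h0)//; move: e2; lz; lra.
  exists h, tau, th, a, b, beta, eta, D2; split.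
  - by split.
  - by split=> //; move: Dn b0 a0; lz; lra.
  - by split=> //; apply: le_trans bth1; rewrite mulr_ge0 ?(ltW h0)//; move: e2; lz; lra.
  - by split.
  have := Hmin _ m spm; rewrite -subr_ge0 (roll_change spn spm) -/v -/D -/x -/P -/Q -/lam.
  by rewrite -/tau -/beta -/th -/a -/b -/D2.
have [C [C1 C2 C0]] : exists C : R, [/\ - C <= P, P <= C & 0 <= C].
  exists `|P|; split; rewrite ?normr_ge0 ?ler_norm//.
  by have := ler_norm (- P); rewrite normrN; lz; lra.
move: Q0; rewrite le_eqVlt => /orP[/eqP/esym Q0|Q0]; last first.
  have W0 : 0 < Q + C + m0 * lam + m0 * C + 1.
    by have := mulr_ge0 m00 lam0; have := mulr_ge0 m00 C0; move: H0; lz; lra.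
  have QK : 0 < Q * (kappa - m0) by rewrite mulr_gt0.
  have [e [e0 e1 e2 e3 _]] := small4 (divr_gt0 ltr01 (ltr0n R 2)) (divr_gt0 k0 (ltr0n R 2)) (divr_gt0 QK W0) ltr01.
  have [h [tau [th [a [b [beta [eta [D2 [[h0 he th0 the tt] [a0 ae b0 be] [be0 beh ee rel] [bk tk D2h D2l] fin]]]]]]]]] :=
    data e e0 e1 ltac:((move: e2; lz; lra)).
  have D20 : 0 <= D2 by apply: le_trans D2l; rewrite mulr_ge0 ?sqr_ge0//; move: e1; lz; lra.
  have := @first_order_neg _ kappa m0 lam P Q e h tau th a b beta D2 C h0 e0 he lam0 m00 Q0 th0 a0 b0 ae be beh tk D20 D2h C1 C2.
  have : e * (Q + C + m0 * lam + m0 * C + 1) <= Q * (kappa - m0) by rewrite -ler_pdivlMr.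
  by move=> h1 /(_ ltac:(move: h1; lz; lra)); rewrite ltNge fin.
have xH : lam < m0 / 2 * x by move: H0; rewrite /roll -/v -/lam -/x; lc; lra.
rewrite Q0 expr0n /= add0r in xE.
(* With [Q = lam = 0] the point [g u] is the antipode of [g t]: [K * x = 4] and [P = - 1]. *)
have [l0|l0] := leP lam 0.
  have lz : lam = 0 by apply: le_anti; rewrite l0 lam0.
  have x1 : x != 0 by apply/eqP => xz; move: xH; rewrite xz mulr0 lz ltxx.
  have Kx : K * x = 4.
    apply: (mulIf x1); move: xE; rewrite lz expr0n /= add0r => xE.
    have -> : K * x * x = 4 * (K * x ^+ 2 / 4) by field.
    by rewrite -xE.
  have [e [e0 e1 e2 e3 _]] := small4 (divr_gt0 ltr01 (ltr0n R 2)) (divr_gt0 k0 (ltr0n R 2)) (divr_gt0 km (ltr0n R 2)) ltr01.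
  have [h [tau [th [a [b [beta [eta [D2 [[h0 he th0 the tt] [a0 ae b0 be] [be0 beh ee rel] [bk tk D2h D2l] fin]]]]]]]]] :=
    data e e0 e1 ltac:((move: e2; lz; lra)).
  move: fin; rewrite Q0 lz /P Kx => fin.
  have h20 : 0 < h ^+ 2 by rewrite exprn_gt0.
  have := ler_wpM2l m00 D2h; have := ltr_pM2r h20 m0 (kappa - e).
  have -> : (m0 < kappa - e) = true by move: e3; lz; lra.
  move: bk fin H0; lz; lra.
(* For [Q = 0] the decomposition of [x] reads [x * (P + 1) = 2 * lam ^+ 2], and [roll < 0] bounds
   [lam] by [m0 / 2 * x]. *)
have Am : P + 1 < m0 * lam.
  have x1 : 0 < x.
    rewrite lt_neqAle x0 andbT eq_sym; apply/eqP => xz; move: xH; rewrite xz mulr0; lz; lra.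
  rewrite -(ltr_pM2l x1).
  have h1 : lam * lam < lam * (m0 / 2 * x) by rewrite ltr_pM2l.
  have h2 : x * (P + 1) = 2 * lam ^+ 2.
    have -> : lam ^+ 2 = x - K * x ^+ 2 / 4 by move: xE; lz; lra.
    by rewrite /P; field.
  by rewrite h2 expr2; move: h1; lz; lra.
pose W := 3 * m0 * lam * kappa + 2 * m0 * C + 1.
have ml0 : 0 <= m0 * lam by rewrite mulr_ge0.
have W1 : 0 <= m0 * lam * kappa by rewrite mulr_ge0// ltW.
have W0 : 0 < W by rewrite /W; have := mulr_ge0 m00 C0; move: W1; lz; lra.
have [e [e0 e1 e2 e3 e4]] := small4 (divr_gt0 ltr01 (ltr0n R 2)) (divr_gt0 km (mulr_gt0 (ltr0n R 2) (ltr_pwDl ltr01 m00)))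
   (divr_gt0 (divr_gt0 km (ltr0n R 4)) W0) (divr_gt0 ltr01 (ltr_pwDl ltr01 ml0)).
have e2' : e * (2 * (1 + m0)) <= kappa - m0 by rewrite -ler_pdivlMr// mulr_gt0// ltr_pwDl.
have e4' : e * (1 + m0 * lam) <= 1 by rewrite -ler_pdivlMr// ltr_pwDl.
have e3' : e * W <= (kappa - m0) / 4 by rewrite -ler_pdivlMr.
have em0 := mulr_ge0 (ltW e0) m00.
have [h [tau [th [a [b [beta [eta [D2 [[h0 he th0 the tt] [a0 ae b0 be] [be0 beh ee rel] [bk tk D2h D2l] fin]]]]]]]]] :=
    data e e0 e1 ltac:(move: e2' em0; lz; lra).
have k1m : m0 * (1 + e) <= kappa - e by move: e2' em0; lz; lra.
have tau0 : 0 <= tau.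
  by apply: le_trans tk; rewrite mulr_ge0 ?(ltW h0)//; move: e2' em0; lz; lra.
have PG : P <= m0 * lam * (1 - e) by move: e4' Am; lz; lra.
have neg : (kappa - e - m0) * (P - lam * (kappa - e)) + e * (3 * m0 * lam * (kappa - e) + 2 * m0 * C) < 0.
  have s1 : P - lam * (kappa - e) <= - 1.
    have : m0 <= kappa - e by move: k1m em0; lz; lra.
    by move=> hm; have := ler_wpM2l lam0 hm; move: Am; lz; lra.
  have s2 : (kappa - m0) / 2 <= kappa - e - m0 by move: e2' em0; lz; lra.
  have s3 : (kappa - e - m0) * (P - lam * (kappa - e)) <= - (kappa - e - m0).
    by rewrite -[X in _ <= X]mulr1 mulNr -mulrN ler_wpM2l//; move: s2 km; lz; lra.
  have s4 : e * (3 * m0 * lam * (kappa - e) + 2 * m0 * C) <= e * W.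
    rewrite ler_pM2l// /W; have := mulr_ge0 ml0 (ltW e0); lz; lra.
  by move: s2 s3 s4 e3' km; lz; lra.
have := @second_order_neg _ (kappa - e) m0 lam P e h tau th a b beta eta D2 C C2 C0 h0 e0 e1 l0 m00 a0 b0 th0 tau0 the tt be0 beh ee rel bk tk D2h D2l k1m PG neg.
move=> hneg; move: fin hneg; rewrite Q0; lz; lra.
Qed.

(** The minimizing normal may be replaced by the right limit [n']: rotating to [n'] changes [lam]
    into [c * lam - a * Q <= lam], so minimality over the normals at [t] forces equality, and [Q']
    stays nonnegative. *)
Lemma no_min_right (n : V) : sp t n -> 0 <= dot3 (g u - g t) (tg t n) ->
  roll m0 u t n < 0 -> (forall y m, sp y m -> roll m0 u t n <= roll m0 u y m) -> False.
Proof.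
move=> spn Q0 H0 Hmin.
have [n' rf] := right_frame_exists K0 ov t.
have [spn' pos _ _ _] := rf.
have [nn Nn np nd] := spn; have [nn' Nn' np' nd'] := spn'.
have del0 := ov_del ov.
pose v : V := g u - g t; rewrite -/v in Q0.
pose a := dot3 n (tg t n'); pose c := dot3 n n'.
have a0 : 0 <= a := pos n spn.
have par := frame_parseval (ov_s ov) (ov_NN ov t) nn' Nn'.
have ac : a ^+ 2 + c ^+ 2 = 1 by rewrite -nn par (dotC n (N _)) Nn /a /c; ring.
pose Q := dot3 v (tg t n); pose lam := dot3 v n.
pose Q' := dot3 v (tg t n'); pose lam' := dot3 v n'.
have QE : Q = Q' * c - lam' * a.
  by rewrite /Q frameTE dotZr (frame_orient s v n nn' Nn').
have lE : lam = Q' * a + lam' * c.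
  by rewrite /lam par (dotC n (N _)) Nn mulr0 addr0.
have lam0 : 0 <= lam := np u.
have lam0' : 0 <= lam' := np' u.
have c1 : c <= 1 by have := sqr_ge0 a; move: ac; lc; nra.
have min1 : lam <= lam'.
  by have := Hmin t n' spn'; rewrite /roll -/v -/lam -/lam'; lc; lra.
have l'E : lam' = c * lam - a * Q.
  rewrite QE lE; transitivity ((a ^+ 2 + c ^+ 2) * lam'); first by rewrite ac mul1r.
  by ring.
have Q'E : Q' = a * lam + c * Q.
  rewrite QE lE; transitivity ((a ^+ 2 + c ^+ 2) * Q'); first by rewrite ac mul1r.
  by ring.
have aQ : 0 <= a * Q by rewrite mulr_ge0.
have cl : 0 <= (1 - c) * lam by rewrite mulr_ge0// subr_ge0.
have aQ0 : a * Q = 0 by move: l'E min1 aQ cl; lc; lra.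
have cl0 : (1 - c) * lam = 0 by move: l'E min1 aQ cl; lc; lra.
have ll : lam' = lam by move: l'E aQ0 cl0; lc; lra.
have Q'0 : 0 <= Q'.
  rewrite Q'E; have [c0|c0] := leP 0 c.
    by rewrite addr_ge0// mulr_ge0.
  have lz : lam = 0.
    by move/eqP: cl0; rewrite mulf_eq0 => /orP[/eqP h|/eqP//]; move: h c0; lc; lra.
  move/eqP: aQ0; rewrite mulf_eq0 => /orP[/eqP az|/eqP ->]; last by rewrite lz !mulr0 addr0.
  exfalso; have cz : c = - 1.
    move: ac; rewrite az expr0n /= add0r => /eqP; rewrite sqrf_eq1 => /orP[/eqP h|/eqP//].
    by move: h c0; lc; lra.
  have dec := frame_decomp (ov_s ov) (ov_NN ov t) nn' Nn' n.
  move: dec; rewrite -/a -/c az cz (dotC n (N _)) Nn !scale0r add0r addr0 scaleN1r => nE.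
  by move: nd; rewrite nE dotNr; move: nd' del0; lc; lra.
have rE : roll m0 u t n' = roll m0 u t n by rewrite /roll -/v -/lam -/lam' ll.
by apply: (no_min_frame rf Q'0); rewrite rE.
Qed.
End Local.
End NoMin.

(** * Existence of a minimum and the rolling theorem *)

Section Rolling.
Variables (R : realType) (K : R) (g : R -> vec3 R) (L : R) (o : vec3 R) (del s r : R).
Hypotheses (K0 : 0 <= K) (ov : oval K g L o del s r).
Local Notation V := (vec3 R).
Local Notation q := (Num.sqrt K).
Local Notation N := (nK K).
Local Notation sp := (supp K g o del).
Local Notation tg x n := (frameT s (N (g x)) n).
Local Notation W := 'rV[R]_4.
Local Notation i0 := (inord 0 : 'I_4).
Local Notation i1 := (inord 1 : 'I_4).
Local Notation i2 := (inord 2 : 'I_4).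
Local Notation i3 := (inord 3 : 'I_4).
(** Pairs of a parameter and a normal are encoded as vectors with four coordinates, so that
    compactness of boxes applies. *)
Let vec (w : W) : V := mk3 (w ord0 i1) (w ord0 i2) (w ord0 i3).
Let enc (t : R) (n : V) : W :=
  \row_j (if (j : nat) == 0%N then t else if (j : nat) == 1%N then c0 n else
     if (j : nat) == 2%N then c1 n else c2 n).

Let encK (t : R) (n : V) : enc t n ord0 i0 = t /\ vec (enc t n) = n.
Proof.
rewrite /vec /enc !mxE !inordK//; split=> //.
by apply: vec3P; rewrite ?c0_mk ?c1_mk ?c2_mk.
Qed.

Let cont_coord (j : 'I_4) : continuous (fun w : W => w ord0 j).
Proof. exact: coord_continuous. Qed.

Let cont_comp (f : R -> R) (j : 'I_4) : continuous f -> continuous (fun w : W => f (w ord0 j)).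
Proof. by move=> cf w; apply: continuous_comp; [exact: cont_coord | exact: cf]. Qed.

Let cont_dot (A : R -> V) : continuous (fun t => c0 (A t)) -> continuous (fun t => c1 (A t)) ->
  continuous (fun t => c2 (A t)) -> continuous (fun w : W => dot3 (A (w ord0 i0)) (vec w)).
Proof.
move=> h0 h1 h2 w.
have -> : (fun w : W => dot3 (A (w ord0 i0)) (vec w)) = (fun w : W => c0 (A (w ord0 i0)) * w ord0 i1 +
   c1 (A (w ord0 i0)) * w ord0 i2 + c2 (A (w ord0 i0)) * w ord0 i3).
  by apply/funext => z; rewrite dotE /vec c0_mk c1_mk c2_mk.
have k0 := @cont_comp (fun t => c0 (A t)) i0 h0 w.
have k1 := @cont_comp (fun t => c1 (A t)) i0 h1 w.
have k2 := @cont_comp (fun t => c2 (A t)) i0 h2 w.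
have j1 := @cont_coord i1 w; have j2 := @cont_coord i2 w; have j3 := @cont_coord i3 w.
exact: (cvgD (cvgD (cvgM k0 j1) (cvgM k1 j2)) (cvgM k2 j3)).
Qed.

Let cont_affine (p : V) (k : R) : [/\ continuous (fun t => c0 (p - k *: g t)), continuous (fun t => c1 (p - k *: g t))
   & continuous (fun t => c2 (p - k *: g t))].
Proof.
have main (f : V -> R) : (forall u v, f (u - v) = f u - f v) -> (forall k u, f (k *: u) = k * f u) ->
    (forall u, `|f u| <= norm3 u) -> continuous (fun t => f (p - k *: g t)).
  move=> fB fZ fn; apply: (@lip_continuous _ _ `|k|) => x y.
  have -> : f (p - k *: g y) - f (p - k *: g x) = - (k * f (g y - g x)) by rewrite !fB !fZ; ring.
  by rewrite normrN normrM ler_wpM2l//; apply: le_trans (fn _) (ov_lip K0 ov x y).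
by split; apply: main => [u v|k' u|u]; rewrite ?c0D ?c0N ?c1D ?c1N ?c2D ?c2N ?c0Z ?c1Z ?c2Z//;
  case: (coord_norm u).
Qed.

Let cont_dot_affine (p : V) (k : R) : continuous (fun w : W => dot3 (p - k *: g (w ord0 i0)) (vec w)).
Proof. by have [h0 h1 h2] := cont_affine p k; exact: (@cont_dot (fun t => p - k *: g t)). Qed.

Let cont_sq (u : R) : continuous (fun w : W => dot3 (g u - g (w ord0 i0)) (g u - g (w ord0 i0))).
Proof.
apply: (@cont_comp (fun t => dot3 (g u - g t) (g u - g t))).
have [h0 h1 h2] := cont_affine (g u) 1.
have -> : (fun t => dot3 (g u - g t) (g u - g t)) = (fun t => c0 (g u - 1 *: g t) * c0 (g u - 1 *: g t) +
  c1 (g u - 1 *: g t) * c1 (g u - 1 *: g t) + c2 (g u - 1 *: g t) * c2 (g u - 1 *: g t)).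
  by apply/funext => t; rewrite !scale1r dotE.
exact: continuous_sum3.
Qed.

Let S := [set w : W | 0 <= w ord0 i0 <= L /\ sp (w ord0 i0) (vec w)].

Let closed_cont (f : W -> R) (D : set R) : continuous f -> closed D -> closed (f @^-1` D).
Proof. by move=> cf cD; apply: preimage_closed => // w _; exact: cf. Qed.

Let closed_S : closed S.
Proof.
have -> : S = ((fun w : W => w ord0 i0) @^-1` [set x | 0 <= x]) `&` ((fun w : W => w ord0 i0) @^-1` [set x | x <= L])
   `&` ((fun w : W => dot3 (vec w) (vec w)) @^-1` [set x | x = 1])
   `&` ((fun w : W => dot3 (N (g (w ord0 i0))) (vec w)) @^-1` [set x | x = 0])
   `&` (\bigcap_(u in [set: R]) ((fun w : W => dot3 (g u - g (w ord0 i0)) (vec w)) @^-1` [set x | 0 <= x]))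
   `&` ((fun w : W => dot3 (o - g (w ord0 i0)) (vec w)) @^-1` [set x | del <= x]).
  apply/seteqP; split=> w /=.
    by move=> [/andP[h1 h2] [h3 h4 h5 h6]]; do !split => //; move=> u _; exact: h5.
  by move=> [[[[[h1 h2] h3] h4] h5] h6]; split; [rewrite h1 h2 | split=> // u; exact: h5].
have cB (p : V) : continuous (fun w : W => dot3 (p - g (w ord0 i0)) (vec w)).
  have := @cont_dot_affine p 1.
  by have -> : (fun w : W => dot3 (p - 1 *: g (w ord0 i0)) (vec w)) = (fun w : W => dot3 (p - g (w ord0 i0)) (vec w))
    by apply/funext => w; rewrite scale1r.
have cN : continuous (fun w : W => dot3 (N (g (w ord0 i0))) (vec w)).
  have := @cont_dot_affine (mk3 0 0 1) q.
  by have -> : (fun w : W => dot3 (mk3 0 0 1 - q *: g (w ord0 i0)) (vec w)) = (fun w : W => dot3 (N (g (w ord0 i0))) (vec w))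
    by apply/funext => w; rewrite nKE.
have cn : continuous (fun w : W => dot3 (vec w) (vec w)).
  move=> w; have -> : (fun w : W => dot3 (vec w) (vec w)) = (fun w : W => w ord0 i1 * w ord0 i1 +
     w ord0 i2 * w ord0 i2 + w ord0 i3 * w ord0 i3).
    by apply/funext => z; rewrite dotE /vec c0_mk c1_mk c2_mk.
  have j1 := @cont_coord i1 w; have j2 := @cont_coord i2 w; have j3 := @cont_coord i3 w.
  exact: (cvgD (cvgD (cvgM j1 j1) (cvgM j2 j2)) (cvgM j3 j3)).
do !apply: closedI.
- by apply: closed_cont; [exact: cont_coord | exact: closed_ge].
- by apply: closed_cont; [exact: cont_coord | exact: closed_le].
- by apply: closed_cont; [exact: cn | exact: closed_eq].
- by apply: closed_cont; [exact: cN | exact: closed_eq].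
- apply: closed_bigI => u _; apply: closed_cont; [exact: cB | exact: closed_ge].
- by apply: closed_cont; [exact: cB | exact: closed_ge].
Qed.

Let compact_S : compact S.
Proof.
have L0 := ov_L ov.
pose A (j : 'I_4) : set R := [set` `[- (L + 1), L + 1] ].
apply: (subclosed_compact closed_S (@rV_compact R 4 A _)); first by move=> j; exact: segment_compact.
move=> w [/andP[w0 wL] [nn _ _ _]] j; rewrite /A /= in_itv /=.
have bd : `|w ord0 j| <= L + 1; last by rewrite -ler_norml.
have n1 := norm3_unit nn; have [b1 b2 b3] := coord_norm (vec w).
rewrite /vec c0_mk in b1; rewrite /vec c1_mk in b2; rewrite /vec c2_mk in b3.
rewrite -/(vec w) n1 in b1 b2 b3.
have jE : j = i0 \/ j = i1 \/ j = i2 \/ j = i3.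
  case: j => -[|[|[|[|j]]]] hj //; [left|right; left|right; right; left|right; right; right];
    by apply: val_inj; rewrite /= inordK.
case: jE => [->|[->|[->|->]]]; first by rewrite ger0_norm//; lra.
- by lra.
- by lra.
- by lra.
Qed.

Lemma roll_min (m0 u : R) : exists t n, sp t n /\ forall y m, sp y m -> roll g m0 u t n <= roll g m0 u y m.
Proof.
have L0 := ov_L ov.
pose f (w : W) : R := roll g m0 u (w ord0 i0) (vec w).
have S0 : S !=set0.
  have [n spn] := ov_supp ov 0; have [e1 e2] := encK 0 n.
  by exists (enc 0 n); split; rewrite ?e1 ?e2// lexx ltW.
have cf : continuous f.
  move=> w; have h1 := @cont_dot_affine (g u) 1 w.
  suff h3 : continuous_at w (fun w : W => dot3 (g u - g (w ord0 i0)) (vec w)).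
    exact: (cvgB h3 (cvgM (@cvg_cst _ (m0 / 2) _ _ _) (@cont_sq u w))).
  move: h1; by have -> : (fun w : W => dot3 (g u - 1 *: g (w ord0 i0)) (vec w)) = (fun w : W => dot3 (g u - g (w ord0 i0)) (vec w))
    by apply/funext => z; rewrite scale1r.
have [w] := compact_EVT_min S0 compact_S (continuous_subspaceT cf).
rewrite inE => -[wL spw] hw.
exists (w ord0 i0), (vec w); split=> // y m spm.
have /andP[h1 h2] := floor_itv (y / L).
rewrite ler_pdivlMr// in h1; rewrite intrD ltr_pdivrMr// mulrDl mul1r in h2.
have [c [hc1 hc2]] : exists c : R, (forall z, g (z + c) = g z) /\ 0 <= y + c <= L.
  move: h1 h2; case: (Num.floor (y / L)) => i.
    rewrite -[(Posz i)%:~R]/(i%:R : R) => h1 h2; exists (- (i%:R * L)); split=> [z|]; first exact: (per_natN ov).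
    by move: h1 h2; move: (i%:R * L) => A; lra.
  rewrite -[(Negz i)%:~R]/(- (i.+1%:R) : R) mulNr => h1 h2; exists (i.+1%:R * L); split=> [z|]; first exact: (per_nat ov).
  by move: h1 h2; move: (i.+1%:R * L) => A; lra.
have [e1 e2] := encK (y + c) m.
have := hw (enc (y + c) m); rewrite /f e1 e2 /roll hc1 => -> //.
rewrite inE; split; rewrite e1 ?e2//.
by move: spm; rewrite /supp hc1.
Qed.

(** The gap between [m0] and [kappa] is what the strict inequalities at a minimum consume. If [g u]
    lies backwards from the minimizing point, the curve is reversed. *)
Theorem rolling (kappa m0 : R) : ae_curv K g o del s kappa -> 0 <= m0 -> m0 < kappa ->
  forall (u t : R) (n : V), sp t n -> m0 / 2 * dot3 (g u - g t) (g u - g t) <= dot3 (g u - g t) n.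
Proof.
move=> hk m00 mk u t n spn; rewrite leNgt; apply/negP => neg.
have [t1 [n1 [sp1 min1]]] := roll_min m0 u.
have H0 : roll g m0 u t1 n1 < 0 by apply: le_lt_trans (min1 t n spn) _; rewrite /roll subr_lt0.
have [Q0|Q0] := leP 0 (dot3 (g u - g t1) (tg t1 n1)).
  exact: (no_min_right K0 ov hk m00 mk sp1 Q0 H0 min1).
have ov' := oval_rev K0 ov.
have hr (y z : R) (m : V) : roll (fun t => g (- t)) m0 y z m = roll g m0 (- y) (- z) m by [].
have sp1' : supp K (fun t => g (- t)) o del (- t1) n1 by apply/supp_rev; rewrite opprK.
apply: (@no_min_right _ _ _ _ _ _ _ _ K0 ov' kappa m0 (- u) (- t1) (ae_curv_rev hk) m00 mk n1 sp1').
- by rewrite !opprK frameTNs dotNr oppr_ge0 ltW.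
- by rewrite hr !opprK.
- by move=> y m /supp_rev spm; rewrite !hr !opprK; exact: min1.
Qed.
End Rolling.

(** * Triangles and chords *)

Section Circum.
Variable R : realType.
Local Notation V := (vec3 R).

(** The circumcentre of [0], [P], [M] is [c / (2 * G)]. Its coefficients are nonnegative because the
    angles at [P] and [M] are not obtuse, so the two ball inequalities add up to a lower bound of
    [dot3 c w]; Cauchy's inequality turns it into one for the length of [c], which is related to the
    circumradius by [dot3 c c = G * S]. *)
Lemma circum_gram_ge (P M w : V) (rho2 : R) : 0 < rho2 -> dot3 w w = rho2 ->
  rho2 / 2 * dot3 P P <= dot3 P w -> rho2 / 2 * dot3 M M <= dot3 M w ->
  dot3 P M <= dot3 P P -> dot3 P M <= dot3 M M ->
  rho2 * (dot3 P P * dot3 M M * dot3 (M - P) (M - P)) <= 4 * (dot3 P P * dot3 M M - dot3 P M ^+ 2).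
Proof.
move=> r0 ww hP hM h1 h2.
pose u : R := dot3 P P; pose v : R := dot3 M M; pose p : R := dot3 P M.
rewrite -/u -/v -/p in hP hM h1 h2 *.
have u0 : 0 <= u := dot_ge0 P; have v0 : 0 <= v := dot_ge0 M.
have wE : dot3 (M - P) (M - P) = u + v - 2 * p.
  by rewrite (dotDl M) (dotDr M) (dotDr M) !dotNl !dotNr (dotC M P) -/u -/v -/p; ring.
rewrite wE; set S := u * v * (u + v - 2 * p); set G := u * v - p ^+ 2.
have S0 : 0 <= S by rewrite mulr_ge0 ?mulr_ge0//; lra.
have G0 : 0 <= G by rewrite subr_ge0; exact: cauchy_sq.
have [Sz|Sn] := eqVneq S 0; first by rewrite Sz mulr0 mulr_ge0.
have Sp : 0 < S by rewrite lt_neqAle eq_sym Sn S0.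
pose c : V := (v * (u - p)) *: P + (u * (v - p)) *: M.
have cc : dot3 c c = G * S.
  by rewrite /c (dotDl (_ *: P)) !(dotDr (_ *: P)) !dotZl !dotZr (dotC M P) -/u -/v -/p /G /S; ring.
have cw : rho2 / 2 * S <= dot3 c w.
  rewrite /c dotDl !dotZl.
  have a1 : v * (u - p) * (rho2 / 2 * u) <= v * (u - p) * dot3 P w by rewrite ler_wpM2l// mulr_ge0//; move: h1; lc; lra.
  have a2 : u * (v - p) * (rho2 / 2 * v) <= u * (v - p) * dot3 M w by rewrite ler_wpM2l// mulr_ge0//; move: h2; lc; lra.
  by rewrite /S; move: a1 a2; lc; lra.
have cs := cauchy_sq c w; rewrite cc ww in cs.
have l0 : 0 <= rho2 / 2 * S by rewrite mulr_ge0// divr_ge0// ltW.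
have sq : (rho2 / 2 * S) ^+ 2 <= dot3 c w ^+ 2 by rewrite lerXn2r ?nnegrE// (le_trans l0 cw).
have := le_trans sq cs.
have -> : (rho2 / 2 * S) ^+ 2 = rho2 * S * (rho2 * S) / 4 by field.
have -> : G * S * rho2 = rho2 * S * (4 * G) / 4 by field.
by rewrite ler_pM2r ?invr_gt0// ler_pM2l// mulr_gt0.
Qed.

Lemma dot_subC (x y : V) : dot3 (x - y) (x - y) = dot3 (y - x) (y - x).
Proof. by rewrite -[x - y]opprB dotNl dotNr opprK. Qed.

Lemma circ_inv_sqC (x y z : V) : circ_inv_sq x y z = circ_inv_sq y x z.
Proof. by rewrite !circ_inv_sqE (dot_subC x y); congr (_ / _); ring. Qed.

Lemma circ_inv_sq_rev (x y z : V) : circ_inv_sq x y z = circ_inv_sq z y x.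
Proof. by rewrite !circ_inv_sqE (dot_subC y z) (dot_subC x z) (dot_subC x y); congr (_ / _); ring. Qed.

Lemma asin_zero : asin 0 = 0 :> R.
Proof.
have z : 0 <= (0 : R) <= 1 by rewrite lexx ler01.
have [h0 _ _] := asin_itv z; have := asin_le_cube z; rewrite expr0n /= mulr0 addr0 => h1.
by apply: le_anti; rewrite h0 h1.
Qed.

(** In terms of sines the difference of the two sides is the product of
    [sin C ^+ 2 - sin (A + B) ^+ 2] and [sin C ^+ 2 - sin (A - B) ^+ 2]. Both factors are positive
    if [C > A + B]. *)
Lemma half_angle_triangle (A B C : R) : 0 <= A <= pi / 2 -> 0 <= B <= pi / 2 -> 0 <= C <= pi / 2 ->
  (forall x y z : R, x = sin A ^+ 2 -> y = sin B ^+ 2 -> z = sin C ^+ 2 ->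
   4 * (x * y * z) <= 2 * (x * y + y * z + z * x) - x ^+ 2 - y ^+ 2 - z ^+ 2) -> C <= A + B.
Proof.
move=> /andP[A0 A1] /andP[B0 B1] /andP[C0 C1] h; rewrite leNgt; apply/negP => CAB.
have pi0 := pi_gt0 R.
have sA := cos2Dsin2 A; have sB := cos2Dsin2 B.
have nn (x : R) : 0 <= x -> x <= pi / 2 -> 0 <= sin x /\ 0 <= cos x.
  by move=> x0 x1; split; [apply: sin_ge0_pi|apply: cos_ge0_pihalf]; apply/andP; split; move: x1; lc; lra.
have [a1 a2] := nn A A0 A1; have [b1 b2] := nn B B0 B1.
have AB0 : 0 <= A + B by rewrite addr_ge0.
have AB1 : A + B <= pi / 2 by lra.
have [d1 d2] := nn _ AB0 AB1.
have lt : sin (A + B) < sin C.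
  by rewrite ltr_sin// !in_itv /=; apply/andP; split; move: AB1 C1; lc; lra.
have := h _ _ _ erefl erefl erefl.
set x := sin A in sA a1 *; set y := sin B in sB b1 *; set z := sin C in lt *.
rewrite leNgt => /negP; apply.
have E : z ^+ 2 * (z ^+ 2) - 2 * z ^+ 2 * (x ^+ 2 + y ^+ 2 - 2 * x ^+ 2 * y ^+ 2) + (x ^+ 2 - y ^+ 2) ^+ 2 =
   (z ^+ 2 - (x * cos B + cos A * y) ^+ 2) * (z ^+ 2 - (x * cos B - cos A * y) ^+ 2).
  have cA : cos A ^+ 2 = 1 - x ^+ 2 by move: sA; lc; lra.
  have cB : cos B ^+ 2 = 1 - y ^+ 2 by move: sB; lc; lra.
  transitivity (z ^+ 2 * (z ^+ 2) - 2 * z ^+ 2 * (x ^+ 2 * cos B ^+ 2 + cos A ^+ 2 * y ^+ 2) + (x ^+ 2 * cos B ^+ 2 - cos A ^+ 2 * y ^+ 2) ^+ 2).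
    by rewrite cA cB; ring.
  by ring.
rewrite sinD -/x -/y in lt d1.
have p1 : 0 < z ^+ 2 - (x * cos B + cos A * y) ^+ 2.
  by rewrite subr_gt0 ltrXn2r ?nnegrE// (le_trans d1 (ltW lt)).
have p2 : 0 < z ^+ 2 - (x * cos B - cos A * y) ^+ 2.
  have := mulr_ge0 (mulr_ge0 a1 b2) (mulr_ge0 a2 b1); move: p1; lc; lra.
by have := mulr_gt0 p1 p2; rewrite -E; lc; lra.
Qed.

End Circum.

(** * Inscribed triangles and short arcs *)

Section Star.
Variables (R : realType) (K : R) (g : R -> vec3 R) (L : R) (o : vec3 R) (del s r : R).
Hypotheses (K0 : 0 <= K) (ov : oval K g L o del s r).
Local Notation V := (vec3 R).
Local Notation q := (Num.sqrt K).
Local Notation N := (nK K).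
Local Notation sp := (supp K g o del).

Definition in_discs (kappa : R) : Prop := forall (u t : R) (n : V), sp t n ->
  kappa / 2 * dot3 (g u - g t) (g u - g t) <= dot3 (g u - g t) n.

Lemma in_discs_of_ae (kappa : R) : 0 < kappa -> ae_curv K g o del s kappa -> in_discs kappa.
Proof.
move=> k0 hk u t n spn; have v0 := dot_ge0 (g u - g t).
rewrite -subr_ge0; apply: (@eps_ge0 _ _ (dot3 (g u - g t) (g u - g t))) => // e e0.
have [e1 [e10 h1 h2 _ _]] := small4 e0 k0 e0 e0.
have := rolling K0 ov hk (m0 := kappa - e1); rewrite subr_ge0 => /(_ h2) /(_ ltac:(lra)) /(_ u t n spn).
have := ler_wpM2r v0 h1; have := mulr_ge0 (ltW e10) v0; lc; lra.
Qed.

Variables (kappa rho : R).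
Hypotheses (k0 : 0 < kappa) (rho0 : 0 < rho) (rhoE : rho ^+ 2 = kappa ^+ 2 + K) (disc : in_discs kappa).

(** The tangent disc is cut out of S_K by the Euclidean ball of radius [1 / rho] with centre
    [g t + rho ^- 2 *: w]; the second clause says that the curve lies in this ball. *)
Lemma disc_vector (t : R) : exists w : V, dot3 w w = rho ^+ 2 /\
  forall u, rho ^+ 2 / 2 * dot3 (g u - g t) (g u - g t) <= dot3 (g u - g t) w.
Proof.
have [n spn] := ov_supp ov t; have [nn Nn _ _] := spn.
have NN := ov_NN ov t.
exists (kappa *: n + q *: N (g t)); split.
  rewrite (dotDl (kappa *: n)) !(dotDr (kappa *: n)) !dotZl !dotZr nn NN Nn (dotC n (N _)) Nn rhoE.
  by transitivity (kappa ^+ 2 + q * q); [ring | rewrite sqK].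
move=> u; rewrite (dotDr (kappa *: n)) !dotZr (SK_chord (ov_SK ov t) (ov_SK ov u)) rhoE.
have := ler_wpM2l (ltW k0) (disc u spn).
have : q * q * dot3 (g u - g t) (g u - g t) = K * dot3 (g u - g t) (g u - g t) by rewrite sqK.
lc; lra.
Qed.

Lemma circ_ge (a b c : R) : g a <> g b -> g b <> g c -> g c <> g a ->
  rho ^+ 2 <= circ_inv_sq (g a) (g b) (g c).
Proof.
have main (x y z : R) : g x <> g y -> g y <> g z -> g z <> g x ->
   dot3 (g y - g x) (g y - g x) <= dot3 (g z - g y) (g z - g y) ->
   dot3 (g z - g x) (g z - g x) <= dot3 (g z - g y) (g z - g y) -> rho ^+ 2 <= circ_inv_sq (g x) (g y) (g z).
  move=> xy yz zx l1 l2; have [w [ww hw]] := disc_vector x.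
  have pos (p p' : V) : p <> p' -> 0 < dot3 (p' - p) (p' - p).
    by move=> hp; apply: dot_gt0; rewrite subr_eq0 eq_sym; apply/eqP.
  have u0 := pos _ _ xy; have w0 := pos _ _ yz; have v0 := pos _ _ zx; rewrite dot_subC in v0.
  have zy : g z - g y = (g z - g x) - (g y - g x) by apply: vec3P; rewrite !vE; ring.
  have := @circum_gram_ge _ (g y - g x) (g z - g x) w (rho ^+ 2) (exprn_gt0 2 rho0) ww (hw y) (hw z).
  rewrite -zy /circ_inv_sq ler_pdivlMr ?mulr_gt0//; apply.
    move: l2; rewrite zy (dotDl (g z - g x)) !(dotDr (g z - g x)) !dotNl !dotNr (dotC (g z - g x) (g y - g x)).
    by move: u0 v0; lc; lra.
  move: l1; rewrite zy (dotDl (g z - g x)) !(dotDr (g z - g x)) !dotNl !dotNr (dotC (g z - g x) (g y - g x)).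
  by move: u0 v0; lc; lra.
move=> ab bc ca.
pose u := dot3 (g b - g a) (g b - g a); pose v := dot3 (g c - g a) (g c - g a); pose w := dot3 (g c - g b) (g c - g b).
have [h1|h1] := leP u w; have [h2|h2] := leP v w.
- exact: main.
- rewrite circ_inv_sqC; apply: main; rewrite ?(dot_subC (g a) (g b)) -/u -/v -/w//; try (exact: nesym); by move: h1 h2; lc; lra.
- rewrite circ_inv_sq_rev; apply: main; rewrite ?(dot_subC (g b) (g c)) ?(dot_subC (g a) (g b)) ?(dot_subC (g a) (g c)) -/u -/v -/w//; try (exact: nesym); by move: h1 h2; lc; lra.
have [h3|h3] := leP u v.
  rewrite circ_inv_sqC; apply: main; rewrite ?(dot_subC (g a) (g b)) -/u -/v -/w//; try (exact: nesym); by move: h1 h2; lc; lra.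
rewrite circ_inv_sq_rev; apply: main; rewrite ?(dot_subC (g b) (g c)) ?(dot_subC (g a) (g b)) ?(dot_subC (g a) (g c)) -/u -/v -/w//; try (exact: nesym); by move: h1 h2 h3; lc; lra.
Qed.

Lemma chord_rho (x y : R) : rho * norm3 (g y - g x) <= 2.
Proof.
have [w [ww hw]] := disc_vector x; have c0 := norm3_ge0 (g y - g x).
have wn : norm3 w = rho by rewrite /norm3 ww sqrtr_sqr gtr0_norm.
have := le_trans (hw y) (dot_le _ _); rewrite wn -norm3_sq.
have [->|cn] := eqVneq (norm3 (g y - g x)) 0; first by rewrite mulr0.
have cp : 0 < rho * norm3 (g y - g x) by rewrite mulr_gt0// lt_neqAle eq_sym cn c0.
by move=> h; rewrite -(ler_pM2r cp); move: h; move: (norm3 _) => c; lc; lra.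
Qed.

Let be (x y : R) : R := asin (rho * norm3 (g y - g x) / 2).

Let be_itv (x y : R) : [/\ 0 <= be x y, be x y <= pi / 2 & sin (be x y) = rho * norm3 (g y - g x) / 2].
Proof.
apply: asin_itv; have := chord_rho x y; have := mulr_ge0 (ltW rho0) (norm3_ge0 (g y - g x)); lc => *.
by apply/andP; split; lra.
Qed.

Let be_triangle (x y z : R) : be x z <= be x y + be y z.
Proof.
have [A0 A1 sA] := be_itv x y; have [B0 B1 sB] := be_itv y z; have [C0 C1 sC] := be_itv x z.
have be0 (u v : R) : g u = g v -> be u v = 0.
  by move=> e; rewrite /be e subrr norm3_0 mulr0 mul0r asin_zero.
have [e1|n1] := pselect (g x = g y); first by (have -> : be x z = be y z by rewrite /be e1); rewrite lerDr.
have [e2|n2] := pselect (g y = g z); first by (have -> : be x z = be x y by rewrite /be e2); rewrite lerDl.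
have [e3|n3] := pselect (g z = g x); first by rewrite (be0 x z)// addr_ge0.
apply: half_angle_triangle; rewrite ?A0 ?B0 ?C0//= => a b c -> -> ->.
have := circ_ge n1 n2 n3; rewrite circ_inv_sqE.
have pos (p p' : V) : p <> p' -> 0 < dot3 (p' - p) (p' - p).
  by move=> hp; apply: dot_gt0; rewrite subr_eq0 eq_sym; apply/eqP.
have u0 := pos _ _ n1; have w0 := pos _ _ n2; have v0 := pos _ _ n3; rewrite dot_subC in v0.
rewrite ler_pdivlMr ?mulr_gt0// => h.
rewrite sA sB sC; have sq (p : V) : (rho * norm3 p / 2) ^+ 2 = rho ^+ 2 / 4 * dot3 p p.
  by rewrite -norm3_sq; field.
rewrite !sq; move: h; move: (dot3 _ _) (dot3 (g z - g x) _) (dot3 (g z - g y) _) => u v w h.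
have r4 : 0 <= rho ^+ 4 / 16 by rewrite divr_ge0// exprn_ge0// ltW.
have := ler_wpM2l r4 h; lc; lra.
Qed.

Lemma chord_le_carc (x t : R) : x <= t -> rho * (t - x) <= pi -> norm3 (g t - g x) <= carc rho (t - x).
Proof.
move=> xt rl.
have B : be x t <= rho * (t - x) / 2.
  have step (y z : R) : y < z -> rho * (z - y) / 2 <= 1 -> be y z <= rho * (z - y) / 2 + 5 * (rho * (z - y) / 2) ^+ 3.
    move=> yz r1; have yz0 : 0 < z - y by rewrite subr_gt0.
    have p0 : 0 <= rho * (z - y) / 2 by rewrite divr_ge0// mulr_ge0// ltW.
    apply: le_trans (asin_le_cube _); last by rewrite p0.
    apply: ler_asin => //; first by rewrite divr_ge0// mulr_ge0 ?norm3_ge0// ltW.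
    rewrite ler_pM2r ?invr_gt0// ler_pM2l//.
    by have := ov_lip K0 ov y z; rewrite gtr0_norm.
  have small (e : R) : 0 < e -> exists2 d : R, 0 < d & forall y z : R, y < z -> z < y + d -> be y z <= (rho / 2 + e) * (z - y).
    move=> e0.
    have r3 : 0 < 1 + rho ^+ 3 by rewrite ltr_pwDl// exprn_ge0// ltW.
    have [d [d0 d1 d2 d3 _]] := small4 (divr_gt0 e0 r3) (divr_gt0 ltr01 rho0) ltr01 ltr01.
    exists d => // y z yz zd; pose h : R := z - y.
    have h0 : 0 < h by rewrite /h subr_gt0.
    have hd : h <= d by rewrite /h; lra.
    have dr : d * rho <= 1 by rewrite -ler_pdivlMr.
    have de : d * (1 + rho ^+ 3) <= e by rewrite -ler_pdivlMr.
    have hr : rho * h <= 1 by have := ler_wpM2l (ltW rho0) hd; lra.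
    apply: (le_trans (step y z yz _)); rewrite -/h; first (move: hr; lc; lra).
    have -> : 5 * (rho * h / 2) ^+ 3 = 5 / 8 * rho ^+ 3 * h * h * h by field.
    have r30 : 0 <= rho ^+ 3 by rewrite exprn_ge0// ltW.
    have a1 : rho ^+ 3 * h * h <= e.
      have a2 : rho ^+ 3 * h <= e by have := ler_wpM2l r30 hd; move: de; lc; lra.
      have h1 : h <= 1 by move: d3 hd; lc; lra.
      have a3 : 0 <= rho ^+ 3 * h by rewrite mulr_ge0// ltW.
      have := ler_wpM2l a3 h1; move: a2; lc; lra.
    have := ler_wpM2r (ltW h0) a1; have := mulr_gt0 e0 h0; lc; lra.
  have := @dini_le _ (be x) x t (rho / 2) xt.
  have -> : be x x = 0 by rewrite /be subrr norm3_0 mulr0 mul0r asin_zero.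
  rewrite subr0 => H; have -> : rho * (t - x) / 2 = rho / 2 * (t - x) by ring.
  apply: H => y _ e e0; have [d d0 hd] := small e e0; exists d => // z _; split=> /andP[h1 h2].
    by have := hd y z h1 h2; have := be_triangle x y z; lc; lra.
  have := hd z y h2 ltac:((move: h1; lc; lra)); have := be_triangle x z y; lc; lra.
have [b0 b1 bs] := be_itv x t.
have pi0 := pi_gt0 R.
have tx0 : 0 <= rho * (t - x) by rewrite mulr_ge0 ?subr_ge0// ltW.
have : sin (be x t) <= sin (rho * (t - x) / 2).
  rewrite leNgt; apply/negP; rewrite ltr_sin ?in_itv /=.
  - by move: B; lra.
  - by apply/andP; split; lra.
  - by apply/andP; split; move: b1; lc; lra.
rewrite bs carcE ler_pdivlMr//; lra.
Qed.

End Star.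

(** * Twist of the moving frame *)

Section RotAlg.
Variable R : realType.
Local Notation V := (vec3 R).

Lemma cross_cross (a b c d : V) : dot3 (cross a b) (cross c d) = dot3 a c * dot3 b d - dot3 a d * dot3 b c.
Proof. by rewrite !vE; ring. Qed.

Lemma cross_crossl (a b c : V) : cross (cross a b) c = dot3 a c *: b - dot3 b c *: a.
Proof. by apply: vec3P; rewrite !vE; ring. Qed.

Lemma crossC (a b : V) : cross a b = - cross b a.
Proof. by apply: vec3P; rewrite !vE; ring. Qed.

Lemma crossZr (k : R) (a b : V) : cross a (k *: b) = k *: cross a b.
Proof. by apply: vec3P; rewrite !vE; ring. Qed.

Lemma crossZl (k : R) (a b : V) : cross (k *: a) b = k *: cross a b.
Proof. by apply: vec3P; rewrite !vE; ring. Qed.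

Section Frame.
Variables (s : R) (m n : V).
Hypotheses (ss : s * s = 1) (mm : dot3 m m = 1) (nn : dot3 n n = 1) (mn : dot3 m n = 0).
Local Notation T := (frameT s m n).

Lemma cross_Tm : s *: cross T m = n.
Proof.
by rewrite frameTE crossZl cross_crossl mm (dotC n m) mn scale0r subr0 scalerA ss !scale1r.
Qed.

Lemma cross_nT : s *: cross n T = m.
Proof.
rewrite frameTE crossZr crossC cross_crossl mn nn scale0r sub0r opprK scalerA ss !scale1r //.
Qed.

Lemma tilt_frame (al be : R) : al ^+ 2 + be ^+ 2 = 1 ->
  let nu := al *: n + be *: m in let M := al *: m - be *: n in
  [/\ dot3 M M = 1, dot3 nu nu = 1, dot3 M nu = 0 & frameT s M nu = T].
Proof.
move=> ab nu M; split.
- rewrite /M (dotDl (al *: m)) !(dotDr (al *: m)) !dotNl !dotNr !dotZl !dotZr mm nn mn (dotC n m) mn -[RHS]ab; ring.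
- rewrite /nu (dotDl (al *: n)) !(dotDr (al *: n)) !dotZl !dotZr mm nn mn (dotC n m) mn -[RHS]ab; ring.
- rewrite /nu /M (dotDl (al *: m)) !(dotDr (al *: n)) !dotNl !dotZl !dotZr mm nn mn (dotC n m) mn; ring.
rewrite !frameTE; congr (_ *: _); rewrite -[RHS]scale1r -ab /M /nu.
by apply: vec3P; rewrite !vE; ring.
Qed.
End Frame.

(** The rows are the vectors of one frame in the coordinates of another of the same orientation. The
    fields are the relations of a rotation matrix that the identities below need, in the form in
    which linear arithmetic combines them. *)
Record rotation (t1 t2 t3 n1 n2 n3 m1 m2 m3 : R) : Prop := Rotation {
  rot_c1 : t1 ^+ 2 + n1 ^+ 2 + m1 ^+ 2 = 1;
  rot_c2 : t2 ^+ 2 + n2 ^+ 2 + m2 ^+ 2 = 1;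
  rot_c3 : t3 ^+ 2 + n3 ^+ 2 + m3 ^+ 2 = 1;
  rot_c23 : t2 * t3 + n2 * n3 + m2 * m3 = 0;
  rot_r1 : t1 ^+ 2 + t2 ^+ 2 + t3 ^+ 2 = 1;
  rot_r2 : n1 ^+ 2 + n2 ^+ 2 + n3 ^+ 2 = 1;
  rot_r3 : m1 ^+ 2 + m2 ^+ 2 + m3 ^+ 2 = 1;
  rot_r13 : t1 * m1 + t2 * m2 + t3 * m3 = 0;
  rot_r23 : n1 * m1 + n2 * m2 + n3 * m3 = 0;
  rot_t1 : t1 = n2 * m3 - n3 * m2;
  rot_t2 : t2 = n3 * m1 - n1 * m3;
  rot_t3 : t3 = n1 * m2 - n2 * m1;
  rot_n3 : n3 = m1 * t2 - m2 * t1;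
  rot_m2 : m2 = t3 * n1 - t1 * n3;
  rot_m3 : m3 = t1 * n2 - t2 * n1 }.

Lemma frame_rotation (s : R) (m n m0 n0 : V) : s * s = 1 -> dot3 m m = 1 -> dot3 n n = 1 -> dot3 m n = 0 ->
  dot3 m0 m0 = 1 -> dot3 n0 n0 = 1 -> dot3 m0 n0 = 0 ->
  let T := frameT s m n in let T0 := frameT s m0 n0 in
  rotation (dot3 T T0) (dot3 T n0) (dot3 T m0) (dot3 n T0) (dot3 n n0) (dot3 n m0)
    (dot3 m T0) (dot3 m n0) (dot3 m m0).
Proof.
move=> ss mm nn mn mm0 nn0 mn0 T T0.
have par := frame_parseval ss mm nn mn; have par0 := frame_parseval ss mm0 nn0 mn0.
have TT : dot3 T T = 1 by exact: frameTT.
have TT0 : dot3 T0 T0 = 1 by exact: frameTT.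
have Tm : dot3 T m = 0 by exact: frameTm.
have nm : dot3 n m = 0 by rewrite dotC.
have nm0 : dot3 n0 m0 = 0 by rewrite dotC.
have TE : T = s *: cross m n by exact: frameTE.
have TE0 : T0 = s *: cross m0 n0 by exact: frameTE.
have nE : n = s *: cross T m by rewrite cross_Tm.
have nE0 : n0 = s *: cross T0 m0 by rewrite cross_Tm.
have mE : m = s *: cross n T by rewrite cross_nT.
have mE0 : m0 = s *: cross n0 T0 by rewrite cross_nT.
have bc (a b c d : V) : dot3 (s *: cross a b) (s *: cross c d) = dot3 a c * dot3 b d - dot3 a d * dot3 b c.
  by rewrite dotZl dotZr mulrA ss mul1r cross_cross.
rewrite -/T in par; rewrite -/T0 in par0; clearbody T T0; split.
- by rewrite -TT0 (par T0 T0) !(dotC T0); ring.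
- by rewrite -nn0 (par n0 n0) !(dotC n0); ring.
- by rewrite -mm0 (par m0 m0) !(dotC m0); ring.
- by rewrite -nm0 (par n0 m0) !(dotC n0) !(dotC m0); ring.
- by rewrite -TT (par0 T T); ring.
- by rewrite -nn (par0 n n); ring.
- by rewrite -mm (par0 m m); ring.
- by rewrite -Tm (par0 T m); ring.
- by rewrite -nm (par0 n m); ring.
- by rewrite {1}TE {1}TE0 bc; ring.
- by rewrite {1}TE {1}nE0 bc; ring.
- by rewrite {1}TE {1}mE0 bc; ring.
- by rewrite {1}nE {1}mE0 bc; ring.
- by rewrite {1}mE {1}nE0 bc; ring.
- by rewrite {1}mE {1}mE0 bc; ring.
Qed.

Section Reals.
Variables t1 t2 t3 n1 n2 n3 m1 m2 m3 : R.
Hypothesis rot : rotation t1 t2 t3 n1 n2 n3 m1 m2 m3.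
Let a := t1 + n2.
Let b := t2 - n1.
Let d := 1 + m3 - t1 - n2.

(** [a] and [b] are [1 + m3] times the cosine and the sine of the twist, and [d] is [1 + m3] times
    one minus the cosine. *)
Lemma twist_norm : a ^+ 2 + b ^+ 2 = (1 + m3) ^+ 2.
Proof. by case: rot => *; rewrite /a /b; lra. Qed.

(** While the frame rotates at unit rate about its third vector, [b' = a] and [d' = b]; this is the
    numerator of the derivative of [b / d]. *)
Lemma twist_wronski : a * d - b ^+ 2 = - (1 + m3) * d.
Proof. by have := twist_norm; rewrite /a /b /d; lra. Qed.

Lemma twist_tan : d ^+ 2 + b ^+ 2 = 2 * (1 + m3) * d.
Proof. by have := twist_norm; rewrite /a /b /d; lra. Qed.

Lemma twist_cross : b * (t3 + m1) = d * (n3 - m2).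
Proof. by case: rot => *; rewrite /b /d; lra. Qed.

Lemma twist_sum : (n3 + m2) ^+ 2 = d * (1 + n2 - t1 - m3).
Proof. by case: rot => *; rewrite /d; lra. Qed.

End Reals.

Section Corner.
Variables t1 t2 t3 p1 p2 p3 N1 N2 N3 al be : R.
Hypothesis rot : rotation t1 t2 t3 p1 p2 p3 N1 N2 N3.
Hypothesis ab : al ^+ 2 + be ^+ 2 = 1.
Let k0 := 1 + al * N3 - be * N2.
Let k1 := - (be * p3 + t1 + al * p2).
Let k2 := be * t3 - p1 + al * t2.
Let b0 := - be * N1.
Let b1 := t2 - al * p1.

(** [k0 + k1 * cos phi + k2 * sin phi] is [twist_d] at a normal rotated by [phi] ([rotate_d]). The
    identity says that it has a double zero. *)
Lemma corner_norm : k0 ^+ 2 = k1 ^+ 2 + k2 ^+ 2.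
Proof.
case: rot => c1 c2 c3 c23 r1 r2 r3 r13 r23 et1 et2 et3 en3 em2 em3.
have e1 : be ^+ 2 * (t3 ^+ 2 + p3 ^+ 2 + N3 ^+ 2) = be ^+ 2 by rewrite c3 mulr1.
have e2 : al ^+ 2 * (t2 ^+ 2 + p2 ^+ 2 + N2 ^+ 2) = al ^+ 2 by rewrite c2 mulr1.
have e3 : al * be * (t2 * t3 + p2 * p3 + N2 * N3) = 0 by rewrite c23 mulr0.
have e4 : (al ^+ 2 + be ^+ 2) * (N2 ^+ 2 + N3 ^+ 2) = N2 ^+ 2 + N3 ^+ 2 by rewrite ab mul1r.
have e5 : al * N3 = al * (t1 * p2 - t2 * p1) by rewrite -em3.
have e6 : be * N2 = be * (t3 * p1 - t1 * p3) by rewrite -em2.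
have ab' := ab; rewrite /k0 /k1 /k2; move: ab' c2 c3 e1 e2 e3 e4 e5 e6 r1 r2; lc; lra.
Qed.

Lemma corner_mixed : b0 * k1 - b1 * k0 = - (al + N3) * k2.
Proof.
case: rot => c1 c2 c3 c23 r1 r2 r3 r13 r23 et1 et2 et3 en3 em2 em3.
have e1 : be * (t1 * N1 + t2 * N2 + t3 * N3) = 0 by rewrite r13 mulr0.
have e2 : be ^+ 2 * t2 = be ^+ 2 * (p3 * N1 - p1 * N3) by rewrite -et2.
have e3 : al * be * t3 = al * be * (p1 * N2 - p2 * N1) by rewrite -et3.
have e4 : (al ^+ 2 + be ^+ 2) * t2 = t2 by rewrite ab mul1r.
have e5 : (al ^+ 2 + be ^+ 2) * (N3 * p1) = N3 * p1 by rewrite ab mul1r.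
rewrite /b0 /b1 /k0 /k1 /k2; move: e1 e2 e3 e4 e5; lc; lra.
Qed.

Hypothesis rot' : rotation t1 t2 t3 (al * p1 + be * N1) (al * p2 + be * N2) (al * p3 + be * N3)
   (al * N1 - be * p1) (al * N2 - be * p2) (al * N3 - be * p3).

(** The numerator of the derivative of the twist quotient when the normal is rotated at a fixed
    point: [k0 + k1] and [b0 + b1] are its denominator and numerator, [k2] and [p2 + al * t1] their
    derivatives. *)
Lemma corner_wronski : (k0 + k1) * (p2 + al * t1) - (b0 + b1) * k2 = - (k0 + k1) * (al + N3).
Proof.
have h1 := twist_wronski rot'; have h2 := twist_cross rot'.
have h1' : al * ((t1 + (al * p2 + be * N2)) *
     (1 + (al * N3 - be * p3) - t1 - (al * p2 + be * N2)) -
     (t2 - (al * p1 + be * N1)) ^+ 2) = al * (- (1 + (al * N3 - be * p3)) *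
     (1 + (al * N3 - be * p3) - t1 - (al * p2 + be * N2))) by rewrite h1.
have h2' : be * ((t2 - (al * p1 + be * N1)) * (t3 + (al * N1 - be * p1))) =
   be * ((1 + (al * N3 - be * p3) - t1 - (al * p2 + be * N2)) *
     (al * p3 + be * N3 - (al * N2 - be * p2))) by rewrite h2.
pose D := k0 + k1; pose B := b0 + b1.
have e1 : (al ^+ 2 + be ^+ 2) * (D * p2) = D * p2 by rewrite ab mul1r.
have e2 : (al ^+ 2 + be ^+ 2) * (B * p1) = B * p1 by rewrite ab mul1r.
have e3 : (al ^+ 2 + be ^+ 2) * (D * N3) = D * N3 by rewrite ab mul1r.
rewrite /D /B /k0 /k1 /b0 /b1 in e1 e2 e3; rewrite /k0 /k1 /k2 /b0 /b1.
(move: e1 e2 e3 h1' h2'; lc; lra).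
Qed.
End Corner.
End RotAlg.

Lemma ge1_of_sqr (R : realType) (x : R) : 0 <= x -> 1 <= x ^+ 2 -> 1 <= x.
Proof.
move=> x0; apply: contraLR; rewrite -!ltNge => x1; rewrite expr2.
by apply: (le_lt_trans _ x1); apply: ler_piMr => //; exact: ltW.
Qed.

Section TwistDef.
Variables (R : realType) (K : R) (g : R -> vec3 R) (s kappa rho x0 : R) (n0 : vec3 R).
Local Notation V := (vec3 R).
Local Notation q := (Num.sqrt K).
Local Notation N := (nK K).
Local Notation tg x n := (frameT s (N (g x)) n).

(** The moving frame tilted about its tangent. On a circle of curvature [kappa] the Frenet equations
    become [T' = rho nu], [nu' = - rho T], and the axis is constant. *)
Definition disc_nu (t : R) (n : V) : V := (kappa / rho) *: n + (q / rho) *: N (g t).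
Definition disc_axis (t : R) (n : V) : V := (kappa / rho) *: N (g t) - (q / rho) *: n.
(* If theta is the twist about the axis of the frame at [t] relative to the one at [x0], then
   twist_b = 2 sin theta, twist_d = 2 (1 - cos theta) up to a common positive factor,
   and twist = cot (theta / 2). *)
Definition twist_b (t : R) (n : V) : R :=
  dot3 (tg t n) (disc_nu x0 n0) - dot3 (disc_nu t n) (tg x0 n0).
Definition twist_d (t : R) (n : V) : R :=
  1 + dot3 (disc_axis t n) (disc_axis x0 n0) - dot3 (tg t n) (tg x0 n0) - dot3 (disc_nu t n) (disc_nu x0 n0).
Definition twist (t : R) (n : V) : R := twist_b t n / twist_d t n.
End TwistDef.

Section Twist.
Variables (R : realType) (K : R) (g : R -> vec3 R) (L : R) (o : vec3 R) (del s r : R).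
Hypotheses (K0 : 0 <= K) (ov : oval K g L o del s r).
Variables (kappa rho x0 : R) (n0 : vec3 R).
Local Notation V := (vec3 R).
Local Notation q := (Num.sqrt K).
Local Notation N := (nK K).
Local Notation sp := (supp K g o del).
Local Notation tg x n := (frameT s (N (g x)) n).
Hypotheses (k0 : 0 < kappa) (rho0 : 0 < rho) (rhoE : rho ^+ 2 = kappa ^+ 2 + K).
Hypotheses (disc : in_discs K g o del kappa) (sp0 : sp x0 n0).
Local Notation nu := (disc_nu K g kappa rho).
Local Notation ax := (disc_axis K g kappa rho).
Local Notation tb := (twist_b K g s kappa rho x0 n0).
Local Notation td := (twist_d K g s kappa rho x0 n0).
Local Notation al := (kappa / rho).
Local Notation be := (q / rho).
Local Notation T0 := (tg x0 n0).
Local Notation nu0 := (nu x0 n0).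
Local Notation ax0 := (ax x0 n0).

Lemma tilt_sq : al ^+ 2 + be ^+ 2 = 1.
Proof.
rewrite !expr_div_n sqr_sqrtr// -mulrDl -rhoE divff//.
by rewrite expf_neq0// lt0r_neq0.
Qed.

Lemma tilt_gt0 : [/\ 0 < al, 0 <= be & al * q = be * kappa].
Proof. by split; [rewrite divr_gt0 | rewrite divr_ge0 ?sqrtr_ge0// ltW | rewrite mulrAC [RHS]mulrAC (mulrC kappa)]. Qed.

Lemma tilt_supp (t : R) (n : V) : sp t n ->
  [/\ dot3 (ax t n) (ax t n) = 1, dot3 (nu t n) (nu t n) = 1, dot3 (ax t n) (nu t n) = 0
    & frameT s (ax t n) (nu t n) = tg t n].
Proof. by move=> [nn Nn _ _]; exact: (tilt_frame s (ov_NN ov t) nn Nn tilt_sq). Qed.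

Lemma disc_rotation (t : R) (n : V) : sp t n ->
  rotation (dot3 (tg t n) T0) (dot3 (tg t n) nu0) (dot3 (tg t n) ax0)
    (dot3 (nu t n) T0) (dot3 (nu t n) nu0) (dot3 (nu t n) ax0)
    (dot3 (ax t n) T0) (dot3 (ax t n) nu0) (dot3 (ax t n) ax0).
Proof.
move=> spn; have [h1 h2 h3 h4] := tilt_supp spn; have [k1 k2 k3 k4] := tilt_supp sp0.
by have := frame_rotation (ov_s ov) h1 h2 h3 k1 k2 k3; rewrite /= h4 k4.
Qed.

Lemma normal_rotation (t : R) (n : V) : sp t n ->
  rotation (dot3 (tg t n) T0) (dot3 (tg t n) nu0) (dot3 (tg t n) ax0)
    (dot3 n T0) (dot3 n nu0) (dot3 n ax0)
    (dot3 (N (g t)) T0) (dot3 (N (g t)) nu0) (dot3 (N (g t)) ax0).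
Proof.
move=> [nn Nn _ _]; have [k1 k2 k3 k4] := tilt_supp sp0.
by have := frame_rotation (ov_s ov) (ov_NN ov t) nn Nn k1 k2 k3; rewrite /= k4.
Qed.

Lemma nu_dot (t : R) (n u : V) : dot3 (nu t n) u = al * dot3 n u + be * dot3 (N (g t)) u.
Proof. by rewrite /disc_nu dotDl !dotZl. Qed.

Lemma ax_dot (t : R) (n u : V) : dot3 (ax t n) u = al * dot3 (N (g t)) u - be * dot3 n u.
Proof. by rewrite /disc_axis dotDl dotNl !dotZl. Qed.

Lemma N_tilt (t : R) (n u : V) : dot3 (N (g t)) u = al * dot3 (ax t n) u + be * dot3 (nu t n) u.
Proof.
rewrite nu_dot ax_dot.
by transitivity ((al ^+ 2 + be ^+ 2) * dot3 (N (g t)) u); [rewrite tilt_sq mul1r | ring].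
Qed.

Lemma n_tilt (t : R) (n u : V) : dot3 n u = al * dot3 (nu t n) u - be * dot3 (ax t n) u.
Proof.
rewrite nu_dot ax_dot.
by transitivity ((al ^+ 2 + be ^+ 2) * dot3 n u); [rewrite tilt_sq mul1r | ring].
Qed.

(** On the unit normals the tangent disc is the cap about [ax t n] with cosine of radius [al]; the
    bound is the disc inequality multiplied by [be]. *)
Lemma axis_ge (t y : R) (n : V) : sp t n -> al <= dot3 (N (g y)) (ax t n).
Proof.
move=> spn; have [nn Nn _ _] := spn; have q0 := sqrtr_ge0 K.
have [al0 be0 ab] := tilt_gt0.
have -> : N (g y) = N (g t) - q *: (g y - g t) by rewrite !nKE; apply: vec3P; rewrite !vE; ring.
rewrite (dotDl (N (g t))) dotNl dotZl dotC ax_dot (ov_NN ov) (dotC n) Nn dotC ax_dot.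
rewrite (dotC (N (g t)) (g y - g t)) (dotC n (g y - g t)) (SK_chord (ov_SK ov t) (ov_SK ov y)).
have := ler_wpM2l be0 (disc y spn).
set x := dot3 (g y - g t) (g y - g t); set l := dot3 (g y - g t) n => h.
have e1 : al * (q * x / 2) <= be * l.
  apply: le_trans h; have -> : al * (q * x / 2) = al * q * x / 2 by field; exact: lt0r_neq0.
  by rewrite ab; have -> // : be * kappa * x / 2 = be * (kappa / 2 * x) by field; exact: lt0r_neq0.
have := ler_wpM2l q0 e1; lra.
Qed.

(** By [twist_tan] the value is nonnegative once [1 + m3 > 0]. If it vanished, [axis_ge] at both
    points would make the axes equal and then the frames, so [n = n0]; the discs at the two points
    would bound [dot3 (g t - g x0) n] from opposite sides. *)
Lemma twist_d_gt0 (t : R) (n : V) : sp t n -> g t <> g x0 -> 0 < td t n.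
Proof.
move=> spn gt; have [al0 be0 _] := tilt_gt0; have ab := tilt_sq; have k0' := k0.
have rot := disc_rotation spn.
have h1 := axis_ge t sp0; rewrite (N_tilt t n) in h1.
have h2 := axis_ge x0 spn; rewrite (N_tilt x0 n0) (dotC ax0) (dotC nu0) in h2.
have TE := twist_tan rot; have SE := twist_sum rot.
have : td t n = 1 + dot3 (ax t n) ax0 - dot3 (tg t n) T0 - dot3 (nu t n) nu0 by [].
case: rot => c1 c2 c3 c23 r1 r2 r3 _ _ _ _ _ _ _ _.
move=> tdE; rewrite -tdE in TE SE.
have nn0E : dot3 n n0 = al * (al * dot3 (nu t n) nu0 - be * dot3 (nu t n) ax0)
    - be * (al * dot3 (ax t n) nu0 - be * dot3 (ax t n) ax0).
  by rewrite (n_tilt t n) 2!(dotC _ n0) !(n_tilt x0 n0) !(dotC nu0) !(dotC ax0).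
move: h1 h2 TE SE tdE c1 c2 c3 r1 r2 r3 nn0E.
move: (dot3 (tg t n) T0) (dot3 (tg t n) nu0) (dot3 (tg t n) ax0) (dot3 (nu t n) T0) (dot3 (nu t n) nu0) (dot3 (nu t n) ax0)
  (dot3 (ax t n) T0) (dot3 (ax t n) nu0) (dot3 (ax t n) ax0) => t1 t2 t3 n1 n2 n3 m1 m2 m3.
move: (td t n) => d h1 h2 TE SE tdE cc1 cc2 c3 r1 r2 r3 nn0E.
have sq0 (x y z w : R) : x ^+ 2 + y ^+ 2 + z ^+ 2 = w -> z ^+ 2 = w -> x = 0 /\ y = 0.
  move=> e1 e2; have : x ^+ 2 + y ^+ 2 = 0 by move: e1 e2; lc; lra.
  by move/eqP; rewrite paddr_eq0 ?sqr_ge0// !sqrf_eq0 => /andP[/eqP -> /eqP ->].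
have le1 (x y z : R) : x ^+ 2 + y ^+ 2 + z ^+ 2 = 1 -> z <= 1 /\ - 1 <= z.
  move=> e1; have : z ^+ 2 <= 1 ^+ 2 by have := sqr_ge0 x; have := sqr_ge0 y; rewrite expr1n; move: e1; lc; lra.
  by rewrite expr1n => h; split; nra.
have [m31 m32] := le1 _ _ _ c3.
have m3p : 0 < 1 + m3.
  rewrite ltNge; apply/negP => h; have m3E : m3 = - 1 by move: h m32; lc; lra.
  have [_ n3E] := sq0 _ _ _ _ c3 ltac:(by rewrite m3E sqrrN expr1n).
  move: h1; rewrite m3E n3E; lc; lra.
have dn : d != 0.
  apply/eqP => d0; rewrite d0 mul0r in SE.
  have nm : n3 + m2 = 0 by move/eqP: SE; rewrite sqrf_eq0 => /eqP.
  have m3E : m3 = 1.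
    have e2 : be * (n3 + m2) = 0 by rewrite nm mulr0.
    have : al * 1 <= al * m3 by move: e2 h1 h2; lc; lra.
    by rewrite ler_pM2l// => h; move: h m31; lc; lra.
  have [_ n3E] := sq0 _ _ _ _ c3 ltac:(by rewrite m3E expr1n).
  have [_ m2E] := sq0 _ _ _ _ r3 ltac:(by rewrite m3E expr1n).
  have [t11 _] : t1 <= 1 /\ - 1 <= t1 by apply: (le1 t3 t2); move: r1; lc; lra.
  have [n21 _] : n2 <= 1 /\ - 1 <= n2 by apply: (le1 n1 n3); move: r2; lc; lra.
  have n2E : n2 = 1 by move: d0 m3E n21 t11 tdE; lc; lra.
  have [nn _ _ _] := spn; have [nn0 _ _ _] := sp0.
  have nnE : dot3 n n0 = 1 by rewrite nn0E n2E n3E m2E m3E; move: ab; lc; lra.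
  have ne : n = n0.
    apply/eqP; rewrite -subr_eq0 -dot_eq0; apply/eqP.
    by rewrite (dotDl n) !(dotDr n) !dotNl !dotNr nn nn0 (dotC n0 n) nnE; ring.
  have d1 := disc x0 spn; have d2 := disc t sp0.
  rewrite -ne (dot_subC (g t)) -[g t - g x0]opprB dotNl in d2.
  apply: gt; apply/esym/eqP; rewrite -subr_eq0 -dot_eq0 eq_le dot_ge0 andbT.
  by rewrite -(ler_pM2l k0) mulr0; move: d1 d2; lc; lra.
rewrite lt_neqAle eq_sym dn /= leNgt; apply/negP => dneg.
have : 2 * (1 + m3) * d < 0 by rewrite pmulr_rlt0// mulr_gt0.
by rewrite -TE ltNge addr_ge0// sqr_ge0.
Qed.

Lemma rotate_frame (t : R) (n : V) (C S : R) : sp t n ->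
  tg t (C *: n - S *: tg t n) = C *: tg t n + S *: n.
Proof.
move=> [nn Nn _ _].
have e := cross_Tm (ov_s ov) (ov_NN ov t) Nn.
have key (T : V) : s *: cross (N (g t)) (C *: n - S *: T) =
    C *: (s *: cross (N (g t)) n) + S *: (s *: cross T (N (g t))).
  by apply: vec3P; rewrite !vE; ring.
by rewrite (frameTE s (N (g t)) (_ - _)) (key (tg t n)) e -frameTE.
Qed.

Section Rotate.
Variables (t : R) (n : V) (C S : R).
Hypothesis spn : sp t n.
Let n' : V := C *: n - S *: tg t n.
Let t1 : R := dot3 (tg t n) T0.
Let t2 : R := dot3 (tg t n) nu0.
Let t3 : R := dot3 (tg t n) ax0.
Let p1 : R := dot3 n T0.
Let p2 : R := dot3 n nu0.
Let p3 : R := dot3 n ax0.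
Let N1 : R := dot3 (N (g t)) T0.
Let N2 : R := dot3 (N (g t)) nu0.
Let N3 : R := dot3 (N (g t)) ax0.

Lemma rotate_b : tb t n' = - be * N1 + C * (t2 - al * p1) + S * (p2 + al * t1).
Proof.
rewrite /twist_b nu_dot rotate_frame// /n' (dotDl (C *: tg t n)) (dotDl (C *: n)) dotNl !dotZl.
by rewrite -/t1 -/t2 -/p1 -/p2 -/N1; ring.
Qed.

Lemma rotate_d : td t n' = 1 + al * N3 - be * N2 + C * - (be * p3 + t1 + al * p2) + S * (be * t3 - p1 + al * t2).
Proof.
rewrite /twist_d nu_dot ax_dot rotate_frame// /n' (dotDl (C *: tg t n)) !(dotDl (C *: n)) !dotNl !dotZl.
by rewrite -/t1 -/t2 -/t3 -/p1 -/p2 -/p3 -/N2 -/N3; ring.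
Qed.
End Rotate.

(* The normals between [n] and [n'] are supporting too.  As [twist_d] is, up to a positive factor,
   the square of an affine function of [tan (phi / 2)], it would vanish at one of them if this
   affine function changed sign. *)
Lemma twist_corner (t : R) (n n' : V) : sp t n -> sp t n' -> g t <> g x0 ->
  0 <= dot3 n (tg t n') -> tb t n' / td t n' <= tb t n / td t n.
Proof.
move=> spn spn' gt S0.
have [nn Nn np nd] := spn; have [nn' Nn' np' nd'] := spn'.
have del0 := ov_del ov; have [al0 be0 _] := tilt_gt0.
pose T : V := tg t n; pose T' : V := tg t n'.
have TT : dot3 T T = 1 by exact: (frameTT (ov_s ov) (ov_NN ov t) nn Nn).
have Tn : dot3 T n = 0 by exact: frameTn.
have TN : dot3 T (N (g t)) = 0 by exact: frameTm.
pose S : R := dot3 n T'; pose C : R := dot3 n n'; rewrite -/T' -/S in S0.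
have nE : n = C *: n' - (- S) *: T'.
  have := frame_decomp (ov_s ov) (ov_NN ov t) nn' Nn' n.
  by rewrite -/T' -/S -/C (dotC n (N _)) Nn scale0r addr0 scaleNr opprK addrC.
have TE : T = C *: T' - S *: n'.
  by rewrite /T {1}nE rotate_frame// scaleNr.
have CS : C ^+ 2 + S ^+ 2 = 1.
  rewrite -nn (frame_parseval (ov_s ov) (ov_NN ov t) nn' Nn' n n) -/T' -/S -/C (dotC n (N _)) Nn; ring.
have n'E : n' = C *: n - S *: T.
  rewrite -[LHS]scale1r -CS {1}nE TE; clearbody C S T'; apply: vec3P; rewrite !vE; ring.
have C1 : C <= 1 by have := sqr_ge0 S; move: CS; lc; nra.
have Cm : 0 < 1 + C.
  rewrite ltNge; apply/negP => h; have CE : C = - 1 by have := sqr_ge0 S; move: CS h; lc; nra.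
  have SE : S = 0 by move: CS; rewrite CE sqrrN expr1n => h'; apply/eqP; rewrite -sqrf_eq0; apply/eqP; move: h'; lc; lra.
  by move: nd'; rewrite n'E CE SE scale0r subr0 scaleN1r dotNr; move: nd del0; lc; lra.
have d0 := twist_d_gt0 spn gt; have d0' := twist_d_gt0 spn' gt.
have bE (c z : R) := @rotate_b t n c z spn; have dE' (c z : R) := @rotate_d t n c z spn.
have rot := normal_rotation spn.
have rot' := disc_rotation spn; rewrite !(nu_dot t n) !(ax_dot t n) in rot'.
have cn := corner_norm rot tilt_sq; have cm := corner_mixed rot tilt_sq.
have cw := corner_wronski tilt_sq rot'.
have ge := axis_ge t sp0.
have b1E := bE 1 0; have d1E := dE' 1 0; rewrite !scale1r !scale0r !subr0 in b1E d1E.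
have bCE := bE C S; have dCE := dE' C S; rewrite -/T -n'E in bCE dCE.
move: cn cm cw ge b1E d1E bCE dCE dE'.
move: (dot3 (tg t n) T0) (dot3 (tg t n) nu0) (dot3 (tg t n) ax0) (dot3 n T0) (dot3 n nu0) (dot3 n ax0)
  (dot3 (N (g t)) T0) (dot3 (N (g t)) nu0) (dot3 (N (g t)) ax0) => t1 t2 t3 p1 p2 p3 N1 N2 N3.
pose k_0 : R := 1 + al * N3 - be * N2; pose k_1 : R := - (be * p3 + t1 + al * p2).
pose k_2 : R := be * t3 - p1 + al * t2; pose b_0 : R := - be * N1; pose b_1 : R := t2 - al * p1; pose b_2 : R := p2 + al * t1.
rewrite -/k_0 -/k_1 -/k_2 -/b_0 -/b_1 -/b_2.
clearbody k_0 k_1 k_2 b_0 b_1 b_2 => cn cm cw ge b1E d1E bCE dCE dE'.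
rewrite !mul1r !mul0r !addr0 in b1E d1E.
(* For [S > 0] this is [S] times the affine function [td t n + U * k_2], where [U = S / (1 + C)] is
   the tangent of half the angle from [n] to [n']. *)
have P0 : 0 <= (1 - C) * k_2 + S * td t n.
  rewrite leNgt; apply/negP => P0.
  have Sn : S != 0.
    apply/eqP => SE; move: P0; have -> : C = 1.
      by apply: (addIr 1); move: CS; rewrite SE expr0n /= addr0 => h; apply: (mulfI (lt0r_neq0 Cm)); move: h; lc; lra.
    by rewrite SE subrr !mul0r addr0 ltxx.
  have Sp : 0 < S by rewrite lt_neqAle eq_sym Sn S0.
  pose U : R := S / (1 + C).
  have UE : U * (1 + C) = S by rewrite divfK// lt0r_neq0.
  have U0 : 0 < U by rewrite divr_gt0.
  have SU : S * U = 1 - C.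
    apply: (mulIf (lt0r_neq0 Cm)); rewrite -mulrA UE; move: CS; lc; lra.
  have Q0 : td t n + U * k_2 < 0.
    by rewrite -(ltr_pM2l Sp) mulr0; move: P0; rewrite -SU; lc; lra.
  have k2n : k_2 < 0.
    rewrite ltNge; apply/negP => h; have := mulr_ge0 (ltW U0) h; move: Q0 d0; lc; lra.
  pose u : R := td t n / - k_2.
  have k2p : 0 < - k_2 by rewrite oppr_gt0.
  have u0 : 0 < u by rewrite divr_gt0.
  have uU : u <= U by rewrite ler_pdivrMr//; move: Q0; lc; lra.
  have uE : u * k_2 = - td t n by rewrite /u; field; rewrite lt_eqF.
  have w0 : 0 < 1 + u ^+ 2 by rewrite ltr_pwDl// sqr_ge0.
  pose c : R := (1 - u ^+ 2) / (1 + u ^+ 2); pose z : R := 2 * u / (1 + u ^+ 2).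
  have cz : c ^+ 2 + z ^+ 2 = 1 by rewrite /c /z; field; rewrite lt0r_neq0.
  (* The coefficients of the rotated normal in terms of [n] and [n'], nonnegative since [u <= U]. *)
  pose A : R := (S - u * (1 + C)) * (1 + u * U) / (S * (1 + u ^+ 2)).
  pose B : R := 2 * u / (S * (1 + u ^+ 2)).
  have A0 : 0 <= A.
    apply: divr_ge0; last by rewrite mulr_ge0// ltW.
    apply: mulr_ge0; last by rewrite addr_ge0// mulr_ge0// ltW.
    by rewrite subr_ge0 -UE ler_pM2r.
  have B0 : 0 <= B by rewrite divr_ge0// mulr_ge0// ltW.
  pose m : V := c *: n - z *: T.
  have mE : m = A *: n + B *: n'.
    rewrite n'E /m.
    have -> : c = A + B * C.
      have AE : (S - u * (1 + C)) * (1 + u * U) = S * (1 - u ^+ 2) - 2 * u * C.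
        have -> : (S - u * (1 + C)) * (1 + u * U) = S - u * (1 + C) + u * (S * U) - u ^+ 2 * (U * (1 + C)) by ring.
        by rewrite SU UE; ring.
      by rewrite /A /B /c AE; field; rewrite lt0r_neq0//= Sn.
    have -> : z = B * S by rewrite /B /z; field; rewrite lt0r_neq0//= Sn.
    by clearbody T A B C S; apply: vec3P; rewrite !vE; ring.
  have mm : dot3 m m = 1.
    rewrite /m (dotDl (c *: n)) !(dotDr (c *: n)) !dotNl !dotNr !dotZl !dotZr nn TT Tn (dotC n T) Tn -[RHS]cz; ring.
  (* A convex combination of unit vectors has length at most 1, so normalized coefficients sum to at
     least 1; this preserves the height [del] in [supp]. *)
  have AB1 : 1 <= A + B.
    have e1 : 1 = A ^+ 2 + B ^+ 2 + 2 * (A * B) * C.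
      rewrite -[LHS]mm mE (dotDl (A *: n)) !(dotDr (A *: n)) !dotZl !dotZr nn nn' (dotC n' n) -/C; ring.
    have e2 : 1 ^+ 2 <= (A + B) ^+ 2.
      have := ler_wpM2l (mulr_ge0 A0 B0) C1; rewrite expr1n; move: e1; lc; lra.
    by apply: ge1_of_sqr; [exact: addr_ge0 | rewrite expr1n in e2].
  have spm : sp t m.
    split=> //.
    - by rewrite mE dotDr !dotZr Nn Nn' !mulr0 addr0.
    - by move=> y; rewrite mE (dotDr (A *: n)) !dotZr addr_ge0// mulr_ge0.
    rewrite mE (dotDr (A *: n)) !dotZr.
    have e1 := ler_wpM2l A0 nd; have e2 := ler_wpM2l B0 nd'; have e3 := ler_wpM2r (ltW del0) AB1.
    by move: e1 e2 e3; lc; lra.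
  have := twist_d_gt0 spm gt; rewrite /m dE'.
  have -> : k_0 + c * k_1 + z * k_2 = ((k_0 + k_1) + 2 * (u * k_2) + u ^+ 2 * (k_0 - k_1)) / (1 + u ^+ 2).
    by rewrite /c /z; field; rewrite lt0r_neq0.
  have dd0 : td t n * (k_0 + k_1 + 2 * (u * k_2) + u ^+ 2 * (k_0 - k_1)) = 0.
    have e1 : u ^+ 2 * ((k_0 + k_1) * (k_0 - k_1)) = (u * k_2) ^+ 2.
      have -> : (k_0 + k_1) * (k_0 - k_1) = k_2 ^+ 2.
        have -> : (k_0 + k_1) * (k_0 - k_1) = k_0 ^+ 2 - k_1 ^+ 2 by ring.
        by rewrite cn addrC addKr.
      by generalize u => u1; ring.
    have -> : td t n * (k_0 + k_1 + 2 * (u * k_2) + u ^+ 2 * (k_0 - k_1)) =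
       (k_0 + k_1) ^+ 2 + 2 * (u * k_2) * (k_0 + k_1) + u ^+ 2 * ((k_0 + k_1) * (k_0 - k_1)) by rewrite d1E; ring.
    by rewrite e1 uE d1E; ring.
  move/eqP: dd0; rewrite mulf_eq0 (gt_eqF d0) /= => /eqP ->.
  by rewrite mul0r ltxx.
rewrite ler_pdivrMr// mulrAC ler_pdivlMr//.
have E : tb t n' * td t n - tb t n * td t n' = - (al + N3) * ((1 - C) * k_2 + S * td t n).
  have -> : - (al + N3) * ((1 - C) * k_2 + S * td t n) = (1 - C) * (- (al + N3) * k_2) + S * (- (k_0 + k_1) * (al + N3)).
    by rewrite d1E; ring.
  by rewrite -cm -cw b1E d1E bCE dCE; ring.
rewrite -subr_le0 E mulNr oppr_le0 mulr_ge0//; move: ge al0; lc; lra.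
Qed.

End Twist.

(** * Real estimates for the twist *)

Section TwistReal.
Variable R : realType.

(** [2 * atan] has derivative [2 / (1 + c ^+ 2)] at [c], so the rate [rho * (1 + c ^+ 2) / 2] for
    the cotangent of half the twist becomes the rate [rho]. *)
Lemma atan_step (c rho e : R) : 0 < e -> exists2 e' : R, 0 < e' & exists2 dl : R, 0 < dl &
  forall h z : R, 0 < h -> h < dl -> z <= c - (rho * (1 + c ^+ 2) / 2 - e') * h ->
    2 * atan z - 2 * atan c <= (- rho + e) * h.
Proof.
move=> e0; have c1 : 0 < 1 + c ^+ 2 by rewrite ltr_pwDl// sqr_ge0.
pose e' : R := e * (1 + c ^+ 2) / 4.
exists e'; first by rewrite divr_gt0// mulr_gt0.
pose A : R := rho * (1 + c ^+ 2) / 2 - e'.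
have A1 : 0 < `|A| + 1 by have := normr_ge0 A; lra.
have e20 : 0 < e / 4 / (`|A| + 1) by rewrite divr_gt0// divr_gt0.
have [d d0 hd] := derive_diff_at (is_derive1_atan c) e20.
exists (d / (`|A| + 1)); first by rewrite divr_gt0.
move=> h z h0 hdl hz.
have Ah : `|A| * h < d.
  move: hdl; rewrite ltr_pdivlMr// => hdl; move: hdl; lc; lra.
have := hd (c - A * h).
have -> : c - A * h - c = - (A * h) by ring.
rewrite normrN normrM (gtr0_norm h0) => /(_ Ah); rewrite ler_norml => /andP[_ up].
have mono : atan z <= atan (c - A * h) by apply: le_atan; exact: hz.
have s1 : e / 4 / (`|A| + 1) * (`|A| * h) <= e / 4 * h.
  have -> : e / 4 / (`|A| + 1) * (`|A| * h) = e / 4 * h * (`|A| / (`|A| + 1)).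
    by move: A1; generalize `|A| => B B1; field; rewrite lt0r_neq0.
  rewrite ler_piMr//; first by rewrite mulr_ge0// ?divr_ge0// ltW.
  by rewrite ler_pdivrMr// mul1r lerDl.
have s2 : (1 + c ^+ 2)^-1 * - (A * h) = (- rho / 2 + e / 4) * h.
  by rewrite /A /e'; field; rewrite lt0r_neq0.
by move: up mono s1; rewrite s2; lz; lra.
Qed.

(** The excess turning [w = tau - kappa * h] need not be of order [h]. The second identity shows
    that it contributes [- w * d * Z], of the favourable sign, which absorbs the part of the error
    [E] proportional to [tau]; the rest is of order [e * h]. *)
Lemma twist_quotient (a b d mu Z B2 k2 rho kappa q e' : R) : 0 < d -> 0 < Z -> 0 <= rho -> 0 < kappa -> 0 <= q ->
  0 <= 1 + mu -> a * d - b ^+ 2 = - (1 + mu) * d -> d * B2 - b * k2 = - d * Z -> 0 < e' ->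
  exists2 e : R, [/\ 0 < e, e <= 1 & e < kappa] & forall h w tau e1 e2 by_ dy E : R,
    0 < h -> h <= e -> tau <= e -> tau = kappa * h + w -> - (e * h) <= w -> E = e * (2 * tau + 5 * q * h) ->
    `|e1| <= 5 * E -> `|e2| <= 5 * E ->
    by_ = b + rho * h * a + w * B2 + e1 -> dy = d + rho * h * b + w * k2 + e2 -> 0 < dy ->
    by_ / dy <= b / d - (rho * (1 + mu) / d - e') * h.
Proof.
move=> d0 Z0 r0 kp q0 m0 wr1 wr2 e'0.
pose G : R := 5 * (d + `|b|); pose X : R := rho * (1 + mu).
pose F : R := rho * `|b| + (1 + kappa) * `|k2| + 5 * (2 + 5 * q).
pose Q : R := d * Z + G * (2 * kappa + 5 * q).
have b0 := normr_ge0 b; have kk0 := normr_ge0 k2.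
have G0 : 0 < G by rewrite /G; lra.
have X0 : 0 <= X by rewrite mulr_ge0.
have F0 : 0 < F.
  rewrite /F; have := mulr_ge0 r0 b0; have k1 : 0 <= 1 + kappa by lra.
  by have := mulr_ge0 k1 kk0; lc; lra.
have dZ : 0 < d * Z by rewrite mulr_gt0.
have Q0 : 0 < Q.
  by rewrite /Q ltr_pwDl// mulr_ge0 ?(ltW G0)//; lc; lra.
have XFQ : 0 < X * F + Q by rewrite ltr_wpDl// mulr_ge0// ltW.
have [ea [ea0 ea1 ea2 ea3 _]] := small4 ltr01 (divr_gt0 kp (ltr0n R 2)) (divr_gt0 dZ (mulr_gt0 (ltr0n R 2) G0)) ltr01.
have [e [e0 h1 h2 h3 _]] := small4 ea0 (divr_gt0 d0 (mulr_gt0 (ltr0n R 2) F0))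
   (divr_gt0 (mulr_gt0 e'0 (divr_gt0 (exprn_gt0 2 d0) (ltr0n R 2))) XFQ) ea0.
have e1 : e <= 1 by move: ea1 h1; lc; lra.
exists e; first by split=> //; move: ea2 h1; lz; lra.
have eG : e * (2 * G) <= d * Z by rewrite -ler_pdivlMr ?mulr_gt0//; move: ea3 h1 b0; lz; lra.
have eF : e * (2 * F) <= d by rewrite -ler_pdivlMr// mulr_gt0.
have eQ : e * (X * F + Q) <= e' * (d ^+ 2 / 2) by rewrite -ler_pdivlMr.
move=> h w tau f1 f2 by_ dy E hp he te tauE wh EE f1E f2E byE dyE dy0.
have tau0 : 0 <= 2 * tau + 5 * q * h.
  have : 0 <= (kappa - e) * h by rewrite mulr_ge0 ?(ltW hp)//; move: ea2 h1; lz; lra.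
  have := mulr_ge0 q0 (ltW hp); rewrite tauE; move: wh; lz; lra.
have E0 : 0 <= E by rewrite EE mulr_ge0// ltW.
have dydist : `|dy - d| <= e * F.
  have -> : dy - d = rho * h * b + w * k2 + f2 by rewrite dyE; ring.
  have s1 : `|rho * h * b| <= e * (rho * `|b|).
    rewrite normrM normrM (ger0_norm r0) (gtr0_norm hp).
    have := ler_wpM2r (mulr_ge0 r0 b0) he; lz; lra.
  have wa : `|w| <= e * (1 + kappa).
    have kh : kappa * h <= kappa * e by rewrite ler_wpM2l// ltW.
    have eh : e * h <= e by rewrite ler_piMr ?(ltW e0)//; move: e1 he; lz; lra.
    by rewrite ler_norml; apply/andP; split; have := mulr_gt0 kp e0; have := mulr_gt0 kp hp; move: eh tauE te wh; lz; lra.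
  have s2 : `|w * k2| <= e * ((1 + kappa) * `|k2|).
    by rewrite normrM mulrA ler_wpM2r.
  have s3 : 5 * E <= e * (5 * (2 + 5 * q)).
    rewrite EE mulrCA ler_pM2l// ler_pM2l//.
    have qh : q * h <= q by rewrite ler_piMr//; move: e1 he; lz; lra.
    (move: ea1 h1 qh te; lz; lra).
  have := ler_normD (rho * h * b + w * k2) f2; have := ler_normD (rho * h * b) (w * k2).
  by rewrite /F; move: s1 s2 s3 f2E; lz; lra.
have [dy1 dy2] : dy <= d + e * F /\ d / 2 <= dy.
  by move: dydist; rewrite ler_norml => /andP[]; move: eF; lc => *; split; lra.
rewrite ler_pdivrMr// -(ler_pM2r d0).
have -> : (b / d - (rho * (1 + mu) / d - e') * h) * dy * d = b * dy - (X - e' * d) * h * dy.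
  by rewrite /X; field; rewrite lt0r_neq0.
have key : by_ * d - b * dy = - (X * h * d) - w * (d * Z) + (f1 * d - b * f2).
  have -> : by_ * d - b * dy = rho * h * (a * d - b ^+ 2) + w * (d * B2 - b * k2) + (f1 * d - b * f2).
    by rewrite byE dyE; ring.
  by rewrite wr1 wr2 /X; ring.
have s1 : f1 * d - b * f2 <= G * E.
  have u1 : f1 * d <= 5 * E * d by rewrite ler_pM2r//; exact: le_trans (ler_norm _) f1E.
  have u2 : - (b * f2) <= `|b| * (5 * E).
    apply: (le_trans (ler_norm _)); rewrite normrN normrM ler_wpM2l//.
  by rewrite /G; move: u1 u2; lz; lra.
have s2 : - (w * (d * Z)) + G * E <= e * Q * h.
  have -> : G * E = G * e * (2 * kappa + 5 * q) * h + w * (e * (2 * G)) by rewrite EE tauE; ring.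
  have := ler_wpM2r _ wh => /(_ (d * Z - e * (2 * G))); rewrite subr_ge0 => /(_ eG).
  have := mulr_ge0 (mulr_ge0 (ltW e0) (ltW hp)) (mulr_ge0 (ltW e0) (ltW (mulr_gt0 (ltr0n R 2) G0))).
  by rewrite /Q; lc; lra.
have s3 : X * (dy - d) + e * Q <= e' * d * dy.
  have u1 : X * (dy - d) <= X * (e * F) by rewrite ler_wpM2l//; move: dy1; lz; lra.
  have ed : 0 <= e' * d by apply: mulr_ge0; exact: ltW.
  have u2 := ler_wpM2l ed dy2.
  by move: u1 u2 eQ; lz; lra.
have := ler_wpM2r (ltW hp) s3; move: key s1 s2; lz; lra.
Qed.
End TwistReal.

(** * Rate of the twist to the right of a point *)

Section TwistLocal.
Variables (R : realType) (K : R) (g : R -> vec3 R) (L : R) (o : vec3 R) (del s r : R).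
Hypotheses (K0 : 0 <= K) (ov : oval K g L o del s r).
Variables (kappa rho x0 : R) (n0 : vec3 R).
Local Notation V := (vec3 R).
Local Notation q := (Num.sqrt K).
Local Notation N := (nK K).
Local Notation sp := (supp K g o del).
Local Notation tg x n := (frameT s (N (g x)) n).
Hypotheses (k0 : 0 < kappa) (rho0 : 0 < rho) (rhoE : rho ^+ 2 = kappa ^+ 2 + K).
Hypotheses (hk : ae_curv K g o del s kappa) (disc : in_discs K g o del kappa) (sp0 : sp x0 n0).
Local Notation nu := (disc_nu K g kappa rho).
Local Notation ax := (disc_axis K g kappa rho).
Local Notation tb := (twist_b K g s kappa rho x0 n0).
Local Notation td := (twist_d K g s kappa rho x0 n0).
Local Notation tw := (twist K g s kappa rho x0 n0).
Local Notation al := (kappa / rho).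
Local Notation be := (q / rho).
Local Notation T0 := (tg x0 n0).
Local Notation nu0 := (nu x0 n0).
Local Notation ax0 := (ax x0 n0).

Lemma frame_expansion (t : R) (n : V) (e : R) : right_frame K g o del s r t n ->
  0 < e -> e <= 1 -> e < kappa -> exists2 dl : R, 0 < dl & forall y m, t < y -> y < t + dl -> sp y m ->
    [/\ y - t <= e, - dot3 m (tg t n) <= e, (kappa - e) * (y - t) <= - dot3 m (tg t n) &
     forall E, E = e * (2 * - dot3 m (tg t n) + 5 * q * (y - t)) ->
     [/\ norm3 (m - n + (- dot3 m (tg t n)) *: tg t n) <= E,
         norm3 (N (g y) - N (g t) + (q * (y - t)) *: tg t n) <= E
       & norm3 (tg y m - tg t n - (- dot3 m (tg t n)) *: n - (q * (y - t)) *: N (g t)) <= E]].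
Proof.
move=> rf e0 e1 ek; have [spn _ _ _ _] := rf; have [nn Nn np _] := spn.
have q0 := sqrtr_ge0 K; have q1 : 0 < q + 1 by lra.
have [d1 d10 lt] := local_turn K0 ov hk e0 ek rf.
have [dl [dl0 dl1 dl2 dl3 _]] := small4 d10 e0 (divr_gt0 ltr01 q1) ltr01.
exists dl => // y m ty yd spm; have [mm Nm mp _] := spm.
have [h1 h2 h3 h4] := lt y m ty ltac:((move: dl1 yd; lc; lra)) spm.
pose h : R := y - t; rewrite -/h in h2 h3 h4 *.
have h0 : 0 < h by rewrite /h; move: ty; lc; lra.
have hdl : h < dl by rewrite /h; move: yd; lc; lra.
have qh1 : q * h <= 1.
  have : dl * (q + 1) <= 1 by rewrite -ler_pdivlMr.
  by have := ler_wpM2l q0 (ltW hdl); move: dl0; lc; lra.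
pose T : V := tg t n; rewrite -/T in h2 h4 *.
pose tau : R := - dot3 m T; rewrite -/tau in h2 *.
have TT : dot3 T T = 1 by exact: (frameTT (ov_s ov) (ov_NN ov t) nn Nn).
have Tn : dot3 T n = 0 by exact: frameTn.
pose D : V := g y - g t.
have Dh : norm3 D <= h by have := ov_lip K0 ov t y; rewrite gtr0_norm.
have tau0 : 0 <= tau by apply: le_trans h2; rewrite mulr_ge0 ?(ltW h0)//; move: ek; lc; lra.
have taue : tau <= e.
  have -> : tau = dot3 (n - m) T by rewrite dotDl dotNl (dotC n T) Tn add0r.
  by apply: (le_trans (dot_le _ _)); rewrite (norm3_unit TT) mulr1 norm3BC.
pose th : R := 1 - dot3 m n; pose ep : R := dot3 m (N (g t)).
have thE : th = norm3 (m - n) ^+ 2 / 2.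
  by rewrite norm3_sq (dotDl m) !(dotDr m) !dotNl !dotNr mm nn (dotC n m) /th; field.
have th0 : 0 <= th by rewrite thE divr_ge0// sqr_ge0.
have th1 : th <= 1.
  rewrite thE; have : norm3 (m - n) ^+ 2 <= 1 ^+ 2.
    by rewrite lerXn2r ?nnegrE ?norm3_ge0//; apply: le_trans e1.
  by rewrite expr1n; lc; lra.
have epE : `|ep| <= q * (e * h).
  rewrite /ep dotC (dot_N t Nm) normrM (ger0_norm q0) ler_wpM2l//.
  have a1 := np y; have a2 := mp t; rewrite -(opprB (g y)) dotNl in a2; rewrite -/D in a1 a2 *.
  rewrite ler0_norm; last by move: a2; lc; lra.
  have : dot3 D (n - m) <= e * h.
    apply: (le_trans (dot_le _ _)); rewrite mulrC norm3BC.
    by apply: ler_pM; rewrite ?norm3_ge0.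
  by rewrite dotDr dotNr; move: a1; lc; lra.
have qeh : q * (e * h) <= 1.
  have : e * (q * h) <= 1 * 1 by apply: ler_pM => //; [exact: ltW | rewrite mulr_ge0// ltW].
  by lc; lra.
have par : 1 = tau ^+ 2 + (1 - th) ^+ 2 + ep ^+ 2.
  by rewrite -{1}mm (frame_parseval (ov_s ov) (ov_NN ov t) nn Nn m m) -/T /tau /th /ep; ring.
have thb : th <= e * tau + q * (e * h).
  have a1 : tau ^+ 2 <= e * tau by rewrite expr2 ler_wpM2r.
  have a2 : ep ^+ 2 <= q * (e * h).
    have -> : ep ^+ 2 = `|ep| * `|ep| by rewrite -normrM -expr2 ger0_norm// sqr_ge0.
    apply: (le_trans _ epE); apply: ler_piMr => //; exact: le_trans epE qeh.
  have a3 : th * th <= th by rewrite ler_piMr.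
  by move: par a1 a2 a3; lc; lra.
pose rn : V := m - n + tau *: T.
have rnE : rn = (- th) *: n + ep *: N (g t).
  have := frame_decomp (ov_s ov) (ov_NN ov t) nn Nn m; rewrite -/T -/ep => dec.
  rewrite /rn {1}dec /tau /th; generalize (dot3 m T) (dot3 m n) ep => A B C.
  by clearbody T; apply: vec3P; rewrite !vE; ring.
have rnb : norm3 rn <= e * tau + 2 * q * (e * h).
  rewrite rnE; apply: (le_trans (norm3D _ _)); rewrite !norm3Z (norm3_unit nn) (norm3_unit (ov_NN ov t)).
  by rewrite normrN (ger0_norm th0) !mulr1; move: thb epE; lc; lra.
pose rN : V := N (g y) - N (g t) + (q * h) *: T.
have rNE : rN = (- q) *: (D - h *: T).
  by rewrite /rN /D !nKE; clearbody T; apply: vec3P; rewrite !vE; ring.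
have rNb : norm3 rN <= q * (e * h).
  by rewrite rNE norm3Z normrN (ger0_norm q0) ler_wpM2l.
have eh0 : 0 <= q * (e * h) by rewrite !mulr_ge0// ltW.
have et0 : 0 <= e * tau by rewrite mulr_ge0// ltW.
split=> //; first by move: hdl dl2; lz; lra.
move=> E ->; split.
- by apply: (le_trans rnb); move: eh0 et0; lc; lra.
- by apply: (le_trans rNb); move: eh0 et0; lc; lra.
pose A : V := N (g t) - (q * h) *: T; pose B : V := n - tau *: T.
have AB : s *: cross A B = T + tau *: n + (q * h) *: N (g t).
  have e1' := cross_Tm (ov_s ov) (ov_NN ov t) Nn; have e2' := cross_nT (ov_s ov) nn Nn.
  rewrite -/T in e1' e2'.
  have key (a b c : V) (x z : R) : s *: cross (a - x *: c) (b - z *: c) =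
      s *: cross a b + z *: (s *: cross c a) + x *: (s *: cross b c).
    by apply: vec3P; rewrite !vE; ring.
  by rewrite /A /B key e1' e2' -frameTE.
have -> : tg y m - T - tau *: n - (q * h) *: N (g t) = s *: (cross rN m + cross A rn).
  have -> : tg y m - T - tau *: n - (q * h) *: N (g t) = tg y m - (T + tau *: n + (q * h) *: N (g t)).
    by apply: vec3P; rewrite !vE; ring.
  rewrite -AB frameTE /rN /rn /A /B; move: (N (g y)) (N (g t)) => Ny Nt; clearbody T.
  by apply: vec3P; rewrite !vE; ring.
have s1 : `|s| = 1 by apply/eqP; rewrite -sqr_norm_eq1 expr2 (ov_s ov).
rewrite norm3Z s1 mul1r; apply: (le_trans (norm3D _ _)).
have c1 := norm3_cross rN m; rewrite (norm3_unit mm) mulr1 in c1.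
have c2 := norm3_cross A rn.
have A2 : norm3 A <= 2.
  apply: (le_trans (norm3B _ _)); rewrite norm3Z (norm3_unit (ov_NN ov t)) (norm3_unit TT) mulr1.
  by rewrite ger0_norm ?mulr_ge0// ?(ltW h0)//; move: qh1; lz; lra.
have c3 : norm3 A * norm3 rn <= 2 * (e * tau + 2 * q * (e * h)) by apply: ler_pM; rewrite ?norm3_ge0.
by move: c1 c2 c3 rNb; lz; lra.
Qed.

(** To first order the frame at [y] arises by a rotation through [rho * h] about the tilted axis and
    a further rotation through [w] of the normal at a fixed point. [twist_wronski] and
    [corner_wronski] show that both lower the quotient. *)
Lemma twist_right_frame (t : R) (n : V) (e : R) : right_frame K g o del s r t n -> g t <> g x0 -> 0 < e ->
  exists2 dl : R, 0 < dl & forall y m, t < y -> y < t + dl -> sp y m -> g y <> g x0 ->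
    2 * atan (tw y m) - 2 * atan (tw t n) <= (- rho + e) * (y - t).
Proof.
move=> rf gt e0; have [spn _ _ _ _] := rf.
have q0 := sqrtr_ge0 K; have [al0 be0 aq] := tilt_gt0 K k0 rho0; have ab := tilt_sq K0 rho0 rhoE.
have k0' := k0; have rho0' := rho0.
have [al1 be1] : al <= 1 /\ be <= 1.
  by move: ab al0 be0; generalize al be => a b; lc => ab a0 b0; split; nra.
have d0 := twist_d_gt0 K0 ov k0 rho0 rhoE disc sp0 spn gt.
have rotn := normal_rotation K0 ov rho0 rhoE sp0 spn.
have rotd := disc_rotation K0 ov rho0 rhoE sp0 spn.
have wr1 := twist_wronski rotd; have tt := twist_tan rotd.
have rotd' := rotd; rewrite !(nu_dot _ _ _ _ t n) !(ax_dot _ _ _ _ t n) in rotd'.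
have wr2 := corner_wronski ab rotd'.
have Nge : al <= dot3 (N (g t)) ax0 by apply: (axis_ge _ _ _ _ _ sp0); eassumption.
have bdE : tb t n = dot3 (tg t n) nu0 - dot3 (nu t n) T0 by [].
have ddE : td t n = 1 + dot3 (ax t n) ax0 - dot3 (tg t n) T0 - dot3 (nu t n) nu0 by [].
rewrite -bdE -ddE in wr1 tt.
pose a : R := dot3 (tg t n) T0 + dot3 (nu t n) nu0; rewrite -/a in wr1.
pose mu : R := dot3 (ax t n) ax0; rewrite -/mu in wr1 tt.
pose t1 : R := dot3 (tg t n) T0; pose t2 : R := dot3 (tg t n) nu0; pose t3 : R := dot3 (tg t n) ax0.
pose p1 : R := dot3 n T0; pose p2 : R := dot3 n nu0; pose p3 : R := dot3 n ax0.
pose N1 : R := dot3 (N (g t)) T0; pose N2 : R := dot3 (N (g t)) nu0; pose N3 : R := dot3 (N (g t)) ax0.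
rewrite -/t1 -/t2 -/t3 -/p1 -/p2 -/p3 -/N1 -/N2 -/N3 in wr2; rewrite -/N3 in Nge.
have bE : tb t n = - be * N1 + (t2 - al * p1) by rewrite bdE nu_dot -/t2 -/p1 -/N1; ring.
have dE' : td t n = 1 + al * N3 - be * N2 - (be * p3 + t1 + al * p2).
  by rewrite ddE nu_dot ax_dot -/t1 -/p2 -/p3 -/N2 -/N3; ring.
have aE : a = t1 + (al * p2 + be * N2) by rewrite /a nu_dot.
rewrite -bE -dE' in wr2.
pose Z : R := al + N3; pose B2 : R := p2 + al * t1; pose k2 : R := be * t3 - p1 + al * t2.
rewrite -/Z -/B2 -/k2 in wr2.
have Z0 : 0 < Z by rewrite /Z; move: Nge al0; lc; lra.
have mu0 : 0 <= 1 + mu.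
  rewrite leNgt; apply/negP => h; have : 2 * (1 + mu) * td t n < 0 by rewrite pmulr_llt0// pmulr_rlt0.
  by rewrite -tt ltNge addr_ge0// sqr_ge0.
pose c : R := tw t n.
have cE : 1 + c ^+ 2 = 2 * (1 + mu) / td t n.
  rewrite /c /twist; apply: (mulIf (lt0r_neq0 (exprn_gt0 2 d0))).
  transitivity (td t n ^+ 2 + tb t n ^+ 2); first by field; rewrite lt0r_neq0.
  by rewrite tt; field; rewrite lt0r_neq0.
have [e' e'0 [d1 d10 hat]] := atan_step c rho e0.
have [e2 [e20 e21 e22] hq] := twist_quotient d0 Z0 (ltW rho0) k0 q0 mu0 wr1 wr2 e'0.
have [d2 d20 hexp] := frame_expansion rf e20 e21 e22.
exists (Num.min d1 d2); first by rewrite lt_min d10 d20.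
move=> y m ty; rewrite -ltrBlDl lt_min => /andP[y1 y2] spm gy.
have y2' : y < t + d2 by rewrite -ltrBlDl.
have [x1 x2 x3 hE] := hexp y m ty y2' spm.
pose tau : R := - dot3 m (tg t n); rewrite -/tau in x2 x3 hE.
pose h : R := y - t; rewrite -/h in x1 x3 hE y1 *.
have h0 : 0 < h by rewrite /h subr_gt0.
have [r1 r2 r3] := hE _ erefl.
set E := e2 * _ in r1 r2 r3.
apply: hat => //; rewrite cE.
have -> : rho * (2 * (1 + mu) / td t n) / 2 = rho * (1 + mu) / td t n by field; rewrite lt0r_neq0.
have [n0n n0N _ _] := sp0.
have [u1 u2 _ u4] := tilt_supp K0 ov rho0 rhoE sp0.
have TT0 : dot3 T0 T0 = 1 by exact: (frameTT (ov_s ov) (ov_NN ov x0) n0n n0N).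
have rb (v u : V) : dot3 u u = 1 -> norm3 v <= E -> `|dot3 v u| <= E.
  by move=> uu vE; apply: (le_trans (cauchy _ _)); rewrite (norm3_unit uu) mulr1.
pose vT : V := tg y m - tg t n - tau *: n - (q * h) *: N (g t).
pose vn : V := m - n + tau *: tg t n.
pose vN : V := N (g y) - N (g t) + (q * h) *: tg t n.
have TyE (u : V) : dot3 (tg y m) u = dot3 (tg t n) u + tau * dot3 n u + q * h * dot3 (N (g t)) u + dot3 vT u.
  by rewrite /vT (dotDl (_ - _ - _)) (dotDl (_ - _)) (dotDl (tg y m)) !dotNl !dotZl; ring.
have myE (u : V) : dot3 m u = dot3 n u - tau * dot3 (tg t n) u + dot3 vn u.
  by rewrite /vn (dotDl (m - n)) (dotDl m) !dotNl !dotZl; ring.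
have NyE (u : V) : dot3 (N (g y)) u = dot3 (N (g t)) u - q * h * dot3 (tg t n) u + dot3 vN u.
  by rewrite /vN (dotDl (_ - _)) (dotDl (N (g y))) !dotNl !dotZl; ring.
have rk : al * kappa + be * q = rho.
  have -> : al * kappa + be * q = (kappa ^+ 2 + q * q) / rho by field; rewrite lt0r_neq0.
  by rewrite sqK// -rhoE expr2 mulfK// lt0r_neq0.
have kr : kappa = rho * al by field; rewrite lt0r_neq0.
have qr : q = rho * be by field; rewrite lt0r_neq0.
have alb (x : R) : `|x| <= E -> `|al * x| <= E.
  by move=> xE; rewrite normrM (gtr0_norm al0); apply: le_trans xE; rewrite ler_piMl.
have beb (x : R) : `|x| <= E -> `|be * x| <= E.
  by move=> xE; rewrite normrM (ger0_norm be0); apply: le_trans xE; rewrite ler_piMl.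
pose w : R := tau - kappa * h.
pose e1 : R := dot3 vT nu0 - al * dot3 vn T0 - be * dot3 vN T0.
pose e3 : R := al * dot3 vN ax0 - be * dot3 vn ax0 - dot3 vT T0 - al * dot3 vn nu0 - be * dot3 vN nu0.
have g1 := rb _ _ u2 r3; have g2 := alb _ (rb _ _ TT0 r1); have g3 := beb _ (rb _ _ TT0 r2).
have g4 := alb _ (rb _ _ u1 r2); have g5 := beb _ (rb _ _ u1 r1); have g6 := rb _ _ TT0 r3.
have g7 := alb _ (rb _ _ u2 r1); have g8 := beb _ (rb _ _ u2 r2).
have E0 : 0 <= E by exact: le_trans (norm3_ge0 _) r1.
have b1 : `|e1| <= 5 * E.
  rewrite /e1; move: E0 g1 g2 g3; rewrite -/vT -/vn -/vN !ler_norml; lc => E0 /andP[? ?] /andP[? ?] /andP[? ?].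
  by apply/andP; split; lra.
have b3 : `|e3| <= 5 * E.
  rewrite /e3; move: E0 g4 g5 g6 g7 g8; rewrite -/vT -/vn -/vN !ler_norml; lc => E0 /andP[? ?] /andP[? ?] /andP[? ?] /andP[? ?] /andP[? ?].
  by apply/andP; split; lra.
apply: (hq h w tau e1 e3 (tb y m) (td y m) E) => //.
- by rewrite /w; ring.
- by rewrite /w; move: x3; lz; lra.
- rewrite bE aE /twist_b nu_dot TyE myE NyE -/t2 -/p2 -/N2 -/p1 -/t1 -/N1 /e1 /w /B2 -/vn -/vT -/vN.
  move: (dot3 vT nu0) (dot3 vn T0) (dot3 vN T0) => f1 f2 f3.
  have z1 : h * t1 * (al * kappa + be * q) = h * t1 * rho by rewrite rk.
  have z2 : h * p2 * (rho * al) = h * p2 * kappa by rewrite -kr.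
  have z3 : h * N2 * (rho * be) = h * N2 * q by rewrite -qr.
  by move: z1 z2 z3; lz; lra.
- rewrite bE dE' /twist_d nu_dot ax_dot TyE !myE !NyE -/t2 -/p2 -/N2 -/p1 -/t1 -/N1 -/t3 -/p3 -/N3 /e3 /w /k2 -/vn -/vT -/vN.
  move: (dot3 vN ax0) (dot3 vn ax0) (dot3 vT T0) (dot3 vn nu0) (dot3 vN nu0) => f1 f2 f3 f4 f5.
  have z1 : h * t2 * (al * kappa + be * q) = h * t2 * rho by rewrite rk.
  have z2 : h * p1 * (rho * al) = h * p1 * kappa by rewrite -kr.
  have z3 : h * N1 * (rho * be) = h * N1 * q by rewrite -qr.
  have z4 : h * t3 * (al * q) = h * t3 * (be * kappa) by rewrite aq.
  by move: z1 z2 z3 z4; lz; lra.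
- exact: (twist_d_gt0 K0 ov k0 rho0 rhoE disc sp0 spm gy).
Qed.

End TwistLocal.

(** * Length of the curve and the global bounds *)

Section Length.
Variables (R : realType) (K : R) (g : R -> vec3 R) (L : R) (o : vec3 R) (del s r : R).
Hypotheses (K0 : 0 <= K) (ov : oval K g L o del s r).
Variables (kappa rho : R).
Local Notation V := (vec3 R).
Local Notation q := (Num.sqrt K).
Local Notation N := (nK K).
Local Notation sp := (supp K g o del).
Local Notation tg x n := (frameT s (N (g x)) n).
Local Notation grev := (fun t : R => g (- t)).
Hypotheses (k0 : 0 < kappa) (rho0 : 0 < rho) (rhoE : rho ^+ 2 = kappa ^+ 2 + K).

Lemma in_discs_rev : in_discs K g o del kappa -> in_discs K grev o del kappa.
Proof. by move=> disc u t n /supp_rev spn; exact: disc. Qed.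

Lemma twist_rev (x0 : R) (n0 : V) (t : R) (n : V) :
  twist K grev (- s) kappa rho (- x0) n0 (- t) n = - twist K g s kappa rho x0 n0 t n.
Proof.
rewrite /twist /twist_b /twist_d /disc_nu /disc_axis !opprK !frameTNs !dotNl !dotNr opprK -mulNr.
by congr (_ / _); ring.
Qed.

Section Base.
Variables (x0 : R) (n0 : V).
Hypotheses (hk : ae_curv K g o del s kappa) (disc : in_discs K g o del kappa) (sp0 : sp x0 n0).
Local Notation tw := (twist K g s kappa rho x0 n0).

(** At a corner the normal first jumps to the right limit, which does not raise the quotient
    ([twist_corner]), and then [twist_right_frame] applies. *)
Lemma twist_right (t : R) (n : V) (e : R) : sp t n -> g t <> g x0 -> 0 < e ->
  exists2 dl : R, 0 < dl & forall y m, t < y -> y < t + dl -> sp y m -> g y <> g x0 ->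
    2 * atan (tw y m) - 2 * atan (tw t n) <= (- rho + e) * (y - t).
Proof.
move=> spn gt e0; have [n' rf] := right_frame_exists K0 ov t.
have [spn' pos _ _ _] := rf.
have [dl dl0 hdl] := twist_right_frame K0 ov k0 rho0 rhoE hk disc sp0 rf gt e0.
exists dl => // y m ty yd spm gy; have := hdl y m ty yd spm gy.
have : atan (tw t n') <= atan (tw t n).
  by apply: le_atan; exact: (twist_corner K0 ov k0 rho0 rhoE disc sp0 spn spn' gt (pos n spn)).
lra.
Qed.
End Base.
End Length.

Section Length2.
Variables (R : realType) (K : R) (g : R -> vec3 R) (L : R) (o : vec3 R) (del s r : R).
Hypotheses (K0 : 0 <= K) (ov : oval K g L o del s r).
Variables (kappa rho : R).
Local Notation V := (vec3 R).
Local Notation q := (Num.sqrt K).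
Local Notation sp := (supp K g o del).
Local Notation grev := (fun t : R => g (- t)).
Hypotheses (k0 : 0 < kappa) (rho0 : 0 < rho) (rhoE : rho ^+ 2 = kappa ^+ 2 + K).
Hypotheses (hk : ae_curv K g o del s kappa) (disc : in_discs K g o del kappa).

Lemma twist_left (x0 : R) (n0 : V) (t : R) (n : V) (e : R) : sp x0 n0 -> sp t n -> g t <> g x0 -> 0 < e ->
  exists2 dl : R, 0 < dl & forall y m, t - dl < y -> y < t -> sp y m -> g y <> g x0 ->
    2 * atan (twist K g s kappa rho x0 n0 t n) - 2 * atan (twist K g s kappa rho x0 n0 y m) <= (- rho + e) * (t - y).
Proof.
move=> sp0 spn gt e0.
have sr (x : R) (m : V) : sp x m -> supp K grev o del (- x) m by move=> h; apply/supp_rev; rewrite opprK.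
have gt' : grev (- t) <> grev (- x0) by rewrite !opprK.
have [dl dl0 hdl] := twist_right K0 (oval_rev K0 ov) k0 rho0 rhoE (ae_curv_rev hk) (in_discs_rev disc) (sr _ _ sp0)
  (sr _ _ spn) gt' e0.
exists dl => // y m yd yt spm gy.
have := hdl (- y) m ltac:(lra) ltac:(lra) (sr _ _ spm); rewrite !opprK => /(_ gy).
rewrite !twist_rev !atanN; lra.
Qed.

Theorem length_le : rho * L <= 2 * pi.
Proof.
have L0 := ov_L ov; have rho0' := rho0.
have [sel hs] := sel_exists ov.
pose f (y : R) : R := 2 * atan (twist K g s kappa rho 0 (sel 0) y (sel y)).
(* The base parameter 0 is left out, because [twist_d] is positive only away from it. As [f] is
   twice an arctangent, it drops by less than [2 * pi] on the rest of the period. *)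
have main (a b : R) : 0 < a -> a <= b -> b < L -> rho * (b - a) <= 2 * pi.
  move=> a0 ab bL.
  have gn (y : R) : a <= y -> y <= b -> g y <> g 0.
    by move=> h1 h2; apply: nesym; apply: (ov_inj ov); lra.
  have : f b - f a <= - rho * (b - a).
    apply: dini_le => // x /andP[x1 x2] e e0.
    have [d1 d10 h1] := twist_right K0 ov k0 rho0 rhoE hk disc (hs 0) (hs x) (gn x x1 x2) e0.
    have [d2 d20 h2] := twist_left (hs 0) (hs x) (gn x x1 x2) e0.
    exists (Num.min d1 d2); first by rewrite lt_min d10 d20.
    move=> y /andP[y1 y2]; have gy := gn y y1 y2.
    have m1 : Num.min d1 d2 <= d1 by rewrite ge_min lexx.
    have m2 : Num.min d1 d2 <= d2 by rewrite ge_min lexx orbT.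
    split=> /andP[w1 w2].
      by apply: (h1 y (sel y) w1 _ (hs y) gy); exact: lt_le_trans w2 (lerD (lexx x) m1).
    by apply: (h2 y (sel y) _ w2 (hs y) gy); apply: le_lt_trans w1; rewrite lerD2l lerN2.
  have := atan_gtNpi2 (twist K g s kappa rho 0 (sel 0) b (sel b)).
  have := atan_ltpi2 (twist K g s kappa rho 0 (sel 0) a (sel a)).
  rewrite /f; lra.
rewrite -subr_ge0; apply: (@eps_ge0 _ _ (2 * rho)) => [|e e0]; first by rewrite mulr_ge0// ltW.
have [h [h0 h1 h2 _ _]] := small4 e0 (divr_gt0 L0 (ltr0n R 4)) e0 e0.
have := main h (L - h) h0 ltac:(lra) ltac:(lra).
have := ler_wpM2l (ltW rho0) h1; lra.
Qed.

Lemma arc_bound (a b : R) : a < b -> b < a + L ->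
  rho * (b - a) <= 2 * pi /\ norm3 (g b - g a) <= carc rho (b - a).
Proof.
move=> ab bL; have rho0' := rho0; have rL := length_le; have pi0 := pi_gt0 R.
have r1 : rho * (b - a) <= rho * L by rewrite ler_pM2l//; lra.
split; first exact: le_trans r1 rL.
have [h|h] := leP (rho * (b - a)) pi; first by exact: (chord_le_carc K0 ov k0 rho0 rhoE disc (ltW ab) h).
(* The complementary arc has the same chord, and [rho * L <= 2 * pi] puts its half angle below
   [pi - rho * (b - a) / 2], whose sine is that of the original half angle. *)
have E : rho * (a + L - b) = rho * L - rho * (b - a) by ring.
have h' : rho * (a + L - b) <= pi by lra.
have p0 : 0 < rho * (a + L - b) by rewrite mulr_gt0//; lra.
have := chord_le_carc K0 ov k0 rho0 rhoE disc (ltW bL) h'.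
rewrite (ov_per ov) norm3BC => H; apply: (le_trans H).
rewrite !carcE ler_pM2r ?invr_gt0// ler_pM2l//.
have -> : sin (rho * (b - a) / 2) = sin (pi - rho * (b - a) / 2) by rewrite [pi - _]addrC sinDpi sinN opprK.
rewrite leNgt; apply/negP; rewrite ltr_sin ?in_itv /=.
- by lra.
- by apply/andP; split; lra.
- by apply/andP; split; lra.
Qed.

Lemma kappa_arc_ge (a b : R) : a < b -> b < a + L -> kappa <= kappa_arc K g a b.
Proof.
move=> ab bL; have [rl cl] := arc_bound ab bL; have l0 : 0 < b - a by lra.
have Kr : K <= rho ^+ 2 by rewrite rhoE lerDr sqr_ge0.
rewrite /kappa_arc dK_chord.
have c0 := norm3_ge0 (g b - g a); have qc := chord_q ov a b.
have ex := cgc_exists K0 l0 c0 rho0 Kr rl cl.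
have sol := xgetPex 0 ex; rewrite -/(kappaK K (b - a) (dist_of_chord K (norm3 (g b - g a)))) in sol.
have low := cgc_lower K0 l0 c0 qc sol rho0 rl cl.
move: low sol; move: (kappaK _ _ _) => k low [kp _ _].
have : rho ^+ 2 <= Num.sqrt (k ^+ 2 + K) ^+ 2 by rewrite lerXn2r ?nnegrE ?sqrtr_ge0// ltW.
by rewrite sqr_sqrtr ?addr_ge0 ?sqr_ge0// rhoE lerD2r => sq; have k0' := k0; move: k0' kp sq; lc => *; nra.
Qed.

Lemma chi_pts_ge (a b c : R) : g a <> g b -> g b <> g c -> g c <> g a -> kappa <= chi_pts K g a b c.
Proof.
move=> ab bc ca; rewrite (chi_ptsE K0 a b c (ov_SK ov)) /circle_gcurv.
have := circ_ge K0 ov k0 rho0 rhoE disc ab bc ca; rewrite rhoE => h.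
rewrite -[kappa]ger0_norm ?(ltW k0)// -sqrtr_sqr ler_wsqrtr//; lra.
Qed.

End Length2.

(** When no arc fits, the default value 0 of [xget] satisfies the bound as well. *)
Lemma kappaK_ge0 (R : realType) (K l d : R) : 0 <= kappaK K l d.
Proof.
rewrite /kappaK; case: xgetP => [x -> [] // | _]; exact: lexx.
Qed.

(** * Equivalence of the four conditions *)

Section Equiv.
Variables (R : realType) (K : R) (g : R -> vec3 R) (L : R) (o : vec3 R) (del s r : R).
Hypotheses (K0 : 0 <= K) (ov : oval K g L o del s r).
Variable kappa : R.
Local Notation q := (Num.sqrt K).

Lemma ae_on_sub (P Q : R -> Prop) : (forall t, P t -> Q t) -> ae_on L P -> ae_on L Q.
Proof. by move=> PQ; apply: negligibleS => t [h1 h2]; split=> // /PQ. Qed.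

Lemma short_scale (d : R) : 0 < d -> exists h : R, [/\ 0 < h, 2 * h < d, 2 * h < L & 0 < K -> 4 * h <= 2 * pi / q].
Proof.
move=> d0; have L0 := ov_L ov; have pi0 := pi_gt0 R; have q0 := sqrtr_ge0 K.
have q1 : 0 < q + 1 by lra.
have [h [h0 h1 h2 h3 _]] := small4 (divr_gt0 d0 (ltr0n R 3)) (divr_gt0 L0 (ltr0n R 3)) (divr_gt0 pi0 (mulr_gt0 (ltr0n R 2) q1)) d0.
exists h; split=> //; [lra|lra|].
move=> Kp; have qp : 0 < q by rewrite sqrtr_gt0.
rewrite ler_pdivlMr//; have : h * (2 * (q + 1)) <= pi by rewrite -ler_pdivlMr// mulr_gt0.
lra.
Qed.

Lemma kappa_ae_of_global : kappa_global_ge K g L kappa ->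
  ae_on L (fun t => exists l, kappa_sigma_lim K g t l /\ kappa <= l).
Proof.
move=> C; apply: ae_on_sub (ae_smooth K0 ov) => t [n [k sm]].
have lim := @kappa_lim _ _ _ _ _ _ _ _ K0 ov _ _ _ sm; exists k; split=> //.
rewrite leNgt; apply/negP => kk.
have e0 : 0 < kappa - k by lra.
have [d [d0 hd]] := lim _ e0.
have [h [h0 h1 h2 h3]] := short_scale d0.
have lt1 : t - h < t + h by lra.
have lt2 : t + h < t - h + L by lra.
have dK1 := ov_dK ov (ltW lt1).
have : kappa <= kappa_arc K g (t - h) (t + h).
  by apply: C => // Kp; have := h3 Kp; lra.
have := hd (t - h) (t + h) ltac:(lra) ltac:(lra) ltac:(lra) ltac:(lra).
rewrite ltr_norml => /andP[_]; lra.
Qed.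

Lemma chi_ae_of_global : chi_global_ge K g kappa ->
  ae_on L (fun t => exists l, chi_sigma_lim K g t l /\ kappa <= l).
Proof.
move=> D; apply: ae_on_sub (ae_smooth K0 ov) => t [n [k sm]].
have lim := @chi_lim _ _ _ _ _ _ _ _ K0 ov _ _ _ sm; exists k; split=> //.
rewrite leNgt; apply/negP => kk.
have e0 : 0 < kappa - k by lra.
have [d [d0 hd]] := lim _ e0.
have [h [h0 h1 h2 h3]] := short_scale d0.
have lt1 : t - h < t by lra.
have lt2 : t < t + h by lra.
have lt3 := lt_trans lt1 lt2.
have a1 := ov_dK ov (ltW lt1); have a2 := ov_dK ov (ltW lt2); have a3 := ov_dK ov (ltW lt3).
have : kappa <= chi_pts K g (t - h) t (t + h).
  apply: D.
  - by apply: (ov_inj ov) => //; lra.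
  - by apply: (ov_inj ov) => //; lra.
  - by apply: nesym; apply: (ov_inj ov) => //; lra.
  by move=> Kp; have := h3 Kp; rewrite (dKC K (g (t + h))); lra.
have := hd h h h0 ltac:(lra) h0 ltac:(lra).
rewrite ltr_norml => /andP[_]; lra.
Qed.

Lemma global_of_ae : 0 < kappa -> ae_on L (fun t => exists l, kappa_sigma_lim K g t l /\ kappa <= l) ->
  kappa_global_ge K g L kappa /\ chi_global_ge K g kappa.
Proof.
move=> k0 A; have hk := ae_curv_of_lim K0 ov A.
have disc := in_discs_of_ae K0 ov k0 hk.
pose rho : R := Num.sqrt (kappa ^+ 2 + K).
have p0 : 0 < kappa ^+ 2 + K by rewrite ltr_pwDl// exprn_gt0.
have rho0 : 0 < rho by rewrite sqrtr_gt0.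
have rhoE : rho ^+ 2 = kappa ^+ 2 + K by rewrite sqr_sqrtr// ltW.
split=> [a b ab bL _ | a b c ab bc ca _].
  exact: (kappa_arc_ge K0 ov k0 rho0 rhoE hk disc ab bL).
exact: (chi_pts_ge K0 ov k0 rho0 rhoE disc ab bc ca).
Qed.

End Equiv.

Theorem theorem4p2 (R : realType) (K : R) (g : R -> vec3 R) (L kappa : R) :
  0 <= K -> closed_convex_curve K g L -> 0 <= kappa ->
  let A := ae_on L (fun t => exists l, kappa_sigma_lim K g t l /\ kappa <= l) in
  let B := ae_on L (fun t => exists l, chi_sigma_lim K g t l /\ kappa <= l) in
  let C := kappa_global_ge K g L kappa in
  let D := chi_global_ge K g kappa in
  [/\ A <-> B, A <-> C & A <-> D].
Proof.
move=> K0 cc kappa0 A B C D.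
have [ o [del [s [r ov]]]] := curve_oval K0 cc.
have AB : A <-> B := ae_kappa_chi K0 ov kappa.
have CA : C -> A := @kappa_ae_of_global _ _ _ _ _ _ _ _ K0 ov kappa.
have DB : D -> B := @chi_ae_of_global _ _ _ _ _ _ _ _ K0 ov kappa.
have AC : A -> C /\ D.
  (* For [kappa = 0] both global bounds hold by the sign conventions; the disc arguments need
     [kappa > 0]. *)
  move: kappa0; rewrite le_eqVlt => /orP[/eqP kz _|kp]; last exact: (global_of_ae K0 ov kp).
  split=> [a b ab bL _ | a b c ab bc ca _]; rewrite -kz; first exact: kappaK_ge0.
  by rewrite (chi_ptsE K0 a b c (ov_SK ov)) sqrtr_ge0.
split=> //; split=> [/AC[]//|]; [exact: CA | by move/DB/AB].
Qed.
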